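(* Let $T>0$, $d\ge 1$, $H\in(0,1/2)$, let $B^H$ be a $d$-dimensional fractional Brownian motion with Hurst parameter $H$ on a probability space $(\Omega,\mathcal F,P)$, and let $b:[0,T]\times\mathbb{R}^d\to\mathbb{R}^d$ be a continuous bounded function. Assume that for every $x\in\mathbb{R}^d$ the stochastic differential equation $$dX_t=b(t,X_t)\,dt+dB^H_t,\quad t\in[0,T],\qquad X_0=x,$$ has a unique strong solution, denoted $X(x)=(X_t(x))_{t\in[0,T]}$, and that pathwise uniqueness holds for this equation. Then for every $x_0\in\mathbb{R}^d$, $$\lim_{x\to x_0}E\Big[\sup_{0\le t\le T}|X_t(x)-X_t(x_0)|^2\Big]=0.$$
   Context: A one-dimensional fractional Brownian motion (fBm) with Hurst parameter $H$ is a centered (continuous) Gaussian process with covariance $R_H(t,s)=\frac12\left(t^{2H}+s^{2H}-|t-s|^{2H}\right)$. A $d$-dimensional fBm has components that are independent one-dimensional fBms. Given an fBm $B^H$, there is a ($d$-dimensional) Brownian motion $W$ with $B^H_t=\int_0^tK_H(t,s)\,dW_s$, where for $t>s$ $$K_H(t,s)=c_H\Big[\big(\tfrac ts\big)^{H-\frac12}(t-s)^{H-\frac12}-(H-\tfrac12)s^{\frac12-H}\int_s^t(u-s)^{H-\frac12}u^{H-\frac32}\,du\Big],\quad c_H=\Big[\tfrac{2H}{(1-2H)\beta(1-2H,H+\frac12)}\Big]^{1/2},$$ $\beta(\cdot,\cdot)$ being the beta function. $B^H$ is called an $\{\mathcal F_t\}$-fBm if the associated $W$ is an $\{\mathcal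 F_t\}$-Brownian motion. The equation is understood in integral form: $X_t=x+\int_0^tb(s,X_s)\,ds+B^H_t$ for $t\in[0,T]$. Strong solution: a process $X$ on $(\Omega,\mathcal F,P)$ satisfying the equation and adapted to the filtration generated by $B^H$ (augmented by the $P$-null sets). Weak solution: a sextuple $(\Omega,\mathcal F,\{\mathcal F_t\}_{t\in[0,T]},P,X,B^H)$ where $(\Omega,\mathcal F,P)$ is a probability space with a filtration satisfying the usual conditions, $X$ is $\{\mathcal F_t\}$-adapted, $B^H$ is an $\{\mathcal F_t\}$-fBm, and $X,B^H$ satisfy the equation. Pathwise uniqueness holds if, for each initial condition, whenever $(X,B^H)$ and $(\widetilde X,B^H)$ are two weak solutions on the same filtered probability space (with the same $B^H$ and the same initial condition), $X$ and $\widetilde X$ are indistinguishable. *)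

(* Defs.v *)
From HB Require Import structures.
From mathcomp Require Import all_boot all_order all_algebra.
From mathcomp Require Import all_classical all_reals all_analysis.

Set Implicit Arguments.
Unset Strict Implicit.
Unset Printing Implicit Defensive.

Import Order.TTheory GRing.Theory Num.Theory.
Import numFieldNormedType.Exports.

Local Open Scope classical_set_scope.
Local Open Scope ring_scope.

(* The library norm on row vectors is the sup norm, hence this definition. *)
Definition enorm (R : realType) (d : nat) (v : 'rV[R]_d) : R :=
  Num.sqrt (\sum_(i < d) v 0 i ^+ 2).

Section Probability.
Context {R : realType} {disp : measure_display} {Omega : measurableType disp}.
Variable P : probability Omega R.

Definition gen_sigma (I : Type) (D : set I) (Y : I -> Omega -> R) :
    set (set Omega) :=
  <<s [set A | exists2 t, D t &
         exists2 U : set R, measurable U & A = Y t @^-1` U] >>.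

Definition indep2 (G1 G2 : set (set Omega)) : Prop :=
  forall A1 A2, G1 A1 -> G2 A2 -> P (A1 `&` A2) = (P A1 * P A2)%E.

(* Since setT belongs to every sigma-algebra, the product rule for the full
   family covers all subfamilies. *)
Definition mutual_indep (d : nat) (G : 'I_d -> set (set Omega)) : Prop :=
  forall A : 'I_d -> set Omega, (forall i, G i (A i)) ->
    fine (P (\bigcap_(i in [set: 'I_d]) A i)) = \prod_(i < d) fine (P (A i)).

(* The library's [normal_prob m s] is not the Dirac mass at m when s = 0, so
   the degenerate case is separate. *)
Definition gaussian_rv (Y : Omega -> R) : Prop :=
  measurable_fun setT Y /\
  exists m s : R, 0 <= s /\
    forall U : set R, measurable U ->
      P (Y @^-1` U) = if s == 0 then \d_m U else normal_prob m s U.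

Definition centered_gaussian_process (T : R) (C : R -> R -> R)
    (Y : R -> Omega -> R) : Prop :=
  [/\ forall (n : nat) (t c : 'I_n -> R), (forall k, 0 <= t k <= T) ->
        gaussian_rv (fun w => \sum_(k < n) c k * Y (t k) w),
      forall t, 0 <= t <= T -> ('E_P[Y t])%E = 0%E &
      forall s t, 0 <= s <= T -> 0 <= t <= T ->
        covariance P (Y t) (Y s) = (C t s)%:E].

Definition continuous_gaussian_iid (d : nat) (T : R) (C : R -> R -> R)
    (B : R -> Omega -> 'rV[R]_d) : Prop :=
  [/\ forall i, centered_gaussian_process T C (fun t w => B t w 0 i),
      mutual_indep (fun i => gen_sigma `[0, T] (fun t w => B t w 0 i)) &
      forall w, {within `[0, T], continuous (fun t => B t w)}].

Definition fbm_cov (H t s : R) : R :=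
  2^-1 * (t `^ (2 * H) + s `^ (2 * H) - `|t - s| `^ (2 * H)).

Definition is_fbm (d : nat) (T H : R) (B : R -> Omega -> 'rV[R]_d) : Prop :=
  continuous_gaussian_iid T (fbm_cov H) B.

Definition is_bm (d : nat) (T : R) (W : R -> Omega -> 'rV[R]_d) : Prop :=
  continuous_gaussian_iid T (fun t s => Num.min t s) W.

Definition usual_filtration (T : R) (F : R -> set (set Omega)) : Prop :=
  [/\ forall t, 0 <= t <= T -> sigma_algebra setT (F t) /\ F t `<=` measurable,
      forall s t, 0 <= s -> s <= t -> t <= T -> F s `<=` F t,
      forall t, 0 <= t -> t < T -> F t = \bigcap_(s in `]t, T]) F s &
      P.-negligible `<=` F 0].

Definition adapted (d : nat) (T : R) (F : R -> set (set Omega))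
    (X : R -> Omega -> 'rV[R]_d) : Prop :=
  forall t, 0 <= t <= T -> forall (i : 'I_d) (U : set R), measurable U ->
    F t ((fun w => X t w 0 i) @^-1` U).

Definition augmented_filtration (d : nat) (B : R -> Omega -> 'rV[R]_d) (t : R) :
    set (set Omega) :=
  <<s gen_sigma [set si : R * 'I_d | 0 <= si.1 <= t]
        (fun si w => B si.1 w 0 si.2) `|` P.-negligible >>.

Definition is_filtration_bm (d : nat) (T : R) (F : R -> set (set Omega))
    (W : R -> Omega -> 'rV[R]_d) : Prop :=
  [/\ is_bm T W,
      adapted T F W &
      forall s t, 0 <= s -> s <= t -> t <= T ->
        indep2 (F s)
          (gen_sigma [set: 'I_d] (fun i w => W t w 0 i - W s w 0 i))].

(* The triple (a, u, v) encodes the step function a * \1_`]u, v]. *)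
Definition step_fun (phi : seq (R * R * R)) (s : R) : R :=
  \sum_(p <- phi) p.1.1 * \1_(`]p.1.2, p.2]) s.

Definition step_int (W : R -> Omega -> R) (phi : seq (R * R * R)) (w : Omega) :
    R :=
  \sum_(p <- phi) p.1.1 * (W p.2 w - W p.1.2 w).

(* I is (a version of) the integral of the deterministic f against the Brownian
   motion W over [0, t]: the L^2(P)-limit of the integrals of step functions
   converging to f in L^2([0, t]). *)
Definition is_wiener_integral (W : R -> Omega -> R) (t : R) (f : R -> R)
    (I : Omega -> R) : Prop :=
  measurable_fun setT I /\
  exists phi : nat -> seq (R * R * R),
    [/\ forall n p, p \in phi n -> 0 <= p.1.2 /\ p.1.2 <= p.2 /\ p.2 <= t,
        (fun n => \int[lebesgue_measure]_(s in `[0%R, t])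
            ((step_fun (phi n) s - f s) ^+ 2)%:E)%E @ \oo --> 0%E &
        (fun n => \int[P]_w ((step_int W (phi n) w - I w) ^+ 2)%:E)%E
          @ \oo --> 0%E].

Definition euler_beta (p q : R) : R :=
  \int[lebesgue_measure]_(x in `]0, 1[) (x `^ (p - 1) * (1 - x) `^ (q - 1)).

Definition fbm_const (H : R) : R :=
  Num.sqrt (2 * H / ((1 - 2 * H) * euler_beta (1 - 2 * H) (H + 2^-1))).

Definition fbm_kernel (H t s : R) : R :=
  fbm_const H *
  ((t / s) `^ (H - 2^-1) * (t - s) `^ (H - 2^-1)
   - (H - 2^-1) * s `^ (2^-1 - H)
     * \int[lebesgue_measure]_(u in `]s, t[)
         ((u - s) `^ (H - 2^-1) * u `^ (H - 3 / 2))).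

Definition is_filtration_fbm (d : nat) (T H : R) (F : R -> set (set Omega))
    (B : R -> Omega -> 'rV[R]_d) : Prop :=
  is_fbm T H B /\
  exists W : R -> Omega -> 'rV[R]_d,
    is_filtration_bm T F W /\
    forall t, 0 <= t <= T -> forall i : 'I_d,
      is_wiener_integral (fun s w => W s w 0 i) t (fbm_kernel H t)
        (fun w => B t w 0 i).

(* Integrability of the drift is required because the library integral is a
   total function, equal to an arbitrary value otherwise. *)
Definition solves_sde (d : nat) (T : R) (b : R -> 'rV[R]_d -> 'rV[R]_d)
    (x : 'rV[R]_d) (B X : R -> Omega -> 'rV[R]_d) : Prop :=
  {ae P, forall w,
    (forall i : 'I_d, lebesgue_measure.-integrable `[0, T]
       (fun s => (b s (X s w) 0 i)%:E)) /\
    (forall t, 0 <= t <= T ->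
       X t w = x
         + \row_(i < d) (\int[lebesgue_measure]_(s in `[0, t]) b s (X s w) 0 i)
         + B t w)}.

Definition indistinguishable (d : nat) (T : R) (X Y : R -> Omega -> 'rV[R]_d) :
    Prop :=
  {ae P, forall w, forall t, 0 <= t <= T -> X t w = Y t w}.

Definition strong_solution (d : nat) (T : R) (b : R -> 'rV[R]_d -> 'rV[R]_d)
    (B : R -> Omega -> 'rV[R]_d) (x : 'rV[R]_d) (X : R -> Omega -> 'rV[R]_d) :
    Prop :=
  [/\ forall t, 0 <= t <= T -> forall i : 'I_d,
        measurable_fun setT (fun w => X t w 0 i),
      adapted T (augmented_filtration B) X &
      solves_sde T b x B X].

Definition weak_solution (d : nat) (T H : R) (b : R -> 'rV[R]_d -> 'rV[R]_d)
    (x : 'rV[R]_d) (F : R -> set (set Omega)) (X B : R -> Omega -> 'rV[R]_d) :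
    Prop :=
  [/\ usual_filtration T F,
      adapted T F X,
      is_filtration_fbm T H F B &
      solves_sde T b x B X].

End Probability.

Definition pathwise_uniqueness (R : realType) (d : nat) (T H : R)
    (b : R -> 'rV[R]_d -> 'rV[R]_d) : Prop :=
  forall (x : 'rV[R]_d) (disp : measure_display) (Omega : measurableType disp)
    (P : probability Omega R) (F : R -> set (set Omega))
    (B X Y : R -> Omega -> 'rV[R]_d),
    weak_solution P T H b x F X B -> weak_solution P T H b x F Y B ->
    indistinguishable P T X Y.

(* Main.v *)
(* Write X_t(x) = phi_t(x) + B_t. The drift part phi is pathwise Lipschitz in t,
   so it is enough to bound the L^2 norm of the gap D = phi(x) - phi(y) by
   C |x - y| at dyadic times. The increments of D are integrals of
   b(s, B_s + phi_s(x)) - b(s, B_s + phi_s(y)), and since b is only continuous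
   all regularity must come from B. For H < 1/2 the increments of B are
   negatively correlated, hence B is locally nondeterministic: B_r minus a
   linear combination of its past increments up to s is a Gaussian variable
   independent of the past, with variance at least (r - s)^(2H) / 2. Averaging
   over it shows that, conditionally on the past of s, a spatial difference of b
   of order k at time r is Lipschitz with constant of order (r - s)^(- k H),
   k = 1, 2.
   Riemann sums of the increments of D are then estimated by stochastic sewing:
   they are halved dyadically, the martingale parts being orthogonal in L^2.
   This gives |D_t - D_s| <= C (t - s)^(1/2) ((t - s)^(1/2 - H) |D| + o(1)) in
   L^2, and because 1/2 - H > 0 the estimate closes on short windows and is
   iterated over [0, T]. *)
Require Import Defs.
From mathcomp Require Import all_boot all_order all_algebra.
From mathcomp Require Import all_classical all_reals all_analysis.
From mathcomp Require Import measurable_realfun ring lra.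
Set Implicit Arguments.
Unset Strict Implicit.
Unset Printing Implicit Defensive.
Import Order.TTheory GRing.Theory Num.Theory.
Import numFieldNormedType.Exports.
Local Open Scope classical_set_scope.
Local Open Scope ring_scope.

(** * Bounded random variables and their L^2 norm *)

(** H < 1/2 acts three times: t^(2H) is concave, which fixes the signs of the increment covariances;
    (r - s)^(- 2H) is summable over a grid with a bound uniform in the mesh; and the leftover power
    1/2 - H is positive. The smoothing estimates are kept in dual form, as expectations against past
    events and then against bounded past-measurable weights; a conditional expectation is bounded in
    L^2 by testing it against itself. The first factor of the latter is at most of order u - k, so
    the estimate stays linear in D and can be iterated. The resulting bound is linear in x - y, with
    a constant independent of the mesh. No maximal inequality is then needed: the supremum over
    [0, T] is bounded by a sum over 2^m + 1 times plus a remainder of order 2^(- m), and m is fixed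
    before x tends to x0. *)

Definition brv (R : realType) (disp : measure_display)
    (Omega : measurableType disp) (Z : Omega -> R) : Prop :=
  measurable_fun setT Z /\ exists K : R, forall w, `|Z w| <= K.

Section BoundedFunctions.
Context {R : realType} {disp : measure_display} {Omega : measurableType disp}.
Implicit Types X Y Z : Omega -> R.

Lemma brv_cst (c : R) : brv (fun _ : Omega => c).
Proof. by split; [exact: measurable_cst|exists `|c|]. Qed.

Lemma brvD X Y : brv X -> brv Y -> brv (fun w => X w + Y w).
Proof.
move=> [mX [K hK]] [mY [L hL]]; split; first exact: measurable_funD.
by exists (K + L) => w; rewrite (le_trans (ler_normD _ _))// lerD.
Qed.

Lemma brvM X Y : brv X -> brv Y -> brv (fun w => X w * Y w).
Proof.
move=> [mX [K hK]] [mY [L hL]]; split; first exact: measurable_funM.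
by exists (K * L) => w; rewrite normrM ler_pM.
Qed.

Lemma brvZ (c : R) X : brv X -> brv (fun w => c * X w).
Proof. by move=> bX; apply: brvM => //; exact: brv_cst. Qed.

Lemma brvN X : brv X -> brv (fun w => - X w).
Proof. by move=> /(brvZ (-1)); under eq_fun do rewrite mulN1r. Qed.

Lemma brvB X Y : brv X -> brv Y -> brv (fun w => X w - Y w).
Proof. by move=> bX bY; apply: brvD => //; exact: brvN. Qed.

Lemma brv_norm X : brv X -> brv (fun w => `|X w|).
Proof.
move=> [mX [K hK]]; split; first exact: measurableT_comp.
by exists K => w; rewrite normr_id.
Qed.

Lemma brvX X : brv X -> brv (fun w => X w ^+ 2).
Proof. by move=> bX; under eq_fun do rewrite expr2; exact: brvM. Qed.

Lemma brv_sum (I : Type) (s : seq I) (p : pred I) (X : I -> Omega -> R) :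
  (forall i, p i -> brv (X i)) -> brv (fun w => \sum_(i <- s | p i) X i w).
Proof.
move=> h; elim: s => [|i s ih].
  rewrite (_ : (fun w => _) = fun=> 0); first exact: brv_cst.
  by apply/funext => w; rewrite big_nil.
case: (boolP (p i)) => pi.
  rewrite (_ : (fun w => _) = fun w => X i w + \sum_(i <- s | p i) X i w).
    by apply: brvD => //; exact: h.
  by apply/funext => w; rewrite big_cons pi.
rewrite (_ : (fun w => _) = fun w => \sum_(i <- s | p i) X i w)//.
by apply/funext => w; rewrite big_cons (negbTE pi).
Qed.

Lemma brv_indic (A : set Omega) : measurable A -> brv (\1_A : Omega -> R).
Proof.
move=> mA; split; first exact: measurable_indic.
by exists 1 => w; rewrite indicE; case: (_ \in _); rewrite ?normr1 ?normr0.
Qed.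

Lemma brv_comp (f : R -> R) X : measurable_fun setT f ->
  (exists K : R, forall x, `|f x| <= K) -> measurable_fun setT X ->
  brv (fun w => f (X w)).
Proof. by move=> mf [K hK] mX; split; [exact: measurableT_comp|exists K]. Qed.

End BoundedFunctions.

Section BoundedExpectation.
Context {R : realType} {disp : measure_display} {Omega : measurableType disp}.
Variable P : probability Omega R.
Implicit Types X Y Z : Omega -> R.

Definition Ex Z : R := \int[P]_w Z w.

Lemma brv_integrable Z : brv Z -> P.-integrable setT (EFin \o Z).
Proof.
move=> [mZ [K hK]]; apply: measurable_bounded_integrable => //.
  exact: le_lt_trans (probability_le1 P measurableT) (ltry _).
exists K; split; first exact: num_real.
by move=> M KM w _ /=; rewrite (le_trans (hK w))// ltW.
Qed.

Lemma eq_Ex X Y : (forall w, X w = Y w) -> Ex X = Ex Y.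
Proof. by move=> h; congr Ex; apply/funext. Qed.

Lemma Ex_cst (c : R) : Ex (fun=> c) = c.
Proof. rewrite /Ex Rintegral_cst// -[RHS]mulr1; congr (_ * _).
by rewrite -[RHS]/(fine 1%E); congr fine; exact: probability_setT. Qed.

Lemma ExD X Y : brv X -> brv Y -> Ex (fun w => X w + Y w) = Ex X + Ex Y.
Proof. by move=> bX bY; apply: RintegralD => //; exact: brv_integrable. Qed.

Lemma ExB X Y : brv X -> brv Y -> Ex (fun w => X w - Y w) = Ex X - Ex Y.
Proof. by move=> bX bY; apply: RintegralB => //; exact: brv_integrable. Qed.

Lemma ExZ c X : brv X -> Ex (fun w => c * X w) = c * Ex X.
Proof. by move=> bX; apply: RintegralZl => //; exact: brv_integrable. Qed.

Lemma Ex_sum (I : Type) (s : seq I) (p : pred I) (X : I -> Omega -> R) :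
  (forall i, p i -> brv (X i)) ->
  Ex (fun w => \sum_(i <- s | p i) X i w) = \sum_(i <- s | p i) Ex (X i).
Proof.
move=> h; elim: s => [|i s ih].
  rewrite big_nil -[RHS](Ex_cst 0).
  by apply: eq_Ex => w; rewrite big_nil.
rewrite big_cons; case: ifPn => pi.
  rewrite -ih -ExD//; first by apply: eq_Ex => w; rewrite big_cons pi.
    exact: h.
  exact: brv_sum.
by rewrite -ih; apply: eq_Ex => w; rewrite big_cons (negbTE pi).
Qed.

Lemma Ex_le X Y : brv X -> brv Y -> (forall w, X w <= Y w) -> Ex X <= Ex Y.
Proof.
by move=> bX bY h; apply: le_Rintegral => //; exact: brv_integrable.
Qed.

Lemma Ex_ge0 X : (forall w, 0 <= X w) -> 0 <= Ex X.
Proof. by move=> h; apply: Rintegral_ge0. Qed.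

Lemma Ex_norm X : brv X -> `|Ex X| <= Ex (fun w => `|X w|).
Proof. by move=> bX; apply: le_normr_Rintegral => //; exact: brv_integrable. Qed.

Lemma Ex_bound X (K : R) : brv X -> (forall w, `|X w| <= K) -> `|Ex X| <= K.
Proof.
move=> bX h; rewrite (le_trans (Ex_norm bX))// -[leRHS]Ex_cst.
by apply: Ex_le => //; [exact: brv_norm|exact: brv_cst].
Qed.

Lemma Ex_indic (A : set Omega) : measurable A -> Ex \1_A = fine (P A).
Proof. by move=> mA; rewrite /Ex /Rintegral integral_indic// setIT. Qed.

Lemma Ex_cvg (Z_ : nat -> Omega -> R) Z (K : R) :
  (forall n, measurable_fun setT (Z_ n)) -> measurable_fun setT Z ->
  (forall n w, `|Z_ n w| <= K) ->
  {ae P, forall w, Z_ n w @[n --> \oo] --> Z w} ->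
  Ex (Z_ n) @[n --> \oo] --> Ex Z.
Proof.
move=> mZ_ mZ hK hZ; rewrite /Ex /Rintegral.
have [|||||iZ _ cZ] := @dominated_convergence _ _ _ P setT measurableT
   (fun n w => (Z_ n w)%:E) (fun w => (Z w)%:E) (fun=> K%:E).
- by move=> n; exact/measurable_EFinP.
- exact/measurable_EFinP.
- by apply: filterS hZ => w hw _; exact: cvg_EFin (nearW _ _) hw.
- exact: finite_measure_integrable_cst.
- by apply: aeW => w n _ /=; rewrite lee_fin.
apply: fine_cvg; rewrite fineK//.
exact: integrable_fin_num.
Qed.

Lemma Ex_sqr_ge0 X : 0 <= Ex (fun w => X w ^+ 2).
Proof. by apply: Ex_ge0 => w; exact: sqr_ge0. Qed.

Definition nr X : R := Num.sqrt (Ex (fun w => X w ^+ 2)).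

Lemma nr_ge0 X : 0 <= nr X. Proof. exact: sqrtr_ge0. Qed.

Lemma nr_sqr X : nr X ^+ 2 = Ex (fun w => X w ^+ 2).
Proof. by rewrite sqr_sqrtr// Ex_sqr_ge0. Qed.

Lemma cauchy_schwarz X Y : brv X -> brv Y ->
  `|Ex (fun w => X w * Y w)| <= nr X * nr Y.
Proof.
move=> bX bY.
have bXY := brvM bX bY; have bX2 := brvX bX; have bY2 := brvX bY.
set c := Ex _; set a := Ex (fun w => X w ^+ 2).
set b := Ex (fun w => Y w ^+ 2).
have a0 : 0 <= a by exact: Ex_sqr_ge0.
have b0 : 0 <= b by exact: Ex_sqr_ge0.
have H t : 0 <= t ^+ 2 * a + 2 * t * c + b.
  have -> : t ^+ 2 * a + 2 * t * c + b = Ex (fun w => (t * X w + Y w) ^+ 2).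
    rewrite -!ExZ// -!ExD//; try exact: brvZ; last first.
      by apply: brvD; exact: brvZ.
    by apply: eq_Ex => w; ring.
  exact: Ex_sqr_ge0.
have cab : c ^+ 2 <= a * b.
  have [a1|a1] := eqVneq a 0.
    (* With a = 0 the polynomial is affine in t; unless c = 0, its value at this point is -1. *)
    have := H (- (b + 1) / (2 * c)); have := H 0.
    rewrite a1 mul0r mulr0 add0r.
    have [->|c1] := eqVneq c 0; first by rewrite expr0n.
    have -> : 2 * (- (b + 1) / (2 * c)) * c = - (b + 1) by field.
    by lra.
  have a2 : 0 < a by rewrite lt_neqAle eq_sym a1.
  have := H (- c / a).
  have -> : (- c / a) ^+ 2 * a + 2 * (- c / a) * c + b = (a * b - c ^+ 2) / a by field.
  by rewrite pmulr_lge0 ?invr_gt0// subr_ge0.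
rewrite /nr -sqrtrM// -sqrtr_sqr ler_wsqrtr//.
Qed.

Lemma Ex_mul_le X Y : brv X -> brv Y -> Ex (fun w => X w * Y w) <= nr X * nr Y.
Proof. by move=> bX bY; exact: le_trans (ler_norm _) (cauchy_schwarz bX bY). Qed.

Lemma nrD X Y : brv X -> brv Y -> nr (fun w => X w + Y w) <= nr X + nr Y.
Proof.
move=> bX bY; rewrite -(ler_pXn2r (ltn0Sn 1)) ?nnegrE ?addr_ge0 ?nr_ge0//.
have -> : nr (fun w => X w + Y w) ^+ 2 =
    nr X ^+ 2 + 2 * Ex (fun w => X w * Y w) + nr Y ^+ 2.
  rewrite !nr_sqr -ExZ; last exact: brvM.
  rewrite -ExD; [|exact: brvX|by apply: brvZ; exact: brvM].
  rewrite -ExD; [|by apply: brvD; [exact: brvX|apply: brvZ; exact: brvM]|exact: brvX].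
  by apply: eq_Ex => w; ring.
have := Ex_mul_le bX bY; rewrite sqrrD; move: (nr X * nr Y) => a; lra.
Qed.

Lemma nrZ c X : brv X -> nr (fun w => c * X w) = `|c| * nr X.
Proof.
move=> bX; rewrite /nr; under eq_Ex do rewrite exprMn.
by rewrite ExZ; [rewrite sqrtrM ?sqr_ge0// sqrtr_sqr|exact: brvX].
Qed.

Lemma nrN X : nr (fun w => - X w) = nr X.
Proof. by rewrite /nr; under eq_Ex do rewrite sqrrN. Qed.

Lemma nrB X Y : brv X -> brv Y -> nr (fun w => X w - Y w) <= nr X + nr Y.
Proof.
by move=> bX bY; rewrite -(nrN Y); apply: nrD => //; exact: brvN.
Qed.

Lemma nr_le X Y : brv X -> brv Y -> (forall w, `|X w| <= `|Y w|) -> nr X <= nr Y.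
Proof.
move=> bX bY h; apply: ler_wsqrtr; apply: Ex_le; try exact: brvX.
by move=> w; rewrite -[leLHS]real_normK ?num_real// -[leRHS]real_normK ?num_real//
  ler_pXn2r ?nnegrE.
Qed.

Lemma nr_norm X : nr (fun w => `|X w|) = nr X.
Proof. by rewrite /nr; under eq_Ex do rewrite real_normK ?num_real//. Qed.

Lemma nr_cst c : nr (fun=> c) = `|c|.
Proof. by rewrite /nr Ex_cst sqrtr_sqr. Qed.

Lemma nr_bound X K : brv X -> (forall w, `|X w| <= K) -> nr X <= K.
Proof.
move=> bX h; have K0 : 0 <= K.
  have [//|K0] := leP 0 K.
  suff : P setT = 0%E by rewrite probability_setT => /eqP; rewrite onee_eq0.
  suff -> : @setT Omega = set0 by rewrite measure0.
  by apply/seteqP; split => // w; have := le_lt_trans (h w) K0; rewrite ltNge normr_ge0.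
rewrite -[leRHS]ger0_norm// -(nr_cst K); apply: nr_le => //; first exact: brv_cst.
by move=> w; rewrite (ger0_norm K0).
Qed.

Lemma nr_sum (I : Type) (s : seq I) (p : pred I) (X : I -> Omega -> R) :
  (forall i, p i -> brv (X i)) ->
  nr (fun w => \sum_(i <- s | p i) X i w) <= \sum_(i <- s | p i) nr (X i).
Proof.
move=> h; elim: s => [|i s ih].
  rewrite big_nil (_ : (fun w => _) = fun=> 0) ?nr_cst ?normr0//.
  by apply/funext => w; rewrite big_nil.
rewrite big_cons; case: ifPn => pi.
  rewrite (_ : (fun w => _) = fun w => X i w + \sum_(i <- s | p i) X i w).
    apply: le_trans (nrD _ _) _; [exact: h|exact: brv_sum|by rewrite lerD2l].
  by apply/funext => w; rewrite big_cons pi.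
rewrite (_ : (fun w => _) = fun w => \sum_(i <- s | p i) X i w)//.
by apply/funext => w; rewrite big_cons (negbTE pi).
Qed.

Lemma nr_cvg0 (Z_ : nat -> Omega -> R) (K : R) :
  (forall n, measurable_fun setT (Z_ n)) ->
  (forall n w, `|Z_ n w| <= K) ->
  {ae P, forall w, Z_ n w @[n --> \oo] --> (0 : R)} ->
  nr (Z_ n) @[n --> \oo] --> (0 : R).
Proof.
move=> mZ hK h0; rewrite -[X in _ --> X]sqrtr0.
apply: continuous_cvg; first exact: sqrt_continuous.
rewrite -[X in _ --> X](Ex_cst 0).
apply: (@Ex_cvg _ _ (K ^+ 2)).
- by move=> n; exact: measurable_funX.
- exact: measurable_cst.
- move=> n w; rewrite ger0_norm ?sqr_ge0// -real_normK ?num_real//.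
  by rewrite ler_pXn2r ?nnegrE// (le_trans _ (hK n w)).
- apply: filterS h0 => w h; rewrite -[X in _ --> X](mulr0 0).
  by under eq_fun do rewrite expr2; exact: cvgM.
Qed.

(** Pythagoras for martingale differences. Orthogonality is asked for i < j only, the case in which
    the later term is tested against an earlier, already known one. *)
Lemma nr_orth_sum (n : nat) (M : nat -> Omega -> R) :
  (forall i, (i < n)%N -> brv (M i)) ->
  (forall i j, (i < j)%N -> (j < n)%N -> Ex (fun w => M i w * M j w) = 0) ->
  nr (fun w => \sum_(i < n) M i w) ^+ 2 = \sum_(i < n) nr (M i) ^+ 2.
Proof.
elim: n => [|n ih] bM orth.
  rewrite big_ord0 (_ : (fun w => _) = fun=> 0) ?nr_cst ?normr0 ?expr0n//.
  by apply/funext => w; rewrite big_ord0.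
have bS : brv (fun w => \sum_(i < n) M i w).
  by apply: brv_sum => i _; apply: bM; exact: leqW.
have bn : brv (M n) by exact: bM.
rewrite big_ord_recr/= -ih; last 2 first.
- by move=> i h; apply: bM; exact: leqW.
- by move=> i j ij jn; apply: orth => //; exact: leqW.
have E0 : Ex (fun w => (\sum_(i < n) M i w) * M n w) = 0.
  under eq_Ex do rewrite mulr_suml.
  rewrite Ex_sum; last by move=> i _; apply: brvM => //; apply: bM; exact: leqW.
  by rewrite big1// => i _; apply: orth.
rewrite !nr_sqr.
pose S w := \sum_(i < n) M i w.
transitivity (Ex (fun w => (S w ^+ 2 + 2 * (S w * M n w)) + M n w ^+ 2)).
  by apply: eq_Ex => w; rewrite big_ord_recr/= -/(S w); ring.
have bSM : brv (fun w => S w * M n w) by exact: brvM.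
have bS2 : brv (fun w => S w ^+ 2) by exact: brvX.
have b2 : brv (fun w => 2 * (S w * M n w)) by exact: brvZ.
rewrite ExD; [|exact: brvD|exact: brvX].
by rewrite ExD// ExZ// E0 mulr0 addr0.
Qed.

End BoundedExpectation.

(** * Increments of fractional Brownian motion *)

Section PowerInequalities.
Context {R : realType}.
Implicit Types p x y : R.

(** Young's inequality for the product of y^p and 1, with the conjugate exponents 1 / p and 1 / (1 -
    p). *)
Lemma powR_le_tangent1 p y : 0 < p < 1 -> 0 <= y -> y `^ p <= 1 + p * (y - 1).
Proof.
move=> /andP[p0 p1] y0.
have q0 : 0 < 1 - p by rewrite subr_gt0.
have := @conjugate_powR R (y `^ p) 1 p^-1 (1 - p)^-1 (powR_ge0 _ _) ler01.
rewrite !invr_gt0 !invrK mulr1 powR1 mul1r => /(_ p0 q0) H.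
have e : p + (1 - p) = 1 by ring.
by have := H e; rewrite -powRrM mulfV ?gt_eqF// powRr1//; lra.
Qed.

Lemma powR_le_tangent p x y : 0 < p < 1 -> 0 < x -> 0 <= y ->
  y `^ p <= x `^ p + p * x `^ p * (y / x - 1).
Proof.
move=> hp x0 y0.
have -> : y `^ p = x `^ p * (y / x) `^ p.
  by rewrite -powRM ?divr_ge0 ?(ltW x0)// mulrC divfK ?gt_eqF.
rewrite (mulrC p) -mulrA -{2}[x `^ p]mulr1 -mulrDr ler_wpM2l ?powR_ge0//.
by apply: powR_le_tangent1 => //; rewrite divr_ge0 ?(ltW x0).
Qed.

(** The tangent at the barycentre [x] is averaged over both points, and its slope cancels. The case
    [x = 0] is separate because the tangent divides by [x]. *)
Lemma powR_concave p a b l : 0 < p < 1 -> 0 <= a -> 0 <= b -> 0 <= l <= 1 ->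
  l * a `^ p + (1 - l) * b `^ p <= (l * a + (1 - l) * b) `^ p.
Proof.
move=> hp a0 b0 /andP[l0 l1]; have p0 : 0 < p by case/andP: hp.
set x := l * a + _.
have x0 : 0 <= x by rewrite addr_ge0// mulr_ge0// subr_ge0.
have [xz|xz] := eqVneq x 0.
  have la : l * a = 0.
    by apply/eqP; rewrite eq_le mulr_ge0// andbT -xz lerDl mulr_ge0// subr_ge0.
  have lb : (1 - l) * b = 0 by move: xz; rewrite /x la add0r.
  rewrite xz powR0 ?gt_eqF//.
  move/eqP : la; rewrite mulf_eq0 => /orP[/eqP lz|/eqP ->].
    by move: lb; rewrite lz subr0 mul1r => ->; rewrite powR0 ?gt_eqF//; lra.
  move/eqP : lb; rewrite mulf_eq0 => /orP[/eqP ->|/eqP ->];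
    by rewrite powR0 ?gt_eqF// !(mul0r,mulr0) addr0.
have xp : 0 < x by rewrite lt_neqAle eq_sym xz.
have Ta := powR_le_tangent hp xp a0.
have Tb := powR_le_tangent hp xp b0.
have m0 : 0 <= 1 - l by rewrite subr_ge0.
have := lerD (ler_wpM2l l0 Ta) (ler_wpM2l m0 Tb).
suff -> : l * (x `^ p + p * x `^ p * (a / x - 1)) +
  (1 - l) * (x `^ p + p * x `^ p * (b / x - 1)) = x `^ p by [].
have xE : l * a + (1 - l) * b = x by [].
transitivity (x `^ p + p * x `^ p * ((l * a + (1 - l) * b) / x - 1)).
  by clearbody x; field.
by rewrite xE divff//; ring.
Qed.

(** The inner points [c] and [a + e] are convex combinations of the outer points [a] and [c + e],
    with exchanged weights l and 1 - l; the two concavity inequalities are added. *)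
Lemma powR_decr_increments p a c e : 0 < p < 1 -> 0 <= a -> a <= c -> 0 <= e ->
  (c + e) `^ p + a `^ p <= c `^ p + (a + e) `^ p.
Proof.
move=> hp a0 ac e0.
have [ez|ez] := eqVneq (c - a + e) 0.
  have -> : e = 0 by lra.
  have -> : c = a by lra.
  by rewrite addr0.
have s0 : 0 < c - a + e.
  by rewrite lt_neqAle eq_sym ez/=; lra.
pose l := e / (c - a + e).
have l0 : 0 <= l by rewrite divr_ge0// ltW.
have l1 : l <= 1 by rewrite ler_pdivrMr//; lra.
have c0 : 0 <= c by exact: le_trans ac.
have ce0 : 0 <= c + e by exact: addr_ge0.
have H1 := powR_concave hp a0 ce0 (introT andP (conj l0 l1)).
have hl : 0 <= 1 - l <= 1 by lra.
have H2 := powR_concave hp a0 ce0 hl.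
have E1 : l * a + (1 - l) * (c + e) = c by rewrite /l; field.
have E2 : (1 - l) * a + (1 - (1 - l)) * (c + e) = a + e by rewrite /l; field.
rewrite E1 in H1; rewrite E2 in H2.
lra.
Qed.

(** Comparison with the integral of t^(- g): the tangent to t^(1 - g) at n + 1, evaluated at n,
    bounds each term by an increment of t^(1 - g) / (1 - g). *)
Lemma sum_powRN_le (g : R) (n : nat) : 0 < g < 1 ->
  \sum_(i < n) (i.+1%:R : R) `^ (- g) <= n%:R `^ (1 - g) / (1 - g).
Proof.
move=> /andP[g0 g1]; have q0 : 0 < 1 - g by rewrite subr_gt0.
have hp : 0 < 1 - g < 1 by lra.
elim: n => [|n ih]; first by rewrite big_ord0 powR0 ?gt_eqF// mul0r.
rewrite big_ord_recr/=; apply: le_trans (lerD ih (lexx _)) _.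
rewrite ler_pdivlMr// mulrDl divfK ?gt_eqF//.
have n0 : 0 < n.+1%:R :> R by rewrite ltr0n.
have := powR_le_tangent hp n0 (ler0n R n).
have -> : n%:R / n.+1%:R - 1 = - n.+1%:R^-1 :> R.
  by rewrite -natr1; field; rewrite natr1 gt_eqF.
have -> : n.+1%:R `^ (1 - g) = n.+1%:R * n.+1%:R `^ (- g) :> R.
  by rewrite powRD ?powRr1 ?(ltW n0)// (gt_eqF n0) implybT.
set u := _ `^ (- g) => H; apply: le_trans (lerD H (lexx _)) _.
have -> : (1 - g) * (n.+1%:R * u) * - n.+1%:R^-1 = - ((1 - g) * u).
  by field; rewrite nat1r gt_eqF.
lra.
Qed.

Lemma sum_geometric_le (w : R) (n : nat) : 0 <= w < 1 ->
  \sum_(i < n) w ^+ i <= (1 - w)^-1.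
Proof.
move=> /andP[w0 w1]; have q0 : 0 < 1 - w by rewrite subr_gt0.
rewrite -[leRHS]mul1r ler_pdivlMr// mulrC -opprB mulNr -subrX1 opprB.
by rewrite gerBl exprn_ge0.
Qed.

End PowerInequalities.

Section QuadraticForm.
Context {R : realType}.

(** As for a graph Laplacian, the difference of the two sides is half the sum of (c_i - c_k)^2 (-
    G_ik). The diagonal does not contribute and the other entries have a sign. *)
Lemma sum_sqr_rowsum_le (n : nat) (G : 'I_n -> 'I_n -> R) (c : 'I_n -> R) :
  (forall i k, G i k = G k i) -> (forall i k, i != k -> G i k <= 0) ->
  \sum_i c i ^+ 2 * (\sum_k G i k) <= \sum_i \sum_k c i * c k * G i k.
Proof.
move=> Gs Gn.
have E : \sum_i \sum_k c k ^+ 2 * G i k = \sum_i c i ^+ 2 * \sum_k G i k.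
  rewrite exchange_big/=; apply: eq_bigr => i _; rewrite mulr_sumr.
  by apply: eq_bigr => k _; rewrite Gs.
rewrite -subr_ge0.
have -> : \sum_i \sum_k c i * c k * G i k - \sum_i c i ^+ 2 * (\sum_k G i k) =
    2^-1 * \sum_i \sum_k (c i - c k) ^+ 2 * - G i k.
  have -> : \sum_i \sum_k (c i - c k) ^+ 2 * - G i k =
      2 * \sum_i \sum_k c i * c k * G i k - \sum_i \sum_k c i ^+ 2 * G i k
      - \sum_i \sum_k c k ^+ 2 * G i k.
    rewrite mulr_sumr -!sumrB; apply: eq_bigr => i _.
    by rewrite mulr_sumr -!sumrB; apply: eq_bigr => k _; ring.
  rewrite E; under [X in 2 * _ - X - _]eq_bigr do rewrite -mulr_sumr.
  by field.
rewrite mulr_ge0// sumr_ge0// => i _; rewrite sumr_ge0// => k _.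
have [->|ik] := eqVneq i k; first by rewrite subrr expr0n/= mul0r.
by rewrite mulr_ge0 ?sqr_ge0// oppr_ge0 Gn.
Qed.

End QuadraticForm.

Section FbmIncrements.
Context {R : realType}.
Variables (H : R) (tau : nat -> R).
Hypothesis hH : 0 < H < 2^-1.
Hypothesis tau0 : tau 0%N = 0.
Hypothesis tauS : forall i, tau i <= tau i.+1.
Let p := 2 * H.

Let hp : 0 < p < 1.
Proof. by rewrite /p; case/andP: hH => H0 H1; apply/andP; split; lra. Qed.

Let tauM i j : (i <= j)%N -> tau i <= tau j.
Proof. by move=> /subnK <-; elim: (j - i)%N => // n ih; exact: le_trans (tauS _). Qed.

Lemma fbm_covC t s : fbm_cov H t s = fbm_cov H s t.
Proof. by rewrite /fbm_cov distrC (addrC (t `^ _)). Qed.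

Lemma fbm_cov0 t : 0 <= t -> fbm_cov H t 0 = 0.
Proof.
move=> t0; rewrite /fbm_cov subr0 (ger0_norm t0) powR0 ?addr0 ?subrr ?mulr0//.
by case/andP: hp => h _; rewrite gt_eqF.
Qed.

Definition fbm_incr_cov i k : R :=
  fbm_cov H (tau i.+1) (tau k.+1) - fbm_cov H (tau i.+1) (tau k)
  - fbm_cov H (tau i) (tau k.+1) + fbm_cov H (tau i) (tau k).

Lemma fbm_incr_covC i k : fbm_incr_cov i k = fbm_incr_cov k i.
Proof.
rewrite /fbm_incr_cov (fbm_covC (tau i.+1)) (fbm_covC (tau i.+1)).
by rewrite (fbm_covC (tau i)) (fbm_covC (tau i)); ring.
Qed.

(** The one-variable terms of [fbm_cov] cancel, leaving a difference of two increments of t^(2H) of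
    equal length, whose sign is given by concavity. *)
Lemma fbm_incr_cov_le0 i k : (i < k)%N -> fbm_incr_cov i k <= 0.
Proof.
move=> ik; rewrite /fbm_incr_cov /fbm_cov.
have h1 := tauM ik; have h2 := tauS i; have h3 := tauS k.
rewrite (distrC (tau i.+1)) (distrC (tau i.+1)) (distrC (tau i)) (distrC (tau i)).
rewrite !ger0_norm ?subr_ge0//; try lra.
have a0 : 0 <= tau k - tau i.+1 by lra.
have ac : tau k - tau i.+1 <= tau k - tau i by lra.
have e0 : 0 <= tau k.+1 - tau k by lra.
have := powR_decr_increments hp a0 ac e0.
have -> : tau k - tau i + (tau k.+1 - tau k) = tau k.+1 - tau i by ring.
have -> : tau k - tau i.+1 + (tau k.+1 - tau k) = tau k.+1 - tau i.+1 by ring.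
by rewrite -/p; lra.
Qed.

Lemma fbm_incr_cov_neq_le0 i k : i != k -> fbm_incr_cov i k <= 0.
Proof.
rewrite neq_ltn => /orP[|]; first exact: fbm_incr_cov_le0.
by rewrite fbm_incr_covC; exact: fbm_incr_cov_le0.
Qed.

(** The increments up to [tau n] add up to the value there, because the process vanishes at
    [tau 0 = 0]. *)
Lemma sum_fbm_incr_cov i n : \sum_(k < n) fbm_incr_cov i k =
  fbm_cov H (tau i.+1) (tau n) - fbm_cov H (tau i) (tau n).
Proof.
have t0 j : 0 <= tau j by rewrite -tau0 tauM.
elim: n => [|n ih]; first by rewrite big_ord0 tau0 !fbm_cov0// subrr.
by rewrite big_ord_recr/= ih /fbm_incr_cov; ring.
Qed.

(** The increment of t^(2H) between [tau i] and [tau i.+1] is nonnegative and is dropped. For the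
    last row, i = n - 1, the bound left is half the full power of the last gap. *)
Lemma fbm_incr_cov_rowsum i n : (i < n)%N ->
  2^-1 * ((tau n - tau i) `^ p - (tau n - tau i.+1) `^ p)
  <= \sum_(k < n) fbm_incr_cov i k.
Proof.
move=> i_n; rewrite sum_fbm_incr_cov /fbm_cov.
have h1 := tauM i_n; have h2 := tauS i.
have ti : 0 <= tau i by rewrite -tau0 tauM.
rewrite (distrC (tau i.+1)) (distrC (tau i)) !ger0_norm ?subr_ge0//; last lra.
have : tau i `^ p <= tau i.+1 `^ p.
  by rewrite ge0_ler_powR ?nnegrE//; [case/andP: hp => /ltW|lra].
rewrite -/p; lra.
Qed.

End FbmIncrements.

(** * Gaussian densities *)

Section NormalDensity.
Context {R : realType}.
Local Notation mu := (@lebesgue_measure R).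
Implicit Types (m s x a b c : R).

Lemma normal_pdf_expR m s x : 0 < s ->
  normal_pdf m s x = normal_peak s * expR (- (x - m) ^+ 2 / (s ^+ 2 *+ 2)).
Proof. by move=> s0; rewrite normal_pdfE ?gt_eqF. Qed.

Lemma normal_peak2 s : 0 < s -> normal_peak s = 2 * normal_peak (2 * s).
Proof.
move=> s0; rewrite /normal_peak.
have -> : (2 * s) ^+ 2 * pi *+ 2 = 2 ^+ 2 * (s ^+ 2 * pi *+ 2).
  by rewrite exprMn -mulrA mulrnAr.
rewrite [in RHS]sqrtrM ?sqr_ge0//.
by rewrite [in RHS]sqrtr_sqr ger0_norm// invfM mulrA divff ?mul1r// pnatr_eq0.
Qed.

Lemma normal_pdf_translate c m s x : 0 < s ->
  normal_pdf (c + m) s x = normal_pdf m s (x - c).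
Proof. by move=> s0; rewrite !normal_pdf_expR// opprD addrA. Qed.

(** Doubling the deviation absorbs a quadratic factor: with u = (x - m)^2 / s^2 the exponent gains
    3u/8, and 1 + u <= 3 (1 + 3u/8) <= 3 e^(3u/8). The remaining factor 2 is the ratio of the
    peaks. *)
Lemma normal_pdf_quad_le m s x : 0 < s ->
  (1 + (x - m) ^+ 2 / s ^+ 2) * normal_pdf m s x <= 6 * normal_pdf m (2 * s) x.
Proof.
move=> s0; have s20 : 0 < 2 * s by rewrite mulr_gt0.
rewrite !normal_pdf_expR// (normal_peak2 s0).
set c := normal_peak _; have c0 : 0 <= c by exact: normal_peak_ge0.
set u := (x - m) ^+ 2 / s ^+ 2.
have u0 : 0 <= u by rewrite divr_ge0// sqr_ge0.
have -> : - (x - m) ^+ 2 / (s ^+ 2 *+ 2) = - (u / 2).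
  by rewrite /u; field; rewrite gt_eqF.
have -> : - (x - m) ^+ 2 / ((2 * s) ^+ 2 *+ 2) = - (u / 8).
  by rewrite /u; field; rewrite gt_eqF.
have -> : - (u / 8) = 3 / 8 * u + - (u / 2) by field.
rewrite expRD; have := expR_ge1Dx (3 / 8 * u).
set A := expR (3 / 8 * u) => hA.
have E0 : 0 <= expR (- (u / 2)) by exact: expR_ge0.
have : (1 + u) * (2 * c * expR (- (u / 2))) <=
    (3 * A) * (2 * c * expR (- (u / 2))).
  by apply: ler_wpM2r; [rewrite !mulr_ge0|lra].
by move=> /le_trans; apply; rewrite le_eqVlt; apply/orP; left; apply/eqP; ring.
Qed.

(** For |m| <= s the two exponents differ by a quadratic in x that is at most 1, hence the factor e;
    2 is the ratio of the peaks. *)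
Lemma normal_pdf_recenter_le m s x : 0 < s -> `|m| <= s ->
  normal_pdf m s x <= 2 * expR 1 * normal_pdf 0 (2 * s) x.
Proof.
move=> s0 ms; have s20 : 0 < 2 * s by rewrite mulr_gt0.
rewrite !normal_pdf_expR// (normal_peak2 s0) subr0.
set c := normal_peak _; have c0 : 0 <= c by exact: normal_peak_ge0.
rewrite -!mulrA ler_wpM2l// mulrCA ler_wpM2l// -expRD ler_expR.
have s2 : 0 < s ^+ 2 by rewrite exprn_gt0.
have m2 : m ^+ 2 <= s ^+ 2.
  by rewrite -[leLHS]real_normK ?num_real// ler_pXn2r// nnegrE ltW.
rewrite -subr_ge0.
have -> : 1 + - x ^+ 2 / ((2 * s) ^+ 2 *+ 2) - - (x - m) ^+ 2 / (s ^+ 2 *+ 2) =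
   (8 * s ^+ 2 - x ^+ 2 + 4 * (x - m) ^+ 2) / (8 * s ^+ 2).
  by field; rewrite gt_eqF.
rewrite divr_ge0//; last by rewrite mulr_ge0// ltW.
have := sqr_ge0 (x - 2 * m); have := sqr_ge0 x; nra.
Qed.

Lemma is_derive_normal_pdf m s x : 0 < s ->
  is_derive x (1 : R) (normal_pdf m s) (- ((x - m) / s ^+ 2 * normal_pdf m s x)).
Proof.
move=> s0.
have -> : normal_pdf m s =
    (fun y => normal_peak s * expR (- (y - m) ^+ 2 / (s ^+ 2 *+ 2))).
  by apply/funext => y; rewrite normal_pdf_expR.
apply: is_derive_eq; rewrite /GRing.scale/=; field.
by rewrite gt_eqF.
Qed.

Lemma is_derive_normal_pdf_mean m s x : 0 < s ->
  is_derive m (1 : R) (fun m => normal_pdf m s x)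
    ((x - m) / s ^+ 2 * normal_pdf m s x).
Proof.
move=> s0.
have -> : (fun m => normal_pdf m s x) =
    (fun m => normal_peak s * expR (- (x - m) ^+ 2 / (s ^+ 2 *+ 2))).
  by apply/funext => y; rewrite normal_pdf_expR.
rewrite normal_pdf_expR//; apply: is_derive_eq; rewrite /GRing.scale/=; field.
by rewrite gt_eqF.
Qed.

Lemma is_derive2_normal_pdf_mean m s x : 0 < s ->
  is_derive m (1 : R) (fun m => (x - m) / s ^+ 2 * normal_pdf m s x)
    (((x - m) ^+ 2 / s ^+ 2 - 1) / s ^+ 2 * normal_pdf m s x).
Proof.
move=> s0; have h := is_derive_normal_pdf_mean m x s0.
apply: is_derive_eq; rewrite /GRing.scale/=; field.
by rewrite gt_eqF.
Qed.

Lemma lipschitz_of_derive (f df : R -> R) (K r : R) a b :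
  (forall x, is_derive x (1 : R) f (df x)) ->
  (forall x, `|x| <= r -> `|df x| <= K) -> `|a| <= r -> `|b| <= r ->
  `|f b - f a| <= K * `|b - a|.
Proof.
move=> hf hK.
wlog ab : a b / a <= b.
  move=> H ar br; have [/H|/ltW/H] := leP a b; first exact.
  by rewrite distrC (distrC b); exact.
move=> ar br; have [|c] := @MVT_segment R f df a b ab.
  by apply: derivable_within_continuous => x _; apply: ex_derive.
 rewrite in_itv/= => /andP[ac cb] ->.
rewrite normrM ler_wpM2r//; apply: hK.
by move: ar br; rewrite !ler_norml => /andP[? ?] /andP[? ?]; apply/andP; split; lra.
Qed.

(** The factor 6 of [normal_pdf_quad_le] times the factor 2 e of [normal_pdf_recenter_le]. *)
Let K0 := (12 * expR 1 : R).

(** Means up to 2 s are allowed because a second difference evaluates the derivative at m + a with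
    both |m| and |a| at most s. Doubling once for the polynomial and once for the mean gives the
    deviation 4 s. *)
Let dq_le s x c : 0 < s -> `|c| <= 2 * s ->
  `|(x - c) / s ^+ 2 * normal_pdf c s x| <= K0 / s * normal_pdf 0 (4 * s) x.
Proof.
move=> s0 cs; have s20 : 0 < 2 * s by rewrite mulr_gt0.
have := normal_pdf_recenter_le x s20 cs.
rewrite (_ : 2 * (2 * s) = 4 * s); last by ring.
have := normal_pdf_quad_le c x s0.
have p0 := normal_pdf_ge0 c s x.
rewrite normrM (ger0_norm p0) => h1 h2.
have h3 : `|(x - c) / s ^+ 2| <= s^-1 * (1 + (x - c) ^+ 2 / s ^+ 2).
  have -> : (x - c) / s ^+ 2 = s^-1 * ((x - c) / s) by field; rewrite gt_eqF.
  rewrite normrM (gtr0_norm (x := s^-1)) ?invr_gt0// ler_pM2l ?invr_gt0//.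
  have -> : (x - c) ^+ 2 / s ^+ 2 = `|(x - c) / s| ^+ 2.
    by rewrite real_normK ?num_real// expr_div_n.
  by have := sqr_ge0 (`|(x - c) / s| - 1); nra.
apply: le_trans (ler_wpM2r p0 h3) _.
rewrite -[leLHS]mulrA (mulrC K0) -[leRHS]mulrA ler_wpM2l ?invr_ge0 ?(ltW s0)//.
by apply: le_trans h1 _; rewrite /K0; lra.
Qed.

Let ddq_le s x c : 0 < s -> `|c| <= 2 * s ->
  `|((x - c) ^+ 2 / s ^+ 2 - 1) / s ^+ 2 * normal_pdf c s x|
  <= K0 / s ^+ 2 * normal_pdf 0 (4 * s) x.
Proof.
move=> s0 cs; have s20 : 0 < 2 * s by rewrite mulr_gt0.
have := normal_pdf_recenter_le x s20 cs.
rewrite (_ : 2 * (2 * s) = 4 * s); last by ring.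
have := normal_pdf_quad_le c x s0.
have p0 := normal_pdf_ge0 c s x.
rewrite normrM (ger0_norm p0) => h1 h2.
have s2 : 0 < s ^+ 2 by rewrite exprn_gt0.
have u0 : 0 <= (x - c) ^+ 2 / s ^+ 2 by rewrite divr_ge0 ?sqr_ge0// ltW.
have h3 : `|((x - c) ^+ 2 / s ^+ 2 - 1) / s ^+ 2| <=
    (s ^+ 2)^-1 * (1 + (x - c) ^+ 2 / s ^+ 2).
  rewrite normrM mulrC (gtr0_norm (x := (s ^+ 2)^-1)) ?invr_gt0//.
  by rewrite ler_pM2l ?invr_gt0// ler_norml; apply/andP; split; lra.
apply: le_trans (ler_wpM2r p0 h3) _.
rewrite -[leLHS]mulrA (mulrC K0) -[leRHS]mulrA ler_wpM2l ?invr_ge0 ?(ltW s2)//.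
by apply: le_trans h1 _; rewrite /K0; lra.
Qed.

Lemma normal_pdf_diff1_le c a s x : 0 < s -> `|a| <= s ->
  `|normal_pdf (c + a) s x - normal_pdf c s x|
  <= K0 * `|a| / s * normal_pdf c (4 * s) x.
Proof.
move=> s0 as_; have s40 : 0 < 4 * s by rewrite mulr_gt0.
rewrite -{2 3}[c]addr0 !normal_pdf_translate//.
have := @lipschitz_of_derive (fun m => normal_pdf m s (x - c)) _ _ (2 * s) 0 a
  (fun m => is_derive_normal_pdf_mean m (x - c) s0)
  (fun m => @dq_le s (x - c) m s0).
rewrite normr0 subr0 => H; apply: le_trans (H _ _) _; [lra|lra|].
by rewrite le_eqVlt; apply/orP; left; apply/eqP; ring.
Qed.

Lemma normal_pdf_diff2_le a b s x : 0 < s -> `|a| <= s -> `|b| <= s ->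
  `|normal_pdf (a + b) s x - normal_pdf a s x - normal_pdf b s x
    + normal_pdf 0 s x|
  <= K0 * `|a| * `|b| / s ^+ 2 * normal_pdf 0 (4 * s) x.
Proof.
move=> s0 as_ bs.
pose q m := normal_pdf m s x.
pose dq m := (x - m) / s ^+ 2 * q m.
have hq m : is_derive m (1 : R) q (dq m) by exact: is_derive_normal_pdf_mean.
have hdq m := @is_derive2_normal_pdf_mean m s x s0.
pose F m := q (m + a) - q m.
have hF m : is_derive m (1 : R) F (dq (m + a) - dq m).
  apply: is_deriveB.
  have -> : (fun m => q (m + a)) = q \o (fun m => m + a) by [].
  rewrite -[dq _]mulr1; apply: is_derive1_comp.
  by apply: is_derive_eq; rewrite addr0.
have hK m : `|m| <= s -> `|dq (m + a) - dq m| <=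
    K0 / s ^+ 2 * normal_pdf 0 (4 * s) x * `|a|.
  move=> ms; have := @lipschitz_of_derive dq _ _ (2 * s) m (m + a) hdq
     (fun m => @ddq_le s x m s0).
  rewrite addrAC subrr add0r; apply; first lra.
  by rewrite (le_trans (ler_normD _ _))//; lra.
have := @lipschitz_of_derive F _ _ s 0 b hF hK.
rewrite normr0 subr0 => H.
have -> : normal_pdf (a + b) s x - normal_pdf a s x - normal_pdf b s x
    + normal_pdf 0 s x = F b - F 0.
  by rewrite /F /q add0r (addrC b); ring.
apply: le_trans (H _ _) _ => //; first exact: ltW.
by rewrite le_eqVlt; apply/orP; left; apply/eqP; ring.
Qed.

Lemma integrable_le_normal_pdf (f : R -> R) m s K :
  measurable_fun setT f -> (forall x, `|f x| <= K * normal_pdf m s x) ->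
  mu.-integrable setT (EFin \o f).
Proof.
move=> mf hf; apply: (@le_integrable _ _ _ mu setT measurableT _
   (fun x => (K * normal_pdf m s x)%:E)) => //.
- exact/measurable_EFinP.
- by move=> x _ /=; rewrite lee_fin (le_trans (hf x))// ler_norm.
- rewrite (_ : (fun x => _) = (fun x => K%:E * (normal_pdf m s x)%:E)%E) //.
  exact/integrableZl/integrable_normal_pdf.
Qed.

Lemma Rintegral_normal_pdf m s : \int[mu]_x normal_pdf m s x = 1.
Proof. by rewrite /Rintegral integral_normal_pdf. Qed.

Lemma Rintegral_le_normal_pdf (f : R -> R) m s K :
  measurable_fun setT f -> (forall x, 0 <= f x <= K * normal_pdf m s x) ->
  \int[mu]_x f x <= K.
Proof.
move=> mf hf.
have hn x : `|f x| <= K * normal_pdf m s x.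
  by have /andP[f0 fK] := hf x; rewrite ger0_norm.
rewrite -[leRHS]mulr1 -(Rintegral_normal_pdf m s) -RintegralZl//.
  apply: le_Rintegral => //; first exact: integrable_le_normal_pdf hn.
  - rewrite (_ : _ \o _ = (fun x => K%:E * (normal_pdf m s x)%:E)%E) //.
    exact/integrableZl/integrable_normal_pdf.
  - by move=> x _; case/andP : (hf x).
exact: integrable_normal_pdf.
Qed.

(** For |a| <= s the pointwise bound is integrated; beyond that scale the trivial bound 2 is already
    below the right-hand side. *)
Lemma normal_diff1_L1 c a s : 0 < s ->
  \int[mu]_x `|normal_pdf (c + a) s x - normal_pdf c s x| <= K0 * `|a| / s.
Proof.
move=> s0.
have mf : measurable_fun setT
    (fun x => `|normal_pdf (c + a) s x - normal_pdf c s x|).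
  apply: measurableT_comp => //; apply: measurable_funB;
    exact: measurable_normal_pdf.
have [as_|sa] := leP `|a| s.
  apply: Rintegral_le_normal_pdf mf _ => x; rewrite normr_ge0/=.
  exact: normal_pdf_diff1_le.
apply: (@le_trans _ _ 2); last first.
  rewrite ler_pdivlMr//; apply: (@le_trans _ _ (12 * `|a|)); first lra.
  by rewrite ler_wpM2r// /K0 ler_peMr//; have := expR_ge1Dx (1 : R); lra.
apply: (@le_trans _ _ (\int[mu]_x (normal_pdf (c + a) s x + normal_pdf c s x))).
  apply: le_Rintegral => //.
  - apply: integrable_norm.
    have -> : EFin \o (fun x => normal_pdf (c + a) s x - normal_pdf c s x) =
      ((fun x => (normal_pdf (c + a) s x)%:E) \- (fun x => (normal_pdf c s x)%:E))%E.
      by [].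
    by apply: integrableB => //; exact: integrable_normal_pdf.
  - have -> : EFin \o (fun x => normal_pdf (c + a) s x + normal_pdf c s x) =
      ((fun x => (normal_pdf (c + a) s x)%:E) \+ (fun x => (normal_pdf c s x)%:E))%E.
      by [].
    by apply: integrableD => //; exact: integrable_normal_pdf.
  - move=> x _; rewrite (le_trans (ler_normB _ _))//.
    by rewrite !ger0_norm// normal_pdf_ge0.
rewrite RintegralD//; [|exact: integrable_normal_pdf..].
by rewrite !Rintegral_normal_pdf; lra.
Qed.

(** If both shifts are at most s, the pointwise bound is integrated. Otherwise the larger one, b
    say, exceeds s: the expression is split into two first differences in a, and the missing factor
    |b| / s is at least 1. *)
Lemma normal_diff2_L1 a b s : 0 < s ->
  \int[mu]_x `|normal_pdf (a + b) s x - normal_pdf a s x - normal_pdf b s x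
    + normal_pdf 0 s x| <= 2 * K0 * `|a| * `|b| / s ^+ 2.
Proof.
move=> s0.
wlog ab : a b / `|a| <= `|b|.
  move=> H; have [/H//|/ltW/H] := leP `|a| `|b|.
  have -> : 2 * K0 * `|b| * `|a| = 2 * K0 * `|a| * `|b| by ring.
  rewrite (_ : (fun x => _) = (fun x => `|normal_pdf (a + b) s x
    - normal_pdf a s x - normal_pdf b s x + normal_pdf 0 s x|))//.
  by apply/funext => x; congr `|_|; rewrite (addrC b); ring.
have mf : measurable_fun setT (fun x => `|normal_pdf (a + b) s x
    - normal_pdf a s x - normal_pdf b s x + normal_pdf 0 s x|).
  apply: measurableT_comp => //; apply: measurable_funD;
    [apply: measurable_funB;[apply: measurable_funB|]|];
    exact: measurable_normal_pdf.
have s20 : 0 < s ^+ 2 by rewrite exprn_gt0.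
have [bs|sb] := leP `|b| s.
  have as_ : `|a| <= s by exact: le_trans bs.
  apply: (Rintegral_le_normal_pdf (m := 0) (s := 4 * s)) mf _ => x.
  rewrite normr_ge0/=; apply: le_trans (normal_pdf_diff2_le x s0 as_ bs) _.
  rewrite ler_wpM2r ?normal_pdf_ge0// ler_wpM2r ?invr_ge0 ?(ltW s20)//.
  by rewrite -!mulrA ler_peMl// ?ler1n// !mulr_ge0.
have iD c : mu.-integrable setT
    (EFin \o (fun x => `|normal_pdf (c + a) s x - normal_pdf c s x|)).
  apply: (@integrable_norm _ _ _ mu setT
    (fun x => normal_pdf (c + a) s x - normal_pdf c s x)).
  have -> : EFin \o (fun x => normal_pdf (c + a) s x - normal_pdf c s x) =
    ((fun x => (normal_pdf (c + a) s x)%:E) \- (fun x => (normal_pdf c s x)%:E))%E.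
    by [].
  by apply: integrableB => //; exact: integrable_normal_pdf.
apply: (@le_trans _ _ (\int[mu]_x
  (`|normal_pdf (b + a) s x - normal_pdf b s x| +
   `|normal_pdf (0 + a) s x - normal_pdf 0 s x|))).
  apply: le_Rintegral => //.
  - have iN : mu.-integrable setT (EFin \o
      (fun x => `|normal_pdf (b + a) s x - normal_pdf b s x| +
       `|normal_pdf (0 + a) s x - normal_pdf 0 s x|)).
      exact: (integrableD _ (iD b) (iD 0)).
    apply: le_integrable iN => //; first exact/measurable_EFinP.
    move=> x _ /=; rewrite normr_id lee_fin [leRHS]ger0_norm ?addr_ge0//.
    rewrite add0r (addrC b); apply: le_trans (ler_normB _ _).
    by rewrite le_eqVlt; apply/orP; left; apply/eqP; congr `|_|; ring.
  - exact: (integrableD _ (iD b) (iD 0)).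
  - move=> x _; rewrite add0r (addrC b); apply: le_trans (ler_normB _ _).
    by rewrite le_eqVlt; apply/orP; left; apply/eqP; congr `|_|; ring.
rewrite RintegralD//; apply: le_trans (lerD (normal_diff1_L1 b a s0)
  (normal_diff1_L1 0 a s0)) _.
have -> : K0 * `|a| / s + K0 * `|a| / s = (2 * K0 * `|a|) * s / s ^+ 2.
  by field; rewrite gt_eqF.
rewrite ler_wpM2r ?invr_ge0 ?(ltW s20)// ler_wpM2l ?mulr_ge0//.
exact: ltW.
Qed.

End NormalDensity.

Lemma integrable_EFinB (R : realType) (d : measure_display)
    (T : measurableType d) (mu : {measure set T -> \bar R}) (f g : T -> R) :
  mu.-integrable setT (EFin \o f) -> mu.-integrable setT (EFin \o g) ->
  mu.-integrable setT (EFin \o (fun x => f x - g x)).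
Proof. by move=> intf intg; exact: (integrableB measurableT intf intg). Qed.

Lemma integrable_EFinZl (R : realType) (d : measure_display)
    (T : measurableType d) (mu : {measure set T -> \bar R}) (c : R) (f : T -> R) :
  mu.-integrable setT (EFin \o f) ->
  mu.-integrable setT (EFin \o (fun x => c * f x)).
Proof. by move=> intf; exact: (integrableZl measurableT c intf). Qed.

(** * Moments and characteristic function of the normal law *)

Section NormalMoments.
Context {R : realType}.
Local Notation mu := (@lebesgue_measure R).
Implicit Types (m s x a b c : R).

(** Integration by parts on the line: over [m - n - 1, m + n + 1] the integral is a difference of
    values of [F], which the decay hypothesis makes of order 1 / n. *)
Lemma Rintegral_derive_eq0 (F f : R -> R) m C :
  (forall x, is_derive x (1 : R) F (f x)) -> continuous f ->
  mu.-integrable setT (EFin \o f) -> (forall x, `|F x| * `|x - m| <= C) ->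
  \int[mu]_x f x = 0.
Proof.
move=> hF cf intf hC.
have mf : measurable_fun setT f by exact: continuous_measurable_fun.
pose I n : set R := [set` `[m - n.+1%:R, m + n.+1%:R]].
pose f_ n x := (f x * \1_(I n) x)%:E.
have [|||||_ _ cvf] := @dominated_convergence _ _ _ mu setT measurableT f_
   (EFin \o f) (EFin \o (fun x => `|f x|)).
- move=> n; apply/measurable_EFinP; apply: measurable_funM => //.
  by apply: measurable_indic; exact: measurable_itv.
- exact/measurable_EFinP.
- apply: aeW => x _ /=; apply: cvg_near_cst.
  near=> n; rewrite /f_ indicE mem_set ?mulr1//; rewrite /I/= in_itv/=.
  have : `|m - x| < n%:R by near: n; exact: nbhs_infty_gtr.
  have : n%:R <= n.+1%:R :> R by rewrite ler_nat.
  by rewrite ltr_norml => h /andP[h1 h2]; apply/andP; split; lra.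
- exact: integrable_norm.
- apply: aeW => x n _; rewrite /f_/= lee_fin normrM ler_piMr// indicE.
  by case: (_ \in _); rewrite ?normr1 ?normr0.
have FE n : (\int[mu]_x f_ n x = (F (m + n.+1%:R) - F (m - n.+1%:R))%:E)%E.
  rewrite /f_; under eq_integral do rewrite EFinM.
  rewrite (_ : integral _ _ _ = \int[mu]_(x in I n) (f x)%:E)%E.
    rewrite (@continuous_FTC2 _ f F)//.
    - by rewrite ltrD2l gt0_cp// ltr0n.
    - exact: continuous_subspaceT.
    - split=> //.
      + apply: cvg_at_right_filter; apply: differentiable_continuous.
        by apply/derivable1_diffP; exact: ex_derive.
      + apply: cvg_at_left_filter; apply: differentiable_continuous.
        by apply/derivable1_diffP; exact: ex_derive.
    - by move=> x _; rewrite derive1E; exact: derive_val.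
  rewrite [RHS]integral_mkcond; apply: eq_integral => x _.
  by rewrite -EFinM restrict_EFin/= indicE patchE;
    case: (_ \in _); rewrite ?mulr1 ?mulr0.
rewrite /Rintegral.
have -> : (\int[mu]_x (f x)%:E = 0)%E; last by [].
apply: (cvg_unique _ cvf) => //=.
rewrite /=; under eq_fun do rewrite FE.
apply: cvg_EFin; first exact: nearW.
have h n : `|F (m + n.+1%:R) - F (m - n.+1%:R)| <= (2 * C) * (n.+1%:R)^-1.
  have n0 : 0 < n.+1%:R :> R by rewrite ltr0n.
  rewrite ler_pdivlMr//; apply: le_trans (ler_wpM2r (ltW n0) (ler_normB _ _)) _.
  have := hC (m + n.+1%:R); have := hC (m - n.+1%:R).
  by rewrite addrAC subrr add0r normrN addrAC subrr add0r (gtr0_norm n0); lra.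
have hc : (fun n => 2 * C / n.+1%:R) @ \oo --> (0 : R).
  by rewrite -[X in _ --> X](mulr0 (2 * C)); apply: cvgMr; exact: cvg_harmonic.
rewrite (_ : fine \o _ = fun n => F (m + n.+1%:R) - F (m - n.+1%:R))//.
apply: norm_cvg0; apply: squeeze_cvgr (cvg_cst 0) hc.
by near=> n; rewrite normr_ge0 h.
Unshelve. all: by end_near. Qed.

Lemma continuous_of_derive (f : R -> R) :
  (forall x, exists df, is_derive x (1 : R) f df) -> continuous f.
Proof.
move=> h x; have [df hf] := h x.
by apply: differentiable_continuous; apply/derivable1_diffP; exact: ex_derive.
Qed.

Lemma normal_pdf_lin_le m s x : 0 < s ->
  `|x - m| * normal_pdf m s x <= 6 * s * normal_pdf m (2 * s) x.
Proof.
move=> s0; have := normal_pdf_quad_le m x s0.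
have p0 := normal_pdf_ge0 m s x; move=> h1.
have h3 : `|x - m| <= s * (1 + (x - m) ^+ 2 / s ^+ 2).
  rewrite -[leLHS](divfK (lt0r_neq0 s0)) mulrC ler_pM2l//.
  have -> : (x - m) ^+ 2 / s ^+ 2 = (`|x - m| / s) ^+ 2.
    by rewrite expr_div_n real_normK ?num_real.
  by have := sqr_ge0 (`|x - m| / s - 1); nra.
apply: le_trans (ler_wpM2r p0 h3) _.
by rewrite -[leLHS]mulrA (mulrC 6) -[leRHS]mulrA ler_pM2l.
Qed.

Lemma normal_pdf_sqr_le m s x : 0 < s ->
  (x - m) ^+ 2 * normal_pdf m s x <= 6 * s ^+ 2 * normal_pdf m (2 * s) x.
Proof.
move=> s0; have := normal_pdf_quad_le m x s0.
have p0 := normal_pdf_ge0 m s x; move=> h1.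
have s2 : 0 < s ^+ 2 by rewrite exprn_gt0.
rewrite (mulrC 6) -[leRHS]mulrA -ler_pdivrMl// mulrA.
by apply: le_trans h1; rewrite ler_wpM2r// mulrC lerDr.
Qed.

Lemma normal_pdf_sqr_bounded m s x : 0 < s ->
  (x - m) ^+ 2 * normal_pdf m s x <= 6 * s ^+ 2 * normal_peak (2 * s).
Proof.
move=> s0; apply: le_trans (normal_pdf_sqr_le m x s0) _.
apply: ler_wpM2l; first by rewrite mulr_ge0// sqr_ge0.
by rewrite normal_pdf_ub// mulf_neq0 ?gt_eqF.
Qed.

Lemma normal_pdf_lin_bounded m s x : 0 < s ->
  `|x - m| * normal_pdf m s x <= 6 * s * normal_peak (2 * s).
Proof.
move=> s0; apply: le_trans (normal_pdf_lin_le m x s0) _.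
by rewrite ler_wpM2l ?mulr_ge0 ?(ltW s0)// normal_pdf_ub// mulf_neq0 ?gt_eqF.
Qed.

Lemma measurable_lin_normal_pdf m s :
  measurable_fun setT (fun x : R => (x - m) * normal_pdf m s x).
Proof.
apply: measurable_funM; last exact: measurable_normal_pdf.
exact: measurable_funB.
Qed.

Lemma integrable_lin_normal_pdf m s : 0 < s ->
  mu.-integrable setT (EFin \o (fun x => (x - m) * normal_pdf m s x)).
Proof.
move=> s0; apply: (@integrable_le_normal_pdf _ _ m (2 * s) (6 * s)).
  exact: measurable_lin_normal_pdf.
move=> x; rewrite normrM (ger0_norm (normal_pdf_ge0 _ _ _)).
exact: normal_pdf_lin_le.
Qed.

Lemma normal_mean m s : 0 < s -> \int[mu]_x ((x - m) * normal_pdf m s x) = 0.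
Proof.
move=> s0.
apply: (@Rintegral_derive_eq0 (fun x => - s ^+ 2 * normal_pdf m s x)
  (fun x => (x - m) * normal_pdf m s x) m
  (s ^+ 2 * (6 * s * normal_peak (2 * s)))).
- move=> x; have hp := is_derive_normal_pdf m x s0.
  by apply: is_derive_eq; rewrite /GRing.scale/=; field; rewrite gt_eqF.
- apply: continuous_of_derive => x; have hp := is_derive_normal_pdf m x s0.
  by eexists; apply: is_derive_eq.
- exact: integrable_lin_normal_pdf.
- move=> x; rewrite normrM normrN (ger0_norm (sqr_ge0 s)).
  rewrite (ger0_norm (normal_pdf_ge0 _ _ _)) -[leLHS]mulrA ler_wpM2l ?sqr_ge0//.
  by rewrite mulrC normal_pdf_lin_bounded.
Qed.

Lemma integrable_sqr_normal_pdf m s : 0 < s ->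
  mu.-integrable setT (EFin \o (fun x => (x - m) ^+ 2 * normal_pdf m s x)).
Proof.
move=> s0; apply: (@integrable_le_normal_pdf _ _ m (2 * s) (6 * s ^+ 2)).
  apply: measurable_funM; last exact: measurable_normal_pdf.
  by apply: measurable_funX; exact: measurable_funB.
move=> x; rewrite normrM (ger0_norm (normal_pdf_ge0 _ _ _)) ger0_norm ?sqr_ge0//.
exact: normal_pdf_sqr_le.
Qed.

Lemma normal_variance m s : 0 < s ->
  \int[mu]_x ((x - m) ^+ 2 * normal_pdf m s x) = s ^+ 2.
Proof.
move=> s0.
have : \int[mu]_x ((x - m) ^+ 2 * normal_pdf m s x - s ^+ 2 * normal_pdf m s x) = 0.
  apply: (@Rintegral_derive_eq0 (fun x => - s ^+ 2 * ((x - m) * normal_pdf m s x))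
    (fun x => (x - m) ^+ 2 * normal_pdf m s x - s ^+ 2 * normal_pdf m s x) m (s ^+ 2 * (6 * s ^+ 2 * normal_peak (2 * s)))).
  - move=> x; have hp := is_derive_normal_pdf m x s0.
    by apply: is_derive_eq; rewrite /GRing.scale/=; field; rewrite gt_eqF.
  - apply: continuous_of_derive => x; have hp := is_derive_normal_pdf m x s0.
    by eexists; apply: is_derive_eq.
  - apply: integrable_EFinB; first exact: integrable_sqr_normal_pdf.
    exact/integrable_EFinZl/integrable_normal_pdf.
  - move=> x; rewrite !normrM normrN (ger0_norm (sqr_ge0 s)).
    rewrite (ger0_norm (normal_pdf_ge0 _ _ _)) -[leLHS]mulrA ler_wpM2l ?sqr_ge0//.
    rewrite mulrAC -expr2 real_normK ?num_real//.
    exact: normal_pdf_sqr_bounded.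
rewrite RintegralB//; last 2 first.
- exact: integrable_sqr_normal_pdf.
- exact/integrable_EFinZl/integrable_normal_pdf.
rewrite RintegralZl//; last exact: integrable_normal_pdf.
by rewrite Rintegral_normal_pdf mulr1 => /eqP; rewrite subr_eq0 => /eqP.
Qed.

Lemma integrable_bounded_normal_pdf (f : R -> R) m s K :
  measurable_fun setT f -> (forall x, `|f x| <= K) ->
  mu.-integrable setT (EFin \o (fun x => f x * normal_pdf m s x)).
Proof.
move=> mf hf; apply: (@integrable_le_normal_pdf _ _ m s K).
  by apply: measurable_funM => //; exact: measurable_normal_pdf.
move=> x; rewrite normrM (ger0_norm (normal_pdf_ge0 _ _ _)).
by rewrite ler_wpM2r// normal_pdf_ge0.
Qed.

Lemma measurable_cos_affine (eta theta : R) :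
  measurable_fun setT (fun x : R => cos (eta * x + theta)).
Proof.
apply: continuous_measurable_fun; apply: continuous_of_derive => x.
have -> : (fun x : R => cos (eta * x + theta)) =
  cos \o (fun x : R => eta * x + theta) by [].
by eexists; apply: is_derive_eq.
Qed.

Lemma measurable_sin_affine (eta theta : R) :
  measurable_fun setT (fun x : R => sin (eta * x + theta)).
Proof.
apply: continuous_measurable_fun; apply: continuous_of_derive => x.
have -> : (fun x : R => sin (eta * x + theta)) =
  sin \o (fun x : R => eta * x + theta) by [].
by eexists; apply: is_derive_eq.
Qed.

Lemma norm_cos_le1 x : `|cos x| <= 1.
Proof. by rewrite ler_norml cos_geN1 cos_le1. Qed.

Lemma norm_sin_le1 x : `|sin x| <= 1.
Proof. by rewrite ler_norml sin_geN1 sin_le1. Qed.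

(** The free phase [theta] keeps the characteristic function real: two phases recover its real and
    imaginary parts, and products of cosines stay in the family. *)
Let charf s theta eta := \int[mu]_x (cos (eta * x + theta) * normal_pdf 0 s x).

(** Integration by parts with the antiderivative s^2 sin (eta x + theta) times the density. It turns
    the derivative of [charf] in eta back into [charf]. *)
Let charf_parts s theta eta : 0 < s ->
  \int[mu]_x (x * sin (eta * x + theta) * normal_pdf 0 s x)
  = s ^+ 2 * eta * charf s theta eta.
Proof.
move=> s0.
have iC := integrable_bounded_normal_pdf 0 s (measurable_cos_affine eta theta)
   (fun x => norm_cos_le1 _).
have iS : mu.-integrable setT
    (EFin \o (fun x : R => x * sin (eta * x + theta) * normal_pdf 0 s x)).
  apply: (@integrable_le_normal_pdf _ _ 0 (2 * s) (6 * s)).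
    apply: measurable_funM; last exact: measurable_normal_pdf.
    by apply: measurable_funM => //; exact: measurable_sin_affine.
  move=> x; apply: le_trans (normal_pdf_lin_le 0 x s0).
  rewrite subr0 !normrM (ger0_norm (normal_pdf_ge0 _ _ _)).
  by rewrite ler_wpM2r ?normal_pdf_ge0// ler_piMr// norm_sin_le1.
have : \int[mu]_x (s ^+ 2 * eta * (cos (eta * x + theta) * normal_pdf 0 s x) -
    x * sin (eta * x + theta) * normal_pdf 0 s x) = 0.
  apply: (@Rintegral_derive_eq0
    (fun x => s ^+ 2 * (sin (eta * x + theta) * normal_pdf 0 s x))
    (fun x => s ^+ 2 * eta * (cos (eta * x + theta) * normal_pdf 0 s x) -
    x * sin (eta * x + theta) * normal_pdf 0 s x) 0
    (s ^+ 2 * (6 * s * normal_peak (2 * s)))).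
  - move=> x; have hp := is_derive_normal_pdf 0 x s0.
    have hs : is_derive x (1 : R) (fun x : R => sin (eta * x + theta))
        (eta * cos (eta * x + theta)).
      rewrite (_ : (fun x : R => sin (eta * x + theta)) =
        sin \o (fun x : R => eta * x + theta))//.
      by apply: is_derive_eq; rewrite /GRing.scale/=; ring.
    by apply: is_derive_eq; rewrite /GRing.scale/=; field; rewrite gt_eqF.
  - apply: continuous_of_derive => x; have hp := is_derive_normal_pdf 0 x s0.
    have hs : is_derive x (1 : R) (fun x : R => sin (eta * x + theta))
        (eta * cos (eta * x + theta)).
      rewrite (_ : (fun x : R => sin (eta * x + theta)) =
        sin \o (fun x : R => eta * x + theta))//.
      by apply: is_derive_eq; rewrite /GRing.scale/=; ring.
    have hc : is_derive x (1 : R) (fun x : R => cos (eta * x + theta))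
        (- eta * sin (eta * x + theta)).
      rewrite (_ : (fun x : R => cos (eta * x + theta)) =
        cos \o (fun x : R => eta * x + theta))//.
      by apply: is_derive_eq; rewrite /GRing.scale/=; ring.
    by eexists; apply: is_derive_eq.
  - by apply: integrable_EFinB => //; exact: integrable_EFinZl.
  - move=> x; rewrite normrM (ger0_norm (sqr_ge0 s)) normrM.
    rewrite (ger0_norm (normal_pdf_ge0 _ _ _)) -[leLHS]mulrA ler_wpM2l ?sqr_ge0//.
    apply: le_trans (normal_pdf_lin_bounded 0 x s0).
    by rewrite mulrC ler_wpM2l// ler_piMl ?norm_sin_le1// normal_pdf_ge0.
rewrite RintegralB//; last exact: integrable_EFinZl.
by rewrite RintegralZl// => /eqP; rewrite subr_eq0 => /eqP <-.
Qed.

Let is_derive_charf s theta eta : 0 < s ->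
  is_derive eta (1 : R) (charf s theta) (- (s ^+ 2 * eta * charf s theta eta)).
Proof.
move=> s0; rewrite -charf_parts//.
pose f (e x : R) := cos (e * x + theta) * normal_pdf 0 s x.
have hf (e x : R) : is_derive e (1 : R) (f ^~ x)
    (- (x * sin (e * x + theta) * normal_pdf 0 s x)).
  have hc : is_derive e (1 : R) (fun e : R => cos (e * x + theta))
        (- x * sin (e * x + theta)).
      rewrite (_ : (fun e : R => cos (e * x + theta)) =
        cos \o (fun e : R => e * x + theta))//.
      by apply: is_derive_eq; rewrite /GRing.scale/=; ring.
  by rewrite /f; apply: is_derive_eq; rewrite /GRing.scale/=; ring.
have d1 e x : partial1of2 f e x = - (x * sin (e * x + theta) * normal_pdf 0 s x).
  by rewrite partial1of2E; exact: derive_val.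
have intf e : mu.-integrable setT (EFin \o f e).
  exact: integrable_bounded_normal_pdf (measurable_cos_affine e theta)
    (fun x => norm_cos_le1 _).
have intG : mu.-integrable setT
    (EFin \o (fun x : R => `|x| * normal_pdf 0 s x)).
  apply: (@integrable_le_normal_pdf _ _ 0 (2 * s) (6 * s)).
    apply: measurable_funM; last exact: measurable_normal_pdf.
    by apply: continuous_measurable_fun; exact: norm_continuous.
  move=> x; apply: le_trans (normal_pdf_lin_le 0 x s0).
  by rewrite subr0 normrM normr_id (ger0_norm (normal_pdf_ge0 _ _ _)).
have Ie : [set` `]eta - 1, eta + 1[] eta.
  by rewrite /= in_itv/=; apply/andP; split; lra.
have hG e x : [set` `]eta - 1, eta + 1[] e -> setT x ->
    `|partial1of2 f e x| <= `|x| * normal_pdf 0 s x.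
  move=> _ _; rewrite d1 normrN !normrM (ger0_norm (normal_pdf_ge0 _ _ _)).
  by rewrite ler_wpM2r ?normal_pdf_ge0// ler_piMr// norm_sin_le1.
have G0 x : 0 <= `|x| * normal_pdf 0 s x by rewrite mulr_ge0// normal_pdf_ge0.
have := @derivable_under_integral R _ _ mu f setT measurableT eta _ _ Ie
  (fun e _ => intf e) (fun e x _ _ => @ex_derive _ _ _ _ _ _ _ (hf e x)) _ G0 intG hG.
have := @differentiation_under_integral R _ _ mu f setT measurableT eta _ _ Ie
  (fun e _ => intf e) (fun e x _ _ => @ex_derive _ _ _ _ _ _ _ (hf e x)) _ G0 intG hG.
rewrite derive1E => E D; apply: DeriveDef => //.
rewrite E; under eq_Rintegral do rewrite d1.
under eq_Rintegral do rewrite -mulN1r.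
rewrite RintegralZl ?mulN1r//.
apply: (@integrable_le_normal_pdf _ _ 0 (2 * s) (6 * s)).
  apply: measurable_funM; last exact: measurable_normal_pdf.
  by apply: measurable_funM => //; exact: measurable_sin_affine.
move=> x; apply: le_trans (normal_pdf_lin_le 0 x s0).
rewrite subr0 !normrM (ger0_norm (normal_pdf_ge0 _ _ _)).
by rewrite ler_wpM2r ?normal_pdf_ge0// ler_piMr// norm_sin_le1.
Qed.

(** In eta the integral solves y' = - s^2 eta y, so its product with e^(s^2 eta^2 / 2) is constant;
    the constant is its value at eta = 0. *)
Lemma normal_charf s theta eta : 0 < s ->
  \int[mu]_x (cos (eta * x + theta) * normal_pdf 0 s x) =
  cos theta * expR (- (s ^+ 2 * eta ^+ 2 / 2)).
Proof.
move=> s0.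
pose g e := charf s theta e * expR (s ^+ 2 * e ^+ 2 / 2).
have hg e : is_derive e (1 : R) g 0.
  have hc := is_derive_charf theta e s0.
  have he : is_derive e (1 : R) (fun e => expR (s ^+ 2 * e ^+ 2 / 2))
      (s ^+ 2 * e * expR (s ^+ 2 * e ^+ 2 / 2)).
    rewrite (_ : (fun e : R => expR (s ^+ 2 * e ^+ 2 / 2)) =
        expR \o (fun e : R => s ^+ 2 * e ^+ 2 / 2))//.
    by apply: is_derive_eq; rewrite /GRing.scale/=; field.
  by rewrite /g; apply: is_derive_eq; rewrite /GRing.scale/=; ring.
have := is_derive_0_is_cst eta 0 hg.
rewrite /g expr0n/= mulr0 mul0r expR0 mulr1.
rewrite [X in _ = X](_ : _ = cos theta) => [h|].
  by rewrite -/(charf s theta eta) expRN -h mulfK// gt_eqF// expR_gt0.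
rewrite /charf; under eq_Rintegral do rewrite mul0r add0r.
rewrite RintegralZl//; last exact: integrable_normal_pdf.
by rewrite Rintegral_normal_pdf mulr1.
Qed.

Lemma integral_normal_prob m s (f : R -> R) :
  (normal_prob m s).-integrable setT (EFin \o f) ->
  \int[normal_prob m s]_x f x = \int[mu]_x (f x * normal_pdf m s x).
Proof.
move=> intf; congr fine.
have mf : measurable_fun setT f.
  by apply/measurable_EFinP; exact: (measurable_int (normal_prob m s)).
rewrite -(Radon_Nikodym_change_of_variables (@normal_prob_dominates R m s))//=.
apply: ae_eq_integral => //.
- apply: emeasurable_funM => //; first exact/measurable_EFinP.
  apply: (measurable_int mu) => //.
  by apply: Radon_Nikodym_integrable; exact: normal_prob_dominates.
- apply/measurable_EFinP; apply: measurable_funM => //.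
  exact: measurable_normal_pdf.
- rewrite (_ : (fun x => (f x * normal_pdf m s x)%:E) =
    (fun x => (f x)%:E * (normal_pdf m s x)%:E)%E); last first.
    by apply/funext => x; rewrite EFinM.
  apply: ae_eqe_mul2l => /=.
  rewrite Radon_NikodymE//=; first exact: normal_prob_dominates.
  move=> abmu; case: cid => /= h [h1 h2 h3].
  apply: integral_ae_eq => //=.
  + by apply/measurable_EFinP; exact: measurable_normal_pdf.
  + by move=> E E01 mE; rewrite -h3.
Qed.

End NormalMoments.

(** * Characteristic functions *)

Section Orthogonality.
Context {R : realType} {disp : measure_display} {Omega : measurableType disp}.
Variable P : probability Omega R.
Local Notation mu := (@lebesgue_measure R).
Local Notation Ex := (Ex P).
Implicit Types (Z V : Omega -> R).

Lemma brv_mul_indic Z (A : set Omega) : brv Z -> measurable A ->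
  brv (fun w => Z w * \1_A w).
Proof. by move=> bZ mA; apply: brvM => //; exact: brv_indic. Qed.

Definition orth_event Z (A : set Omega) : Prop :=
  measurable A /\ Ex (fun w => Z w * \1_A w) = 0.

Lemma orth_event_dynkin Z : brv Z -> Ex Z = 0 -> dynkin (orth_event Z).
Proof.
move=> bZ EZ; split.
- split => //; rewrite -[RHS]EZ; apply: eq_Ex => w.
  by rewrite indicE in_setT mulr1.
- move=> A [mA EA]; split; first exact: measurableC.
  transitivity (Ex (fun w => Z w - Z w * \1_A w)).
    apply: eq_Ex => w; rewrite !indicE in_setC.
    by case: (_ \in _); rewrite ?mulr1 ?mulr0; ring.
  by rewrite ExB ?EZ ?EA ?subrr//; exact: brv_mul_indic.
- move=> F tF hF.
  have mF n : measurable (F n) by case: (hF n).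
  have mU : measurable (\bigcup_k F k) by exact: bigcup_measurable.
  split => //.
  have [K hK] := bZ.2.
  have mI n : measurable (\big[setU/set0]_(i < n) F i) by exact: bigsetU_measurable.
  have cv : Ex (fun w => Z w * \1_(\big[setU/set0]_(i < n) F i) w) @[n --> \oo]
      --> Ex (fun w => Z w * \1_(\bigcup_k F k) w).
    apply: (@Ex_cvg _ _ _ _ _ _ K).
    - by move=> n; exact: (brv_mul_indic bZ (mI n)).1.
    - exact: (brv_mul_indic bZ mU).1.
    - move=> n w; rewrite normrM; apply: le_trans (hK w).
      by rewrite ler_piMr// indicE; case: (_ \in _); rewrite ?normr1 ?normr0.
    - apply: aeW => w; apply: cvg_near_cst.
      have [[k _ Fkw]|nF] := pselect ((\bigcup_k F k) w).
        near=> n; rewrite !indicE !mem_set//; first by exists k.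
        by rewrite -bigcup_mkord; exists k => //=; near: n; exact: nbhs_infty_gt.
      near=> n; rewrite !indicE !memNset// => h; apply: nF.
      by move: h; rewrite -bigcup_mkord => -[k _ ?]; exists k.
  apply: (cvg_unique _ cv) => //=.
  rewrite (_ : (fun n => _) = fun=> 0); first exact: cvg_cst.
  apply/funext => n.
  transitivity (\sum_(i < n) Ex (fun w => Z w * \1_(F i) w)).
    rewrite -Ex_sum; last by move=> i _; exact: brv_mul_indic.
    apply: eq_Ex => w; rewrite -mulr_sumr; congr (_ * _).
    elim: n {mI cv} => [|n ih].
      by rewrite !big_ord0 indic0.
    rewrite !big_ord_recr/= -ih !indicE in_setU.
    have : ~~ ((w \in \big[setU/set0]_(i < n) F i) && (w \in F n)).
      apply/negP => /andP[]; rewrite !inE -bigcup_mkord => -[k /= kn Fk] Fn.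
      have := tF k n Logic.I Logic.I (ex_intro _ w (conj Fk Fn)) => kEn.
      by move: kn; rewrite kEn ltnn.
    by case: (w \in _); case: (w \in F n) => //= _; rewrite ?addr0 ?add0r.
  by rewrite big1// => i _; case: (hF i).
Unshelve. all: by end_near. Qed.

(** The pi-lambda theorem. With a centred indicator for [Z], it extends a product rule from a
    pi-system to the sigma-algebra it generates. *)
Lemma orth_event_g_sigma Z (G : set (set Omega)) : brv Z -> Ex Z = 0 ->
  setI_closed G -> (forall A, G A -> orth_event Z A) ->
  forall A, <<s G >> A -> orth_event Z A.
Proof.
move=> bZ EZ GI hG A.
rewrite -setI_closed_g_dynkin_g_sigma_algebra//; apply: smallest_sub => //.
exact: orth_event_dynkin.
Qed.

Section Fubini.
Variables (f : Omega * R -> R) (K : R).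
Hypothesis mf : measurable_fun setT f.
Hypothesis intf : forall w, mu.-integrable setT (fun x => (f (w, x))%:E).
Hypothesis hK : forall w, \int[mu]_x `|f (w, x)| <= K.

Let mEf : measurable_fun setT (EFin \o f).
Proof. exact/measurable_EFinP. Qed.

Let intp : (P \x mu)%E.-integrable setT (EFin \o f).
Proof.
have intNf w : (\int[mu]_x `|f (w, x)|%:E = (\int[mu]_x `|f (w, x)|)%:E)%E.
  rewrite /Rintegral fineK//; apply: integrable_fin_num => //.
  exact: (integrable_norm (intf w)).
have K0 : 0 <= K.
  have [w _] : [set: Omega] !=set0.
    apply/set0P/eqP => e; have := @probability_setT _ _ _ P.
    by rewrite e measure0 => /eqP; rewrite eq_sym onee_eq0.
  by apply: le_trans (hK w); apply: Rintegral_ge0.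
apply/integrable12ltyP => //.
apply: (@le_lt_trans _ _ (\int[P]_w K%:E)%E).
  apply: ge0_le_integral => //.
  - by move=> w _; exact: integral_ge0.
  - apply: (@measurable_fun_fubini_tonelli_F _ _ _ _ _ mu (abse \o (EFin \o f))).
      exact: measurableT_comp.
    by move=> z; exact: abse_ge0.
  - by move=> w _; rewrite /= intNf lee_fin.
rewrite integral_cst//; apply: (@le_lt_trans _ _ K%:E); last exact: ltry.
by rewrite -[leRHS]mule1 lee_wpmul2l// probability_le1.
Qed.

Lemma measurable_Rintegral_section :
  measurable_fun setT (fun w => \int[mu]_x f (w, x)).
Proof.
apply/measurable_EFinP.
rewrite (_ : EFin \o _ = fubini_F mu (EFin \o f)); first exact: measurable_fubini_F intp.
apply/funext => w; rewrite /fubini_F/= /Rintegral fineK//.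
exact: integrable_fin_num.
Qed.

Lemma measurable_Ex_section : (forall x, brv (fun w => f (w, x))) ->
  measurable_fun setT (fun x => Ex (fun w => f (w, x))).
Proof.
move=> bf; apply/measurable_EFinP.
rewrite (_ : EFin \o _ = fubini_G P (EFin \o f)); first exact: measurable_fubini_G intp.
apply/funext => x; rewrite /fubini_G/= /Ex /Rintegral fineK//.
by apply: integrable_fin_num => //; exact: brv_integrable.
Qed.

Lemma Ex_Fubini : (forall x, brv (fun w => f (w, x))) ->
  Ex (fun w => \int[mu]_x f (w, x)) = \int[mu]_x Ex (fun w => f (w, x)).
Proof.
move=> bf; have := @Fubini _ _ _ _ _ P mu (EFin \o f) intp.
rewrite /Ex /Rintegral => E; congr fine.
transitivity (\int[P]_w \int[mu]_x (f (w, x))%:E)%E.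
  by apply: eq_integral => w _; rewrite fineK//; exact: integrable_fin_num.
rewrite E.
apply: eq_integral => x _; rewrite fineK//; apply: integrable_fin_num => //.
exact: brv_integrable.
Qed.

End Fubini.

Lemma measurable_cos : measurable_fun setT (@cos R).
Proof. by apply: continuous_measurable_fun; exact: continuous_cos. Qed.

Lemma brv_cos V : measurable_fun setT V -> brv (fun w => cos (V w)).
Proof.
apply: brv_comp; first exact: measurable_cos.
by exists 1 => x; exact: norm_cos_le1.
Qed.

Section Uniqueness.
Variables Z V : Omega -> R.
Hypothesis bZ : brv Z.
Hypothesis mV : measurable_fun setT V.
Hypothesis cosZV : forall eta theta,
  Ex (fun w => Z w * cos (eta * V w + theta)) = 0.

Let EZ : Ex Z = 0.
Proof.
rewrite -[RHS](cosZV 0 0); apply: eq_Ex => w.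
by rewrite mul0r addr0 cos0 mulr1.
Qed.

Let ExZ_gauss c e : 0 < e -> Ex (fun w => Z w * normal_pdf c e (V w)) = 0.
Proof.
move=> e0; have ei0 : 0 < e^-1 by rewrite invr_gt0.
have [K hK] := bZ.2.
(* The Fourier transform of a Gaussian is Gaussian: integrating this cosine against the density of
   deviation 1 / e gives the density of deviation e at [V]. Each cosine has mean 0 against [Z]. *)
pose f (z : Omega * R) := normal_peak e * (Z z.1 *
  (cos ((V z.1 - c) * z.2 + 0) * normal_pdf 0 e^-1 z.2)).
have fE w : Z w * normal_pdf c e (V w) = \int[mu]_x f (w, x).
  rewrite /f/=.
  have iC := integrable_bounded_normal_pdf 0 e^-1
    (measurable_cos_affine (V w - c) 0) (fun x => norm_cos_le1 _).
  rewrite RintegralZl//; last exact: integrable_EFinZl.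
  rewrite RintegralZl// normal_charf// cos0 mul1r normal_pdf_expR// mulrCA.
  by congr (_ * (_ * expR _)); field; rewrite gt_eqF.
have mf : measurable_fun setT f.
  apply: measurable_funM => //; apply: measurable_funM.
    by apply: measurableT_comp => //; exact: bZ.1.
  apply: measurable_funM.
    apply: (measurableT_comp measurable_cos); apply: measurable_funD => //.
    apply: measurable_funM => //; apply: measurable_funB => //.
    exact: measurableT_comp.
  by apply: measurableT_comp => //; exact: measurable_normal_pdf.
have hf w x : `|f (w, x)| <= normal_peak e * K * normal_pdf 0 e^-1 x.
  rewrite /f/= normrM (ger0_norm (normal_peak_ge0 _)) -[leRHS]mulrA.
  apply: ler_wpM2l; first exact: normal_peak_ge0.
  rewrite normrM ler_pM// normrM (ger0_norm (normal_pdf_ge0 _ _ _)).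
  by rewrite ler_piMl ?norm_cos_le1// normal_pdf_ge0.
have mfw w : measurable_fun setT (fun x => f (w, x)).
  by apply: (measurableT_comp mf); exact: measurable_pair1.
have mfx x : measurable_fun setT (fun w => f (w, x)).
  by apply: (measurableT_comp mf); exact: measurable_pair2.
under eq_Ex do rewrite fE.
rewrite (@Ex_Fubini f (normal_peak e * K))//.
- rewrite (_ : (fun x => _) = fun=> 0).
    by rewrite Rintegral_cst// mul0r.
  apply/funext => x; rewrite /f/=.
  transitivity (Ex (fun w => (normal_peak e * normal_pdf 0 e^-1 x) *
      (Z w * cos (x * V w + - c * x)))).
    apply: eq_Ex => w; rewrite addr0.
    by rewrite (_ : x * V w + - c * x = (V w - c) * x); ring.
  rewrite ExZ ?cosZV ?mulr0//; apply: brvM => //; apply: brv_cos.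
  by apply: measurable_funD => //; exact: measurable_funM.
- move=> w; exact: integrable_le_normal_pdf (mfw w) (hf w).
- move=> w; apply: (@Rintegral_le_normal_pdf _ _ 0 e^-1).
    exact: measurableT_comp.
  by move=> x; rewrite normr_ge0/=.
- move=> x; split; first exact: mfx.
  by exists (normal_peak e * K * normal_pdf 0 e^-1 x) => w.
Qed.

(** Smoothing h at scale e moves it by at most 6 L e, and the smoothed function of [V] is a
    superposition of Gaussian densities, each orthogonal to [Z]. *)
Let ExZ_lipschitz (h : R -> R) (L : R) : measurable_fun setT h ->
  (forall x, `|h x| <= 1) -> (forall x y, `|h x - h y| <= L * `|x - y|) ->
  Ex (fun w => Z w * h (V w)) = 0.
Proof.
move=> mh h1 hL.
have [K hK] := bZ.2.
have K0 : 0 <= `|K| by [].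
have hK' w : `|Z w| <= `|K| by rewrite (le_trans (hK w))// ler_norm.
have L0 : 0 <= L.
  by have := hL 1 0; rewrite subr0 normr1 mulr1; exact: le_trans.
have bh : brv (fun w => h (V w)) by apply: brv_comp => //; exists 1.
have smooth e : 0 < e -> `|Ex (fun w => Z w * h (V w))| <= `|K| * (L * (6 * e)).
  move=> e0.
  pose q w c := normal_pdf (V w) e c.
  have qE w c : q w c = normal_pdf c e (V w).
    rewrite /q !normal_pdf_expR//; congr (_ * expR _).
    by field; rewrite gt_eqF.
  have iq w : mu.-integrable setT (EFin \o (fun c => h c * q w c)).
    exact: integrable_bounded_normal_pdf mh h1.
  pose f (z : Omega * R) := Z z.1 * (h z.2 * normal_pdf z.2 e (V z.1)).
  have mpdf : measurable_fun setT
      (fun z : Omega * R => normal_pdf z.2 e (V z.1)).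
    rewrite (_ : (fun _ => _) = (fun z : Omega * R =>
       normal_peak e * expR (- (V z.1 - z.2) ^+ 2 / (e ^+ 2 *+ 2)))); last first.
      by apply/funext => z; rewrite normal_pdf_expR.
    apply: measurable_funM => //; apply: measurableT_comp => //.
    apply: measurable_funM => //; apply: measurableT_comp => //.
    apply: measurable_funX; apply: measurable_funB => //.
    exact: measurableT_comp.
  have mf : measurable_fun setT f.
    apply: measurable_funM; first by apply: measurableT_comp => //; exact: bZ.1.
    by apply: measurable_funM => //; exact: measurableT_comp.
  have hf w x : `|f (w, x)| <= `|K| * normal_pdf (V w) e x.
    rewrite /f/= -qE normrM ler_pM// normrM (ger0_norm (normal_pdf_ge0 _ _ _)).
    by rewrite ler_piMl// normal_pdf_ge0.
  have mfw w : measurable_fun setT (fun x => f (w, x)).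
    by apply: (measurableT_comp mf); exact: measurable_pair1.
  have mfx x : measurable_fun setT (fun w => f (w, x)).
    by apply: (measurableT_comp mf); exact: measurable_pair2.
  have FE w : \int[mu]_x f (w, x) = Z w * \int[mu]_c (h c * q w c).
    rewrite -(@RintegralZl _ _ _ mu setT _ (Z w) measurableT (iq w)).
    by apply: eq_Rintegral => c _; rewrite /f/= qE.
  have hint w : `|h (V w) - \int[mu]_c (h c * q w c)| <= L * (6 * e).
    have -> : h (V w) - \int[mu]_c (h c * q w c) =
        \int[mu]_c (h (V w) * q w c - h c * q w c).
      rewrite RintegralB//; last first.
        by apply: integrable_EFinZl; exact: integrable_normal_pdf.
      rewrite RintegralZl//; last exact: integrable_normal_pdf.
      by rewrite Rintegral_normal_pdf mulr1.
    have iB : mu.-integrable setT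
        (EFin \o (fun c => h (V w) * q w c - h c * q w c)).
      apply: integrable_EFinB => //.
      by apply: integrable_EFinZl; exact: integrable_normal_pdf.
    apply: le_trans (le_normr_Rintegral _ iB) _ => //.
    apply: (@Rintegral_le_normal_pdf _ _ (V w) (2 * e)).
      by apply: measurableT_comp => //; apply/measurable_EFinP;
        exact: measurable_int iB.
    move=> c; rewrite normr_ge0/= -mulrBl normrM.
    rewrite (ger0_norm (normal_pdf_ge0 _ _ _)).
    apply: (@le_trans _ _ (L * (`|c - V w| * q w c))).
      by rewrite mulrA ler_wpM2r ?normal_pdf_ge0// distrC.
    by rewrite -[leRHS]mulrA ler_wpM2l// normal_pdf_lin_le.
  have bF : brv (fun w => \int[mu]_x f (w, x)).
    split; last first.
      exists `|K| => w; rewrite FE normrM.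
      rewrite -[leRHS]mulr1 ler_pM//.
      apply: le_trans (le_normr_Rintegral _ (iq w)) _ => //.
      apply: (@Rintegral_le_normal_pdf _ _ (V w) e).
        by apply: measurableT_comp => //; apply/measurable_EFinP;
          exact: measurable_int (iq w).
      move=> x; rewrite normr_ge0/= normrM (ger0_norm (normal_pdf_ge0 _ _ _)).
      by rewrite ler_wpM2r// normal_pdf_ge0.
    apply: (measurable_Rintegral_section mf (K := `|K|)).
      by move=> w; exact: integrable_le_normal_pdf (mfw w) (hf w).
    move=> w; apply: (@Rintegral_le_normal_pdf _ _ (V w) e).
      exact: measurableT_comp.
    by move=> x; rewrite normr_ge0/=.
  have E0 : Ex (fun w => \int[mu]_x f (w, x)) = 0.
    rewrite (@Ex_Fubini f `|K|)//.
    - rewrite (_ : (fun x => _) = fun=> 0).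
        by rewrite Rintegral_cst// mul0r.
      apply/funext => x; rewrite /f/=.
      transitivity (Ex (fun w => h x * (Z w * normal_pdf x e (V w)))).
        by apply: eq_Ex => w; ring.
      rewrite ExZ ?ExZ_gauss ?mulr0//; apply: brvM => //; apply: brv_comp => //.
        exact: measurable_normal_pdf.
      exists (normal_peak e) => y; rewrite (ger0_norm (normal_pdf_ge0 _ _ _)).
      by rewrite normal_pdf_ub// gt_eqF.
    - move=> w; exact: integrable_le_normal_pdf (mfw w) (hf w).
    - move=> w; apply: (@Rintegral_le_normal_pdf _ _ (V w) e).
        exact: measurableT_comp.
      by move=> x; rewrite normr_ge0/=.
    - move=> x; split; first exact: mfx.
      exists (`|K| * normal_peak e) => w; apply: le_trans (hf w x) _.
      by rewrite ler_wpM2l// normal_pdf_ub// gt_eqF.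
  rewrite -[X in `|X|]subr0 -E0 -ExB//; last exact: brvM.
  apply: Ex_bound; first by apply: brvB => //; exact: brvM.
  by move=> w; rewrite FE -mulrBr normrM ler_pM.
apply/eqP; rewrite -normr_le0; apply/ler_addgt0Pl => e e0; rewrite addr0.
pose D := `|K| * (L * 6) + 1.
have D0 : 0 < D by rewrite ltr_pwDr// !mulr_ge0.
apply: le_trans (smooth (e / D) _) _; first by rewrite divr_gt0.
rewrite (_ : _ * _ = (`|K| * (L * 6)) * e / D); last by ring.
rewrite ler_pdivrMr// mulrC ler_wpM2l ?(ltW e0)// /D lerDl//.
Qed.

Let clamp (x : R) : R := Num.max 0 (Num.min 1 x).

Let clamp_lip x y : `|clamp x - clamp y| <= `|x - y|.
Proof.
wlog xy : x y / x <= y.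
  by move=> H; have [/H//|/ltW/H] := leP x y; rewrite distrC (distrC y).
rewrite distrC (distrC x) (ger0_norm (x := y - x)) ?subr_ge0//.
rewrite /clamp ler_norml.
by have [?|?] := leP 1 y; have [?|?] := leP 1 x;
  have [?|?] := leP 0 (1 : R); have [?|?] := leP 0 y;
  have [?|?] := leP 0 x; apply/andP; split; lra.
Qed.

Let ExZ_ray a : Ex (fun w => Z w * \1_[set` `]-oo, a]] (V w)) = 0.
Proof.
have [K hK] := bZ.2.
(* An n-Lipschitz ramp: 1 up to a and, for n > 0, 0 from a + 1 / n on. *)
pose h n v := clamp (1 - n%:R * (v - a)).
have h1 n v : `|h n v| <= 1.
  rewrite /h /clamp ger0_norm ?le_max ?lexx//.
  by rewrite ge_max ler01 ge_min lexx.
have mh n : measurable_fun setT (h n).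
  apply: measurable_maxr => //; apply: measurable_minr => //.
  apply: measurable_funB => //; apply: measurable_funM => //.
  exact: measurable_funB.
have E0 n : Ex (fun w => Z w * h n (V w)) = 0.
  apply: (ExZ_lipschitz (L := n%:R)) => // x y.
  apply: le_trans (clamp_lip _ _) _.
  have -> : 1 - n%:R * (x - a) - (1 - n%:R * (y - a)) = n%:R * (y - x) by ring.
  by rewrite normrM ger0_norm// distrC.
have cv : Ex (fun w => Z w * h n (V w)) @[n --> \oo] -->
    Ex (fun w => Z w * \1_[set` `]-oo, a]] (V w)).
  apply: (@Ex_cvg _ _ _ _ _ _ K).
  - by move=> n; apply: measurable_funM; [exact: bZ.1|exact: measurableT_comp].
  - apply: measurable_funM; first exact: bZ.1.
    by apply: measurableT_comp => //; apply: measurable_indic; exact: measurable_itv.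
  - move=> n w; rewrite normrM; apply: le_trans (hK w).
    by rewrite ler_piMr.
  - apply: aeW => w; apply: cvgMr; apply: cvg_near_cst.
    rewrite indicE; have [Va|aV] := leP (V w) a.
      rewrite mem_set//; near=> n; rewrite /h /clamp.
      rewrite min_l ?max_r// lerDl oppr_ge0 mulr_ge0_le0// subr_le0//.
    rewrite memNset; last by rewrite /= in_itv/= leNgt aV.
    near=> n; rewrite /h /clamp max_l// ge_min subr_le0.
    apply/orP; right; rewrite -ler_pdivrMr ?subr_gt0// mul1r.
    by near: n; exact: nbhs_infty_ger.
apply: (cvg_unique _ cv) => //=.
by rewrite (_ : (fun n => _) = fun=> 0); [exact: cvg_cst|exact/funext].
Unshelve. all: by end_near. Qed.

(* The mean of Z against a Gaussian smoothing of V is a superposition of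
   characteristic functions; the smoothing is removed by letting its variance
   tend to 0. *)
Lemma Ex_charf_eq0 (U : set R) : measurable U ->
  Ex (fun w => Z w * \1_U (V w)) = 0.
Proof.
move=> mU.
have mVU A : measurable A -> measurable (V @^-1` A).
  by move=> mA; rewrite -[X in measurable X]setTI; exact: mV.
pose G : set (set Omega) := preimage_set_system setT V (@ocitv R).
suff : orth_event Z (V @^-1` U).
  by case=> _ <-; apply: eq_Ex => w; rewrite !indicE; congr (_ * _%:R);
    apply/idP/idP; rewrite !inE.
apply: (@orth_event_g_sigma Z G) => //.
- move=> _ _ [A oA <-] [B oB <-]; exists (A `&` B); first exact: ocitvI.
  by rewrite !setTI preimage_setI.
- move=> _ [_ [[a b] _ <-] <-]/=; rewrite setTI; split.
    by apply: mVU; exact: measurable_itv.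
  have [ab|ba] := leP a b; last first.
    rewrite set_itv_ge -?leNgt ?bnd_simp ?(ltW ba)// preimage_set0.
    by rewrite -[RHS](Ex_cst P 0); apply: eq_Ex => w; rewrite indic0 mulr0.
  have bI x : brv (fun w => Z w * \1_[set` `]-oo, x]] (V w)).
    apply: brvM => //; apply: brv_comp => //.
    by exists 1 => y; rewrite indicE; case: (_ \in _); rewrite ?normr1 ?normr0.
  transitivity (Ex (fun w => Z w * \1_[set` `]-oo, b]] (V w) -
      Z w * \1_[set` `]-oo, a]] (V w))).
    apply: eq_Ex => w; rewrite -mulrBr; congr (_ * _); rewrite !indicE.
    have -> : (w \in V @^-1` [set` `]a, b]]) = (a < V w <= b).
      by apply/idP/idP; rewrite inE/= in_itv.
    have ray x : (V w \in [set` `]-oo, x]]) = (V w <= x).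
      by apply/idP/idP; rewrite inE/= in_itv.
    rewrite !ray; have [Va|aV] := leP (V w) a; rewrite ?subr0//.
    by rewrite (le_trans Va ab) subrr.
  by rewrite ExB// !ExZ_ray subrr.
- by rewrite /G g_sigma_preimageE; exists U => //; rewrite setTI.
Qed.

End Uniqueness.

(** Induction on n: the indicator of the last variable is moved into the weight [Z]. The hypothesis
    for the new weight is the one-variable result, once a product of two cosines is written as a
    half-sum of cosines of linear combinations. *)
Lemma Ex_charf_family_eq0 (n : nat) (V : nat -> Omega -> R) Z : brv Z ->
  (forall i, (i < n)%N -> measurable_fun setT (V i)) ->
  (forall (c : nat -> R) theta,
    Ex (fun w => Z w * cos (\sum_(i < n) c i * V i w + theta)) = 0) ->
  forall U : nat -> set R, (forall i, measurable (U i)) ->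
  Ex (fun w => Z w * \prod_(i < n) \1_(U i) (V i w)) = 0.
Proof.
elim: n Z => [|n ih] Z bZ mV hZ U mU.
  rewrite -[RHS](hZ (fun=> 0) 0); apply: eq_Ex => w.
  by rewrite !big_ord0 addr0 cos0.
have mVn : measurable_fun setT (V n) by exact: mV.
have bI : brv (fun w => \1_(U n) (V n w) : R).
  apply: brv_comp => //; exists 1 => x.
  by rewrite indicE; case: (_ \in _); rewrite ?normr1 ?normr0.
have mS c : measurable_fun setT (fun w => \sum_(i < n) c i * V i w).
  apply: measurable_sum => i; apply: measurable_funM => //.
  by apply: mV; exact: leqW.
have bC c theta : brv (fun w => cos (\sum_(i < n) c i * V i w + theta)).
  by apply: brv_cos; exact: measurable_funD.
rewrite (_ : (fun w => _) = (fun w => (Z w * \1_(U n) (V n w)) *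
    \prod_(i < n) \1_(U i) (V i w))); last first.
  by apply/funext => w; rewrite big_ord_recr/= mulrA mulrAC.
apply: ih => //.
- exact: brvM.
- by move=> i ni; apply: mV; exact: leqW.
- move=> c theta.
  transitivity (Ex (fun w => (Z w * cos (\sum_(i < n) c i * V i w + theta)) *
      \1_(U n) (V n w))); first by apply: eq_Ex => w; ring.
  apply: Ex_charf_eq0 => //; first exact: brvM.
  move=> eta theta'.
  pose cc e (i : nat) : R := if i == n then e else c i.
  have hcc e th : Ex (fun w => Z w *
      cos (\sum_(i < n) c i * V i w + e * V n w + th)) = 0.
    rewrite -[RHS](hZ (cc e) th); apply: eq_Ex => w.
    rewrite big_ord_recr/= /cc eqxx; congr (_ * cos (_ + _ + _)).
    by apply: eq_bigr => i _; rewrite ltn_eqF.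
  have bcc e th : brv (fun w => Z w *
      cos (\sum_(i < n) c i * V i w + e * V n w + th)).
    apply: brvM => //; apply: brv_cos; apply: measurable_funD => //.
    by apply: measurable_funD => //; exact: measurable_funM.
  transitivity (Ex (fun w => 2^-1 *
     (Z w * cos (\sum_(i < n) c i * V i w + eta * V n w + (theta + theta')) +
      Z w * cos (\sum_(i < n) c i * V i w + - eta * V n w + (theta - theta'))))).
    apply: eq_Ex => w; set S := \sum_(i < n) _.
    have -> : S + eta * V n w + (theta + theta') =
      (S + theta) + (eta * V n w + theta') by ring.
    have -> : S + - eta * V n w + (theta - theta') =
      (S + theta) - (eta * V n w + theta') by ring.
    by move: (S + theta) (eta * V n w + theta') => a b; rewrite cosD cosB; field.
  by rewrite ExZ ?ExD ?hcc ?addr0 ?mulr0//; exact: brvD.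
Qed.

End Orthogonality.

(** * Integrating out an independent Gaussian variable *)

Section NormalIndependence.
Context {R : realType} {disp : measure_display} {Omega : measurableType disp}.
Variable P : probability Omega R.
Local Notation mu := (@lebesgue_measure R).
Local Notation Ex := (Ex P).

(** Independence and law in one condition: if [G] contains the whole space, that event gives the law
    of [N]. *)
Definition indep_normal (G : set (set Omega)) (N : Omega -> R) (s : R) : Prop :=
  forall A, G A -> measurable A /\ forall U : set R, measurable U ->
    P (A `&` N @^-1` U) = (P A * normal_prob 0 s U)%E.

(** The identity of Omega, seen as a variable valued in Omega equipped with [G], and [N] have a
    product as joint law; Fubini then integrates [N] out with the first argument frozen.
    Measurability of [F] for [G] in that argument is what makes the product structure usable. *)
Lemma indep_normal_Ex (G : set (set Omega)) (N : Omega -> R) (s K : R)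
    (F : g_sigma_algebraType G * R -> R) :
  sigma_algebra setT G -> indep_normal G N s -> measurable_fun setT N ->
  measurable_fun setT F -> (forall z, `|F z| <= K) ->
  Ex (fun w => F (w, N w)) = Ex (fun w => \int[mu]_x (F (w, x) * normal_pdf 0 s x)).
Proof.
move=> sG iN mN mF hF.
have GE : <<s G >> = G by exact: sigma_algebra_id.
have Gm A : G A -> measurable A by move=> /iN[].
pose j : Omega -> g_sigma_algebraType G := idfun.
have mj : measurable_fun setT j.
  by move=> _ A mA; rewrite setTI; apply: Gm; rewrite -GE.
pose h : Omega -> (g_sigma_algebraType G * measurableTypeR R)%type := fun w => (j w, N w).
have mh : measurable_fun setT h by exact: measurable_fun_pair.
pose J : {mfun Omega >-> g_sigma_algebraType G} := mfun_Sub (mem_set mj).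
pose HH : {mfun Omega >-> (g_sigma_algebraType G * measurableTypeR R)%type} := mfun_Sub (mem_set mh).
pose D : {measure set (g_sigma_algebraType G * measurableTypeR R) -> \bar R} :=
  distribution P HH.
pose PG := distribution P J.
pose nu := normal_prob 0 s.
have mE : measurable_fun setT (EFin \o F) by exact/measurable_EFinP.
have eqm A : measurable A -> (PG \x nu)%E A = D A.
  move=> mA.
  apply: (@product_measure_unique _ _ _ _ R PG nu D) => // B C mB mC.
  have GB : G B by rewrite -GE.
  have [_ /(_ C mC)] := iN B GB.
  done.
have bddF (T : Type) (g : T -> g_sigma_algebraType G * R) :
    [bounded F (g x) | x in [set: T]].
  exists K; split; first exact: num_real.
  by move=> L KL x _ /=; rewrite (le_trans (hF _))// ltW.
have intF : (PG \x nu)%E.-integrable setT (EFin \o F).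
  apply: measurable_bounded_integrable;
    [exact: measurableT| |exact: mF|exact: (bddF _ idfun)].
  suff : ((PG \x nu)%E setT < +oo)%E by [].
  rewrite (eqm setT measurableT) /D/= /distribution /pushforward preimage_setT.
  exact: le_lt_trans (probability_le1 P measurableT) (ltry _).
have mFN : measurable_fun setT (fun w => F (w, N w)).
  exact: (measurableT_comp mF mh).
have intFN : P.-integrable setT ((EFin \o F) \o HH).
  by apply: brv_integrable; split => //; exists K => w.
have mFw w : measurable_fun setT (fun x => F (w, x)).
  by apply: (measurableT_comp mF); exact: measurable_pair1.
have intFw w : nu.-integrable setT (EFin \o (fun x => F (w, x))).
  apply: measurable_bounded_integrable;
    [exact: measurableT| |exact: mFw|exact: (bddF _ (fun x => (w, x)))].
  exact: le_lt_trans (probability_le1 nu measurableT) (ltry _).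
have FE : fubini_F nu (EFin \o F) =
    (fun w => (\int[mu]_x (F (w, x) * normal_pdf 0 s x))%:E).
  apply/funext => w; rewrite /fubini_F -integral_normal_prob// /Rintegral fineK//.
  exact: (integrable_fin_num measurableT (intFw w)).
have mI := measurable_fubini_F intF.
rewrite /Ex /Rintegral; congr fine.
transitivity (\int[distribution P HH]_z (EFin \o F) z)%E.
  by rewrite integral_distribution.
transitivity (\int[(PG \x nu)%E]_z (EFin \o F) z)%E.
  by apply: eq_measure_integral => A mA _; rewrite -eqm.
rewrite -integral12_prod_meas1// FE.
rewrite /PG integral_distribution//; first by rewrite -FE.
apply: brv_integrable; split.
  apply: (measurableT_comp (f := fun w : g_sigma_algebraType G =>
    \int[mu]_x (F (w, x) * normal_pdf 0 s x))) => //.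
  by apply/measurable_EFinP; rewrite (_ : EFin \o _ = fubini_F nu (EFin \o F)).
exists K => w; have iw := integrable_bounded_normal_pdf 0 s (mFw w) (fun x => hF (w, x)).
apply: le_trans (le_normr_Rintegral _ iw) _ => //.
apply: (@Rintegral_le_normal_pdf _ _ 0 s).
  by apply: measurableT_comp => //; apply/measurable_EFinP; exact: measurable_int iw.
move=> x; rewrite normr_ge0/= normrM (ger0_norm (normal_pdf_ge0 _ _ _)).
by rewrite ler_wpM2r// normal_pdf_ge0.
Qed.

End NormalIndependence.

(** * Regression of an increment on the past *)

Section GaussianCombination.
Context {R : realType} {disp : measure_display} {Omega : measurableType disp}.
Variable P : probability Omega R.
Local Notation mu := (@lebesgue_measure R).
Local Notation Ex := (Ex P).

Let int (f : Omega -> R) := P.-integrable setT (EFin \o f).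

Let intD f g : int f -> int g -> int (fun w => f w + g w).
Proof. by move=> intf intg; exact: (integrableD measurableT intf intg). Qed.

Lemma Rintegral_seq_sum (I : Type) (s : seq I) (f : I -> Omega -> R) :
  (forall i, int (f i)) -> int (fun w => \sum_(i <- s) f i w) /\
  Ex (fun w => \sum_(i <- s) f i w) = \sum_(i <- s) Ex (f i).
Proof.
move=> hf; elim: s => [|i s [ih1 ih2]].
  rewrite big_nil (_ : (fun w => _) = fun=> 0); last first.
    by apply/funext => w; rewrite big_nil.
  by rewrite Ex_cst; split => //; exact: finite_measure_integrable_cst.
rewrite big_cons (_ : (fun w => _) =
    fun w => f i w + \sum_(i <- s) f i w); last first.
  by apply/funext => w; rewrite big_cons.
by split; [exact: (intD (hf i) ih1)|
  rewrite -ih2; exact: (RintegralD measurableT (hf i) ih1)].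
Qed.

Variables (T : R) (C : R -> R -> R) (Y : R -> Omega -> R).
Hypothesis gY : centered_gaussian_process P T C Y.

Let tT t := 0 <= t <= T.

Lemma gaussian_process_measurable t : tT t -> measurable_fun setT (Y t).
Proof.
move=> ht; have [h _ _] := gY.
have [+ _] := h 1%N (fun=> t) (fun=> 1) (fun=> ht).
rewrite (_ : (fun w => _) = Y t)//.
by apply/funext => w; rewrite big_ord1 mul1r.
Qed.

Let fine_EY t : tT t -> fine ('E_P[Y t])%E = 0.
Proof. by move=> ht; have [_ -> ] := gY. Qed.

Lemma gaussian_process_cov s t : tT s -> tT t ->
  (\int[P]_w (Y s w * Y t w)%:E = (C s t)%:E)%E.
Proof.
move=> hs ht; have [_ _ h] := gY; rewrite -h// unlock.
rewrite !fine_EY// unlock; apply: eq_integral => w _.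
by rewrite -[RHS]/(((Y s w - 0) * (Y t w - 0))%:E) !subr0.
Qed.

Lemma gaussian_process_sqr_integrable t : tT t -> int (fun w => Y t w ^+ 2).
Proof.
move=> ht; have mY := gaussian_process_measurable ht.
apply/integrableP; split; first by apply/measurable_EFinP; exact: measurable_funX.
under eq_integral => w _.
  rewrite /= ger0_norm ?sqr_ge0// expr2; over.
by rewrite gaussian_process_cov// ltry.
Qed.

Lemma gaussian_process_mul_integrable s t : tT s -> tT t ->
  int (fun w => Y s w * Y t w).
Proof.
move=> hs ht.
apply: le_integrable (intD (gaussian_process_sqr_integrable hs)
  (gaussian_process_sqr_integrable ht)) => //.
  by apply/measurable_EFinP; apply: measurable_funM; exact: gaussian_process_measurable.
move=> w _ /=; rewrite lee_fin (ger0_norm (x := _ + _)) ?addr_ge0 ?sqr_ge0//.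
rewrite ler_norml; have := sqr_ge0 (Y s w - Y t w); have := sqr_ge0 (Y s w + Y t w).
have := sqr_ge0 (Y s w); have := sqr_ge0 (Y t w).
by move=> h1 h2 h3 h4; apply/andP; split; nra.
Qed.

Lemma gaussian_process_integrable t : tT t -> int (Y t).
Proof.
move=> ht; apply: le_integrable (intD (gaussian_process_sqr_integrable ht)
  (finite_measure_integrable_cst P 1 measurableT)) => //.
  by apply/measurable_EFinP; exact: gaussian_process_measurable.
move=> w _ /=; rewrite lee_fin (ger0_norm (x := _ + _)) ?addr_ge0 ?sqr_ge0//.
rewrite ler_norml; have := sqr_ge0 (Y t w - 1); have := sqr_ge0 (Y t w + 1).
by move=> h1 h2; apply/andP; split; nra.
Qed.

Lemma gaussian_process_mean t : tT t -> Ex (Y t) = 0.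
Proof.
by move=> ht; have [_ + _] := gY => /(_ t ht); rewrite unlock /Ex /Rintegral => ->.
Qed.

(* A pair (c, t) encodes the term c * Y t of a linear combination. *)
Definition lincomb (s : seq (R * R)) (w : Omega) : R :=
  \sum_(p <- s) p.1 * Y p.2 w.

Definition cov_form (s s' : seq (R * R)) : R :=
  \sum_(p <- s) \sum_(q <- s') p.1 * q.1 * C p.2 q.2.

Variable s : seq (R * R).
Hypothesis hs : forall p, p \in s -> 0 <= p.2 <= T.

Let n := size s.
Let tm (k : 'I_n) := (nth (0, 0) s k).2.
Let cf (k : 'I_n) := (nth (0, 0) s k).1.

Let htm k : tT (tm k).
Proof. by apply: hs; apply: mem_nth. Qed.

Let SE : lincomb s = fun w => \sum_(k < n) cf k * Y (tm k) w.
Proof. by apply/funext => w; rewrite /lincomb (big_nth (0, 0)) big_mkord. Qed.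

Let QE : cov_form s s = \sum_(k < n) \sum_(l < n) cf k * cf l * C (tm k) (tm l).
Proof.
rewrite /cov_form (big_nth (0, 0)) big_mkord; apply: eq_bigr => k _.
by rewrite (big_nth (0, 0)) big_mkord.
Qed.

Lemma measurable_lincomb : measurable_fun setT (lincomb s).
Proof.
rewrite SE; apply: measurable_sum => k; apply: measurable_funM => //.
exact: gaussian_process_measurable.
Qed.

Let int_S : int (lincomb s) /\ Ex (lincomb s) = 0.
Proof.
have h := @Rintegral_seq_sum _ (index_enum 'I_n) (fun k w => cf k * Y (tm k) w).
rewrite SE; have [k|h1 h2] := h.
  by apply: integrable_EFinZl; exact: gaussian_process_integrable.
split => //; rewrite h2 big1// => k _.
rewrite /Ex RintegralZl//; last exact: gaussian_process_integrable.
by rewrite -/(Ex _) gaussian_process_mean// mulr0.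
Qed.

Let int_S2 : int (fun w => lincomb s w ^+ 2) /\
  Ex (fun w => lincomb s w ^+ 2) = cov_form s s.
Proof.
pose f (kl : 'I_n * 'I_n) w := cf kl.1 * cf kl.2 * (Y (tm kl.1) w * Y (tm kl.2) w).
have h := @Rintegral_seq_sum _ (index_enum ('I_n * 'I_n)%type) f.
have -> : (fun w => lincomb s w ^+ 2) = (fun w => \sum_kl f kl w).
  apply/funext => w; rewrite SE expr2 big_distrlr/= pair_bigA/=.
  by apply: eq_bigr => kl _; rewrite /f; ring.
have iY kl : int (fun w => Y (tm kl.1) w * Y (tm kl.2) w).
  exact: gaussian_process_mul_integrable.
have [kl|h1 h2] := h; first by apply: integrable_EFinZl; exact: (iY kl).
split => //; rewrite h2 QE pair_bigA/=; apply: eq_bigr => kl _.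
rewrite /f /Ex RintegralZl//; last exact: (iY kl).
by rewrite /Rintegral gaussian_process_cov.
Qed.

Let change (nu : probability (measurableTypeR R) R) (f : R -> R) :
  (forall U, measurable U -> P (lincomb s @^-1` U) = nu U) ->
  measurable_fun setT f -> int (fun w => f (lincomb s w)) ->
  nu.-integrable setT (EFin \o f) /\
  Ex (fun w => f (lincomb s w)) = \int[nu]_x f x.
Proof.
move=> law mf intf.
pose S0 : Omega -> measurableTypeR R := lincomb s.
have mS : measurable_fun setT S0 by exact: measurable_lincomb.
pose S : {mfun Omega >-> measurableTypeR R} := mfun_Sub (mem_set mS).
have E : forall A, measurable A -> A `<=` setT -> distribution P S A = nu A.
  by move=> A mA _; exact: law.
have mE : measurable_fun setT (EFin \o f) by exact/measurable_EFinP.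
split.
  apply/integrableP; split => //.
  rewrite -(eq_measure_integral _ E) ge0_integral_distribution//.
    by have /integrableP[] := intf.
  exact: measurableT_comp.
rewrite /Ex /Rintegral -(eq_measure_integral _ E); congr fine.
by rewrite integral_distribution.
Qed.

(** [gaussian_rv] provides an unspecified mean and deviation; they are identified as 0 and the root
    of [cov_form] by computing the first two moments of the law. The Dirac case is treated apart and
    obeys the same cosine formula with variance 0. *)
Lemma lincomb_law :
  (forall theta, Ex (fun w => cos (lincomb s w + theta)) =
    cos theta * expR (- (cov_form s s / 2))) /\
  (forall sg, 0 < sg -> sg ^+ 2 = cov_form s s -> forall U, measurable U ->
    P (lincomb s @^-1` U) = normal_prob 0 sg U).
Proof.
have [g _ _] := gY.
have [mS [m [sg [sg0 law]]]] := g n tm cf htm.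
rewrite -SE in mS law.
have [iS ES] := int_S; have [iS2 ES2] := int_S2.
have icos theta : int (fun w => cos (lincomb s w + theta)).
  by apply: brv_integrable; apply: brv_cos; exact: measurable_funD.
have mcos theta : measurable_fun setT (fun x : R => cos (x + theta)).
  by apply: (measurableT_comp (@measurable_cos R)); exact: measurable_funD.
have [sz|snz] := eqVneq sg 0.
  pose dm : probability (measurableTypeR R) R := @dirac _ (measurableTypeR R) m R.
  have law' U : measurable U -> P (lincomb s @^-1` U) = dm U.
    by move=> mU; rewrite law// sz eqxx.
  have ED (f : R -> R) (mf : measurable_fun setT f) : \int[dm]_x f x = f m.
    rewrite /Rintegral integral_dirac//= ?diracT ?mul1e//.
      by rewrite indicE mem_set ?mul1r.
    exact/measurable_EFinP.
  have m0 : m = 0.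
    have [_ ] := change (nu := dm) law' (@measurable_id _ _ setT) iS.
    by rewrite ED// ES.
  have Q0 : cov_form s s = 0.
    have [_ ] := change (nu := dm) law' (measurable_funX 2 (@measurable_id _ _ setT)) iS2.
    by rewrite ED ?ES2 ?m0 ?expr0n//; exact: measurable_funX.
  split.
    move=> theta; have [_ ->] := change (nu := dm) law' (mcos theta) (icos theta).
    by rewrite ED// m0 add0r Q0 mul0r oppr0 expR0 mulr1.
  by move=> sg' sg'0; rewrite Q0 => /eqP; rewrite sqrf_eq0 (gt_eqF sg'0).
have sp : 0 < sg by rewrite lt_neqAle eq_sym snz.
have law' U : measurable U -> P (lincomb s @^-1` U) = normal_prob m sg U.
  by move=> mU; rewrite law// (negbTE snz).
have ip := integrable_normal_pdf m sg.
have il := integrable_lin_normal_pdf m sp.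
have iq := integrable_sqr_normal_pdf m sp.
have m0 : m = 0.
  have [i1 ] := change law' (@measurable_id _ _ setT) iS.
  rewrite ES integral_normal_prob//= => h.
  have : \int[mu]_x ((x - m) * normal_pdf m sg x + m * normal_pdf m sg x) = m.
    rewrite RintegralD//; last exact: integrable_EFinZl.
    by rewrite normal_mean// add0r RintegralZl// Rintegral_normal_pdf mulr1.
  by under eq_Rintegral do rewrite -mulrDl subrK; rewrite -h.
have Qs : cov_form s s = sg ^+ 2.
  have [i1 ] := change law' (measurable_funX 2 (@measurable_id _ _ setT)) iS2.
  rewrite ES2 integral_normal_prob//= => ->; rewrite -(normal_variance m sp).
  by apply: eq_Rintegral => x _; rewrite m0 subr0.
rewrite Qs; split.
  move=> theta; have [i1 ->] := change law' (mcos theta) (icos theta).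
  rewrite integral_normal_prob// m0.
  have := normal_charf theta 1 sp; rewrite expr1n mulr1 => <-.
  by apply: eq_Rintegral => x _; rewrite mul1r.
move=> sg' sg'0 /eqP; rewrite eqf_sqr => /orP[/eqP ->|/eqP e] U mU.
  by rewrite law' // m0.
by move: sg'0; rewrite e oppr_gt0 ltNge (ltW sp).
Qed.

End GaussianCombination.

Section FbmRegression.
Context {R : realType}.
Variables (H : R) (tau : nat -> R) (n : nat).
Hypothesis hH : 0 < H < 2^-1.
Hypothesis tau0 : tau 0%N = 0.
Hypothesis tauS : forall i, tau i <= tau i.+1.
Hypothesis tau_lt : forall i, (i < n)%N -> tau i < tau i.+1.
Local Notation G := (fbm_incr_cov H tau).

Let p0 : 0 < 2 * H.
Proof. by case/andP: hH => h _; rewrite mulr_gt0. Qed.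

Let tauM i j : (i <= j)%N -> tau i <= tau j.
Proof. by move=> /subnK <-; elim: (j - i)%N => // k ih; exact: le_trans (tauS _). Qed.

Let rowsum_ge0 i m : (i < m)%N -> 0 <= \sum_(k < m) G i k.
Proof.
move=> im; apply: le_trans (fbm_incr_cov_rowsum hH tau0 tauS im).
have h1 := tauM im; have h2 := tauS i.
rewrite mulr_ge0// subr_ge0 ge0_ler_powR ?nnegrE ?(ltW p0)//; lra.
Qed.

Let rowsum_gt0 i : (i < n)%N -> 0 < \sum_(k < n) G i k.
Proof.
move=> im; apply: lt_le_trans (fbm_incr_cov_rowsum hH tau0 tauS im).
have h1 := tauM im; have h2 := tau_lt im.
rewrite mulr_gt0// subr_gt0 gt0_ltr_powR ?nnegrE//; lra.
Qed.

Let Gram : 'M[R]_n := \matrix_(i, k) G i k.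

(** On a null vector the quadratic form vanishes, while it dominates the squares of the entries
    weighted by the row sums, which are positive because the times increase strictly. *)
Let Gram_unit : Gram \in unitmx.
Proof.
rewrite unitmxE unitfE; apply/negP => /det0P[v v0 vG].
have E : \sum_(i < n) \sum_(k < n) v 0 i * v 0 k * G i k = 0.
  transitivity (\sum_(k < n) (v *m Gram) 0 k * v 0 k); last first.
    by rewrite vG big1// => k _; rewrite mxE mul0r.
  rewrite exchange_big/=; apply: eq_bigr => k _.
  by rewrite mxE mulr_suml; apply: eq_bigr => i _; rewrite mxE; ring.
have := @sum_sqr_rowsum_le R n (fun i k => G i k) (v 0)
  (fun i k => fbm_incr_covC H tau i k)
  (fun i k ik => fbm_incr_cov_neq_le0 hH tauS ik).
rewrite E => le0.
have h i : 0 <= v 0 i ^+ 2 * (\sum_(k < n) G i k).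
  by rewrite mulr_ge0 ?sqr_ge0// ltW// rowsum_gt0.
have /eqP : \sum_(i < n) v 0 i ^+ 2 * (\sum_(k < n) G i k) = 0.
  by apply/eqP; rewrite eq_le le0 sumr_ge0.
rewrite psumr_eq0// => /allP hz.
move/eqP : v0; apply; apply/rowP => i; rewrite mxE.
have := hz i (mem_index_enum i); rewrite mulf_eq0 sqrf_eq0 => /orP[/eqP//|].
by rewrite gt_eqF// rowsum_gt0.
Qed.

(* The variance bound is the local nondeterminism of the process: the part of
   the last increment that is uncorrelated with the earlier ones does not lose
   variance, because off-diagonal covariances are nonpositive and row sums are
   covariances with the endpoint, hence nonnegative. *)
Lemma fbm_regression : exists c : nat -> R,
  [/\ c n = 1,
   forall j, (j < n)%N -> \sum_(i < n.+1) c i * G i j = 0 &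
   2^-1 * (tau n.+1 - tau n) `^ (2 * H)
     <= \sum_(i < n.+1) \sum_(k < n.+1) c i * c k * G i k].
Proof.
pose g : 'rV[R]_n := \row_j G n j.
pose a := - (g *m invmx Gram).
(* Minus the regression coefficients below n; at n itself [insub] fails and the coefficient is 1. *)
pose c (i : nat) : R := if insub i is Some i' then a 0 (i' : 'I_n) else 1.
have cn : c n = 1 by rewrite /c insubN ?ltnn.
have ci (i : 'I_n) : c i = a 0 i by rewrite /c valK.
exists c; split => //.
  move=> j jn; rewrite big_ord_recr/= cn mul1r.
  have : (a *m Gram) 0 (Ordinal jn) = - G n j.
    by rewrite /a mulNmx mulmxKV// !mxE.
  rewrite mxE => E; rewrite -[RHS](subrr (G n j)) addrC; congr (_ + _).
  by rewrite -E; apply: eq_bigr => i _; rewrite ci [Gram _ _]mxE.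
apply: le_trans (@sum_sqr_rowsum_le R n.+1 (fun i k => G i k) (fun i => c i)
  (fun i k => fbm_incr_covC H tau i k)
  (fun i k ik => fbm_incr_cov_neq_le0 hH tauS ik)).
rewrite big_ord_recr/= cn expr1n mul1r.
apply: (@le_trans _ _ (\sum_(k < n.+1) G n k)); last first.
  by rewrite lerDr sumr_ge0// => i _; rewrite mulr_ge0 ?sqr_ge0// rowsum_ge0//; exact: leqW.
apply: le_trans (fbm_incr_cov_rowsum hH tau0 tauS (ltnSn n)).
by rewrite subrr powR0 ?subr0// gt_eqF.
Qed.

End FbmRegression.

(** * Independence of the innovation *)

Section CharfIndependence.
Context {R : realType} {disp : measure_display} {Omega : measurableType disp}.
Variable P : probability Omega R.
Local Notation Ex := (Ex P).
Variables (n : nat) (V : nat -> Omega -> R) (N : Omega -> R).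
Variables (g : (nat -> R) -> R) (e : R -> R).
Hypothesis mV : forall i, (i < n)%N -> measurable_fun setT (V i).
Hypothesis mN : measurable_fun setT N.
Hypothesis e0 : e 0 = 1.
Hypothesis eN : forall eta, e (- eta) = e eta.
Hypothesis charf : forall (c : nat -> R) eta theta,
  Ex (fun w => cos (\sum_(i < n) c i * V i w + eta * N w + theta)) =
  cos theta * e eta * g c.

Let S (c : nat -> R) w := \sum_(i < n) c i * V i w.

Let mS c : measurable_fun setT (S c).
Proof.
apply: measurable_sum => i; apply: measurable_funM => //.
exact: mV.
Qed.

Let mSN c eta theta :
  measurable_fun setT (fun w => S c w + eta * N w + theta).
Proof.
apply: measurable_funD => //; apply: measurable_funD; first exact: mS.
exact: measurable_funM.
Qed.

Let mNa eta theta : measurable_fun setT (fun w => eta * N w + theta).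
Proof. by apply: measurable_funD => //; exact: measurable_funM. Qed.

Let mSa c theta : measurable_fun setT (fun w => S c w + theta).
Proof. by apply: measurable_funD => //; exact: mS. Qed.

Let charfS c theta : Ex (fun w => cos (S c w + theta)) = cos theta * g c.
Proof.
rewrite -[RHS]mulr1 mulrAC -e0 -charf; apply: eq_Ex => w.
by rewrite mul0r addr0.
Qed.

Let g0 : g (fun=> 0) = 1.
Proof.
have := charfS (fun=> 0) 0; rewrite cos0 mul1r => <-.
rewrite -[RHS](Ex_cst P 1); apply: eq_Ex => w.
by rewrite /S big1 ?addr0 ?cos0// => i _; rewrite mul0r.
Qed.

Let charfN eta theta : Ex (fun w => cos (eta * N w + theta)) = cos theta * e eta.
Proof.
rewrite -[RHS]mulr1 -g0 -charf; apply: eq_Ex => w.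
by rewrite big1 ?add0r// => i _; rewrite mul0r.
Qed.

(** Product to sum: the two cosines that appear carry eta and - eta, and evenness of [e] lets their
    means recombine into a product. *)
Let charfM c eta theta theta' :
  Ex (fun w => cos (eta * N w + theta') * cos (S c w + theta)) =
  cos theta' * e eta * (cos theta * g c).
Proof.
transitivity (Ex (fun w => 2^-1 * (cos (S c w + eta * N w + (theta + theta')) +
    cos (S c w + - eta * N w + (theta - theta'))))).
  apply: eq_Ex => w.
  have -> : S c w + eta * N w + (theta + theta') =
    (S c w + theta) + (eta * N w + theta') by ring.
  have -> : S c w + - eta * N w + (theta - theta') =
    (S c w + theta) - (eta * N w + theta') by ring.
  by move: (S c w + theta) (eta * N w + theta') => a b; rewrite cosD cosB; field.
have b1 c' eta' th : brv (fun w => cos (S c' w + eta' * N w + th)).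
  exact: brv_cos.
rewrite ExZ; last exact: brvD.
by rewrite ExD// !charf eN cosD cosB; field.
Qed.

Definition cylinder (U : nat -> set R) : set Omega :=
  [set w | forall i, (i < n)%N -> U i (V i w)].

Let prod_indic (U : nat -> set R) w : \prod_(i < n) \1_(U i) (V i w) = \1_(cylinder U) w :> R.
Proof.
rewrite indicE; case: (boolP (w \in cylinder U)) => [|nw].
  rewrite inE => h; rewrite big1// => i _.
  by rewrite indicE mem_set//; exact: h.
have [i iU] : exists i : 'I_n, ~ U i (V i w).
  apply/existsNP => h; move/negP : nw; apply; rewrite inE => i ni.
  exact: (h (Ordinal ni)).
by rewrite (bigD1 i)//= indicE memNset// mul0r.
Qed.

Lemma measurable_cylinder U : (forall i, measurable (U i)) ->
  measurable (cylinder U).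
Proof.
move=> mU; rewrite (_ : cylinder U = \bigcap_(i in [set i | (i < n)%N])
    (V i @^-1` U i)); last first.
  by apply/seteqP; split => w /= h i; exact: h.
apply: bigcap_measurableType => i /= ni.
by rewrite -[X in measurable X]setTI; exact: mV.
Qed.

(** Uniqueness is used twice. A centred cosine of [N] is orthogonal to all cosines of combinations
    of the [V i], hence to the cylinder; so the centred indicator of the cylinder is orthogonal to
    all cosines of [N], hence to the events of [N]. *)
Lemma cylinder_indep U W : (forall i, measurable (U i)) -> measurable W ->
  P (cylinder U `&` N @^-1` W) = (P (cylinder U) * P (N @^-1` W))%E.
Proof.
move=> mU mW.
have mA := measurable_cylinder mU; set A := cylinder U in mA *.
have mNW : measurable (N @^-1` W).
  by rewrite -[X in measurable X]setTI; exact: mN.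
have bA : brv (\1_A : Omega -> R) by exact: brv_indic.
have bcN eta theta : brv (fun w => cos (eta * N w + theta)) by exact: brv_cos.
have E1 eta theta : Ex (fun w => \1_A w * cos (eta * N w + theta)) =
    fine (P A) * (cos theta * e eta).
  pose Z w := cos (eta * N w + theta) - cos theta * e eta.
  have bZ : brv Z by apply: brvB => //; exact: brv_cst.
  have := @Ex_charf_family_eq0 _ _ _ P n V Z bZ mV _ U mU.
  have hZ (c : nat -> R) th : Ex (fun w => Z w * cos (\sum_(i < n) c i * V i w + th)) = 0.
    have bS : brv (fun w => cos (S c w + th)) by exact: brv_cos.
    transitivity (Ex (fun w => cos (eta * N w + theta) * cos (S c w + th) -
        cos theta * e eta * cos (S c w + th))).
      by apply: eq_Ex => w; rewrite /Z mulrBl.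
    rewrite ExB; [|exact: brvM|exact: brvZ].
    by rewrite ExZ// charfM charfS subrr.
  move=> /(_ hZ) EZ.
  have : Ex (fun w => \1_A w * cos (eta * N w + theta) -
      cos theta * e eta * \1_A w) = 0.
    by rewrite -[RHS]EZ; apply: eq_Ex => w; rewrite prod_indic /Z; ring.
  rewrite ExB; [|exact: brvM|exact: brvZ].
  by rewrite ExZ// Ex_indic// => /eqP; rewrite subr_eq0 => /eqP ->; rewrite mulrC.
pose Z2 w : R := \1_A w - fine (P A).
have bZ2 : brv Z2 by apply: brvB => //; exact: brv_cst.
have hZ2 eta theta : Ex (fun w => Z2 w * cos (eta * N w + theta)) = 0.
  transitivity (Ex (fun w => \1_A w * cos (eta * N w + theta) -
      fine (P A) * cos (eta * N w + theta))).
    by apply: eq_Ex => w; rewrite /Z2 mulrBl.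
  rewrite ExB; [|exact: brvM|exact: brvZ].
  by rewrite ExZ// E1 charfN subrr.
have := Ex_charf_eq0 bZ2 mN hZ2 mW.
have -> : (fun w => Z2 w * \1_W (N w)) =
    (fun w => \1_(A `&` N @^-1` W) w - fine (P A) * \1_(N @^-1` W) w).
  apply/funext => w; rewrite /Z2 mulrBl; congr (_ - _).
  by rewrite !indicE in_setI -natrM mulnb; congr ((_ && _)%:R).
have bNW := @brv_indic R _ _ _ mNW.
have bANW : brv (\1_(A `&` N @^-1` W) : Omega -> R).
  by apply: brv_indic; exact: measurableI.
rewrite ExB//; last exact: brvZ.
rewrite ExZ// !Ex_indic//; last exact: measurableI.
move/eqP; rewrite subr_eq0 => /eqP E.
have fin X : measurable X -> P X \is a fin_num by move=> mX; exact: fin_num_measure.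
rewrite -(fineK (fin _ (measurableI _ _ mA mNW))) E EFinM.
by rewrite !fineK//; exact: fin.
Qed.

End CharfIndependence.

Section GenSigma.
Context {R : realType} {disp : measure_display} {Omega : measurableType disp}.
Variables (I : Type) (D : set I) (Y : I -> Omega -> R).

Let gens : set (set Omega) := [set A | exists2 t, D t &
         exists2 U : set R, measurable U & A = Y t @^-1` U].

Lemma gen_sigma_measurable_fun t : D t ->
  measurable_fun setT (Y t : g_sigma_algebraType gens -> R).
Proof.
move=> Dt _ U mU; rewrite setTI; apply: sub_sigma_algebra.
by exists t => //; exists U.
Qed.

Lemma gen_sigma_preimage (f : g_sigma_algebraType gens -> R) (U : set R) :
  measurable_fun setT f -> measurable U -> gen_sigma D Y (f @^-1` U).
Proof. by move=> mf mU; rewrite -[f @^-1` U]setTI; exact: mf. Qed.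

Lemma gen_sigma_setI A B : gen_sigma D Y A -> gen_sigma D Y B ->
  gen_sigma D Y (A `&` B).
Proof. exact: (@measurableI _ (g_sigma_algebraType gens)). Qed.

Lemma gen_sigma_measurable : (forall t, D t -> measurable_fun setT (Y t)) ->
  gen_sigma D Y `<=` measurable.
Proof.
move=> mY; apply: smallest_sub; first exact: sigma_algebra_measurable.
by move=> _ [t Dt [U mU ->]]; rewrite -[_ @^-1` _]setTI; exact: mY.
Qed.

End GenSigma.

Section FbmIndependence.
Context {R : realType} {disp : measure_display} {Omega : measurableType disp}.
Variable P : probability Omega R.
Local Notation Ex := (Ex P).
Variables (d : nat) (T H : R) (B : R -> Omega -> 'rV[R]_d).
Hypothesis hH : 0 < H < 2^-1.
Hypothesis hB : is_fbm P T H B.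
Variables (tau : nat -> R) (n : nat).
Hypothesis tau0 : tau 0%N = 0.
Hypothesis tauS : forall i, tau i <= tau i.+1.
Hypothesis tau_lt : forall i, (i < n.+1)%N -> tau i < tau i.+1.
Hypothesis tauT : tau n.+1 <= T.
Variable i0 : 'I_d.
Let Y (i : 'I_d) t w : R := B t w 0 i.
Let C := fbm_cov H.

Let gY i : centered_gaussian_process P T C (Y i).
Proof. by have [h _ _] := hB; exact: h. Qed.

Let tauM i j : (i <= j)%N -> tau i <= tau j.
Proof. by move=> /subnK <-; elim: (j - i)%N => // k ih; exact: le_trans (tauS _). Qed.

Let tau_in i : (i <= n.+1)%N -> 0 <= tau i <= T.
Proof. by move=> h; rewrite -tau0 tauM//= (le_trans (tauM h)). Qed.

Section Coefficients.
Variable c : nat -> R.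
Let covN t := \sum_(i < n.+1) c i * (C (tau i.+1) t - C (tau i) t).
Let v := \sum_(i < n.+1) \sum_(k < n.+1) c i * c k * fbm_incr_cov H tau i k.
Hypothesis c_orth : forall j, (j < n)%N ->
  \sum_(i < n.+1) c i * fbm_incr_cov H tau i j = 0.

(** Orthogonality to increments becomes orthogonality to values, since the process starts from 0. *)
Let covN0 j : (j <= n)%N -> covN (tau j) = 0.
Proof.
elim: j => [_|j ih jn].
  rewrite /covN big1// => i _.
  rewrite tau0 /C !fbm_cov0 ?subrr ?mulr0//.
    by case/andP: (@tau_in i (ltnW (ltn_ord i))).
  by case/andP: (@tau_in i.+1 (ltn_ord i)).
have : covN (tau j.+1) - covN (tau j) = 0.
  rewrite -(c_orth jn) /covN -sumrB; apply: eq_bigr => i _.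
  by rewrite /fbm_incr_cov /C; ring.
by rewrite ih 1?ltnW// subr0.
Qed.

Let sV (th : nat -> R) := [seq (th j, tau j) | j <- index_iota 0 n.+1].
Let sN (eta : R) := [seq (eta * c i, tau i.+1) | i <- index_iota 0 n.+1] ++
  [seq (- (eta * c i), tau i) | i <- index_iota 0 n.+1].

Let Nn (i : 'I_d) w := \sum_(k < n.+1) c k * (Y i (tau k.+1) w - Y i (tau k) w).

Let sum_sN eta (F : R * R -> R) : \sum_(q <- sN eta) F q =
  \sum_(k < n.+1) (F (eta * c k, tau k.+1) + F (- (eta * c k), tau k)).
Proof.
have hr (G : nat -> R) : \sum_(i <- index_iota 0 n.+1) G i = \sum_(i < n.+1) G i.
  by rewrite big_mkord.
rewrite /sN; move: (index_iota 0 n.+1) hr => r hr.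
by rewrite big_cat !big_map !hr big_split.
Qed.

Let lincomb_sV i th w : lincomb (Y i) (sV th) w =
  \sum_(j < n.+1) th j * Y i (tau j) w.
Proof. by rewrite /lincomb big_map big_mkord. Qed.

Let lincomb_sN i eta w : lincomb (Y i) (sN eta) w = eta * Nn i w.
Proof.
rewrite /lincomb sum_sN mulr_sumr.
by apply: eq_bigr => k _ /=; ring.
Qed.

Let inV th p : p \in sV th -> 0 <= p.2 <= T.
Proof.
move=> /mapP[j]; rewrite mem_index_iota => /andP[_ jn] ->/=.
by apply: tau_in; exact: ltnW.
Qed.

Let inN eta p : p \in sN eta -> 0 <= p.2 <= T.
Proof.
rewrite mem_cat => /orP[] /mapP[j]; rewrite mem_index_iota => /andP[_ jn] ->/=.
  exact: tau_in.
by apply: tau_in; exact: ltnW.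
Qed.

Let form_N eta t : \sum_(q <- sN eta) q.1 * C t q.2 = eta * covN t.
Proof.
rewrite sum_sN /covN mulr_sumr.
by apply: eq_bigr => k _ /=; rewrite /C (fbm_covC _ t) (fbm_covC _ t); ring.
Qed.

Let cov_formE s s' : cov_form C s s' =
  \sum_(p <- s) p.1 * \sum_(q <- s') q.1 * C p.2 q.2.
Proof.
by apply: eq_bigr => p _; rewrite mulr_sumr; apply: eq_bigr => q _; rewrite mulrA.
Qed.

Let cov_formC s s' : cov_form C s s' = cov_form C s' s.
Proof.
rewrite /cov_form exchange_big/=; apply: eq_bigr => p _; apply: eq_bigr => q _.
by rewrite /C fbm_covC; ring.
Qed.

Let cov_form_VN th eta : cov_form C (sV th) (sN eta) = 0.
Proof.
rewrite cov_formE big_map big_mkord big1// => j _.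
by rewrite /= form_N covN0 ?mulr0// -ltnS.
Qed.

Let cov_form_NN eta : cov_form C (sN eta) (sN eta) = eta ^+ 2 * v.
Proof.
rewrite cov_formE; under eq_bigr do rewrite form_N.
rewrite sum_sN.
rewrite /v exchange_big/= mulr_sumr; apply: eq_bigr => k _.
transitivity (eta ^+ 2 * (c k * (covN (tau k.+1) - covN (tau k)))).
  by move=> /=; ring.
congr (_ * _); rewrite /covN -sumrB mulr_sumr; apply: eq_bigr => i _.
by rewrite /fbm_incr_cov /C; ring.
Qed.

Let cov_form_cat th eta : cov_form C (sV th ++ sN eta) (sV th ++ sN eta) =
  cov_form C (sV th) (sV th) + eta ^+ 2 * v.
Proof.
have E s : cov_form C (sV th ++ sN eta) s = cov_form C (sV th) s + cov_form C (sN eta) s.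
  by rewrite /cov_form big_cat.
have E' s : cov_form C s (sV th ++ sN eta) = cov_form C s (sV th) + cov_form C s (sN eta).
  by rewrite cov_formC E !(cov_formC s).
by rewrite E !E' (cov_formC (sN eta) (sV th)) cov_form_VN cov_form_NN; ring.
Qed.

Let charf i (th : nat -> R) eta theta :
  Ex (fun w => cos (\sum_(j < n.+1) th j * Y i (tau j) w + eta * Nn i w + theta)) =
  cos theta * expR (- (eta ^+ 2 * v / 2)) * expR (- (cov_form C (sV th) (sV th) / 2)).
Proof.
have hs p : p \in sV th ++ sN eta -> 0 <= p.2 <= T.
  by rewrite mem_cat => /orP[]; [exact: inV|exact: inN].
have [/(_ theta) + _] := lincomb_law (gY i) hs.
rewrite cov_form_cat mulrDl opprD expRD (mulrC (expR _)) mulrA => <-.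
by apply: eq_Ex => w; rewrite /lincomb big_cat/= -!/(lincomb _ _ _) lincomb_sV lincomb_sN.
Qed.

Let measurable_Nn : measurable_fun setT (Nn i0).
Proof.
apply: measurable_sum => k; apply: measurable_funM => //.
apply: measurable_funB; apply: (gaussian_process_measurable (gY i0)); apply: tau_in => //.
by apply: ltnW; exact: ltn_ord.
Qed.

(* The past of coordinate i0 at the times tau 0, ..., tau n, together with the
   other coordinates at all times. *)
Definition past_rect : set (set Omega) := [set E | exists A : 'I_d -> set Omega,
  exists2 U : nat -> set R, (forall j, measurable (U j)) &
  [/\ A i0 = cylinder n.+1 (fun j => Y i0 (tau j)) U,
      forall i, i != i0 -> gen_sigma `[0, T] (Y i) (A i) &
      E = \bigcap_(i in [set: 'I_d]) A i]].

Let mY i t : 0 <= t <= T -> measurable_fun setT (Y i t).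
Proof. exact: (gaussian_process_measurable (gY i)). Qed.

Let mYtau j : (j < n.+1)%N -> measurable_fun setT (Y i0 (tau j)).
Proof. by move=> jn; apply: mY; apply: tau_in; exact: ltnW. Qed.

Let gen_meas i A : gen_sigma `[0, T] (Y i) A -> measurable A.
Proof.
apply: gen_sigma_measurable => t; rewrite /= in_itv/= => ht; exact: mY.
Qed.

Let gens i : set (set Omega) := [set A | exists2 t, [set` `[0, T]] t &
         exists2 U : set R, measurable U & A = Y i t @^-1` U].

Let gY_tau i j : (j <= n.+1)%N ->
  measurable_fun setT (Y i (tau j) : g_sigma_algebraType (gens i) -> R).
Proof.
move=> jn; apply: gen_sigma_measurable_fun; rewrite /= in_itv/=.
exact: tau_in.
Qed.

Let gen_cylinder U : (forall j, measurable (U j)) ->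
  gen_sigma `[0, T] (Y i0) (cylinder n.+1 (fun j => Y i0 (tau j)) U).
Proof.
move=> mU; apply: (@measurable_cylinder _ _ (g_sigma_algebraType (gens i0))) => //.
by move=> j jn; apply: gY_tau; exact: ltnW.
Qed.

Let gen_Nn W : measurable W -> gen_sigma `[0, T] (Y i0) (Nn i0 @^-1` W).
Proof.
move=> mW; apply: gen_sigma_preimage => //.
apply: measurable_sum => k; apply: measurable_funM => //.
by apply: measurable_funB; apply: gY_tau => //; apply: ltnW; exact: ltn_ord.
Qed.

Let past_rectI : setI_closed past_rect.
Proof.
move=> _ _ [A [U mU [Ai0 Ai ->]]] [A' [U' mU' [Ai0' Ai' ->]]].
exists (fun i => A i `&` A' i), (fun j => U j `&` U' j).
  by move=> j; exact: measurableI.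
split.
- rewrite Ai0 Ai0'; apply/seteqP; split => w /=.
    by move=> [h1 h2] j jn; split; [exact: h1|exact: h2].
  by move=> h; split => j jn; have [] := h j jn.
- by move=> i ii0; apply: gen_sigma_setI; [exact: Ai|exact: Ai'].
- by rewrite bigcapI.
Qed.

Let mutual_indep_fine (A : 'I_d -> set Omega) :
  (forall i, gen_sigma `[0, T] (Y i) (A i)) ->
  fine (P (\bigcap_(i in [set: 'I_d]) A i)) = \prod_(i < d) fine (P (A i)).
Proof. by case: hB => _ + _; exact. Qed.

Let mbigcap (A : 'I_d -> set Omega) :
  (forall i, gen_sigma `[0, T] (Y i) (A i)) ->
  measurable (\bigcap_(i in [set: 'I_d]) A i).
Proof.
move=> hA; apply: fin_bigcap_measurable => // i _; exact: gen_meas.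
Qed.

(** On a rectangle, mutual independence of the coordinates isolates the factor of [i0]. There the
    characteristic functions factorize, because the combination is uncorrelated with the values at
    [tau 0], ..., [tau n]. Rectangles are stable under intersection, so the product rule extends to
    the generated sigma-algebra. *)
Lemma past_indep_aux : 0 < v ->
  indep_normal P (<<s past_rect >>) (Nn i0) (Num.sqrt v).
Proof.
move=> v0.
have law W : measurable W -> P (Nn i0 @^-1` W) = normal_prob 0 (Num.sqrt v) W.
  move=> mW; have [_ h] := lincomb_law (gY i0) (@inN 1).
  rewrite -(h (Num.sqrt v))// ?sqrtr_gt0//.
    by congr (P _); apply/seteqP; split => w /=; rewrite lincomb_sN mul1r.
  by rewrite cov_form_NN expr1n mul1r sqr_sqrtr// ltW.
have fin X : measurable X -> P X \is a fin_num by move=> mX; exact: fin_num_measure.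
have mNW W : measurable W -> measurable (Nn i0 @^-1` W).
  by move=> mW; exact: gen_meas (gen_Nn mW).
have rect_indep A W : past_rect A -> measurable W -> measurable A /\
    fine (P (A `&` Nn i0 @^-1` W)) = fine (P A) * fine (P (Nn i0 @^-1` W)).
  move=> [A' [U mU [Ai0 Ai ->]]] mW.
  have gA i : gen_sigma `[0, T] (Y i) (A' i).
    have [->|ii0] := eqVneq i i0; last exact: Ai.
    by rewrite Ai0; exact: gen_cylinder.
  split; first exact: mbigcap.
  pose A'' i := if i == i0 then A' i0 `&` Nn i0 @^-1` W else A' i.
  have gA'' i : gen_sigma `[0, T] (Y i) (A'' i).
    rewrite /A''; case: eqP => [->|_]; last exact: gA.
    by apply: gen_sigma_setI => //; exact: gen_Nn.
  have -> : \bigcap_(i in [set: 'I_d]) A' i `&` Nn i0 @^-1` W =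
      \bigcap_(i in [set: 'I_d]) A'' i.
    apply/seteqP; split => w /=.
      move=> [h1 h2] i _; rewrite /A''; case: eqP => [_|_]; last exact: h1.
      by split => //; exact: h1.
    move=> h; split.
      move=> i _; have := h i Logic.I; rewrite /A''; case: eqP => // -> [].
      by [].
    by have := h i0 Logic.I; rewrite /A'' eqxx => -[].
  rewrite !mutual_indep_fine// (bigD1 i0)//= [in RHS](bigD1 i0)//= mulrAC.
  congr (_ * _); last by apply: eq_bigr => i ii0; rewrite /A'' (negbTE ii0).
  rewrite /A'' eqxx Ai0.
  have := @cylinder_indep R disp Omega P n.+1 (fun j => Y i0 (tau j)) (Nn i0)
    (fun th => expR (- (cov_form C (sV th) (sV th) / 2)))
    (fun eta => expR (- (eta ^+ 2 * v / 2))) mYtau measurable_Nn.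
  rewrite expr0n/= !mul0r oppr0 expR0 => /(_ erefl).
  have eN eta : expR (- ((- eta) ^+ 2 * v / 2)) = expR (- (eta ^+ 2 * v / 2)).
    by rewrite sqrrN.
  move=> /(_ eN (charf i0) U W mU mW) ->.
  rewrite fineM//; apply: fin; last exact: mNW.
  exact: gen_meas (gen_cylinder mU).
move=> A GA.
have mGA : measurable A.
  move: A GA; apply: smallest_sub; first exact: sigma_algebra_measurable.
  by move=> A /rect_indep /(_ measurableT)[].
split => // W mW; rewrite -law//.
pose Z w : R := \1_(Nn i0 @^-1` W) w - fine (P (Nn i0 @^-1` W)).
have bNW := @brv_indic R _ _ _ (mNW W mW).
have bZ : brv Z by apply: brvB => //; exact: brv_cst.
have EZA X : measurable X -> Ex (fun w => Z w * \1_X w) =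
    fine (P (X `&` Nn i0 @^-1` W)) - fine (P X) * fine (P (Nn i0 @^-1` W)).
  move=> mX; have bX := @brv_indic R _ _ _ mX.
  rewrite -!Ex_indic//; [|exact: mNW|by apply: measurableI => //; exact: mNW].
  rewrite mulrC -ExZ// -ExB//.
  - apply: eq_Ex => w; rewrite /Z Ex_indic; last exact: mNW.
    rewrite mulrBl; congr (_ - _).
    rewrite !indicE in_setI -natrM mulnb andbC//.
  - by apply: brv_indic; apply: measurableI => //; exact: mNW.
  - exact: brvZ.
have [_] : orth_event P Z A.
  apply: (orth_event_g_sigma (G := past_rect)) => //.
  - have := EZA _ measurableT; rewrite setTI.
    have -> : P setT = 1%E by exact: probability_setT.
    rewrite mul1r subrr => <-; apply: eq_Ex => w.
    by rewrite indicT mulr1.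
  - move=> X /rect_indep /(_ mW)[mX E]; split => //.
    by rewrite EZA// E subrr.
rewrite EZA// => /eqP; rewrite subr_eq0 => /eqP E.
rewrite -(fineK (fin _ (measurableI _ _ mGA (mNW _ mW)))) E EFinM.
by rewrite !fineK//; apply: fin => //; exact: mNW.
Qed.

End Coefficients.

(** The normalization [c n = 1] is there so that the value at the last time minus the innovation
    depends on earlier values only. *)
Lemma past_indep : exists c : nat -> R, exists s : R,
  [/\ c n = 1, 0 < s,
     2^-1 * (tau n.+1 - tau n) `^ (2 * H) <= s ^+ 2 &
     indep_normal P (<<s past_rect >>)
       (fun w => \sum_(k < n.+1) c k * (B (tau k.+1) w 0 i0 - B (tau k) w 0 i0)) s].
Proof.
have [|c [cn orth hv]] := @fbm_regression R H tau n hH tau0 tauS.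
  by move=> i h; apply: tau_lt; exact: leqW.
set v := (X in _ <= X) in hv.
have v0 : 0 < v.
  apply: lt_le_trans hv; rewrite mulr_gt0// powR_gt0// subr_gt0.
  exact: tau_lt.
exists c, (Num.sqrt v); split => //.
- by rewrite sqrtr_gt0.
- by rewrite sqr_sqrtr// ltW.
- exact: past_indep_aux.
Qed.

End FbmIndependence.

(** * Regularization by noise *)

Section MeasurableRow.
Context {R : realType}.

(** The open set where g > a is the union of the rational cubes it contains: there are countably
    many, and each is a finite intersection of conditions on coordinates. *)
Lemma measurable_continuous_row disp (S : measurableType disp) d
    (g : 'rV[R]_d -> R) (f : 'I_d -> S -> R) :
  continuous g -> (forall i, measurable_fun setT (f i)) ->
  measurable_fun setT (fun w => g (\row_i f i w)).
Proof.
move=> cg mf.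
apply: (measurability _ (RGenOInfty.measurableE R)) => _ [_ [a ->] <-].
rewrite setTI; pose box (q : 'rV[rat]_d * nat) : set 'rV[R]_d :=
  [set v | forall i, `|v 0 i - ratr (q.1 0 i)| < q.2.+1%:R^-1].
pose V := [set v | a < g v].
pose E q := if `[< box q `<=` V >] then
  \bigcap_(i in [set: 'I_d]) [set w | `|f i w - ratr (q.1 0 i)| < q.2.+1%:R^-1]
  else set0.
have -> : (fun w => g (\row_i f i w)) @^-1` `]a, +oo[ = \bigcup_q E q.
  apply/seteqP; split => w /=.
    rewrite in_itv/= andbT => aw.
    have : nbhs (\row_i f i w) V.
      apply: (cg _ [set x | a < x]); apply: open_nbhs_nbhs; split; last exact: aw.
      exact: open_gt.
    move=> /nbhs_ballP[e /= e0 eV].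
    have [n ne] : exists n : nat, n.+1%:R^-1 < e / 2.
      have := @near_infty_natSinv_lt R (PosNum (divr_gt0 e0 (ltr0n R 2))).
      by move=> [n _ /(_ n (leqnn _))] /= h; exists n.
    have q_ i : exists q : rat, `|f i w - ratr q| < n.+1%:R^-1.
      have : f i w - n.+1%:R^-1 < f i w + n.+1%:R^-1.
        by rewrite ltrBlDr -addrA ltrDl addr_gt0.
      move=> /rat_in_itvoo[q]; rewrite in_itv/= => /andP[q1 q2].
      by exists q; rewrite ltr_distlC q1 q2.
    have [q hq] := choice q_.
    exists (\row_i q i, n) => //; rewrite /E asboolT.
      by move=> i _ /=; rewrite mxE.
    move=> v hv; apply: eV; split => // i j; rewrite ord1 mxE /ball/=.
    have := hv j; have := hq j; rewrite /= !mxE.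
    move: (f j w) (ratr (q j)) (v 0 j) => x y z h1 h2.
    rewrite (_ : x - z = (x - y) - (z - y)); last by ring.
    rewrite [ltRHS]splitr (le_lt_trans (ler_normB _ _))// ltrD//.
      exact: lt_trans ne.
    exact: lt_trans ne.
  move=> [q _]; rewrite /E; case: asboolP => // qV h.
  rewrite in_itv/= andbT; apply: (qV (\row_i f i w)) => i.
  by rewrite mxE; exact: h.
apply: countable_bigcupT_measurable => [|q]; first exact: countableP.
rewrite /E; case: asboolP => // _.
apply: fin_bigcap_measurable => // i _.
rewrite (_ : [set w | _] = (fun w => `|f i w - ratr (q.1 0 i)|) @^-1` [set` `]-oo, q.2.+1%:R^-1[]).
  rewrite -[X in measurable X]setTI.
  have : measurable_fun setT (fun w => `|f i w - ratr (q.1 0 i)|).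
    by apply: measurableT_comp => //; exact: measurable_funB.
  by apply => //; exact: measurable_itv.
by apply/seteqP; split => w /=; rewrite in_itv.
Qed.

End MeasurableRow.

Section ContinuousIncrement.
Context {R : realType} {d : nat}.

Lemma continuous_translate (g : 'rV[R]_d -> R) z : continuous g ->
  continuous (fun v : 'rV[R]_d => g (v + z)).
Proof.
move=> cg v.
have h : continuous (fun v : 'rV[R]_d => v + z).
  by move=> u; apply: continuousD; [exact: cvg_id|exact: cst_continuous].
exact: (continuous_comp (h v) (cg (v + z))).
Qed.

Lemma continuous_incr (g : 'rV[R]_d -> R) z : continuous g ->
  continuous (fun v : 'rV[R]_d => g (v + z) - g v).
Proof.
move=> cg v; apply: (@continuousB R R 'rV[R]_d); last exact: cg.
exact: (@continuous_translate _ z cg).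
Qed.

End ContinuousIncrement.

Section Translation.
Context {R : realType}.
Local Notation mu := (@lebesgue_measure R).

Lemma Rintegral_translate (f : R -> R) (a : R) :
  measurable_fun setT f -> mu.-integrable setT (EFin \o (fun x => f (x + a))) ->
  \int[mu]_x f x = \int[mu]_x f (x + a).
Proof.
move=> mf intf.
pose phi : R -> measurableTypeR R := fun x => x + a.
have mphi : measurable_fun setT phi by exact: measurable_funD.
pose nu' : {measure set (measurableTypeR R) -> \bar R} :=
  pushforward mu phi.
pose nu := nu' mphi.
have E A : measurable A -> mu A = nu A.
  apply: lebesgue_measure_unique => _ [[x y] _ <-] /=.
  rewrite /nu /nu'/= /pushforward/=.
  have -> : phi @^-1` [set` `]x, y]] = [set` `]x - a, y - a]].
    by apply/seteqP; split => z /=; rewrite !in_itv/= /phi ltrBlDr lerBrDr.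
  rewrite !lebesgue_measure_itv/= !lte_fin ltrD2r.
  by case: ifP => // _; rewrite -!EFinB; congr (_%:E); ring.
rewrite /Rintegral; congr fine.
transitivity (\int[nu]_x (EFin \o f) x)%E.
  by apply: eq_measure_integral => A mA _; exact: E.
rewrite /nu /nu'/= integral_pushforward//; exact/measurable_EFinP.
Qed.

(** Moves a shift from the integrand, which has no regularity, to the mean of the Gaussian density,
    which is smooth. *)
Lemma Rintegral_normal_translate (f : R -> R) (a s K : R) : 0 < s ->
  measurable_fun setT f -> (forall x, `|f x| <= K) ->
  \int[mu]_x (f (x + a) * normal_pdf 0 s x) = \int[mu]_x (f x * normal_pdf a s x).
Proof.
move=> s0 mf hf.
have E x : normal_pdf a s (x + a) = normal_pdf 0 s x.
  by rewrite -[in LHS](addr0 a) normal_pdf_translate// addr0 addrK.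
rewrite (@Rintegral_translate (fun x => f x * normal_pdf a s x) a).
- by congr (Rintegral _ _ _); apply/funext => x; rewrite E.
- by apply: measurable_funM => //; exact: measurable_normal_pdf.
- rewrite (_ : (fun x => _) = (fun x => f (x + a) * normal_pdf 0 s x)); last first.
    by apply/funext => x; rewrite E.
  apply: integrable_bounded_normal_pdf => //.
  by apply: measurableT_comp => //; exact: measurable_funD.
Qed.

End Translation.

Section TimeGrid.
Context {R : realType}.

(** Sorts 0 and the times of [S], then appends [r] and stays there. As [tau n <= s], the last gap is
    at least r - s, and so is the base of the power that bounds the innovation variance. *)
Lemma exists_time_grid (S : seq R) (s r : R) : 0 <= s -> s < r ->
  (forall u, u \in S -> 0 <= u <= s) ->
  exists tau : nat -> R, exists n : nat,
   [/\ tau 0%N = 0, forall i, tau i <= tau i.+1,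
       forall i, (i < n.+1)%N -> tau i < tau i.+1,
       tau n.+1 = r /\ tau n <= s &
       forall u, u \in S -> exists2 j, (j <= n)%N & u = tau j].
Proof.
move=> s0 sr hS.
pose t := sort <=%R (undup (0 :: S)).
have st : sorted <%R t by rewrite sort_lt_sorted undup_uniq.
have memt u : (u \in t) = (u == 0) || (u \in S).
  by rewrite mem_sort mem_undup in_cons.
have ht u : u \in t -> 0 <= u <= s.
  by rewrite memt => /orP[/eqP->|/hS//]; rewrite lexx.
have tn : (0 < size t)%N.
  by case: t {st ht} memt => // /(_ 0); rewrite eqxx.
pose n := (size t).-1.
have nE : n.+1 = size t by rewrite prednK.
pose tau i := if (i <= n)%N then nth 0 t i else r.
have tau_le i : (i <= n)%N -> 0 <= tau i <= s.
  by move=> ni; rewrite /tau ni; apply: ht; rewrite mem_nth// -nE.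
have taulast : tau n.+1 = r by rewrite /tau ltnn.
have tau_lt i : (i < n.+1)%N -> tau i < tau i.+1.
  rewrite ltnS leq_eqVlt => /predU1P[->|ni].
    by rewrite taulast (le_lt_trans _ sr)//; case/andP: (tau_le n (leqnn _)).
  rewrite /tau ni (ltnW ni); apply: (sorted_ltn_nth lt_trans) => //.
    by rewrite inE -nE ltnS ltnW.
  by rewrite inE -nE ltnS.
exists tau, n; split => //.
- apply/eqP; rewrite eq_le; case/andP: (tau_le 0%N (leq0n _)) => -> _; rewrite andbT.
  have : 0 \in t by rewrite memt eqxx.
  move=> /(nthP 0)[j]; rewrite -nE ltnS => jn <-.
  rewrite /tau leq0n; apply: (sorted_leq_nth le_trans) => //.
    by apply: sub_sorted st => x y; exact: ltW.
  by rewrite inE -nE ltnS.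
- move=> i; have [/tau_lt/ltW//|ni] := ltnP i n.+1.
  by rewrite /tau leqNgt ni/= leqNgt (leq_trans ni).
- by split => //; case/andP: (tau_le n (leqnn _)).
- move=> u uS; have : u \in t by rewrite memt uS orbT.
  move=> /(nthP 0)[j]; rewrite -nE ltnS => jn <-; exists j => //.
  by rewrite /tau jn.
Qed.

End TimeGrid.

(** * Smoothing one coordinate at a time, given finitely many past times *)

Section Smoothing.
Context {R : realType} {disp : measure_display} {Omega : measurableType disp}.
Variable P : probability Omega R.
Local Notation Ex := (Ex P).
Local Notation mu := (@lebesgue_measure R).
Variables (d : nat) (T H : R) (B : R -> Omega -> 'rV[R]_d).
Hypothesis hH : 0 < H < 2^-1.
Hypothesis hB : is_fbm P T H B.
Variables (S : seq R) (s r : R).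
Hypothesis s0 : 0 <= s.
Hypothesis sr : s < r.
Hypothesis rT : r <= T.
Hypothesis hS : forall u, u \in S -> 0 <= u <= s.
Let Y (i : 'I_d) t w : R := B t w 0 i.
Let gens i : set (set Omega) := [set A | exists2 t, [set` `[0, T]] t &
         exists2 U : set R, measurable U & A = Y i t @^-1` U].

Definition past_sigma := gen_sigma [set si : R * 'I_d | si.1 \in S]
  (fun si w => B si.1 w 0 si.2).

Let gY i : centered_gaussian_process P T (fbm_cov H) (Y i).
Proof. by have [h _ _] := hB; exact: h. Qed.

Let mY i t : 0 <= t <= T -> measurable_fun setT (Y i t).
Proof. exact: (gaussian_process_measurable (gY i)). Qed.

Let gens_meas i A : <<s gens i >> A -> measurable A.
Proof.
apply: gen_sigma_measurable => t; rewrite /= in_itv/= => ht; exact: mY.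
Qed.

Let r0T : 0 <= r <= T. Proof. by rewrite rT andbT (le_trans s0)// ltW. Qed.

Let gens_Y i t : 0 <= t <= T ->
  measurable_fun setT (Y i t : g_sigma_algebraType (gens i) -> R).
Proof. by move=> ht; apply: gen_sigma_measurable_fun; rewrite /= in_itv. Qed.

Let gens_measurable i (f : Omega -> R) :
  measurable_fun setT (f : g_sigma_algebraType (gens i) -> R) ->
  measurable_fun setT f.
Proof. by move=> mf _ U mU; rewrite setTI; apply: gens_meas; rewrite -[_ @^-1` _]setTI; exact: mf. Qed.

(* Only coordinate j is smoothed, the others being treated as frozen; a bound for
   a vector shift is obtained one coordinate at a time. *)
Definition upd (Q : 'I_d -> Omega -> R) (j : 'I_d) (f : Omega -> R) (w : Omega) (x : R) :=
  \row_i (if i == j then f w + x else Q i w).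

(** Coordinate j at time r is a past part plus the independent [N]; integrating [N] out turns the
    shift [a] into the mean of its density. [sg] and [N] are chosen before [g] and [a], so that one
    kernel serves all terms of a finite difference. [N] depends on coordinate j alone, so
    [Y j r - N] can in turn be a frozen coordinate when another one is smoothed. *)
Lemma coordinate_smoothing (A : set Omega) (j : 'I_d) : past_sigma A ->
  exists sg : R, exists N : Omega -> R,
  [/\ 0 < sg, 2^-1 * (r - s) `^ (2 * H) <= sg ^+ 2,
    measurable_fun setT (N : g_sigma_algebraType (gens j) -> R) &
    forall (Q : 'I_d -> Omega -> R) (g : 'rV[R]_d -> R) (K a : R),
      Q j = Y j r -> (forall i, i != j ->
        measurable_fun setT (Q i : g_sigma_algebraType (gens i) -> R)) ->
      continuous g -> (forall v, `|g v| <= K) ->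
      Ex (fun w => \1_A w * g (upd Q j (Y j r) w a)) =
      Ex (fun w => \1_A w * \int[mu]_x
        (g (upd Q j (fun w => Y j r w - N w) w x) * normal_pdf a sg x))].
Proof.
move=> SA.
have [tau [n [tau0 tauS tau_lt [taur taus] tauSj]]] := exists_time_grid s0 sr hS.
have tauT : tau n.+1 <= T by rewrite taur.
have tauM i k : (i <= k)%N -> tau i <= tau k.
  by move=> /subnK <-; elim: (k - i)%N => // m ih; exact: le_trans (tauS _).
have tau_in i : (i <= n.+1)%N -> 0 <= tau i <= T.
  by move=> h; rewrite -tau0 tauM//= (le_trans (tauM _ _ h)).
have [c [sg [cn sg0 hsg iN]]] := past_indep hH hB tau0 tauS tau_lt tauT j.
set N := (fun w => _) in iN; set G := past_rect _ _ _ _ _ in iN.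
pose G' : set (set Omega) := <<s G >>.
have G_gens i A' : <<s gens i >> A' -> i != j -> G A'.
  move=> hA' ij; exists (fun k => if k == i then A' else setT), (fun=> setT) => //.
  split.
  - by rewrite eq_sym (negbTE ij); apply/seteqP; split.
  - move=> k kj; case: eqP => [->//|_].
    exact: (@measurableT _ (g_sigma_algebraType (gens k))).
  - apply/seteqP; split => w /= h; first by move=> k _; case: eqP.
    by have := h i Logic.I; rewrite eqxx.
have G_tau k U : (k <= n)%N -> measurable U -> G (Y j (tau k) @^-1` U).
  move=> kn mU; pose U' i := if i == k then U else setT.
  exists (fun i => if i == j then Y j (tau k) @^-1` U else setT), U'.
    by move=> i; rewrite /U'; case: ifP.
  split.
  - rewrite eqxx; apply/seteqP; split => w /= h.
      by move=> i _; rewrite /U'; case: eqP => [->|].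
    by have := h k; rewrite ltnS /U' eqxx; exact.
  - move=> i ij; rewrite (negbTE ij).
    exact: (@measurableT _ (g_sigma_algebraType (gens i))).
  - apply/seteqP; split => w /= h; first by move=> i _; case: eqP.
    by have := h j Logic.I; rewrite eqxx.
have sG' : sigma_algebra setT G' by exact: smallest_sigma_algebra.
have G'A : G' A.
  move: A SA; apply: smallest_sub => // _ [[u i] /= uS [U mU ->]].
  apply: sub_sigma_algebra; have [k kn ->] := tauSj _ uS.
  have [->|ij] := eqVneq i j; first exact: G_tau.
  apply: (G_gens i) => //; apply: gen_sigma_preimage => //; apply: gens_Y.
  by apply: tau_in; exact: leqW.
have mG' (f : Omega -> R) : (forall U, measurable U -> G' (f @^-1` U)) ->
    measurable_fun setT (f : g_sigma_algebraType G' -> R).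
  by move=> h _ U mU; rewrite setTI; apply: sub_sigma_algebra; exact: h.
have mtau k : (k <= n)%N ->
    measurable_fun setT (Y j (tau k) : g_sigma_algebraType G' -> R).
  by move=> kn; apply: mG' => U mU; apply: sub_sigma_algebra; exact: G_tau.
have mN : measurable_fun setT (N : g_sigma_algebraType (gens j) -> R).
  apply: measurable_sum => k; apply: measurable_funM => //.
  by apply: measurable_funB; apply: gens_Y; apply: tau_in => //; apply: ltnW.
exists sg, N; split => //.
  apply: le_trans hsg; rewrite ler_wpM2l ?invr_ge0// ge0_ler_powR// ?nnegrE.
  - by case/andP: hH => H0 _; rewrite mulr_ge0// ltW.
  - by rewrite subr_ge0 ltW.
  - by rewrite subr_ge0 ltW// tau_lt.
  - by rewrite taur lerD2l lerN2.
move=> Q g K a Qj mQ cg hg.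
have mYN : measurable_fun setT ((fun w => Y j r w - N w) : g_sigma_algebraType G' -> R).
  (* Since [c n = 1] and [tau n.+1 = r], the value at time r cancels and only values up to [tau n]
     remain. *)
  rewrite (_ : (fun w => _) = fun w => Y j (tau n) w -
      \sum_(k < n) c k * (Y j (tau k.+1) w - Y j (tau k) w)).
    apply: measurable_funB; first exact: mtau.
    apply: measurable_sum => k; apply: measurable_funM => //.
    by apply: measurable_funB; apply: mtau => //; exact: ltnW.
  by apply/funext => w; rewrite /N big_ord_recr/= cn taur /Y; ring.
have mQ' i : i != j -> measurable_fun setT (Q i : g_sigma_algebraType G' -> R).
  move=> ij; apply: mG' => U mU; apply: sub_sigma_algebra; apply: (G_gens i) => //.
  by apply: gen_sigma_preimage => //; exact: mQ.
pose F (z : g_sigma_algebraType G' * R) : R :=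
  \1_A z.1 * g (upd Q j (fun w => Y j r w - N w) z.1 (z.2 + a)).
have mF : measurable_fun setT F.
  apply: measurable_funM.
    apply: (measurableT_comp (f := \1_A : g_sigma_algebraType G' -> R)) => //.
    by apply: measurable_indic; exact: sub_sigma_algebra.
  apply: measurable_continuous_row => // i.
  have [ij|ij] := eqVneq i j.
    apply: measurable_funD; last exact: measurable_funD.
    exact: (measurableT_comp mYN).
  exact: (measurableT_comp (mQ' i ij)).
have hF z : `|F z| <= K.
  rewrite /F indicE; case: (_ \in _); rewrite ?mul1r// mul0r normr0.
  exact: le_trans (hg 0).
have -> : Ex (fun w => \1_A w * g (upd Q j (Y j r) w a)) = Ex (fun w => F (w, N w)).
  apply: eq_Ex => w; congr (_ * g _); apply/rowP => i; rewrite !mxE.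
  by rewrite /=; case: eqP => // _; ring.
rewrite (indep_normal_Ex sG' iN (gens_measurable mN) mF hF).
apply: eq_Ex => w; rewrite /F/=.
have mgx : measurable_fun setT (fun x => g (upd Q j (fun w => Y j r w - N w) w x)).
  apply: measurable_continuous_row => // i.
  by case: eqP => // _; exact: measurable_funD.
rewrite indicE; case: (_ \in _).
  rewrite mul1r -(Rintegral_normal_translate _ sg0 mgx (fun x => hg _)).
  by congr (Rintegral _ _ _); apply/funext => x; rewrite mul1r.
rewrite mul0r /Rintegral (_ : (fun x => _) = cst 0%E) ?integral0//.
by apply/funext => x; rewrite !mul0r.
Qed.

Let past_measurable A : past_sigma A -> measurable A.
Proof.
apply: gen_sigma_measurable => -[u i] /= uS; apply: mY.
by have /andP[-> us] := hS uS; rewrite (le_trans us)// (le_trans (ltW sr)).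
Qed.

Let rho := (r - s) `^ H.

Let rho_gt0 : 0 < rho. Proof. by rewrite powR_gt0// subr_gt0. Qed.

(** The variance bound sg^2 >= rho^2 / 2 is weakened to sg >= rho / 2. *)
Let sg_ge sg : 0 < sg -> 2^-1 * (r - s) `^ (2 * H) <= sg ^+ 2 -> sg^-1 <= 2 / rho.
Proof.
move=> sg0; have -> : (r - s) `^ (2 * H) = rho ^+ 2.
  by rewrite mulrC powRrM powR_mulrn// powR_ge0.
move=> h.
have h2 : rho / 2 <= sg.
  rewrite -(ler_pXn2r (ltn0Sn 1)) ?nnegrE; [|by rewrite ltW// divr_gt0|exact: ltW].
  apply: le_trans h; rewrite expr_div_n expr2; have := sqr_ge0 rho; rewrite expr2; lra.
rewrite -[2 / rho]invrK lef_pV2 ?posrE ?invr_gt0 ?divr_gt0//.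
by rewrite invf_div.
Qed.

Section Kernel.
Variables (Phi : Omega * R -> R) (K : R).
Hypothesis mPhi : measurable_fun setT Phi.
Hypothesis hPhi : forall z, `|Phi z| <= K.
Variables (k : R -> R) (L : R).
Hypothesis ik : mu.-integrable setT (EFin \o k).
Hypothesis hk : \int[mu]_x `|k x| <= L.

Let mk : measurable_fun setT k.
Proof. by apply/measurable_EFinP; exact: measurable_int ik. Qed.

Let ikn : mu.-integrable setT (EFin \o (fun x => `|k x|)).
Proof. exact: integrable_norm ik. Qed.

Let K_ge0 : 0 <= K. Proof. exact: le_trans (hPhi (point, 0)). Qed.

Lemma integrable_kernel w : mu.-integrable setT (EFin \o (fun x => Phi (w, x) * k x)).
Proof.
apply: (@le_integrable _ _ _ mu setT measurableT _ (EFin \o (fun x => K * `|k x|))).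
- apply/measurable_EFinP; apply: measurable_funM => //.
  by apply: (measurableT_comp mPhi); exact: measurable_pair1.
- by move=> x _ /=; rewrite lee_fin normrM [leRHS]ger0_norm ?mulr_ge0// ler_wpM2r.
- exact: integrable_EFinZl.
Qed.

Lemma Rintegral_kernel_le w : \int[mu]_x `|Phi (w, x) * k x| <= K * L.
Proof.
apply: (@le_trans _ _ (\int[mu]_x (K * `|k x|))).
  apply: le_Rintegral => //.
  - exact: integrable_norm (integrable_kernel w).
  - exact: integrable_EFinZl.
  - by move=> x _; rewrite normrM ler_wpM2r.
by rewrite RintegralZl// ler_wpM2l.
Qed.

Lemma kernel_le w : `|\int[mu]_x (Phi (w, x) * k x)| <= K * L.
Proof.
apply: le_trans (Rintegral_kernel_le w).
by apply: le_normr_Rintegral => //; exact: integrable_kernel.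
Qed.

Let mPhik : measurable_fun setT (fun z : Omega * R => Phi z * k z.2).
Proof. by apply: measurable_funM => //; exact: (measurableT_comp mk). Qed.

Lemma brv_kernel : brv (fun w => \int[mu]_x (Phi (w, x) * k x)).
Proof.
split; last by exists (K * L); exact: kernel_le.
exact: (@measurable_Rintegral_section _ _ _ P (fun z => Phi z * k z.2) (K * L)
  mPhik integrable_kernel Rintegral_kernel_le).
Qed.

(** Fubini puts the expectation inside, where a bound for each frozen x is enough. This is how two
    distinct coordinates are smoothed in turn. *)
Lemma Ex_kernel_le C : (forall x, `|Ex (fun w => Phi (w, x))| <= C) ->
  `|Ex (fun w => \int[mu]_x (Phi (w, x) * k x))| <= C * L.
Proof.
move=> hC.
have bPhi x : brv (fun w => Phi (w, x)).
  split; last by exists K.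
  by apply: (measurableT_comp mPhi); exact: measurable_pair2.
have bPk x : brv (fun w => Phi (w, x) * k x) by apply: brvM => //; exact: brv_cst.
have C0 : 0 <= C by exact: le_trans (hC 0).
have mE : measurable_fun setT (fun x => Ex (fun w => Phi (w, x) * k x)).
  exact: (@measurable_Ex_section _ _ _ P (fun z => Phi z * k z.2) (K * L)
    mPhik integrable_kernel Rintegral_kernel_le bPk).
rewrite (@Ex_Fubini _ _ _ P (fun z => Phi z * k z.2) (K * L)
    mPhik integrable_kernel Rintegral_kernel_le bPk).
have hE x : `|Ex (fun w => Phi (w, x) * k x)| <= C * `|k x|.
  rewrite (_ : (fun w => _) = (fun w => k x * Phi (w, x))); last first.
    by apply/funext => w; rewrite mulrC.
  by rewrite ExZ// normrM mulrC ler_wpM2r.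
have iE : mu.-integrable setT (EFin \o (fun x => Ex (fun w => Phi (w, x) * k x))).
  apply: (@le_integrable _ _ _ mu setT measurableT _ (EFin \o (fun x => C * `|k x|))).
  - exact/measurable_EFinP.
  - by move=> x _ /=; rewrite lee_fin [leRHS]ger0_norm ?mulr_ge0.
  - exact: integrable_EFinZl.
apply: le_trans (le_normr_Rintegral _ iE) _ => //.
apply: (@le_trans _ _ (\int[mu]_x (C * `|k x|))).
  apply: le_Rintegral => //; first exact: integrable_norm.
  exact: integrable_EFinZl.
by rewrite RintegralZl// ler_wpM2l.
Qed.

End Kernel.

Lemma Ex_indic_le A Z C : measurable A -> brv Z -> (forall w, `|Z w| <= C) ->
  `|Ex (fun w => \1_A w * Z w)| <= C * fine (P A).
Proof.
move=> mA bZ hZ; have bA := @brv_indic R _ _ _ mA.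
rewrite (le_trans (Ex_norm _ _))//; first exact: brvM.
rewrite -Ex_indic// -ExZ//; apply: Ex_le; [|exact: brvZ|].
  by apply: brv_norm; exact: brvM.
by move=> w; rewrite normrM (ger0_norm (_ : 0 <= \1_A w)) ?indicE// mulrC ler_wpM2r.
Qed.

Let K0 : R := 12 * expR 1.

Let pdf_comb (l : seq (R * R)) sg x := \sum_(p <- l) p.1 * normal_pdf p.2 sg x.

Let pdf_comb_integrable l sg : mu.-integrable setT (EFin \o pdf_comb l sg).
Proof.
rewrite /pdf_comb; elim: l => [|p l ih].
  rewrite (_ : EFin \o _ = cst 0%E); first exact: integrable0.
  by apply/funext => x; rewrite /= big_nil.
rewrite (_ : EFin \o _ = (fun x => (p.1 * normal_pdf p.2 sg x)%:E +
  (\sum_(p <- l) p.1 * normal_pdf p.2 sg x)%:E)%E); last first.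
  by apply/funext => x; rewrite /= big_cons EFinD.
by apply: integrableD => //; apply: integrable_EFinZl; exact: integrable_normal_pdf.
Qed.

(** A finite difference is a list of pairs (coefficient, shift). By linearity it is carried over to
    the same combination of Gaussian densities, against the single function [Phi]. *)
Lemma coordinate_kernel A j : past_sigma A ->
  exists sg : R, exists N : Omega -> R,
  [/\ 0 < sg, sg^-1 <= 2 / rho,
    measurable_fun setT (N : g_sigma_algebraType (gens j) -> R) &
    forall (Q : 'I_d -> Omega -> R) (g : 'rV[R]_d -> R) (K : R),
      Q j = Y j r -> (forall i, i != j ->
        measurable_fun setT (Q i : g_sigma_algebraType (gens i) -> R)) ->
      continuous g -> (forall v, `|g v| <= K) ->
      let Phi := fun z : Omega * R => g (upd Q j (fun w => Y j r w - N w) z.1 z.2) in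
      measurable_fun setT Phi /\
      forall l : seq (R * R),
      Ex (fun w => \1_A w * \sum_(p <- l) p.1 * g (upd Q j (Y j r) w p.2)) =
      Ex (fun w => \1_A w * \int[mu]_x (Phi (w, x) * \sum_(p <- l) p.1 * normal_pdf p.2 sg x))].
Proof.
move=> SA; have bA := @brv_indic R _ _ _ (past_measurable SA).
have [sg [N [sg0 hsg mN rep]]] := coordinate_smoothing j SA.
exists sg, N; split => //; first exact: sg_ge.
move=> Q g K Qj mQ cg hg Phi.
have mQ' i : measurable_fun setT (Q i).
  have [->|ij] := eqVneq i j; first by rewrite Qj; exact: mY.
  exact: (gens_measurable (mQ _ ij)).
have mPhi : measurable_fun setT Phi.
  apply: measurable_continuous_row => // i; case: eqP => _.
    apply: measurable_funD => //; apply: (measurableT_comp (f := fun w => Y j r w - N w)) => //.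
    by apply: measurable_funB; [exact: mY|exact: (gens_measurable mN)].
  exact: (measurableT_comp (mQ' i)).
have hPhi z : `|Phi z| <= K by exact: hg.
have bg x : brv (fun w => g (upd Q j (Y j r) w x)).
  split; last by exists K.
  apply: measurable_continuous_row => // i; case: eqP => _ //.
  by apply: measurable_funD => //; exact: mY.
have bk l : brv (fun w => \int[mu]_x (Phi (w, x) * pdf_comb l sg x)).
  exact: (brv_kernel mPhi hPhi (pdf_comb_integrable l sg) (lexx _)).
split => // l; rewrite -/(pdf_comb _ _); elim: l => [|p l ih].
  apply: eq_Ex => w; rewrite big_nil; congr (_ * _).
  rewrite /Rintegral (_ : (fun x => _) = cst 0%E) ?integral0//.
  by apply/funext => x; rewrite /pdf_comb big_nil mulr0.
transitivity (Ex (fun w => p.1 * (\1_A w * g (upd Q j (Y j r) w p.2)) +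
    \1_A w * \sum_(p <- l) p.1 * g (upd Q j (Y j r) w p.2))).
  by apply: eq_Ex => w; rewrite big_cons; ring.
have bpdf : brv (fun w => \int[mu]_x (Phi (w, x) * normal_pdf p.2 sg x)).
  exact: (brv_kernel mPhi hPhi (integrable_normal_pdf p.2 sg) (lexx _)).
rewrite ExD; last 2 first.
- by apply: brvZ; exact: brvM.
- by apply: brvM => //; apply: brv_sum => q _; exact: brvZ.
rewrite ExZ; last exact: brvM.
rewrite (rep Q g K)// ih -ExZ; last exact: brvM.
rewrite -ExD; [|by apply: brvZ; exact: brvM|by apply: brvM => //; exact: bk].
apply: eq_Ex => w; rewrite mulrCA -mulrDr; congr (_ * _).
have iw := integrable_kernel mPhi hPhi (integrable_normal_pdf p.2 sg) w.
rewrite -RintegralZl//.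
rewrite -RintegralD//; last 2 first.
- exact: integrable_EFinZl.
- exact: (integrable_kernel mPhi hPhi (pdf_comb_integrable l sg) w).
congr (Rintegral _ _ _); apply/funext => x.
by rewrite big_cons mulrDr; congr (_ + _); exact: mulrCA.
Qed.

Lemma coordinate_comb_le A j (l : seq (R * R)) (L : R) : past_sigma A ->
  (forall sg, 0 < sg -> sg^-1 <= 2 / rho ->
    \int[mu]_x `|\sum_(p <- l) p.1 * normal_pdf p.2 sg x| <= L) ->
  forall (Q : 'I_d -> Omega -> R) (g : 'rV[R]_d -> R) (K : R),
  Q j = Y j r ->
  (forall i, i != j ->
     measurable_fun setT (Q i : g_sigma_algebraType (gens i) -> R)) ->
  continuous g -> (forall v, `|g v| <= K) ->
  `|Ex (fun w => \1_A w * \sum_(p <- l) p.1 * g (upd Q j (Y j r) w p.2))|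
    <= K * L * fine (P A).
Proof.
move=> SA hL Q g K Qj mQ cg hg; have mA := past_measurable SA.
have [sg [N [sg0 hsg mN /(_ Q g K Qj mQ cg hg)[mPhi ->]]]] := coordinate_kernel j SA.
have hk := hL sg sg0 hsg; have ik := pdf_comb_integrable l sg.
set Phi := (fun z : Omega * R => _) in mPhi *.
have hPhi z : `|Phi z| <= K by exact: hg.
exact: (Ex_indic_le mA (brv_kernel mPhi hPhi ik hk) (kernel_le mPhi hPhi ik hk)).
Qed.

Let pdf_diff1 a sg : 0 < sg -> sg^-1 <= 2 / rho ->
  \int[mu]_x `|\sum_(p <- [:: (1, a); (-1, 0)]) p.1 * normal_pdf p.2 sg x|
    <= 2 * K0 / rho * `|a|.
Proof.
move=> sg0 hsg; have := normal_diff1_L1 0 a sg0; rewrite add0r -/K0 => h.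
rewrite (_ : (fun x => _) = (fun x => `|normal_pdf a sg x - normal_pdf 0 sg x|)).
  apply: le_trans h _; rewrite (_ : _ / _ * _ = K0 * `|a| * (2 / rho)); last by ring.
  by rewrite ler_wpM2l// mulr_ge0// mulr_ge0// expR_ge0.
by apply/funext => x; rewrite !big_cons big_nil/=; congr (`|_|); ring.
Qed.

Let pdf_diff2 a b sg : 0 < sg -> sg^-1 <= 2 / rho ->
  \int[mu]_x `|\sum_(p <- [:: (1, a + b); (-1, a); (-1, b); (1, 0)])
      p.1 * normal_pdf p.2 sg x|
    <= (2 * K0 / rho) ^+ 2 * `|a| * `|b|.
Proof.
move=> sg0 hsg; have := normal_diff2_L1 a b sg0; rewrite -/K0 => h.
rewrite (_ : (fun x => _) = (fun x => `|normal_pdf (a + b) sg x -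
    normal_pdf a sg x - normal_pdf b sg x + normal_pdf 0 sg x|)).
  apply: le_trans h _; rewrite -exprVn.
  (* Rounds the constant up to a square, the product of two first-order constants that arises for
     distinct coordinates. *)
  have K01 : 2 <= K0.
    by have := @expR_ge1Dx R 1; rewrite /K0; lra.
  have hs : sg^-1 ^+ 2 <= (2 / rho) ^+ 2.
    by rewrite ler_pXn2r// nnegrE ?invr_ge0 ?ltW// divr_gt0.
  apply: (@le_trans _ _ (2 * K0 * `|a| * `|b| * (2 / rho) ^+ 2)).
    by rewrite ler_wpM2l// !mulr_ge0// expR_ge0.
  rewrite (_ : (2 * K0 / rho) ^+ 2 * _ * _ = K0 * (K0 * (`|a| * `|b| * (2 / rho) ^+ 2))); last first.
    rewrite (_ : 2 * K0 / rho = K0 * (2 / rho)) 1?exprMn; last by ring.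
    by rewrite expr2; move: ((2 / rho) ^+ 2) => t; ring.
  rewrite (_ : 2 * K0 * _ * _ * _ = 2 * (K0 * (`|a| * `|b| * (2 / rho) ^+ 2))); last by ring.
  by rewrite ler_wpM2r// !mulr_ge0 ?invr_ge0 ?(ltW rho_gt0) ?expR_ge0.
by apply/funext => x; rewrite !big_cons big_nil/=; congr (`|_|); ring.
Qed.

Let Yr i := Y i r.

Let mYr i : measurable_fun setT (Yr i : g_sigma_algebraType (gens i) -> R).
Proof. exact: gens_Y. Qed.

(** Each coordinate contributes one factor 1 / rho. The difference along j is kept inside [g1] while
    coordinate i is smoothed; then, for each x, coordinate j is smoothed with coordinate i frozen at
    its past part plus x. *)
Lemma mixed_diff2 A i j (g : 'rV[R]_d -> R) (K a b : R) : i != j -> past_sigma A ->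
  continuous g -> (forall v, `|g v| <= K) ->
  `|Ex (fun w => \1_A w *
     (g (B r w + a *: delta_mx 0 i + b *: delta_mx 0 j) -
      g (B r w + a *: delta_mx 0 i) - g (B r w + b *: delta_mx 0 j) + g (B r w)))|
    <= K * (2 * K0 / rho) ^+ 2 * `|a| * `|b| * fine (P A).
Proof.
move=> ij SA cg hg; have mA := past_measurable SA.
have bA := @brv_indic R _ _ _ mA.
pose g1 v := g (v + b *: delta_mx 0 j) - g v.
have cg1 : continuous g1.
  exact: continuous_incr.
have hg1 v : `|g1 v| <= K + K by rewrite (le_trans (ler_normB _ _))// lerD.
have [sg [N [sg0 hsg mN /(_ Yr g1 (K + K) erefl (fun k _ => mYr (i:=k)) cg1 hg1)]]] :=
  coordinate_kernel i SA.
set Phi := (fun z : Omega * R => _) => -[mPhi rep].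
pose l : seq (R * R) := [:: (1, a); (-1, 0)].
have -> : Ex (fun w => \1_A w *
     (g (B r w + a *: delta_mx 0 i + b *: delta_mx 0 j) -
      g (B r w + a *: delta_mx 0 i) - g (B r w + b *: delta_mx 0 j) + g (B r w))) =
  Ex (fun w => \1_A w * \sum_(p <- l) p.1 * g1 (upd Yr i (Y i r) w p.2)).
  have E c w : upd Yr i (Y i r) w c = B r w + c *: delta_mx 0 i.
    apply/rowP => k; rewrite !mxE eqxx/=; case: eqP => [->|]; rewrite ?mulr1//.
    by rewrite mulr0 addr0.
  apply: eq_Ex => w; congr (_ * _); rewrite /l !big_cons big_nil/= !E /g1.
  by rewrite !scale0r !addr0; ring.
have hPhi z : `|Phi z| <= K + K by exact: hg1.
rewrite rep; have ik := pdf_comb_integrable l sg.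
have hk := pdf_diff1 a sg0 hsg.
pose Phi1 (z : Omega * R) := \1_A z.1 * Phi z.
have mPhi1 : measurable_fun setT Phi1.
  apply: measurable_funM => //.
  by apply: (measurableT_comp (f := \1_A : Omega -> R)) => //; exact: measurable_indic.
have hPhi1 z : `|Phi1 z| <= K + K.
  rewrite /Phi1 indicE; case: (_ \in _); first by rewrite mul1r; exact: hg1.
  by rewrite mul0r normr0; exact: le_trans (hg1 0).
have -> : Ex (fun w => \1_A w * \int[mu]_x (Phi (w, x) * pdf_comb l sg x)) =
  Ex (fun w => \int[mu]_x (Phi1 (w, x) * pdf_comb l sg x)).
  apply: eq_Ex => w.
  rewrite -RintegralZl//; last exact: (integrable_kernel mPhi hPhi ik w).
  by congr (Rintegral _ _ _); apply/funext => x; rewrite /Phi1/= mulrA.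
apply: le_trans (Ex_kernel_le mPhi1 hPhi1 ik hk
  (C := K * (2 * K0 / rho * `|b|) * fine (P A)) _) _; last first.
  by rewrite le_eqVlt; apply/orP; left; apply/eqP; ring.
move=> x; pose Q k w := if k == i then Y i r w - N w + x else Yr k w.
have Qj : Q j = Y j r by apply/funext => w; rewrite /Q eq_sym (negbTE ij).
have mQ k : k != j -> measurable_fun setT (Q k : g_sigma_algebraType (gens k) -> R).
  move=> _; rewrite /Q; have [->|_] := eqVneq k i; last exact: mYr.
  by apply: measurable_funD => //; apply: measurable_funB => //; exact: mYr.
have := coordinate_comb_le SA (fun sg => @pdf_diff1 b sg) Qj mQ cg hg.
apply: le_trans; rewrite le_eqVlt; apply/orP; left; apply/eqP; congr (`|_|).
apply: eq_Ex => w; rewrite /Phi1 /Phi !big_cons big_nil/= /g1; congr (_ * _).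
have E1 : upd Q j (Y j r) w 0 = upd Yr i (fun w => Y i r w - N w) w x.
  apply/rowP => k; rewrite !mxE /Q; have [->|] := eqVneq k j => //.
  by rewrite eq_sym (negbTE ij) addr0.
have E2 : upd Q j (Y j r) w b = upd Yr i (fun w => Y i r w - N w) w x + b *: delta_mx 0 j.
  apply/rowP => k; rewrite !mxE eqxx /Q/=; have [->|] := eqVneq k j.
    by rewrite eq_sym (negbTE ij) mulr1.
  by rewrite mulr0 addr0.
by rewrite E1 E2; ring.
Qed.

(** For i = j both shifts act on the same Gaussian, and the second difference of its density is used
    in place of two smoothings. *)
Lemma coordinate_second_diff A i j (g : 'rV[R]_d -> R) (K a b : R) : past_sigma A ->
  continuous g -> (forall v, `|g v| <= K) ->
  `|Ex (fun w => \1_A w *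
     (g (B r w + a *: delta_mx 0 i + b *: delta_mx 0 j) -
      g (B r w + a *: delta_mx 0 i) - g (B r w + b *: delta_mx 0 j) + g (B r w)))|
    <= K * (2 * K0 / rho) ^+ 2 * `|a| * `|b| * fine (P A).
Proof.
move=> SA cg hg; have [<-|ij] := eqVneq i j; last exact: mixed_diff2.
have := coordinate_comb_le SA (fun sg => @pdf_diff2 a b sg) (erefl (Yr i))
  (fun k _ => mYr (i:=k)) cg hg.
rewrite !mulrA; apply: le_trans; rewrite le_eqVlt; apply/orP; left; apply/eqP.
congr (`|_|); apply: eq_Ex => w; congr (_ * _); rewrite !big_cons big_nil/=.
have E c : upd Yr i (Y i r) w c = B r w + c *: delta_mx 0 i.
  apply/rowP => k; rewrite !mxE eqxx/=; case: eqP => [->|]; rewrite ?mulr1//.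
  by rewrite mulr0 addr0.
by rewrite !E scale0r !addr0 scalerDl [B r w + (_ + _)]addrA; ring.
Qed.

Lemma coordinate_first_diff A j (g : 'rV[R]_d -> R) (K a : R) : past_sigma A ->
  continuous g -> (forall v, `|g v| <= K) ->
  `|Ex (fun w => \1_A w * (g (B r w + a *: delta_mx 0 j) - g (B r w)))|
    <= K * (2 * K0 / rho) * `|a| * fine (P A).
Proof.
move=> SA cg hg.
have := coordinate_comb_le SA (fun sg => @pdf_diff1 a sg) (erefl (Yr j))
  (fun k _ => mYr (i:=k)) cg hg.
rewrite !mulrA; apply: le_trans; rewrite le_eqVlt; apply/orP; left; apply/eqP.
congr (`|_|); apply: eq_Ex => w; congr (_ * _); rewrite !big_cons big_nil/=.
have E c : upd Yr j (Y j r) w c = B r w + c *: delta_mx 0 j.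
  apply/rowP => k; rewrite !mxE eqxx/=; case: eqP => [->|]; rewrite ?mulr1//.
  by rewrite mulr0 addr0.
by rewrite !E scale0r !addr0; ring.
Qed.

End Smoothing.

(** * The completed past and its approximation by finitely many times *)

Section Approximation.
Context {R : realType} {disp : measure_display} {Omega : measurableType disp}.
Variable P : probability Omega R.
Local Notation Ex := (Ex P).
Variables (d : nat) (B : R -> Omega -> 'rV[R]_d).

Lemma past_sigma_sub (S S' : seq R) : {subset S <= S'} ->
  past_sigma B S `<=` past_sigma B S'.
Proof.
move=> SS'; apply: smallest_sub; first exact: smallest_sigma_algebra.
move=> _ [[u i] /= /SS' uS' [U mU ->]]; apply: sub_sigma_algebra.
by exists (u, i) => //; exists U.
Qed.

(* Only finitely many past times can be regressed upon at once; completing with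
   respect to P gives a sigma-algebra that contains the augmented filtration. *)
Definition approx_past (s : R) : set (set Omega) := [set A | forall e : R, 0 < e ->
  exists S : seq R, exists A' : set Omega, exists C : set Omega,
  [/\ forall u, u \in S -> 0 <= u <= s, past_sigma B S A', measurable C,
     (P C <= e%:E)%E & forall w, ~ C w -> (A w <-> A' w)]].

Variable T : R.
Hypothesis mBT : forall t i, 0 <= t <= T -> measurable_fun setT (fun w => B t w 0 i).

Lemma past_sigma_measurable s (S : seq R) : s <= T ->
  (forall u, u \in S -> 0 <= u <= s) -> past_sigma B S `<=` measurable.
Proof.
move=> sT hS; apply: gen_sigma_measurable => -[u i] /= /hS/andP[u0 us].
by apply: mBT; rewrite u0 (le_trans us).
Qed.

Lemma approx_past_sigma_algebra s : s <= T -> sigma_algebra setT (approx_past s).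
Proof.
move=> sT; split.
- move=> e e0; exists [::], set0, set0; split => //.
    by have [h _ _] := @smallest_sigma_algebra Omega setT
      [set A | exists2 t, [set si : R * 'I_d | si.1 \in [::]] t &
         exists2 U : set R, measurable U & A = (fun w => B t.1 w 0 t.2) @^-1` U].
  by rewrite measure0 lee_fin ltW.
- move=> A hA e /hA[S [A' [C [hS SA' mC PC AA']]]].
  exists S, (~` A'), C; split => //.
    by rewrite -setTD; have [_ h _] := @smallest_sigma_algebra Omega setT
      [set A | exists2 t, [set si : R * 'I_d | si.1 \in S] t &
         exists2 U : set R, measurable U & A = (fun w => B t.1 w 0 t.2) @^-1` U]; exact: h.
  move=> w /AA' h; split => [[_ nA] /h//|nA'].
  by split => // /h.
- move=> A hA e e0.
  have e20 : 0 < e / 2 by rewrite divr_gt0.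
  have hk k : exists z : seq R * set Omega * set Omega,
     [/\ forall u, u \in z.1.1 -> 0 <= u <= s, past_sigma B z.1.1 z.1.2, measurable z.2,
     (P z.2 <= (e / 2 / (2 ^ k.+1)%:R)%:E)%E & forall w, ~ z.2 w -> (A k w <-> z.1.2 w)].
    have : 0 < e / 2 / (2 ^ k.+1)%:R by rewrite divr_gt0// ltr0n expn_gt0.
    by move=> /(hA k)[S [A' [C h]]]; exists (S, A', C).
  have [z hz] := choice hk.
  pose A' k := (z k).1.2; pose C k := (z k).2.
  have mA' k : measurable (A' k) by have [h1 h2 _ _ _] := hz k; exact: past_sigma_measurable sT h1 _ h2.
  have mC k : measurable (C k) by have [] := hz k.
  (* The list of times must stay finite, so only finitely many approximating events are kept. The
     tail [D N] decreases to the empty set and joins the exceptional set. *)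
  pose D N := \bigcup_k A' k `\` \bigcup_(k in [set k | (k < N)%N]) A' k.
  have mD N : measurable (D N).
    by apply: measurableD; apply: bigcup_measurable.
  have D0 : \bigcap_N D N = set0.
    apply/seteqP; split => // w /= h.
    have [[k _ A'k] _] := h 0%N Logic.I.
    by have [_ []] := h k.+1 Logic.I; exists k => /=.
  have cvD : P (D n) @[n --> \oo] --> 0%E.
    have <- : P (\bigcap_N D N) = 0%E by rewrite D0 measure0.
    apply: nonincreasing_cvg_mu => //.
    - exact: le_lt_trans (probability_le1 P (mD _)) (ltry _).
    - by rewrite D0.
    - apply/nonincreasing_seqP => n; apply/subsetPset => w [h1 h2]; split => //.
      by move=> [k /= kn Ak]; apply: h2; exists k => //=; exact: ltnW.
  have [N hN] : exists N, (P (D N) <= (e / 2)%:E)%E.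
    have : \forall n \near \oo, (P (D n) < (e / 2)%:E)%E.
      apply: (cvD [set x | (x < (e / 2)%:E)%E]); apply: open_nbhs_nbhs; split.
        exact: open_ereal_lt_ereal.
      by rewrite /= lte_fin.
    by move=> [N _ /(_ N (leqnn _))] /= h; exists N; exact: ltW.
  pose S := flatten [seq (z k).1.1 | k <- iota 0 N].
  exists S, (\bigcup_(k in [set k | (k < N)%N]) A' k), (\bigcup_k C k `|` D N); split.
  - move=> u /flattenP[_ /mapP[k _ ->] uS].
    by have [h _ _ _ _] := hz k; exact: h.
  - apply: (@bigcup_measurable _ (g_sigma_algebraType _)) => k /= kN.
    apply: (@past_sigma_sub (z k).1.1); last by have [] := hz k.
    move=> u uz; apply/flattenP; exists (z k).1.1 => //; apply/mapP; exists k => //.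
    by rewrite mem_iota.
  - by apply: measurableU => //; exact: bigcup_measurable.
  - apply: (@le_trans _ _ (P (\bigcup_k C k) + P (D N))%E).
      by apply: measureU2 => //; exact: bigcup_measurable.
    rewrite [e]splitr EFinD; apply: leeD => //.
    apply: le_trans (epsilon_trick0 xpredT (ltW e20)).
    apply: (@le_trans _ _ (\sum_(k <oo) P (C k))%E).
      apply: (measure_sigma_subadditive) => //; exact: bigcup_measurable.
    by apply: lee_nneseries => // k _; have [] := hz k.
  - move=> w /not_orP[nC nD]; split.
    + move=> [k _ Ak]; have Ak' : A' k w.
        have [_ _ _ _ h] := hz k; apply/h => // Ck.
        by apply: nC; exists k.
      by apply: contrapT => h; apply: nD; split => //; exists k.
    + move=> [k kN A'k]; exists k => //; have [_ _ _ _ h] := hz k.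
      by apply/h => // Ck; apply: nC; exists k.
Qed.

Lemma approx_past_mono s t : s <= t -> approx_past s `<=` approx_past t.
Proof.
move=> st A hA e /hA[S [A' [C [hS SA' mC PC AA']]]].
exists S, A', C; split => // u /hS/andP[-> us].
exact: le_trans us st.
Qed.

Lemma approx_past_augmented s : s <= T -> augmented_filtration P B s `<=` approx_past s.
Proof.
move=> sT; apply: smallest_sub; first exact: approx_past_sigma_algebra.
move=> A [|[C [mC PC AC]]]; last first.
  move=> e e0; exists [::], set0, C; split => //.
  - by have [h _ _] := @smallest_sigma_algebra Omega setT
      [set A | exists2 t, [set si : R * 'I_d | si.1 \in [::]] t &
         exists2 U : set R, measurable U & A = (fun w => B t.1 w 0 t.2) @^-1` U].
  - by rewrite PC lee_fin ltW.
  - by move=> w nC; split => // /AC.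
move: A; apply: smallest_sub; first exact: approx_past_sigma_algebra.
move=> _ [[u i] /= us [U mU ->]] e e0.
exists [:: u], ((fun w => B u w 0 i) @^-1` U), set0; split => //.
- by move=> v; rewrite inE => /eqP ->.
- by apply: sub_sigma_algebra; exists (u, i); [rewrite /= inE|exists U].
- by rewrite measure0 lee_fin ltW.
Qed.

(** [approx_past] contains arbitrary subsets of null sets; intersecting with [measurable] leaves
    genuine events, whose indicators can be integrated. *)
Definition past (s : R) : set (set Omega) := approx_past s `&` measurable.

Lemma past_sigma_algebra s : s <= T -> sigma_algebra setT (past s).
Proof.
move=> /approx_past_sigma_algebra[h0 hC hU]; split; first by split.
  move=> A [aA mA]; split; first exact: hC.
  exact: measurableD.
move=> A hA; split; first by apply: hU => n; case: (hA n).
by apply: bigcup_measurable => n _; case: (hA n).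
Qed.

(** Replacing an event by its approximation costs K P(C) on the left and c P(C) on the right, with
    P(C) arbitrarily small; c >= 0 is read off from the whole space. *)
Lemma Ex_past_le s (Z : Omega -> R) (K c : R) : brv Z -> (forall w, `|Z w| <= K) ->
  s <= T ->
  (forall S A, (forall u, u \in S -> 0 <= u <= s) -> past_sigma B S A ->
    `|Ex (fun w => \1_A w * Z w)| <= c * fine (P A)) ->
  forall A, past s A -> `|Ex (fun w => \1_A w * Z w)| <= c * fine (P A).
Proof.
move=> bZ hZ sT h A [aA mA].
have fin X : measurable X -> P X \is a fin_num by move=> mX; exact: fin_num_measure.
have c0 : 0 <= c.
  have := h [::] setT _ _; apply: contraPP => /negP; rewrite -ltNge => c0 /(_ _ _) H.
  have : `|Ex (fun w => \1_setT w * Z w)| <= c * fine (P setT).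
    apply: H => //; exact: (@measurableT _ (g_sigma_algebraType _)).
  have -> : P setT = 1%E by exact: probability_setT.
  by rewrite mulr1 => /le_lt_trans/(_ c0); rewrite normr_lt0.
have K0 : 0 <= K by exact: le_trans (hZ point).
have bA := @brv_indic R _ _ _ mA.
apply/ler_addgt0Pr => e e0.
have e1 : 0 < e / (K + c + 1) by rewrite divr_gt0// ltr_wpDl// addr_ge0.
have [S [A' [C [hS SA' mC PC AA']]]] := aA _ e1.
have mA' : measurable A' by exact: past_sigma_measurable sT hS _ SA'.
have bA' := @brv_indic R _ _ _ mA'; have bC := @brv_indic R _ _ _ mC.
have PCe : fine (P C) <= e / (K + c + 1) by rewrite -lee_fin fineK// fin.
have hd w : `|\1_A w - \1_A' w| <= \1_C w :> R.
  have [Cw|nC] := pselect (C w).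
    rewrite [X in _ <= X]indicE mem_set// !indicE.
    by case: (_ \in _); case: (_ \in _);
      rewrite /= ?subrr ?normr0 ?subr0 ?sub0r ?normrN ?normr1.
  suff -> : \1_A w = \1_A' w :> R by rewrite subrr normr0 indicE.
  rewrite !indicE; congr (_%:R); congr nat_of_bool; apply/idP/idP; rewrite !inE => /AA'; exact.
have PA' : fine (P A') <= fine (P A) + fine (P C).
  rewrite -!Ex_indic// -ExD//; apply: Ex_le => //; first exact: brvD.
  by move=> w; have := hd w; rewrite ler_norml; lra.
have -> : Ex (fun w => \1_A w * Z w) =
    Ex (fun w => \1_A' w * Z w) + Ex (fun w => (\1_A w - \1_A' w) * Z w).
  rewrite -ExD; [|exact: brvM|by apply: brvM => //; exact: brvB].
  by apply: eq_Ex => w; ring.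
have h2 : `|Ex (fun w => (\1_A w - \1_A' w) * Z w)| <= K * fine (P C).
  rewrite (le_trans (Ex_norm _ _))//; first by apply: brvM => //; exact: brvB.
  rewrite -Ex_indic// -ExZ//; apply: Ex_le; [|exact: brvZ|].
    by apply: brv_norm; apply: brvM => //; exact: brvB.
  by move=> w; rewrite normrM mulrC ler_pM.
apply: le_trans (ler_normD _ _) _.
apply: le_trans (lerD (h S A' hS SA') h2) _.
have h3 : (K + c) * fine (P C) <= e.
  apply: (@le_trans _ _ ((K + c + 1) * fine (P C))).
    by rewrite ler_wpM2r ?fine_ge0// lerDl.
  by rewrite mulrC -ler_pdivlMr// ltr_wpDl// addr_ge0.
have := ler_wpM2l c0 PA'; lra.
Qed.

Lemma past_mono s t : s <= t -> past s `<=` past t.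
Proof. by move=> st A [aA mA]; split => //; exact: approx_past_mono aA. Qed.

End Approximation.

Section L1Norm.
Context {R : realType} {d : nat}.

(** Vector shifts are made one coordinate after the other, so this is the norm in which their costs
    add up. *)
Definition l1 (v : 'rV[R]_d) : R := \sum_(i < d) `|v 0 i|.

Lemma l1_ge0 v : 0 <= l1 v. Proof. exact: sumr_ge0. Qed.

Lemma coordinatewise_lipschitz (Phi : 'rV[R]_d -> R) (k : R) :
  (forall z a j, `|Phi (z + a *: delta_mx 0 j) - Phi z| <= k * `|a|) ->
  forall z p, `|Phi (z + p) - Phi z| <= k * l1 p.
Proof.
move=> h z p.
have key (t : seq 'I_d) : `|Phi (z + \sum_(i <- t) p 0 i *: delta_mx 0 i) - Phi z| <=
    k * \sum_(i <- t) `|p 0 i|.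
  elim: t => [|j t ih]; first by rewrite !big_nil addr0 subrr normr0 mulr0.
  rewrite !big_cons mulrDr; set q := \sum_(i <- t) _ in ih *.
  rewrite (_ : _ - Phi z = (Phi (z + q + p 0 j *: delta_mx 0 j) - Phi (z + q)) +
    (Phi (z + q) - Phi z)); first by rewrite (le_trans (ler_normD _ _))// lerD.
  by rewrite [RHS]addrA subrK [_ *: _ + q]addrC [z + (_ + _)]addrA.
by have := key (index_enum _); rewrite -row_sum_delta.
Qed.

End L1Norm.

(** * Smoothing of vector shifts, given the completed past *)

Section VectorSmoothing.
Context {R : realType} {disp : measure_display} {Omega : measurableType disp}.
Variable P : probability Omega R.
Local Notation Ex := (Ex P).
Variables (d : nat) (T H : R) (B : R -> Omega -> 'rV[R]_d).
Hypothesis hH : 0 < H < 2^-1.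
Hypothesis hB : is_fbm P T H B.
Variables (s r : R).
Hypothesis s0 : 0 <= s.
Hypothesis sr : s < r.
Hypothesis rT : r <= T.
Variables (g : 'rV[R]_d -> R) (K : R).
Hypothesis cg : continuous g.
Hypothesis hg : forall v, `|g v| <= K.

(** The constant 2 K0 / rho of the one-coordinate estimates, one factor for each order of
    difference. *)
Definition smoothing_const : R := 2 * (12 * expR 1) / (r - s) `^ H.
Local Notation kap := smoothing_const.

Lemma fbm_measurable t i : 0 <= t <= T -> measurable_fun setT (fun w => B t w 0 i).
Proof.
have [h _ _] := hB; exact: (gaussian_process_measurable (h i)).
Qed.

Let sT : s <= T. Proof. by rewrite (le_trans (ltW sr)). Qed.

Let bg z : brv (fun w => g (B r w + z)).
Proof.
split; last by exists K.
rewrite (_ : (fun w => _) = fun w => g (\row_i (B r w 0 i + z 0 i))).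
  apply: measurable_continuous_row => // i; apply: measurable_funD => //.
  by apply: fbm_measurable; rewrite rT (le_trans s0)// ltW.
by apply/funext => w; congr g; apply/rowP => i; rewrite !mxE.
Qed.

Lemma past_first_diff A z p : past P B s A ->
  `|Ex (fun w => \1_A w * (g (B r w + (z + p)) - g (B r w + z)))| <=
    K * kap * l1 p * fine (P A).
Proof.
move=> FA; have bA := @brv_indic R _ _ _ FA.2.
pose Phi z := Ex (fun w => \1_A w * g (B r w + z)).
have PhiB u v : Ex (fun w => \1_A w * (g (B r w + u) - g (B r w + v))) = Phi u - Phi v.
  by rewrite -ExB; [apply: eq_Ex => w; rewrite mulrBr|exact: brvM|exact: brvM].
rewrite PhiB mulrAC; apply: coordinatewise_lipschitz => u a j; rewrite -PhiB mulrAC.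
apply: (Ex_past_le fbm_measurable _ _ sT _ FA (K := K + K)).
- by apply: brvB; exact: bg.
- by move=> w; rewrite (le_trans (ler_normB _ _))// lerD.
- move=> S A' hS SA'.
  have := coordinate_first_diff hH hB s0 sr rT hS j a SA' (@continuous_translate _ _ g u cg) (fun v => hg _).
  apply: le_trans; rewrite le_eqVlt; apply/orP; left; apply/eqP; congr (`|_|).
  by apply: eq_Ex => w; congr (_ * (g _ - _)); rewrite addrA addrAC.
Qed.

(** The passage from coordinate shifts to vector shifts is made twice, each time on a first
    increment of [Phi]: in q with the other shift along one axis, then in p. *)
Lemma past_second_diff A z p q : past P B s A ->
  `|Ex (fun w => \1_A w * (g (B r w + (z + p + q)) - g (B r w + (z + p))
      - g (B r w + (z + q)) + g (B r w + z)))| <=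
    K * kap ^+ 2 * l1 p * l1 q * fine (P A).
Proof.
move=> FA; have bA := @brv_indic R _ _ _ FA.2.
have [Phi PhiB] : exists Phi : 'rV[R]_d -> R, forall t u v x, Ex (fun w => \1_A w *
    (g (B r w + t) - g (B r w + u) - g (B r w + v) + g (B r w + x))) =
    Phi t - Phi u - Phi v + Phi x.
  exists (fun z => Ex (fun w => \1_A w * g (B r w + z))) => t u v x.
  rewrite -!ExB//; do ?[exact: brvM|by apply: brvB; exact: brvM].
  rewrite -ExD//; do ?[exact: brvM|by apply: brvB; [apply: brvB|]; exact: brvM].
  by apply: eq_Ex => w; ring.
have h1 u a i b j : `|Phi (u + a *: delta_mx 0 i + b *: delta_mx 0 j) -
    Phi (u + a *: delta_mx 0 i) - Phi (u + b *: delta_mx 0 j) + Phi u| <=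
    K * kap ^+ 2 * `|a| * `|b| * fine (P A).
  rewrite -PhiB; apply: (Ex_past_le fbm_measurable _ _ sT _ FA (K := K + K + K + K)).
  - by apply: brvD => //; apply: brvB => //; apply: brvB.
  - move=> w; rewrite (le_trans (ler_normD _ _))// lerD//.
    rewrite (le_trans (ler_normB _ _))// lerD//.
    by rewrite (le_trans (ler_normB _ _))// lerD.
  - move=> S A' hS SA'.
    have := coordinate_second_diff hH hB s0 sr rT hS i j a b SA'
      (@continuous_translate _ _ g u cg) (fun v => hg _).
    apply: le_trans; rewrite le_eqVlt; apply/orP; left; apply/eqP; congr (`|_|).
    apply: eq_Ex => w; rewrite !(addrC _ u) !addrA.
    by rewrite !(addrC (B r w) u).
have h2 u a i : `|Phi (u + a *: delta_mx 0 i + q) - Phi (u + a *: delta_mx 0 i)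
    - (Phi (u + q) - Phi u)| <= K * kap ^+ 2 * l1 q * fine (P A) * `|a|.
  pose Psi v := Phi (v + a *: delta_mx 0 i) - Phi v.
  have := @coordinatewise_lipschitz _ _ Psi (K * kap ^+ 2 * `|a| * fine (P A)) _ u q.
  rewrite (_ : Psi (u + q) - Psi u = Phi (u + a *: delta_mx 0 i + q) -
    Phi (u + a *: delta_mx 0 i) - (Phi (u + q) - Phi u)); last first.
    by rewrite /Psi (addrAC u q); ring.
  rewrite (_ : _ * l1 q = K * kap ^+ 2 * l1 q * fine (P A) * `|a|); last by ring.
  apply=> v b j; have := h1 v a i b j.
  rewrite (_ : Psi _ - Psi v = Phi (v + a *: delta_mx 0 i + b *: delta_mx 0 j) -
    Phi (v + a *: delta_mx 0 i) - Phi (v + b *: delta_mx 0 j) + Phi v); last first.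
    by rewrite /Psi (addrAC v (b *: _)); ring.
  by move=> /le_trans; apply; rewrite le_eqVlt; apply/orP; left; apply/eqP; ring.
pose Psi v := Phi (v + q) - Phi v.
have := @coordinatewise_lipschitz _ _ Psi (K * kap ^+ 2 * l1 q * fine (P A)) _ z p.
rewrite PhiB (_ : Psi (z + p) - Psi z = Phi (z + p + q) - Phi (z + p) - Phi (z + q) + Phi z);
  last by rewrite /Psi; ring.
rewrite (_ : _ * l1 p = K * kap ^+ 2 * l1 p * l1 q * fine (P A)); last by ring.
by apply=> v a i; exact: h2.
Qed.

End VectorSmoothing.

(** * Random shifts *)

Section Freezing.
Context {R : realType} {disp : measure_display} {Omega : measurableType disp}.
Variable P : probability Omega R.
Local Notation Ex := (Ex P).

Definition sub_measurable (G : set (set Omega)) (f : Omega -> R) : Prop :=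
  forall U : set R, measurable U -> G (f @^-1` U).

Variables (G : set (set Omega)).
Hypothesis sG : sigma_algebra setT G.
Hypothesis Gm : G `<=` measurable.

Let G_bigcap (I : finType) (A : I -> set Omega) : (forall i, G (A i)) ->
  G (\bigcap_(i in [set: I]) A i).
Proof.
move=> hA; have GE : <<s G >> = G by exact: sigma_algebra_id.
rewrite -GE; apply: (@fin_bigcap_measurable _ (g_sigma_algebraType G)) => // i _.
by apply: sub_sigma_algebra; exact: hA.
Qed.

Variables (I : finType) (u : I -> Omega -> R) (C : R).
Hypothesis mu_ : forall i, sub_measurable G (u i).
Hypothesis hu : forall i w, `|u i w| <= C.
Hypothesis C0 : 0 <= C.
Variables (Psi : (I -> R) -> Omega -> R) (Lam : (I -> R) -> R) (K : R).
Hypothesis bPsi : forall y, (forall i, `|y i| <= C) -> brv (Psi y).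
Hypothesis hPsi : forall y w, (forall i, `|y i| <= C) -> `|Psi y w| <= K.
Hypothesis hLam : forall y, (forall i, `|y i| <= C) -> `|Lam y| <= K.
Hypothesis cPsi : forall (y_ : nat -> I -> R) y w,
  (forall i, y_ n i @[n --> \oo] --> y i) -> Psi (y_ n) w @[n --> \oo] --> Psi y w.
Hypothesis cLam : forall (y_ : nat -> I -> R) y,
  (forall i, y_ n i @[n --> \oo] --> y i) -> Lam (y_ n) @[n --> \oo] --> Lam y.
Hypothesis PsiLam : forall y A, (forall i, `|y i| <= C) -> G A ->
  `|Ex (fun w => \1_A w * Psi y w)| <= Lam y * fine (P A).

(** A grid of mesh 1 / (n + 1) starting at - C: [idx] is the cell of [u i w], [val] the left end of
    a cell, and [N] bounds the number of cells. *)
Let idx n i w := Num.truncn ((u i w + C) * n.+1%:R).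
Let val n (k : nat) : R := k%:R / n.+1%:R - C.
Let N n := (Num.truncn (2 * C * n.+1%:R)).+1.

Let arg_ge0 n i w : 0 <= (u i w + C) * n.+1%:R.
Proof. by rewrite mulr_ge0//; have := hu i w; rewrite ler_norml; lra. Qed.

Let idx_lt n i w : (idx n i w < N n)%N.
Proof.
rewrite ltnS; apply: le_truncn; rewrite ler_wpM2r//.
by have := hu i w; rewrite ler_norml; lra.
Qed.

Let val_bound n k : (k < N n)%N -> `|val n k| <= C.
Proof.
rewrite ltnS => hk.
have h : k%:R / n.+1%:R <= 2 * C.
  rewrite ler_pdivrMr//; apply: le_trans (_ : (Num.truncn (2 * C * n.+1%:R))%:R <= _).
    by rewrite ler_nat.
  by rewrite truncn_le !mulr_ge0.
have h0 : 0 <= k%:R / n.+1%:R :> R by rewrite divr_ge0.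
by rewrite /val; move: (_ / _) h h0 => a h h0; rewrite ler_norml; apply/andP; split; lra.
Qed.

Let val_idx n i w : `|val n (idx n i w) - u i w| <= n.+1%:R^-1.
Proof.
have /andP[h1 h2] := truncn_itv (arg_ge0 n i w).
have h1' : (idx n i w)%:R / n.+1%:R <= u i w + C by rewrite ler_pdivrMr.
have h2' : u i w + C <= (idx n i w)%:R / n.+1%:R + n.+1%:R^-1.
  by rewrite -[X in _ <= _ + X]mul1r -mulrDl ler_pdivlMr// natr1 ltW.
have h1'' : val n (idx n i w) <= u i w by rewrite lerBlDr.
have h2'' : u i w <= val n (idx n i w) + n.+1%:R^-1 by rewrite /val addrAC lerBrDr.
by rewrite ler_distl lerBlDr h2'' (le_trans h1'')// lerDl invr_ge0.
Qed.

Let val_idx_cvg i w : val n (idx n i w) @[n --> \oo] --> u i w.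
Proof.
apply/cvgrPdist_le => e e0; have := @near_infty_natSinv_lt R (PosNum e0).
apply: filterS => n /= hn; rewrite distrC.
by apply: le_trans (val_idx _ _ _) (ltW hn).
Qed.

Let idxf n w : {ffun I -> 'I_(N n)} := [ffun i => Ordinal (idx_lt n i w)].

Let G_idxf n j : G [set w | idxf n w = j].
Proof.
have -> : [set w | idxf n w = j] = \bigcap_(i in [set: I])
    (u i @^-1` [set` `[val n (j i), val n (j i).+1[]).
  have E i w : (u i w \in `[val n (j i), val n (j i).+1[) = (idx n i w == j i).
    rewrite truncn_eq// in_itv/= /val lerBlDr ltrBrDr.
    by rewrite ler_pdivrMr// ltr_pdivlMr.
  apply/seteqP; split => w /=.
    by move=> h i _ /=; rewrite E -h ffunE.
  move=> h; apply/ffunP => i; apply/val_inj; rewrite ffunE/=.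
  by apply/eqP; rewrite -E; exact: h.
by apply: G_bigcap => i; apply: mu_; exact: measurable_itv.
Qed.

Let valf n (j : {ffun I -> 'I_(N n)}) i := val n (j i).

Let valf_bound n j i : `|@valf n j i| <= C.
Proof. exact: val_bound. Qed.

Let Psi_n n w := \sum_(j : {ffun I -> 'I_(N n)})
  \1_[set w | idxf n w = j] w * Psi (valf j) w.
Let Lam_n n w := \sum_(j : {ffun I -> 'I_(N n)})
  Lam (valf j) * \1_[set w | idxf n w = j] w.

Let pick n (F : {ffun I -> 'I_(N n)} -> R) w :
  \sum_j \1_[set w | idxf n w = j] w * F j = F (idxf n w).
Proof.
rewrite (bigD1 (idxf n w))//= indicE mem_set// mul1r big1 ?addr0// => j jw.
by rewrite indicE memNset ?mul0r// => /= E; rewrite E eqxx in jw.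
Qed.

Let Psi_nE n w : Psi_n n w = Psi (fun i => val n (idx n i w)) w.
Proof.
rewrite /Psi_n (pick (fun j => Psi (valf j) w)); congr (Psi _ w).
by apply/funext => i; rewrite /valf ffunE.
Qed.

Let Lam_nE n w : Lam_n n w = Lam (fun i => val n (idx n i w)).
Proof.
rewrite /Lam_n; under eq_bigr do rewrite mulrC.
rewrite (pick (fun j => Lam (valf j))); congr Lam.
by apply/funext => i; rewrite /valf ffunE.
Qed.

Let bI n j : brv (\1_[set w | idxf n w = j] : Omega -> R).
Proof. by apply: brv_indic; apply: Gm; exact: G_idxf. Qed.

Let bPsi_n n : brv (Psi_n n).
Proof.
by apply: brv_sum => j _; apply: brvM => //; apply: bPsi => i; exact: valf_bound.
Qed.

Let bLam_n n : brv (Lam_n n).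
Proof. by apply: brv_sum => j _; apply: brvZ. Qed.

Let Psi_cvg w : Psi_n n w @[n --> \oo] --> Psi (u ^~ w) w.
Proof.
rewrite (_ : (fun n => Psi_n n w) = fun n => Psi (fun i => val n (idx n i w)) w).
  by apply: cPsi => i; exact: val_idx_cvg.
by apply/funext => n; exact: Psi_nE.
Qed.

Let Lam_cvg w : Lam_n n w @[n --> \oo] --> Lam (u ^~ w).
Proof.
rewrite (_ : (fun n => Lam_n n w) = fun n => Lam (fun i => val n (idx n i w))).
  by apply: cLam => i; exact: val_idx_cvg.
by apply/funext => n; exact: Lam_nE.
Qed.

(* Bounds known for constant shifts pass to bounded past-measurable shifts: round
   them to finitely many values, sum over the level sets, take the limit. *)
Lemma brv_frozen : brv (fun w => Psi (u ^~ w) w).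
Proof.
split; last by exists K => w; exact: hPsi.
apply: (@measurable_fun_cvg _ _ _ _ Psi_n); first by move=> n; case: (bPsi_n n).
by move=> w _; exact: Psi_cvg.
Qed.

Lemma brv_frozen_bound : brv (fun w => Lam (u ^~ w)).
Proof.
split; last by exists K => w; exact: hLam.
apply: (@measurable_fun_cvg _ _ _ _ Lam_n); first by move=> n; case: (bLam_n n).
by move=> w _; exact: Lam_cvg.
Qed.

Lemma Ex_frozen_le :
  `|Ex (fun w => Psi (u ^~ w) w)| <= Ex (fun w => Lam (u ^~ w)).
Proof.
have h n : `|Ex (Psi_n n)| <= Ex (Lam_n n).
  rewrite !Ex_sum; last 2 first.
  - by move=> j _; exact: brvZ.
  - by move=> j _; apply: brvM => //; apply: bPsi => i; exact: valf_bound.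
  apply: le_trans (ler_norm_sum _ _ _) _; apply: ler_sum => j _.
  rewrite ExZ// Ex_indic; last by apply: Gm; exact: G_idxf.
  by apply: PsiLam; [exact: valf_bound|exact: G_idxf].
have c1 : Ex (Psi_n n) @[n --> \oo] --> Ex (fun w => Psi (u ^~ w) w).
  apply: (Ex_cvg (K := K)).
  - by move=> n; case: (bPsi_n n).
  - by case: brv_frozen.
  - move=> n w; rewrite Psi_nE; apply: hPsi => i; apply: val_bound; exact: idx_lt.
  - exact: aeW.
have c2 : Ex (Lam_n n) @[n --> \oo] --> Ex (fun w => Lam (u ^~ w)).
  apply: (Ex_cvg (K := K)).
  - by move=> n; case: (bLam_n n).
  - by case: brv_frozen_bound.
  - move=> n w; rewrite Lam_nE; apply: hLam => i; apply: val_bound; exact: idx_lt.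
  - exact: aeW.
apply: (ler_cvg_to (cvg_norm c1) c2); exact: nearW.
Qed.

End Freezing.

(** * Smoothing of past-measurable shifts *)

Section FrozenSmoothing.
Context {R : realType} {disp : measure_display} {Omega : measurableType disp}.
Variable P : probability Omega R.
Local Notation Ex := (Ex P).
Variables (d : nat) (T H : R) (B : R -> Omega -> 'rV[R]_d).
Hypothesis hH : 0 < H < 2^-1.
Hypothesis hB : is_fbm P T H B.
Variables (s r : R).
Hypothesis s0 : 0 <= s.
Hypothesis sr : s < r.
Hypothesis rT : r <= T.
Variables (g : 'rV[R]_d -> R) (K : R).
Hypothesis cg : continuous g.
Hypothesis hg : forall v, `|g v| <= K.

Let K_ge0 : 0 <= K. Proof. exact: le_trans (hg 0). Qed.

Lemma cvg_sumr (I : Type) (t : seq I) (f_ : nat -> I -> R) (f : I -> R) :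
  (forall i, f_ n i @[n --> \oo] --> f i) ->
  \sum_(i <- t) f_ n i @[n --> \oo] --> \sum_(i <- t) f i.
Proof.
move=> h; elim: t => [|i t ih].
  rewrite big_nil (_ : (fun n => _) = fun=> 0); first exact: cvg_cst.
  by apply/funext => n; rewrite big_nil.
rewrite big_cons (_ : (fun n => _) = fun n => f_ n i + \sum_(i <- t) f_ n i).
  exact: cvgD.
by apply/funext => n; rewrite big_cons.
Qed.

Definition brv_row (G : set (set Omega)) (f : Omega -> 'rV[R]_d) : Prop :=
  (forall i, sub_measurable G (fun w => f w 0 i)) /\
  exists C : R, forall w i, `|f w 0 i| <= C.

Lemma cvg_row (v_ : nat -> 'I_d -> R) (v : 'I_d -> R) :
  (forall i, v_ n i @[n --> \oo] --> v i) ->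
  (\row_i v_ n i) @[n --> \oo] --> (\row_i v i : 'rV[R]_d).
Proof.
move=> h; apply/cvg_ballP => e e0.
have : \forall n \near \oo, forall i, ball (v i) e (v_ n i).
  by apply: filter_forall => i; move/cvg_ballP : (h i); exact.
apply: filterS => n hn; split => // i j; rewrite !mxE; exact: hn.
Qed.

Section Comb.
Variables (k : nat) (c : 'I_k -> R) (L : ('I_k -> 'I_d -> R) -> R).
Hypothesis cL : forall (y_ : nat -> 'I_k -> 'I_d -> R) y,
  (forall m i, y_ n m i @[n --> \oo] --> y m i) -> L (y_ n) @[n --> \oo] --> L y.
Hypothesis bL : forall C : R, exists D : R, forall y : 'I_k -> 'I_d -> R,
  (forall m i, `|y m i| <= C) -> `|L y| <= D.
Hypothesis hL : forall (v : 'I_k -> 'rV[R]_d) A, past P B s A ->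
  `|Ex (fun w => \1_A w * \sum_m c m * g (B r w + v m))| <=
  L (fun m i => v m 0 i) * fine (P A).

Let sT : s <= T. Proof. by rewrite (le_trans (ltW sr)). Qed.

Lemma frozen_comb_le (zeta : Omega -> R) (v : 'I_k -> Omega -> 'rV[R]_d) :
  sub_measurable (past P B s) zeta -> (exists C : R, forall w, `|zeta w| <= C) ->
  (forall m, brv_row (past P B s) (v m)) ->
  [/\ brv (fun w => zeta w * \sum_m c m * g (B r w + v m w)),
     brv (fun w => `|zeta w| * L (fun m i => v m w 0 i)) &
   `|Ex (fun w => zeta w * \sum_m c m * g (B r w + v m w))| <=
   Ex (fun w => `|zeta w| * L (fun m i => v m w 0 i))].
Proof.
move=> mz [C1 hz] hv.
have sG := past_sigma_algebra P (fbm_measurable hB) sT.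
have Gm : past P B s `<=` measurable by move=> A [].
have [C2 hC2] : exists C2 : 'I_k -> R, forall m w i, `|v m w 0 i| <= C2 m.
  by have /choice[C2 h] : forall m, exists C : R, forall w i, `|v m w 0 i| <= C;
    [move=> m; case: (hv m)|exists C2].
pose C := `|C1| + \sum_m `|C2 m|.
(* The weight [zeta] is one more frozen parameter, at index [None]; this upgrades indicators of past
   events to bounded past-measurable weights. *)
pose u (i : option ('I_k * 'I_d)) w := if i is Some p then v p.1 w 0 p.2 else zeta w.
have C0 : 0 <= C by rewrite addr_ge0// sumr_ge0.
have hu i w : `|u i w| <= C.
  case: i => [[m i]|]/=.
    apply: le_trans (hC2 m w i) _; apply: le_trans (ler_norm _) _.
    by rewrite /C (bigD1 m)//= addrCA lerDl addr_ge0// sumr_ge0.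
  by rewrite (le_trans (hz w))// (le_trans (ler_norm _))// lerDl sumr_ge0.
have mu_ i : sub_measurable (past P B s) (u i).
  by case: i => [[m i]|]//=; have [h _] := hv m; exact: h.
pose pt (y : option ('I_k * 'I_d) -> R) m : 'rV[R]_d := \row_i y (Some (m, i)).
pose Psi (y : option ('I_k * 'I_d) -> R) w := y None * \sum_m c m * g (B r w + pt y m).
pose Lam (y : option ('I_k * 'I_d) -> R) := `|y None| * L (fun m i => y (Some (m, i))).
have [D hD] := bL C.
pose D' := C * (`|D| + \sum_m `|c m| * K).
have sK0 : 0 <= \sum_m `|c m| * K by apply: sumr_ge0 => m _; rewrite mulr_ge0.
have bg z : brv (fun w => g (B r w + z)).
  split; last by exists K.
  rewrite (_ : (fun w => _) = fun w => g (\row_i (B r w 0 i + z 0 i))).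
    apply: measurable_continuous_row => // i; apply: measurable_funD => //.
    by apply: (fbm_measurable hB); rewrite rT (le_trans s0)// ltW.
  by apply/funext => w; congr g; apply/rowP => i; rewrite !mxE.
have bPsi y : (forall i, `|y i| <= C) -> brv (Psi y).
  by move=> _; apply: brvZ; apply: brv_sum => m _; exact: brvZ.
have hPsi y w : (forall i, `|y i| <= C) -> `|Psi y w| <= D'.
  move=> hy; rewrite normrM ler_pM// (le_trans (ler_norm_sum _ _ _))//.
  rewrite -[leLHS]add0r lerD//; apply: ler_sum => m _.
  by rewrite normrM ler_wpM2l.
have hLam y : (forall i, `|y i| <= C) -> `|Lam y| <= D'.
  move=> hy; rewrite normrM normr_id ler_pM// -[leLHS]addr0 lerD//.
  by rewrite (le_trans (hD _ _)) ?ler_norm.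
have cPsi (y_ : nat -> option ('I_k * 'I_d) -> R) y w :
  (forall i, y_ n i @[n --> \oo] --> y i) -> Psi (y_ n) w @[n --> \oo] --> Psi y w.
  move=> h; apply: cvgM; first exact: h.
  apply: (cvg_sumr (f_ := fun n m => c m * g (B r w + pt (y_ n) m))) => m; apply: cvgMr.
  have h1 : pt (y_ n) m @[n --> \oo] --> pt y m by apply: cvg_row => i; exact: h.
  have h2 : continuous (fun z : 'rV[R]_d => g (z + B r w)) by exact: continuous_translate.
  rewrite addrC (_ : (fun n => _) = (fun n => g (pt (y_ n) m + B r w))); last first.
    by apply/funext => n; rewrite addrC.
  exact: (cvg_comp _ _ h1 (h2 _)).
have cLam (y_ : nat -> option ('I_k * 'I_d) -> R) y :
  (forall i, y_ n i @[n --> \oo] --> y i) -> Lam (y_ n) @[n --> \oo] --> Lam y.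
  by move=> h; apply: cvgM; [apply: cvg_norm; exact: h|apply: cL => m i; exact: h].
have PsiLam y A : (forall i, `|y i| <= C) -> past P B s A ->
    `|Ex (fun w => \1_A w * Psi y w)| <= Lam y * fine (P A).
  move=> _ FA; have bA := @brv_indic R _ _ _ FA.2.
  rewrite (_ : (fun w => _) = (fun w => y None * (\1_A w * \sum_m c m * g (B r w + pt y m)))).
    rewrite ExZ; last by apply: brvM => //; apply: brv_sum => m _; exact: brvZ.
    rewrite normrM -mulrA ler_wpM2l//.
    have := hL (pt y) FA; rewrite (_ : (fun m i => _) = (fun m i => y (Some (m, i))))//.
    by apply/funext => m; apply/funext => i; rewrite mxE.
  by apply/funext => w; rewrite /Psi mulrCA.
have E1 w : Psi (u ^~ w) w = zeta w * \sum_m c m * g (B r w + v m w).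
  rewrite /Psi/=; congr (_ * _); apply: eq_bigr => m _; congr (_ * g (_ + _)).
  by apply/rowP => i; rewrite mxE.
have E1' : (fun w => zeta w * \sum_m c m * g (B r w + v m w)) = (fun w => Psi (u ^~ w) w).
  by apply/funext => w; rewrite E1.
rewrite E1'; split.
- exact: (brv_frozen sG Gm mu_ hu C0 bPsi hPsi cPsi).
- exact: (brv_frozen_bound sG Gm mu_ hu hLam cLam).
- exact: (Ex_frozen_le sG Gm mu_ hu C0 bPsi hPsi hLam cPsi cLam PsiLam).
Qed.

End Comb.

Local Notation kap := (smoothing_const H s r).

Let kap_ge0 : 0 <= kap.
Proof. by rewrite divr_ge0 ?powR_ge0// mulr_ge0// mulr_ge0// expR_ge0. Qed.

Let cvg_l1 (y_ z_ : nat -> 'I_d -> R) y z :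
  (forall i, y_ n i @[n --> \oo] --> y i) -> (forall i, z_ n i @[n --> \oo] --> z i) ->
  \sum_i `|y_ n i - z_ n i| @[n --> \oo] --> \sum_i `|y i - z i|.
Proof. by move=> hy hz; apply: (cvg_sumr (f_ := fun n i => `|y_ n i - z_ n i|)) => i; apply: cvg_norm; exact: cvgB. Qed.

Let l1_bound C (y z : 'I_d -> R) : (forall i, `|y i| <= C) -> (forall i, `|z i| <= C) ->
  \sum_i `|y i - z i| <= \sum_(i < d) (C + C).
Proof.
by move=> hy hz; apply: ler_sum => i _; rewrite (le_trans (ler_normB _ _))// lerD.
Qed.

Let l1B (u v : 'rV[R]_d) : l1 (u - v) = \sum_i `|u 0 i - v 0 i|.
Proof. by apply: eq_bigr => i _; rewrite !mxE. Qed.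

Lemma frozen_first_diff (zeta : Omega -> R) (phi psi : Omega -> 'rV[R]_d) :
  sub_measurable (past P B s) zeta -> (exists C : R, forall w, `|zeta w| <= C) ->
  brv_row (past P B s) phi -> brv_row (past P B s) psi ->
  [/\ brv (fun w => zeta w * (g (B r w + phi w) - g (B r w + psi w))),
     brv (fun w => `|zeta w| * (K * kap * l1 (phi w - psi w))) &
   `|Ex (fun w => zeta w * (g (B r w + phi w) - g (B r w + psi w)))| <=
   Ex (fun w => `|zeta w| * (K * kap * l1 (phi w - psi w)))].
Proof.
move=> mz bz hphi hpsi.
pose c (m : 'I_2) : R := nth 0 [:: 1; -1] m.
pose v (m : 'I_2) := nth phi [:: phi; psi] m.
pose L (y : 'I_2 -> 'I_d -> R) := K * kap * \sum_i `|y ord0 i - y (lift ord0 ord0) i|.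
have E w : zeta w * (g (B r w + phi w) - g (B r w + psi w)) =
    zeta w * \sum_m c m * g (B r w + v m w).
  by rewrite !big_ord_recl big_ord0 /c /v/=; ring.
have E' w : `|zeta w| * (K * kap * l1 (phi w - psi w)) =
    `|zeta w| * L (fun m i => v m w 0 i).
  by rewrite /L l1B.
rewrite (_ : (fun w => _ * (g _ - g _)) =
    (fun w => zeta w * \sum_m c m * g (B r w + v m w))); last exact/funext.
rewrite (_ : (fun w => `|zeta w| * (_ * l1 _)) =
    (fun w => `|zeta w| * L (fun m i => v m w 0 i))); last exact/funext.
apply: frozen_comb_le => //.
- by move=> y_ y h; apply: cvgMr; exact: cvg_l1.
- move=> C; exists (K * kap * \sum_(i < d) (C + C)) => y hy.
  rewrite /L ger0_norm; last by apply: mulr_ge0; [exact: mulr_ge0|exact: sumr_ge0].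
  by apply: ler_wpM2l; [exact: mulr_ge0|exact: l1_bound].
- move=> x A FA; have := past_first_diff hH hB s0 sr rT cg hg (x (lift ord0 ord0))
    (x ord0 - x (lift ord0 ord0)) FA.
  rewrite [_ + (_ - _)]addrC subrK l1B; apply: le_trans.
  rewrite le_eqVlt; apply/orP; left; apply/eqP; congr (`|_|); apply: eq_Ex => w.
  by congr (_ * _); rewrite !big_ord_recl big_ord0 /c/=; ring.
- by move=> [[|[|m]] hm].
Qed.

Lemma frozen_second_diff (zeta : Omega -> R) (p0 p1 p2 p3 : Omega -> 'rV[R]_d) :
  sub_measurable (past P B s) zeta -> (exists C : R, forall w, `|zeta w| <= C) ->
  brv_row (past P B s) p0 -> brv_row (past P B s) p1 ->
  brv_row (past P B s) p2 -> brv_row (past P B s) p3 ->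
  let D := fun w => g (B r w + p0 w) - g (B r w + p1 w) - (g (B r w + p2 w) - g (B r w + p3 w)) in
  let M := fun w => K * kap * l1 ((p0 w - p1 w) - (p2 w - p3 w)) +
    K * kap ^+ 2 * (l1 (p0 w - p2 w) * l1 (p2 w - p3 w)) in
  [/\ brv (fun w => zeta w * D w), brv (fun w => `|zeta w| * M w) &
   `|Ex (fun w => zeta w * D w)| <= Ex (fun w => `|zeta w| * M w)].
Proof.
move=> mz bz h0 h1 h2 h3 D M.
pose c (m : 'I_4) : R := nth 0 [:: 1; -1; -1; 1] m.
pose v (m : 'I_4) := nth p0 [:: p0; p1; p2; p3] m.
pose j0 : 'I_4 := ord0. pose j1 : 'I_4 := lift ord0 ord0.
pose j2 : 'I_4 := lift ord0 (lift ord0 ord0).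
pose j3 : 'I_4 := lift ord0 (lift ord0 (lift ord0 ord0)).
pose L (y : 'I_4 -> 'I_d -> R) := K * kap * (\sum_i `|(y j0 i - y j1 i) - (y j2 i - y j3 i)|)
  + K * kap ^+ 2 * ((\sum_i `|y j0 i - y j2 i|) * (\sum_i `|y j2 i - y j3 i|)).
have LE (u0 u1 u2 u3 : 'rV[R]_d) : K * kap * l1 ((u0 - u1) - (u2 - u3)) +
    K * kap ^+ 2 * (l1 (u0 - u2) * l1 (u2 - u3)) =
    K * kap * (\sum_i `|(u0 0 i - u1 0 i) - (u2 0 i - u3 0 i)|)
  + K * kap ^+ 2 * ((\sum_i `|u0 0 i - u2 0 i|) * (\sum_i `|u2 0 i - u3 0 i|)).
  rewrite !l1B; congr (_ * _ + _).
  by apply: eq_bigr => i _; rewrite !mxE.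
have E w : zeta w * D w = zeta w * \sum_m c m * g (B r w + v m w).
  by rewrite !big_ord_recl big_ord0 /c /v/= /D; ring.
have E' w : `|zeta w| * M w = `|zeta w| * L (fun m i => v m w 0 i).
  by rewrite /L /M LE.
rewrite (_ : (fun w => _ * D w) =
    (fun w => zeta w * \sum_m c m * g (B r w + v m w))); last exact/funext.
rewrite (_ : (fun w => _ * M w) =
    (fun w => `|zeta w| * L (fun m i => v m w 0 i))); last exact/funext.
apply: frozen_comb_le => //.
- move=> y_ y h; apply: cvgD; apply: cvgMr; last by apply: cvgM; exact: cvg_l1.
  by apply: cvg_l1 => i; exact: cvgB.
- move=> C; exists (K * kap * (\sum_(i < d) ((C + C) + (C + C))) +
    K * kap ^+ 2 * ((\sum_(i < d) (C + C)) * (\sum_(i < d) (C + C)))) => y hy.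
  have s_ge0 (z : 'I_d -> R) : 0 <= \sum_i `|z i| by exact: sumr_ge0.
  rewrite /L ger0_norm; last first.
    apply: addr_ge0; apply: mulr_ge0; [exact: mulr_ge0|exact: s_ge0| |].
      by apply: mulr_ge0 => //; exact: exprn_ge0.
    by apply: mulr_ge0; exact: s_ge0.
  apply: lerD; apply: ler_wpM2l.
  - exact: mulr_ge0.
  - by apply: l1_bound => i; rewrite (le_trans (ler_normB _ _))// lerD.
  - by apply: mulr_ge0 => //; exact: exprn_ge0.
  - by apply: ler_pM; [exact: s_ge0|exact: s_ge0|exact: l1_bound|exact: l1_bound].
- move=> x A FA.
  have bA := @brv_indic R _ _ _ FA.2.
  have bg z : brv (fun w => g (B r w + z)).
    split; last by exists K.
    rewrite (_ : (fun w => _) = fun w => g (\row_i (B r w 0 i + z 0 i))).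
      apply: measurable_continuous_row => // i; apply: measurable_funD => //.
      by apply: (fbm_measurable hB); rewrite rT (le_trans s0)// ltW.
    by apply/funext => w; congr g; apply/rowP => i; rewrite !mxE.
  (* The fourth corner of the parallelogram on the points 3, 2, 0. Replacing point 1 by [y] costs a
     first difference in (p0 - p1) - (p2 - p3); the rest is an exact second difference. *)
  pose y := x j3 + (x j0 - x j2).
  have := past_first_diff hH hB s0 sr rT cg hg (x j1) (y - x j1) FA.
  rewrite [x j1 + _]addrC subrK => H1.
  have := past_second_diff hH hB s0 sr rT cg hg (x j3) (x j2 - x j3) (x j0 - x j2) FA.
  rewrite [x j3 + (x j2 - _)]addrC subrK [x j2 + (x j0 - _)]addrC subrK -/y => H2.
  have -> : Ex (fun w => \1_A w * \sum_m c m * g (B r w + x m)) =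
    Ex (fun w => \1_A w * (g (B r w + y) - g (B r w + x j1))) +
    Ex (fun w => \1_A w * (g (B r w + x j0) - g (B r w + x j2) - g (B r w + y)
      + g (B r w + x j3))).
    rewrite -ExD.
    - apply: eq_Ex => w; rewrite !big_ord_recl big_ord0 /c/= -/j0 -/j1 -/j2 -/j3.
      by ring.
    - by apply: brvM => //; exact: brvB.
    - by apply: brvM => //; apply: brvD => //; apply: brvB => //; exact: brvB.
  apply: le_trans (ler_normD _ _) _; apply: le_trans (lerD H1 H2) _.
  rewrite /L -LE mulrDl lerD//; last first.
    by rewrite le_eqVlt; apply/orP; left; apply/eqP; ring.
  rewrite le_eqVlt; apply/orP; left; apply/eqP; congr (_ * _ * _); congr l1.
  by apply/rowP => i; rewrite /y !mxE; ring.
- by move=> [[|[|[|[|m]]]] hm].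
Qed.

End FrozenSmoothing.

(** * Conditional expectations *)

Section DensityBound.
Context {R : realType} {disp : measure_display} {T : measurableType disp}.
Variable mu : {finite_measure set T -> \bar R}.

(** On the set where f > K the function f - K is positive, yet its integral there is at most 0. *)
Lemma density_le (f : T -> R) (K : R) :
  mu.-integrable setT (EFin \o f) ->
  (forall A, measurable A -> (\int[mu]_(x in A) (f x)%:E <= K%:E * mu A)%E) ->
  mu [set x | K < f x] = 0%E.
Proof.
move=> intf hf; set A := [set x | K < f x].
have mf : measurable_fun setT f by apply/measurable_EFinP; exact: measurable_int intf.
have mA : measurable A.
  rewrite (_ : A = f @^-1` [set` `]K, +oo[]).
    by rewrite -[X in measurable X]setTI; apply: mf => //; exact: measurable_itv.
  by apply/seteqP; split => x /=; rewrite in_itv/= andbT.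
have finA : mu A \is a fin_num by exact: fin_num_measure.
have intfA : mu.-integrable A (EFin \o f) by exact: integrableS intf.
have intK : mu.-integrable A (EFin \o cst K).
  by apply: (integrableS measurableT) => //; exact: finite_measure_integrable_cst.
pose g x := (f x - K)%:E.
have ig : mu.-integrable A g by exact: (integrableB mA intfA intK).
have I0 : (\int[mu]_(x in A) g x <= 0)%E.
  rewrite (_ : g = (fun x => (f x)%:E - (cst K x)%:E)%E); last by apply/funext => x; rewrite -EFinB.
  rewrite integralB//= integral_cst// leeBlDr ?fin_numM// add0e; exact: hf.
have I1 : (\int[mu]_(x in A) `|g x| = 0)%E.
  apply/eqP; rewrite eq_le integral_ge0// andbT; apply: le_trans I0.
  rewrite le_eqVlt; apply/orP; left; apply/eqP; apply: eq_integral => x.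
  by rewrite inE => Ax; rewrite gee0_abs// lee_fin subr_ge0 ltW.
have := (ae_eq_integral_abs mu mA (measurable_int _ ig)).1 I1.
move=> hA; apply: measure_negligible => //; apply: negligibleS hA => x Ax /= /(_ Ax).
by move=> [] /eqP; rewrite subr_eq0 => /eqP E; move: Ax; rewrite /A/= E ltxx.
Qed.

End DensityBound.

Section ConditionalExpectation.
Context {R : realType} {disp : measure_display} {Omega : measurableType disp}.
Variable P : probability Omega R.
Local Notation Ex := (Ex P).
Variable G : set (set Omega).
Hypothesis sG : sigma_algebra setT G.
Hypothesis Gm : G `<=` measurable.

Let GE : <<s G >> = G. Proof. exact: sigma_algebra_id. Qed.

Let j : Omega -> g_sigma_algebraType G := idfun.

Let mj : measurable_fun setT j.
Proof. by move=> _ A mA; rewrite setTI; apply: Gm; rewrite -GE. Qed.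

Let J : {mfun Omega >-> g_sigma_algebraType G} := mfun_Sub (mem_set mj).

Let PG : probability (g_sigma_algebraType G) R := distribution P J.

Lemma sub_measurableP (f : Omega -> R) :
  sub_measurable G f <-> measurable_fun setT (f : g_sigma_algebraType G -> R).
Proof.
split=> h; first by move=> _ U mU; rewrite setTI; apply: sub_sigma_algebra; exact: h.
by move=> U mU; rewrite -GE -[X in _ X]setTI; exact: h.
Qed.

Lemma sub_measurable_brv (f : Omega -> R) (C : R) : sub_measurable G f ->
  (forall w, `|f w| <= C) -> brv f.
Proof.
move=> mf hf; split; last by exists C.
by move=> _ U mU; rewrite setTI; apply: Gm; exact: mf.
Qed.

(** The freezing lemma with a single parameter, the value of [zeta], and the bound 0. *)
Let sub_measurable_Ex0 (Z zeta : Omega -> R) : brv Z ->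
  (forall A, G A -> Ex (fun w => \1_A w * Z w) = 0) ->
  sub_measurable G zeta -> (exists C : R, forall w, `|zeta w| <= C) ->
  Ex (fun w => zeta w * Z w) = 0.
Proof.
move=> bZ hZ mz [C hC]; have [mZ [K hK]] := bZ.
have C0 : 0 <= C by exact: le_trans (hC point).
have K0 : 0 <= K by exact: le_trans (hK point).
apply/eqP; rewrite -normr_le0 -[leRHS](Ex_cst P 0).
apply: (@Ex_frozen_le _ _ _ P G sG Gm unit (fun=> zeta) C (fun=> mz) (fun _ w => hC w) C0
  (fun y w => y tt * Z w) (fun=> 0) (C * K)) => //.
- by move=> y _; exact: brvZ.
- by move=> y w hy; rewrite normrM ler_pM.
- by move=> y _; rewrite normr0 mulr_ge0.
- by move=> y_ y w h; apply: cvgMl; exact: h.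
- by move=> y_ y h; exact: cvg_cst.
- move=> y A _ GA; have bA := @brv_indic R _ _ _ (Gm GA).
  rewrite (_ : (fun w => _) = fun w => y tt * (\1_A w * Z w)); last first.
    by apply/funext => w; rewrite mulrCA.
  by rewrite ExZ; [rewrite hZ// mulr0 normr0 mul0r|exact: brvM].
Qed.

(** The Radon-Nikodym derivative of A |-> E[1_A Z] on [G], with respect to P restricted to [G].
    [density_le] for f and for - f gives |f| <= K almost surely, so truncation at K changes it on a
    null set only and makes the bound hold everywhere. *)
Lemma exists_condE (Z : Omega -> R) (K : R) : brv Z -> (forall w, `|Z w| <= K) ->
  exists E : Omega -> R, [/\ sub_measurable G E, forall w, `|E w| <= K &
    forall zeta, sub_measurable G zeta -> (exists C : R, forall w, `|zeta w| <= C) ->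
    Ex (fun w => zeta w * E w) = Ex (fun w => zeta w * Z w)].
Proof.
move=> bZ hZ; have intZ := brv_integrable P bZ.
have intZA A : measurable A -> P.-integrable A (EFin \o Z).
  by move=> mA; exact: integrableS intZ.
have K0 : 0 <= K by exact: le_trans (hZ point).
pose nu0 : {charge set Omega -> \bar R} := induced_charge intZ.
pose nu' : {charge set (g_sigma_algebraType G) -> \bar R} := pushforward nu0 J.
have mJ : measurable_fun setT J by exact: mj.
pose nu := nu' mJ.
have nuE A : nu A = (\int[P]_(w in A) (Z w)%:E)%E by [].
have nuPG : nu `<< PG.
  apply/null_content_dominatesP => A mA PA; rewrite nuE.
  have mA' : measurable (A : set Omega) by apply: Gm; rewrite -GE.
  apply: null_set_integral => //; apply: measurable_funTS.
  exact: measurable_int intZ.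
pose f := Radon_Nikodym nu PG.
have finf x : f x \is a fin_num by exact: Radon_Nikodym_fin_num.
have intf : PG.-integrable setT f by exact: Radon_Nikodym_integrable.
have fE A : G A -> (\int[P]_(w in A) (Z w)%:E = \int[PG]_(x in A) f x)%E.
  by move=> GA; rewrite -nuE; apply: Radon_Nikodym_integral => //; exact: sub_sigma_algebra.
pose f0 x := fine (f x).
have ff0 : f = EFin \o f0 by apply/funext => x; rewrite /= fineK.
have mf0 : measurable_fun setT f0.
  by apply/measurable_EFinP; rewrite -ff0; exact: measurable_int intf.
have intbd A c : measurable A -> P.-integrable A (EFin \o cst c).
  by move=> mA; apply: integrableS (brv_integrable P (brv_cst c)).
have up : PG [set x | K < f0 x] = 0%E.
  apply: density_le; first by rewrite -ff0.
  move=> A mA; have GA : G A by rewrite -GE.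
  rewrite -[X in (X <= _)%E]/(\int[PG]_(x in A) (EFin \o f0) x)%E -ff0 -fE//.
  have mA' := Gm GA.
  apply: (@le_trans _ _ (\int[P]_(w in A) (cst K w)%:E)%E).
    apply: le_integral => //; [exact: intZA|exact: intbd|].
    by move=> w _; rewrite lee_fin (le_trans (ler_norm _)).
  by rewrite /= integral_cst.
have low : PG [set x | K < - f0 x] = 0%E.
  apply: density_le.
    rewrite (_ : EFin \o _ = (fun x => - f x)%E); first exact: integrableN.
    by apply/funext => x; rewrite ff0.
  move=> A mA; have GA : G A by rewrite -GE.
  have mA' := Gm GA.
  have intfA : PG.-integrable A f := integrableS measurableT mA (@subsetT _ _) intf.
  rewrite (_ : (fun x => _) = (fun x => (-1)%:E * f x)%E); last first.
    by apply/funext => x; rewrite ff0/= -EFinM mulN1r.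
  rewrite (integralZl mA intfA) -fE// -(integralZl mA' (intZA _ mA')).
  apply: (@le_trans _ _ (\int[P]_(w in A) (cst K w)%:E)%E).
    apply: le_integral => //; [|exact: intbd|].
      by apply: integrableZl => //; exact: intZA.
    by move=> w _; rewrite -EFinM lee_fin mulN1r (le_trans (ler_norm _))// normrN.
  by rewrite /= integral_cst.
pose E (w : Omega) : R := Num.max (- K) (Num.min K (f0 w)).
have hE w : `|E w| <= K.
  by rewrite ler_norml /E le_max lexx/= ge_max ge_min lexx/= andbT; lra.
have mE : measurable_fun setT (E : g_sigma_algebraType G -> R).
  by apply: measurable_maxr => //; apply: measurable_minr.
have sE : sub_measurable G E by exact/sub_measurableP.
have bE : brv E by exact: sub_measurable_brv sE hE.
have aeE : {ae PG, forall x, f x = (E x)%:E}.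
  have n1 : PG.-negligible [set x | K < f0 x].
    apply/negligibleP => //; rewrite (_ : [set x | _] = f0 @^-1` [set` `]K, +oo[]).
      by rewrite -[X in measurable X]setTI; apply: mf0 => //; exact: measurable_itv.
    by apply/seteqP; split => x /=; rewrite in_itv/= andbT.
  have n2 : PG.-negligible [set x | K < - f0 x].
    apply/negligibleP => //; rewrite (_ : [set x | _] = f0 @^-1` [set` `]-oo, - K[]).
      by rewrite -[X in measurable X]setTI; apply: mf0 => //; exact: measurable_itv.
    by apply/seteqP; split => x /=; rewrite in_itv/= ltrNr.
  apply: negligibleS (negligibleU n1 n2) => x /= h.
  have [|h1] := ltP K (f0 x); [by left|].
  have [|h2] := ltP K (- f0 x); [by right|].
  exfalso; apply: h; rewrite ff0/=; congr (_%:E).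
  by rewrite /E min_r// max_r// lerNl.
have EZ A : G A -> Ex (fun w => \1_A w * E w) = Ex (fun w => \1_A w * Z w).
  move=> GA; have mA := Gm GA; have mA' : measurable (A : set (g_sigma_algebraType G)).
    exact: sub_sigma_algebra.
  have key X : brv X -> Ex (fun w => \1_A w * X w) = fine (\int[P]_(w in A) (X w)%:E)%E.
    move=> bX; rewrite /Ex /Rintegral; congr fine; rewrite [RHS]integral_mkcond.
    apply: eq_integral => w _; rewrite restrict_EFin/= patchE indicE.
    by case: ifP; rewrite ?mul1r ?mul0r.
  rewrite !key//; congr fine; rewrite fE//.
  transitivity (\int[PG]_(x in A) (E x)%:E)%E; last first.
    apply: ae_eq_integral => //.
    - by apply: measurable_funTS; exact/measurable_EFinP.
    - by apply: measurable_funTS; exact: measurable_int intf.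
    - by apply: filterS aeE => x h _; rewrite h.
  rewrite /PG /distribution integral_pushforward//.
  - by apply/measurable_EFinP.
  - by apply: integrableS (brv_integrable P bE).
exists E; split => // zeta mz bz.
have bzeta : brv zeta by case: bz => C hC; exact: sub_measurable_brv mz hC.
apply/eqP; rewrite -subr_eq0 -ExB; [|exact: brvM|exact: brvM].
apply/eqP; rewrite (_ : (fun w => _) = fun w => zeta w * (E w - Z w)); last first.
  by apply/funext => w; rewrite mulrBr.
apply: sub_measurable_Ex0 => //; first exact: brvB.
move=> A GA; have bA := @brv_indic R _ _ _ (Gm GA).
rewrite (_ : (fun w => _) = fun w => \1_A w * E w - \1_A w * Z w).
  by rewrite ExB; [rewrite EZ// subrr|exact: brvM|exact: brvM].
by apply/funext => w; rewrite mulrBr.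
Qed.

End ConditionalExpectation.

(** * Stochastic sewing *)

Lemma sum_le_cst (R : realType) (m : nat) (f : nat -> R) (c : R) :
  (forall p, (p < m)%N -> f p <= c) -> \sum_(p < m) f p <= m%:R * c.
Proof.
move=> h; apply: (@le_trans _ _ (\sum_(p < m) c)); first by apply: ler_sum => p _; exact: h.
by rewrite sumr_const card_ord mulr_natl.
Qed.

Section Sewing.
Context {R : realType} {disp : measure_display} {Omega : measurableType disp}.
Variable P : probability Omega R.
Local Notation Ex := (Ex P).
Local Notation nr := (nr P).
Variable F : nat -> set (set Omega).
Hypothesis sF : forall k, sigma_algebra setT (F k).
Hypothesis Fm : forall k, F k `<=` measurable.
Hypothesis Fmono : forall k l, (k <= l)%N -> F k `<=` F l.
Variables (Z : nat -> nat -> Omega -> R) (K1 : R).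
Hypothesis bZ : forall k j, brv (Z k j).
Hypothesis hZ : forall k j w, `|Z k j w| <= K1.
Variables (n : nat) (v : nat -> R) (dv : nat -> nat -> R) (al be : nat -> R).
Hypothesis v_ge0 : forall k, 0 <= v k.
Hypothesis dv_ge0 : forall k l, 0 <= dv k l.
Hypothesis al_ge0 : forall i, 0 <= al i.
Hypothesis be_ge0 : forall i, 0 <= be i.

Definition adapted_brv k (z : Omega -> R) : Prop :=
  sub_measurable (F k) z /\ exists C : R, forall w, `|z w| <= C.

(** [Z k j] stands for the step ending at j with the drifts frozen at k. By duality, these two
    hypotheses bound, in L^2, its conditional expectation given [F u] and the change of that
    expectation when the drifts are refrozen at u. [v] is the norm of the gap, [dv] that of its
    increments; [al] and [be] are the singular kernels of orders one and two. *)
Hypothesis first_order : forall k u j z, (k <= u)%N -> (u < j)%N -> (j <= n)%N ->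
  adapted_brv u z ->
  `|Ex (fun w => z w * Z k j w)| <= nr z * (al (j - u) * v k).
Hypothesis second_order : forall k u j z, (k <= u)%N -> (u < j)%N -> (j <= n)%N ->
  adapted_brv u z ->
  `|Ex (fun w => z w * (Z k j w - Z u j w))| <=
  nr z * (al (j - u) * dv k u + be (j - u) * ((u - k)%:R * v k)).
Hypothesis Z_adapted : forall j, (j < n)%N -> adapted_brv j.+1 (Z j j.+1).

Let Alpha (q : nat) : R := \sum_(i < q) al i.+1.
Let Beta (q : nat) : R := \sum_(i < q) be i.+1.

Let Alpha_ge0 q : 0 <= Alpha q. Proof. exact: sumr_ge0. Qed.
Let Beta_ge0 q : 0 <= Beta q. Proof. exact: sumr_ge0. Qed.

Let adapted_bounded k z : adapted_brv k z -> brv z.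
Proof. by case=> mz [C hC]; exact: (sub_measurable_brv (@Fm k) mz hC). Qed.

Let adaptedD k z1 z2 : adapted_brv k z1 -> adapted_brv k z2 ->
  adapted_brv k (fun w => z1 w + z2 w).
Proof.
move=> [m1 [C1 h1]] [m2 [C2 h2]]; split.
  apply/(sub_measurableP (sF k)); apply: measurable_funD; exact/(sub_measurableP (sF k)).
by exists (C1 + C2) => w; rewrite (le_trans (ler_normD _ _))// lerD.
Qed.

Let adaptedN k z : adapted_brv k z -> adapted_brv k (fun w => - z w).
Proof.
move=> [m1 [C1 h1]]; split.
  by apply/(sub_measurableP (sF k)); apply: measurableT_comp => //; exact/(sub_measurableP (sF k)).
by exists C1 => w; rewrite normrN.
Qed.

Let adaptedB k z1 z2 : adapted_brv k z1 -> adapted_brv k z2 ->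
  adapted_brv k (fun w => z1 w - z2 w).
Proof. by move=> h1 h2; apply: adaptedD => //; exact: adaptedN. Qed.

Let adapted_le k l z : (k <= l)%N -> adapted_brv k z -> adapted_brv l z.
Proof. by move=> kl [m1 h1]; split => // U mU; apply: (Fmono kl); exact: m1. Qed.

(** A dual bound applied with the test variable [W] itself, then divided by the norm of [W]. *)
Let nr_dual (W : Omega -> R) c : brv W -> 0 <= c ->
  Ex (fun w => W w * W w) <= nr W * c -> nr W <= c.
Proof.
move=> bW c0; rewrite (_ : (fun w => _) = (fun w => W w ^+ 2)); last first.
  by apply/funext => w; rewrite expr2.
rewrite -nr_sqr expr2; have := nr_ge0 P W; rewrite le_eqVlt => /predU1P[<-//|W0].
by rewrite ler_pM2l.
Qed.

Let block_sum k u q w := \sum_(i < q) Z k (u + i).+1 w.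

Let block_bounded k u q : brv (block_sum k u q).
Proof. exact: brv_sum. Qed.

Let exists_W : exists W : nat -> nat -> nat -> Omega -> R, forall k u q,
  [/\ adapted_brv u (W k u q), forall w, `|W k u q w| <= q%:R * K1 &
   forall z, adapted_brv u z ->
    Ex (fun w => z w * W k u q w) = Ex (fun w => z w * block_sum k u q w)].
Proof.
have h (t : nat * nat * nat) : exists W : Omega -> R,
  [/\ adapted_brv t.1.2 W, forall w, `|W w| <= t.2%:R * K1 &
   forall z, adapted_brv t.1.2 z ->
    Ex (fun w => z w * W w) = Ex (fun w => z w * block_sum t.1.1 t.1.2 t.2 w)].
  have hb w : `|block_sum t.1.1 t.1.2 t.2 w| <= t.2%:R * K1.
    rewrite (le_trans (ler_norm_sum _ _ _))//.
    apply: (@le_trans _ _ (\sum_(i < t.2) K1)); first exact: ler_sum.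
    by rewrite sumr_const card_ord mulr_natl.
  have [E [mE hE EE]] := exists_condE P (sF t.1.2) (@Fm t.1.2)
    (block_bounded t.1.1 t.1.2 t.2) hb.
  exists E; split => //; first by split => //; exists (t.2%:R * K1).
  by move=> z [mz bz]; exact: EE.
have [W hW] := choice h.
by exists (fun k u q => W (k, u, q)) => k u q; exact: (hW (k, u, q)).
Qed.

(* W k u q is the conditional expectation of the q steps following u with the
   drifts frozen at k. *)
Let W := sval (cid exists_W).
Let W_adapted k u q : adapted_brv u (W k u q).
Proof. by rewrite /W; case: cid => /= f /(_ k u q)[]. Qed.
Let W_bounded k u q w : `|W k u q w| <= q%:R * K1.
Proof. by rewrite /W; case: cid => /= f /(_ k u q)[]. Qed.
Let WE k u q z : adapted_brv u z ->
  Ex (fun w => z w * W k u q w) = Ex (fun w => z w * block_sum k u q w).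
Proof. by rewrite /W; case: cid => /= f /(_ k u q)[_ _]; exact. Qed.

Let bW k u q : brv (W k u q). Proof. exact: adapted_bounded (W_adapted k u q). Qed.

Let block_first k u q z : (k <= u)%N -> (u + q <= n)%N -> adapted_brv u z ->
  `|Ex (fun w => z w * block_sum k u q w)| <= nr z * (Alpha q * v k).
Proof.
move=> ku uqn az; have bz := adapted_bounded az.
rewrite (_ : (fun w => _) = fun w => \sum_(i < q) z w * Z k (u + i).+1 w); last first.
  by apply/funext => w; rewrite mulr_sumr.
rewrite Ex_sum; last by move=> i _; exact: brvM.
rewrite (le_trans (ler_norm_sum _ _ _))// /Alpha mulr_suml mulr_sumr.
apply: ler_sum => i _.
have := @first_order k u (u + i).+1 z ku _ _ az; rewrite -addnS addKn; apply.
  by rewrite addnS ltnS leq_addr.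
by apply: leq_trans uqn; rewrite leq_add2l.
Qed.

Let nr_W k u q : (k <= u)%N -> (u + q <= n)%N -> nr (W k u q) <= Alpha q * v k.
Proof.
move=> ku uqn; apply: nr_dual => //; first exact: mulr_ge0.
rewrite WE//; apply: le_trans (ler_norm _) _; exact: block_first.
Qed.

(* Defect of additivity at the midpoint: a martingale increment, and a remainder
   due to refreezing the drifts at the midpoint. *)
Let Mart k q w := W k k (q + q) w - W k k q w - W k (k + q) q w.
Let Rem k q w := W k (k + q) q w - W (k + q) (k + q) q w.

Let Mart_adapted k q : adapted_brv (k + q) (Mart k q).
Proof.
apply: adaptedB => //; apply: adaptedB; apply: (adapted_le (k:=k)) => //; exact: leq_addr.
Qed.

Let block_cat k q w : block_sum k k (q + q) w = block_sum k k q w + block_sum k (k + q) q w.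
Proof.
rewrite /block_sum big_split_ord/=; congr (_ + _).
by apply: eq_bigr => i _; rewrite addnA.
Qed.

Let W_diff k q z : adapted_brv k z ->
  Ex (fun w => z w * (W k k (q + q) w - W k k q w)) =
  Ex (fun w => z w * block_sum k (k + q) q w).
Proof.
move=> az; have bz := adapted_bounded az.
rewrite (_ : (fun w => _) = fun w => z w * W k k (q + q) w - z w * W k k q w); last first.
  by apply/funext => w; rewrite mulrBr.
rewrite ExB; [|exact: brvM|exact: brvM].
rewrite !WE// -ExB; [|exact: brvM|exact: brvM].
by apply: eq_Ex => w; rewrite block_cat; ring.
Qed.

Let Mart_orth k q z : adapted_brv k z -> Ex (fun w => z w * Mart k q w) = 0.
Proof.
move=> az; have bz := adapted_bounded az.
rewrite (_ : (fun w => _) = fun w => z w * (W k k (q + q) w - W k k q w) -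
    z w * W k (k + q) q w); last by apply/funext => w; rewrite mulrBr.
rewrite ExB; [|by apply: brvM => //; exact: brvB|exact: brvM].
rewrite W_diff// WE ?subrr//; apply: adapted_le az; exact: leq_addr.
Qed.

(** [W k k (q + q) - W k k q] and [W k (k + q) q] are conditional expectations of the same second
    half block, at k and at k + q. Testing both at k + q bounds each by [Alpha q * v k]. *)
Let nr_Mart k q : (k + q + q <= n)%N -> nr (Mart k q) <= 2 * Alpha q * v k.
Proof.
move=> hn.
have h1 : nr (fun w => W k k (q + q) w - W k k q w) <= Alpha q * v k.
  have az : adapted_brv k (fun w => W k k (q + q) w - W k k q w) by exact: adaptedB.
  apply: nr_dual; [exact: brvB|exact: mulr_ge0|].
  rewrite W_diff//; apply: le_trans (ler_norm _) _; apply: block_first => //.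
    exact: leq_addr.
  by apply: adapted_le az; exact: leq_addr.
have h2 : nr (W k (k + q) q) <= Alpha q * v k by apply: nr_W => //; exact: leq_addr.
apply: le_trans (nrB _ _ _) _; [exact: brvB|exact: bW|].
by rewrite -mulrA mulr_natl mulr2n lerD.
Qed.

Let Rem_adapted k q : adapted_brv (k + q) (Rem k q).
Proof. exact: adaptedB. Qed.

Let nr_Rem k q : (k + q + q <= n)%N ->
  nr (Rem k q) <= Alpha q * dv k (k + q) + Beta q * (q%:R * v k).
Proof.
move=> hn; have az := Rem_adapted k q; have bz := adapted_bounded az.
apply: nr_dual => //.
  by apply: addr_ge0; apply: mulr_ge0 => //; exact: mulr_ge0.
rewrite [X in Ex X](_ : _ = fun w => Rem k q w * W k (k + q) q w - Rem k q w * W (k + q) (k + q) q w); last first.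
  by apply/funext => w; rewrite {2}/Rem mulrBr.
rewrite ExB; [|exact: brvM|exact: brvM].
rewrite !WE// -ExB; [|exact: brvM|exact: brvM].
rewrite (_ : (fun w => _) = fun w => \sum_(i < q) Rem k q w *
    (Z k (k + q + i).+1 w - Z (k + q) (k + q + i).+1 w)); last first.
  by apply/funext => w; rewrite -mulrBr -sumrB mulr_sumr.
rewrite Ex_sum; last by move=> i _; apply: brvM => //; exact: brvB.
apply: le_trans (ler_norm _) _.
rewrite (le_trans (ler_norm_sum _ _ _))// /Alpha /Beta !mulr_suml -big_split/= mulr_sumr.
apply: ler_sum => i _.
have := @second_order k (k + q) (k + q + i).+1 (Rem k q) _ _ _ az.
have -> : ((k + q + i).+1 - (k + q) = i.+1)%N by rewrite -addnS addKn.
rewrite addKn; apply; first exact: leq_addr.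
  by rewrite ltnS leq_addr.
by apply: leq_trans hn; rewrite -addnS leq_add2l.
Qed.

Let level k m q w := \sum_(p < m) (W (k + p * (q + q)) (k + p * (q + q)) (q + q) w
  - W (k + p * (q + q)) (k + p * (q + q)) q w
  - W (k + p * (q + q) + q) (k + p * (q + q) + q) q w).

Let start_le k m p q : (k + m * (q + q) <= n)%N -> (p < m)%N ->
  (k + p * (q + q) + q + q <= n)%N.
Proof.
move=> hn pm; apply: leq_trans hn; rewrite -addnA -addnA leq_add2l.
by rewrite -[(_ + (q + q))%N]/(_ + _)%N addnC -mulSn leq_mul2r pm orbT.
Qed.

(** The m martingale parts are orthogonal and cost a factor sqrt m; the remainders, which are
    smaller, are added up with a factor m. *)
Let nr_level k m q G0 S : (k + m * (q + q) <= n)%N ->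
  (forall p, (p < m)%N -> v (k + p * (q + q)) <= G0) ->
  (forall p, (p < m)%N -> dv (k + p * (q + q)) (k + p * (q + q) + q) <= S) ->
  nr (level k m q) <= Num.sqrt m%:R * (2 * Alpha q * G0) +
    m%:R * (Alpha q * S + Beta q * (q%:R * G0)).
Proof.
move=> hn hG hS; pose kp p := (k + p * (q + q))%N.
rewrite (_ : level k m q = fun w => (\sum_(p < m) Mart (kp p) q w) + (\sum_(p < m) Rem (kp p) q w)); last first.
  apply/funext => w; rewrite -big_split/=; apply: eq_bigr => p _.
  by rewrite /Mart /Rem; ring.
have bM p : brv (Mart p q) by exact: adapted_bounded (Mart_adapted p q).
have bR p : brv (Rem p q) by exact: adapted_bounded (Rem_adapted p q).
have hm0 : (0 < m)%N -> 0 <= 2 * Alpha q * G0.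
  by move=> m0; rewrite !mulr_ge0//; apply: le_trans (v_ge0 _) (hG 0%N m0).
apply: le_trans (nrD _ _ _) _; [by apply: brv_sum|by apply: brv_sum|].
apply: lerD.
  have [->|m0] := posnP m.
    rewrite (_ : (fun w => _) = fun=> 0); last by apply/funext => w; rewrite big_ord0.
    by rewrite nr_cst normr0 sqrtr0 mul0r.
  rewrite -(ler_pXn2r (ltn0Sn 1)) ?nnegrE; [|exact: nr_ge0|by rewrite mulr_ge0 ?sqrtr_ge0 ?hm0].
  rewrite (nr_orth_sum (M := fun p => Mart (kp p) q)).
  - rewrite exprMn sqr_sqrtr//; apply: (sum_le_cst (f := fun p => nr (Mart (kp p) q) ^+ 2)) => p pm.
    rewrite ler_pXn2r ?nnegrE ?nr_ge0 ?hm0//.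
    apply: le_trans (nr_Mart _) _; first exact: (start_le hn).
    by apply: ler_wpM2l; [exact: mulr_ge0|exact: hG].
  - by move=> p _; exact: bM.
  - move=> p p' pp' p'm; apply: Mart_orth; apply: adapted_le (Mart_adapted _ _).
    rewrite /kp -addnA leq_add2l; apply: (@leq_trans (p.+1 * (q + q))); last by rewrite leq_mul2r pp' orbT.
    by rewrite mulSn addnC leq_add2r leq_addr.
apply: le_trans (nr_sum P _ (X := fun p : 'I_m => Rem (kp p) q) _) _; first by move=> p _; exact: bR.
apply: (sum_le_cst (f := fun p => nr (Rem (kp p) q))) => p pm.
apply: le_trans (nr_Rem _) _; first exact: (start_le hn).
apply: lerD; apply: ler_wpM2l => //; first exact: hS.
by apply: ler_wpM2l => //; exact: hG.
Qed.

(** Interpolates between the conditional expectation of the whole block, at c = a, and the sum of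
    those of the unit steps, at c = 0. *)
Let Tl k a c w := \sum_(p < 2 ^ (a - c)) W (k + p * 2 ^ c) (k + p * 2 ^ c) (2 ^ c) w.

Let sum_pairs (f : nat -> R) m : \sum_(p < m + m) f p = \sum_(p < m) (f (p + p)%N + f (p + p).+1).
Proof.
elim: m => [|m ih]; first by rewrite !big_ord0.
by rewrite addSn addnS !big_ord_recr/= ih -addrA.
Qed.

Let Tl_diff k a c w : (c < a)%N -> Tl k a c.+1 w - Tl k a c w = level k (2 ^ (a - c.+1)) (2 ^ c) w.
Proof.
move=> ca; rewrite /Tl /level.
have -> : (2 ^ (a - c) = 2 ^ (a - c.+1) + 2 ^ (a - c.+1))%N.
  by rewrite -(subnSK ca) expnS mul2n addnn.
rewrite (sum_pairs (fun p => W (k + p * 2 ^ c) (k + p * 2 ^ c) (2 ^ c) w)).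
have -> : (2 ^ c.+1 = 2 ^ c + 2 ^ c)%N by rewrite expnS mul2n addnn.
rewrite -sumrB; apply: eq_bigr => p _.
have -> : ((p + p) * 2 ^ c = p * (2 ^ c + 2 ^ c))%N by rewrite mulnDl mulnDr.
have -> : ((p + p).+1 * 2 ^ c = p * (2 ^ c + 2 ^ c) + 2 ^ c)%N.
  by rewrite mulSn addnC mulnDl mulnDr.
by rewrite addnA; ring.
Qed.

Let bTl k a c : brv (Tl k a c). Proof. exact: brv_sum. Qed.

(** The three terms are the conditional expectation of the whole block given its left end, the
    defects of additivity summed over the dyadic levels, and the deviation of the unit steps from
    their own conditional expectations. *)
Lemma sewing k a G0 (S : nat -> R) : (k + 2 ^ a <= n)%N ->
  (forall p, (p < 2 ^ a)%N -> v (k + p) <= G0) ->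
  (forall c p, (c < a)%N -> (p < 2 ^ (a - c))%N ->
    dv (k + p * 2 ^ c) (k + p * 2 ^ c + 2 ^ c) <= S c) ->
  nr (fun w => \sum_(p < 2 ^ a) Z (k + p) (k + p).+1 w) <=
  (\sum_(i < 2 ^ a) al i.+1) * G0 +
  \sum_(c < a) (Num.sqrt (2 ^ (a - c.+1))%:R * (2 * (\sum_(i < 2 ^ c) al i.+1) * G0) +
    (2 ^ (a - c.+1))%:R * ((\sum_(i < 2 ^ c) al i.+1) * S c +
      (\sum_(i < 2 ^ c) be i.+1) * ((2 ^ c)%:R * G0))) +
  Num.sqrt (2 ^ a)%:R * (2 * K1).
Proof.
move=> hn hG hS; rewrite -!/(Alpha _).
have K10 : 0 <= K1 by exact: le_trans (hZ 0 0 point).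
(* Known at k + p + 1 and orthogonal to what is known at k + p, so the unit deviations form
   martingale differences, each bounded by 2 K1. *)
pose Nj p w := Z (k + p) (k + p).+1 w - W (k + p) (k + p) 1 w.
have Nj_adapted p : (p < 2 ^ a)%N -> adapted_brv (k + p).+1 (Nj p).
  move=> pa; apply: adaptedB.
    by apply: Z_adapted; apply: leq_trans hn; rewrite -addnS leq_add2l.
  exact: adapted_le (leqnSn _) (W_adapted _ _ _).
have bN p : brv (Nj p) by exact: brvB.
have Nj_orth p z : adapted_brv (k + p) z -> Ex (fun w => z w * Nj p w) = 0.
  move=> az; have bz := adapted_bounded az.
  rewrite (_ : (fun w => _) = fun w => z w * Z (k + p) (k + p).+1 w - z w * W (k + p) (k + p) 1 w); last first.
    by apply/funext => w; rewrite mulrBr.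
  rewrite ExB; [|exact: brvM|exact: brvM].
  rewrite WE// (_ : (fun w => z w * block_sum _ _ _ w) = fun w => z w * Z (k + p) (k + p).+1 w) ?subrr//.
  by apply/funext => w; rewrite /block_sum big_ord1 addn0.
have hNj p w : `|Nj p w| <= 2 * K1.
  rewrite (le_trans (ler_normB _ _))// mulr_natl mulr2n lerD//.
  by have := W_bounded (k + p) (k + p) 1 w; rewrite mul1r.
have E w : \sum_(p < 2 ^ a) Z (k + p) (k + p).+1 w =
    Tl k a a w - (\sum_(c < a) level k (2 ^ (a - c.+1)) (2 ^ c) w) + \sum_(p < 2 ^ a) Nj p w.
  have -> : \sum_(c < a) level k (2 ^ (a - c.+1)) (2 ^ c) w = Tl k a a w - Tl k a 0 w.
    rewrite -(telescope_sumr (fun c => Tl k a c w) (leq0n a)) big_mkord.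
    by apply: eq_bigr => c _; rewrite Tl_diff.
  rewrite /Nj sumrB /Tl subn0 expn0.
  rewrite (_ : \sum_(p < 2 ^ a) W (k + p * 1) (k + p * 1) 1 w = \sum_(p < 2 ^ a) W (k + p) (k + p) 1 w).
    by ring.
  by apply: eq_bigr => p _; rewrite muln1.
rewrite (_ : (fun w => _) = fun w => Tl k a a w -
    (\sum_(c < a) level k (2 ^ (a - c.+1)) (2 ^ c) w) + \sum_(p < 2 ^ a) Nj p w); last exact/funext.
have blevel c : brv (level k (2 ^ (a - c.+1)) (2 ^ c)).
  by apply: brv_sum => p _; apply: brvB => //; exact: brvB.
have bsum : brv (fun w => \sum_(c < a) level k (2 ^ (a - c.+1)) (2 ^ c) w).
  by apply: brv_sum => c _; exact: blevel.
apply: le_trans (nrD _ _ _) _; [exact: brvB|exact: brv_sum|].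
apply: lerD; last first.
  rewrite -(ler_pXn2r (ltn0Sn 1)) ?nnegrE; [|exact: nr_ge0|by rewrite !mulr_ge0 ?sqrtr_ge0].
  rewrite (nr_orth_sum (M := Nj)); last 2 first.
  - by move=> p _; exact: bN.
  - move=> p p' pp' p'm; apply: Nj_orth; apply: adapted_le (Nj_adapted p _).
      by rewrite -addnS leq_add2l.
    exact: ltn_trans p'm.
  rewrite exprMn sqr_sqrtr//; apply: (sum_le_cst (f := fun p => nr (Nj p) ^+ 2)) => p pa.
  rewrite ler_pXn2r ?nnegrE ?nr_ge0 ?mulr_ge0//.
  exact: nr_bound.
apply: le_trans (nrB _ _ _) _ => //; apply: lerD.
  rewrite (_ : Tl k a a = W k k (2 ^ a)).
    apply: le_trans (nr_W _ _) _ => //; apply: ler_wpM2l => //.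
    by have := hG 0%N; rewrite addn0 expn_gt0; exact.
  by apply/funext => w; rewrite /Tl subnn expn0 big_ord1 mul0n addn0.
apply: le_trans (nr_sum P _ (X := fun c : 'I_a => level k (2 ^ (a - c.+1)) (2 ^ c)) _) _.
  by move=> c _; exact: blevel.
apply: ler_sum => c _.
have pq : (2 ^ (a - c.+1) * (2 ^ c + 2 ^ c) = 2 ^ a)%N.
  by rewrite addnn -mul2n -expnS -expnD subnK.
apply: nr_level; first by rewrite pq.
- move=> p pm; apply: hG; rewrite -pq ltn_mul2r pm andbT.
  by rewrite addn_gt0 expn_gt0.
- move=> p pm; have -> : (p * (2 ^ c + 2 ^ c) = (p + p) * 2 ^ c)%N by rewrite mulnDl mulnDr.
  apply: hS => //; have := ltn_ord c => ca.
  rewrite -(subnSK ca) expnS mul2n -addnn.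
  by rewrite -addSn leq_add// ltnW.
Qed.

End Sewing.

(** * Deterministic estimates for the sewing bound *)

Section DyadicBlock.
Context {R : realType}.
Variables (H T h ca cb : R).
Hypothesis hH : 0 < H < 2^-1.
Hypothesis h0 : 0 < h.
Hypothesis ca0 : 0 <= ca.
Hypothesis cb0 : 0 <= cb.
Hypothesis T0 : 0 < T.

Let theta : R := 2^-1 - H.
Let H0 : 0 < H. Proof. by case/andP: hH. Qed.
Let Hlt : H < 2^-1. Proof. by case/andP: hH. Qed.
Let theta0 : 0 < theta. Proof. by rewrite subr_gt0. Qed.

Lemma sum_powR_grid (g : R) q : 0 < g < 1 ->
  \sum_(i < q) h * (i.+1%:R * h) `^ (- g) <= (q%:R * h) `^ (1 - g) / (1 - g).
Proof.
move=> hg; rewrite powRM ?ler0n ?(ltW h0)//.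
have E : h `^ (1 - g) = h * h `^ (- g).
  by rewrite powRD ?powRr1 ?(ltW h0)//; apply/implyP => _; rewrite gt_eqF.
rewrite (_ : \sum_(i < q) _ = (h * h `^ (- g)) * \sum_(i < q) (i.+1%:R) `^ (- g)); last first.
  rewrite mulr_sumr; apply: eq_bigr => i _; rewrite powRM ?ler0n ?(ltW h0)//.
  by rewrite mulrAC mulrA.
rewrite E mulrC mulrAC ler_wpM2r//; last exact: sum_powRN_le.
by rewrite mulr_ge0 ?powR_ge0// ltW.
Qed.

Let al (i : nat) := ca * h * (i%:R * h) `^ (- H).
Let be (i : nat) := cb * h * h * (i%:R * h) `^ (- (2 * H)).
Let cb' := cb / (1 - 2 * H).
Let cb'0 : 0 <= cb'. Proof. by rewrite divr_ge0// subr_ge0; move: Hlt; lra. Qed.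

Let Alpha_le q : \sum_(i < q) al i.+1 <= 2 * ca * (q%:R * h) `^ (1 - H).
Proof.
rewrite (_ : \sum_(i < q) _ = ca * \sum_(i < q) h * (i.+1%:R * h) `^ (- H)); last first.
  by rewrite mulr_sumr; apply: eq_bigr => i _; rewrite /al mulrA.
rewrite [2 * ca]mulrC -mulrA ler_wpM2l//.
have hH1 : 0 < H < 1 by rewrite H0/=; move: Hlt; lra.
apply: le_trans (sum_powR_grid q hH1) _.
rewrite [leRHS]mulrC ler_wpM2l ?powR_ge0//.
by move: Hlt => Hl; rewrite -[leRHS]invrK lef_pV2 ?posrE; lra.
Qed.

Let Beta_le q : (\sum_(i < q) be i.+1) * q%:R <= cb' * (q%:R * h) `^ (2 - 2 * H).
Proof.
have [->|q0] := posnP q; first by rewrite big_ord0 mul0r mulr_ge0 ?powR_ge0.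
rewrite (_ : \sum_(i < q) _ = cb * h * \sum_(i < q) h * (i.+1%:R * h) `^ (- (2 * H))); last first.
  by rewrite mulr_sumr; apply: eq_bigr => i _; rewrite /be !mulrA.
have -> : (q%:R * h) `^ (2 - 2 * H) = (q%:R * h) * (q%:R * h) `^ (1 - 2 * H).
  have -> : 2 - 2 * H = 1 + (1 - 2 * H) by ring.
  rewrite powRD ?powRr1 ?mulr_ge0 ?(ltW h0)//; apply/implyP => _.
  by rewrite gt_eqF// mulr_gt0// ltr0n.
rewrite (_ : _ * _ * q%:R = (cb * (q%:R * h)) * \sum_(i < q) h * (i.+1%:R * h) `^ (- (2 * H))); last by ring.
rewrite (_ : cb' * _ = (cb * (q%:R * h)) * ((q%:R * h) `^ (1 - 2 * H) / (1 - 2 * H))); last by rewrite /cb'; ring.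
rewrite ler_wpM2l ?mulr_ge0 ?(ltW h0)//.
by apply: sum_powR_grid; rewrite mulr_gt0//=; move: Hlt; lra.
Qed.

Let w : R := 2^-1 `^ theta.
Let w_bound : 0 <= w < 1.
Proof.
rewrite powR_ge0/= (_ : 1 = 1 `^ theta); last by rewrite powR1.
by apply: gt0_ltr_powR; rewrite ?nnegrE// invf_lt1// ltr1n.
Qed.
Let Cg : R := (1 - w)^-1.
Let Cg0 : 0 <= Cg. Proof. by rewrite invr_ge0 subr_ge0 ltW//; case/andP: w_bound. Qed.

Let x (c : nat) : R := (2 ^ c)%:R * h.
Let x0 c : 0 < x c. Proof. by rewrite mulr_gt0// ltr0n expn_gt0. Qed.

Let x_half a c : (c <= a)%N -> x c = x a * 2^-1 ^+ (a - c).
Proof.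
move=> ca'; rewrite /x -[in RHS](subnK ca') addnK expnD natrM !natrX.
have E : 2 ^+ (a - c) * 2^-1 ^+ (a - c) = 1 :> R.
  by rewrite -exprMn mulfV ?pnatr_eq0// expr1n.
move: (2 ^+ c) (2 ^+ (a - c)) (2^-1 ^+ (a - c)) E => t p q E.
by rewrite -[RHS]mulrA (mulrC h q) mulrACA E mul1r.
Qed.

Let sum_x a : \sum_(c < a) x c `^ theta <= Cg * x a `^ theta.
Proof.
have -> : \sum_(c < a) x c `^ theta = x a `^ theta * \sum_(c < a) w ^+ (a - c).
  rewrite mulr_sumr; apply: eq_bigr => c _; rewrite (x_half (ltnW (ltn_ord c))).
  rewrite powRM ?exprn_ge0// ?(ltW (x0 _))//; congr (_ * _).
  elim: (a - c)%N => [|m ih]; first by rewrite !expr0 powR1.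
  by rewrite !exprS powRM ?exprn_ge0// ih.
rewrite mulrC ler_wpM2r ?powR_ge0//.
apply: le_trans (sum_geometric_le a w_bound).
rewrite (reindex_inj rev_ord_inj)/=; apply: ler_sum => c _.
rewrite subKn//; case/andP: w_bound => w0 w1.
by apply: ler_wiXn2l => //; exact: ltW.
Qed.

(** The first 2 [ca] comes from the whole block; [Cg] sums the geometric series over levels. In the
    bracket, the terms stem from the martingale parts, from [dv] in the remainders, and from the
    second-order kernel. *)
Definition block_const : R := 2 * ca + Cg * (4 * ca + 2 * ca * T `^ 2^-1 +
  cb' * (T `^ 2^-1 * T `^ theta)).

Lemma block_const_ge0 : 0 <= block_const.
Proof.
apply: addr_ge0; first exact: mulr_ge0.
apply: mulr_ge0 => //; apply: addr_ge0; first apply: addr_ge0.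
- exact: mulr_ge0.
- by rewrite !mulr_ge0 ?powR_ge0.
- by apply: mulr_ge0 => //; apply: mulr_ge0; exact: powR_ge0.
Qed.

(** Let L be the block length and y that of a level. The martingale parts give sqrt (L / y) y^(1 -
    H) = L^(1/2) y^theta, and the remainders L y^theta and L y^(2 theta). All carry L^(1/2) y^theta
    with theta = 1/2 - H > 0, so the sum over levels is geometric and governed by the largest
    one. *)
Lemma dyadic_block_le a G0 S K1 : 0 <= G0 -> 0 <= S -> x a <= T ->
  (\sum_(i < 2 ^ a) al i.+1) * G0 +
  \sum_(c < a) (Num.sqrt (2 ^ (a - c.+1))%:R * (2 * (\sum_(i < 2 ^ c) al i.+1) * G0) +
    (2 ^ (a - c.+1))%:R * ((\sum_(i < 2 ^ c) al i.+1) * (S * x c `^ 2^-1) +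
      (\sum_(i < 2 ^ c) be i.+1) * ((2 ^ c)%:R * G0))) +
  Num.sqrt (2 ^ a)%:R * (2 * K1) <=
  x a `^ 2^-1 * (block_const * x a `^ theta * (G0 + S) + 2 * K1 / h `^ 2^-1).
Proof.
move=> G00 S0 xT; set L := x a; have L0 : 0 < L by exact: x0.
set s := L `^ 2^-1; set t := L `^ theta.
have s0 : 0 <= s by exact: powR_ge0.
have t0 : 0 <= t by exact: powR_ge0.
have powS (y p q : R) : 0 < y -> y `^ (p + q) = y `^ p * y `^ q.
  by move=> y0; rewrite powRD//; apply/implyP => _; rewrite gt_eqF.
have hyp y : 0 < y -> y `^ (1 - H) = y `^ 2^-1 * y `^ theta.
  by move=> y0; rewrite -powS//; congr (_ `^ _); rewrite /theta; field.
have yE (y : R) : 0 < y -> y = y `^ 2^-1 * y `^ 2^-1.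
  by move=> y0; rewrite -powS// (_ : 2^-1 + 2^-1 = 1) ?powRr1 ?(ltW y0)//; field.
have LE : L = s * s by exact: yE.
have sT : s <= T `^ 2^-1 by apply: ge0_ler_powR; rewrite ?nnegrE// ltW.
have tT : t <= T `^ theta by apply: ge0_ler_powR; rewrite ?nnegrE// ltW.
have last : Num.sqrt (2 ^ a)%:R * (2 * K1) = s * (2 * K1 / h `^ 2^-1).
  rewrite -powR12_sqrt// /s /L /x powRM ?ler0n ?(ltW h0)//.
  by field; rewrite gt_eqF// powR_gt0.
rewrite last mulrDr lerD2r {last}.
have first_le : (\sum_(i < 2 ^ a) al i.+1) * G0 <= s * t * (2 * ca * (G0 + S)).
  apply: (@le_trans _ _ (2 * ca * L `^ (1 - H) * G0)).
    by rewrite ler_wpM2r//; exact: Alpha_le.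
  rewrite hyp// -/s -/t (_ : _ * G0 = s * t * (2 * ca * G0)); last by ring.
  by rewrite ler_wpM2l ?mulr_ge0// ler_wpM2l ?mulr_ge0// lerDl.
have two_le c : (c < a)%N -> (2 ^ (a - c.+1))%:R <= L / x c.
  move=> lca; rewrite ler_pdivlMr// (x_half (ltnW lca)) -/L mulrCA.
  rewrite -[leRHS]mulr1 ler_wpM2l ?(ltW L0)//.
  rewrite -(subnSK lca) exprS natrX mulrCA -exprMn mulfV ?pnatr_eq0// expr1n; lra.
have level_le c : (c < a)%N ->
  Num.sqrt (2 ^ (a - c.+1))%:R * (2 * (\sum_(i < 2 ^ c) al i.+1) * G0) +
    (2 ^ (a - c.+1))%:R * ((\sum_(i < 2 ^ c) al i.+1) * (S * x c `^ 2^-1) +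
      (\sum_(i < 2 ^ c) be i.+1) * ((2 ^ c)%:R * G0)) <=
  x c `^ theta * (s * ((4 * ca + 2 * ca * T `^ 2^-1 + cb' * (T `^ 2^-1 * T `^ theta)) * (G0 + S))).
  move=> lca; set y := x c; have y0 : 0 < y by exact: x0.
  set r := y `^ 2^-1; set u := y `^ theta.
  have r0 : 0 < r by rewrite powR_gt0.
  have u0 : 0 <= u by exact: powR_ge0.
  have yr : y = r * r by exact: yE.
  have yT : y <= L.
    by rewrite /y /L /x ler_wpM2r ?(ltW h0)// ler_nat leq_pexp2l// ltnW.
  have ut : u <= t by apply: ge0_ler_powR; rewrite ?nnegrE// ltW.
  have A1 : \sum_(i < 2 ^ c) al i.+1 <= 2 * ca * (r * u) by rewrite -hyp//; exact: Alpha_le.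
  have B1 : (\sum_(i < 2 ^ c) be i.+1) * (2 ^ c)%:R <= cb' * (y * (u * u)).
    have -> : y * (u * u) = y `^ (2 - 2 * H).
      rewrite /u -powS// -[X in X * _](powRr1 (ltW y0)) -powS//.
      by congr (_ `^ _); rewrite /theta; field.
    exact: Beta_le.
  have sq : Num.sqrt (2 ^ (a - c.+1))%:R <= s / r.
    have -> : s / r = Num.sqrt (L / y).
      have -> : L / y = (s / r) ^+ 2.
        by rewrite LE yr expr2; field; exact: lt0r_neq0.
      by rewrite sqrtr_sqr ger0_norm// divr_ge0// ltW.
    by apply: ler_wsqrtr; exact: two_le.
  have Aq0 : 0 <= \sum_(i < 2 ^ c) al i.+1.
    by apply: sumr_ge0 => i _; rewrite /al !mulr_ge0 ?powR_ge0// ltW.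
  have Bq0 : 0 <= \sum_(i < 2 ^ c) be i.+1.
    by apply: sumr_ge0 => i _; rewrite /be !mulr_ge0 ?powR_ge0// ltW.
  have t1 : Num.sqrt (2 ^ (a - c.+1))%:R * (2 * (\sum_(i < 2 ^ c) al i.+1) * G0) <= u * (s * (4 * ca * G0)).
    apply: (@le_trans _ _ (s / r * (2 * (2 * ca * (r * u)) * G0))).
      apply: ler_pM => //; first by rewrite !mulr_ge0.
      by rewrite ler_wpM2r// ler_wpM2l.
    rewrite le_eqVlt; apply/orP; left; apply/eqP; field; exact: lt0r_neq0.
  have t2 : (2 ^ (a - c.+1))%:R * ((\sum_(i < 2 ^ c) al i.+1) * (S * r)) <= u * (s * (2 * ca * s * S)).
    apply: (@le_trans _ _ (L / y * (2 * ca * (r * u) * (S * r)))).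
      apply: ler_pM => //; [by rewrite !mulr_ge0// ltW|exact: two_le|].
      by rewrite ler_wpM2r// mulr_ge0// ltW.
    rewrite LE yr; rewrite le_eqVlt; apply/orP; left; apply/eqP; field.
    exact: lt0r_neq0.
  have t3 : (2 ^ (a - c.+1))%:R * ((\sum_(i < 2 ^ c) be i.+1) * ((2 ^ c)%:R * G0)) <= u * (s * (cb' * (s * t) * G0)).
    apply: (@le_trans _ _ (L / y * (cb' * (y * (u * u)) * G0))).
      apply: ler_pM => //; [by rewrite !mulr_ge0|exact: two_le|].
      by rewrite [leLHS]mulrA ler_wpM2r.
    have -> : L / y * (cb' * (y * (u * u)) * G0) = u * (s * (cb' * (s * u) * G0)).
      by rewrite LE; field; exact: lt0r_neq0.
    rewrite ler_wpM2l// ler_wpM2l// ler_wpM2r// ler_wpM2l// ler_wpM2l//.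
  rewrite mulrDr; apply: le_trans (lerD t1 (lerD t2 t3)) _.
  rewrite -!mulrDr ler_wpM2l// ler_wpM2l//.
  have h1 : 2 * ca * s * S <= 2 * ca * T `^ 2^-1 * S.
    by rewrite ler_wpM2r// ler_wpM2l// mulr_ge0.
  have h2 : cb' * (s * t) * G0 <= cb' * (T `^ 2^-1 * T `^ theta) * G0.
    by rewrite ler_wpM2r// ler_wpM2l// ler_pM.
  apply: le_trans (lerD (lexx _) (lerD h1 h2)) _.
  have TS : 0 <= 2 * ca * T `^ 2^-1 by rewrite !mulr_ge0 ?powR_ge0.
  have TT : 0 <= cb' * (T `^ 2^-1 * T `^ theta).
    by apply: mulr_ge0 => //; apply: mulr_ge0; exact: powR_ge0.
  have T4 : 0 <= 4 * ca by rewrite mulr_ge0.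
  move: (4 * ca) (2 * ca * _) (cb' * _) T4 TS TT => p1 p2 p3 hp1 hp2 hp3.
  have := mulr_ge0 hp1 S0; have := mulr_ge0 hp2 G00; have := mulr_ge0 hp3 S0; lra.
set Q := (4 * ca + _ + _) in level_le.
have Q0 : 0 <= Q.
  apply: addr_ge0; first by rewrite addr_ge0 ?mulr_ge0 ?powR_ge0.
  by apply: mulr_ge0 => //; apply: mulr_ge0; exact: powR_ge0.
apply: (@le_trans _ _ (s * t * (2 * ca * (G0 + S)) + Cg * t * (s * (Q * (G0 + S))))).
  apply: lerD => //.
  apply: (@le_trans _ _ (\sum_(c < a) x c `^ theta * (s * (Q * (G0 + S))))).
    by apply: ler_sum => c _; exact: level_le.
  rewrite -mulr_suml; apply: ler_wpM2r; last exact: sum_x.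
  by apply: mulr_ge0 => //; apply: mulr_ge0 => //; exact: addr_ge0.
by rewrite le_eqVlt; apply/orP; left; apply/eqP; rewrite /block_const -/Q; ring.
Qed.

End DyadicBlock.

(** * Absorption on a short window and iteration over [0, T] *)

Section Windows.
Context {R : realType}.
Variables (T : R) (N m0 : nat) (C eps theta : R) (v : nat -> R) (dv : nat -> nat -> R).
Hypothesis T0 : 0 < T.
Hypothesis C0 : 0 <= C.
Hypothesis eps0 : 0 <= eps.
Hypothesis theta0 : 0 < theta.
Hypothesis v_ge0 : forall k, 0 <= v k.
Hypothesis dv_ge0 : forall k l, 0 <= dv k l.
Hypothesis dv0 : forall k, dv k k = 0.
Hypothesis dv_tri : forall k l m, dv k m <= dv k l + dv l m.
Hypothesis v_dv : forall k l, v l <= v k + dv k l.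
Let h : R := T / (2 ^ N)%:R.
Let x (c : nat) : R := (2 ^ c)%:R * h.
Hypothesis block : forall k a G0 S, (k + 2 ^ a <= 2 ^ N)%N -> 0 <= G0 -> 0 <= S ->
  (forall p, (p < 2 ^ a)%N -> v (k + p) <= G0) ->
  (forall c p, (c < a)%N -> (p < 2 ^ (a - c))%N ->
    dv (k + p * 2 ^ c) (k + p * 2 ^ c + 2 ^ c) <= S * x c `^ 2^-1) ->
  dv k (k + 2 ^ a) <= x a `^ 2^-1 * (C * x a `^ theta * (G0 + S) + eps).
Hypothesis m0N : (m0 <= N)%N.
Let L0 : R := T / (2 ^ m0)%:R.
Hypothesis small : C * L0 `^ theta * (4 * L0 `^ 2^-1 + 1) <= 2^-1.

Let h0 : 0 < h. Proof. by rewrite divr_gt0// ltr0n expn_gt0. Qed.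
Let x0 c : 0 < x c. Proof. by rewrite mulr_gt0// ltr0n expn_gt0. Qed.
Let a0 := (N - m0)%N.
Let xa0 : x a0 = L0.
Proof.
rewrite /x /h /L0 /a0 -{2}(subnK m0N) expnD natrM.
by field; rewrite !pnatr_eq0 -!lt0n !expn_gt0.
Qed.

Let x_le c a : (c <= a)%N -> x c <= x a.
Proof. by move=> ca; rewrite /x ler_wpM2r ?(ltW h0)// ler_nat leq_pexp2l. Qed.

(** This is 5 <= 4 sqrt 2, the induction step of the chaining below, where it reproduces the
    constant 4. *)
Let sqrt_step c : x c `^ 2^-1 + 4 * x c `^ 2^-1 <= 4 * x c.+1 `^ 2^-1.
Proof.
have -> : x c.+1 = 2 * x c by rewrite /x expnS natrM mulrA.
rewrite powRM// ?(ltW (x0 _))//; set r := x c `^ 2^-1.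
have r0 : 0 <= r by exact: powR_ge0.
have h2 : 5 / 4 <= 2 `^ 2^-1 :> R.
  rewrite powR12_sqrt// -[leLHS]ger0_norm; last lra.
  by rewrite -sqrtr_sqr ler_wsqrtr// expr2; lra.
have := ler_wpM2r r0 h2; lra.
Qed.

(* S is the best constant with dv <= S tau^(1/2) over the dyadic blocks of the
   window; the smallness of the window bounds S by v at its left end. *)
Let window k0 j : (k0 + 2 ^ a0 <= 2 ^ N)%N -> (j <= 2 ^ a0)%N ->
  v (k0 + j) <= (1 + 8 * T `^ 2^-1) * (v k0 + eps).
Proof.
move=> hk hj.
pose bl (z : 'I_a0.+1 * 'I_(2 ^ a0)) : R := if (z.2 < 2 ^ (a0 - z.1))%N then
  dv (k0 + z.2 * 2 ^ z.1) (k0 + z.2 * 2 ^ z.1 + 2 ^ z.1) / x z.1 `^ 2^-1 else 0.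
pose S := \big[Num.max/0]_z bl z.
have S0 : 0 <= S by exact: bigmax_ge_id.
have dvS c p : (c <= a0)%N -> (p < 2 ^ (a0 - c))%N ->
    dv (k0 + p * 2 ^ c) (k0 + p * 2 ^ c + 2 ^ c) <= S * x c `^ 2^-1.
  move=> ca pa.
  have pa' : (p < 2 ^ a0)%N by rewrite (leq_trans pa)// leq_pexp2l// leq_subr.
  have := le_bigmax 0 bl (Ordinal (ca : (c < a0.+1)%N), Ordinal pa').
  by rewrite -/S /bl/= pa ler_pdivrMr ?powR_gt0.
(* Chaining from the left end of a dyadic block to any of its points: at most one full half block is
   crossed, and the remainder lies in a block of half the length. *)
have chain a : forall p r, (a <= a0)%N -> (p < 2 ^ (a0 - a))%N -> (r <= 2 ^ a)%N ->
    dv (k0 + p * 2 ^ a) (k0 + p * 2 ^ a + r) <= S * (4 * x a `^ 2^-1).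
  elim: a => [|a ih] p r aa pa ra.
    case: r ra => [|[|//]] _.
      by rewrite addn0 dv0 mulr_ge0// mulr_ge0// powR_ge0.
    apply: le_trans (dvS 0%N p _ _) _ => //.
    by rewrite ler_wpM2l// ler_peMl ?powR_ge0// ler1n.
  have pa2 : (p + p + 1 < 2 ^ (a0 - a))%N.
    by rewrite addn1 -(subnSK aa) expnS mul2n -addnn -addnS -addSn leq_add.
  have E1 : (p * 2 ^ a.+1 = (p + p) * 2 ^ a)%N by rewrite expnS mulnA muln2 addnn.
  have [ra'|ra'] := leqP r (2 ^ a).
    rewrite E1; apply: le_trans (ih (p + p)%N r _ _ ra') _.
    - exact: ltnW.
    - by apply: leq_trans pa2; rewrite ltnS leq_addr.
    - rewrite ler_wpM2l// ler_wpM2l//; apply: ge0_ler_powR; rewrite ?nnegrE ?(ltW (x0 _))//.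
      exact: x_le.
  have E2 : (k0 + (p + p) * 2 ^ a + r = k0 + (p + p + 1) * 2 ^ a + (r - 2 ^ a))%N.
    by rewrite [((p + p + 1) * _)%N]mulnDl mul1n -!addnA subnKC// ltnW.
  rewrite E1; apply: le_trans (dv_tri _ (k0 + (p + p) * 2 ^ a + 2 ^ a) _) _.
  apply: (@le_trans _ _ (S * x a `^ 2^-1 + S * (4 * x a `^ 2^-1))).
    apply: lerD; first by apply: dvS; [exact: ltnW|apply: leq_trans pa2; rewrite ltnS leq_addr].
    rewrite E2 (_ : (k0 + (p + p) * 2 ^ a + 2 ^ a = k0 + (p + p + 1) * 2 ^ a)%N); last first.
      by rewrite [((p + p + 1) * _)%N]mulnDl mul1n addnA.
    apply: ih => //; first exact: ltnW.
    by rewrite leq_subLR addnn -mul2n -expnS.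
  by rewrite -mulrDr ler_wpM2l.
have vj i : (i <= 2 ^ a0)%N -> v (k0 + i) <= v k0 + S * (4 * L0 `^ 2^-1).
  move=> hi; apply: le_trans (v_dv k0 _) _; rewrite lerD2l -xa0.
  by have := chain a0 0%N i (leqnn _) _ hi; rewrite mul0n addn0 subnn; exact.
pose G0 := v k0 + S * (4 * L0 `^ 2^-1).
have l0 : 0 <= L0 `^ 2^-1 by exact: powR_ge0.
have G00 : 0 <= G0 by rewrite addr_ge0// !mulr_ge0.
have blockS c p : (c <= a0)%N -> (p < 2 ^ (a0 - c))%N ->
    dv (k0 + p * 2 ^ c) (k0 + p * 2 ^ c + 2 ^ c) <= x c `^ 2^-1 * (C * x c `^ theta * (G0 + S) + eps).
  move=> ca pa.
  have pe : (p * 2 ^ c + 2 ^ c <= 2 ^ a0)%N.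
    by rewrite -[X in (_ <= 2 ^ X)%N](subnK ca) expnD -mulSnr leq_mul2r pa orbT.
  apply: block => //.
  - by apply: leq_trans hk; rewrite -addnA leq_add2l.
  - move=> q qc; rewrite -addnA; apply: vj; apply: leq_trans pe.
    by rewrite leq_add2l ltnW.
  - move=> c' q c'c qc.
    have -> : (k0 + p * 2 ^ c + q * 2 ^ c' = k0 + (p * 2 ^ (c - c') + q) * 2 ^ c')%N.
      by rewrite mulnDl -mulnA -expnD subnK ?addnA// ltnW.
    apply: dvS; first exact: (leq_trans (ltnW c'c)).
    have -> : (a0 - c' = (a0 - c) + (c - c'))%N by rewrite addnBA ?subnK// ltnW.
    rewrite expnD; apply: (@leq_trans (p.+1 * 2 ^ (c - c'))); last by rewrite leq_mul2r pa orbT.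
    by rewrite mulSnr ltn_add2l.
have S_le : S <= C * L0 `^ theta * (G0 + S) + eps.
  apply: bigmax_le.
    by rewrite addr_ge0// !mulr_ge0 ?powR_ge0// addr_ge0.
  move=> [c p] _; rewrite /bl/=; case: ifPn => [pc|_]; last first.
    by rewrite addr_ge0// !mulr_ge0 ?powR_ge0// addr_ge0.
  have ca : (c <= a0)%N by rewrite -ltnS.
  rewrite ler_pdivrMr ?powR_gt0// mulrC; apply: le_trans (blockS c p ca pc) _.
  apply: ler_wpM2l; first exact: powR_ge0.
  rewrite lerD2r; apply: ler_wpM2r; first exact: addr_ge0.
  apply: ler_wpM2l => //.
  by apply: ge0_ler_powR; rewrite ?nnegrE -?xa0 ?(ltW (x0 _)) ?(ltW theta0)//; exact: x_le.
(* Once [G0] is expanded, the coefficient of [S] on the right is exactly the quantity that [small]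
   bounds by 1/2, so it is absorbed on the left. *)
have S_le2 : S <= v k0 + 2 * eps.
  move: S_le small; rewrite /G0; set q := C * L0 `^ theta.
  have q0 : 0 <= q by rewrite mulr_ge0// powR_ge0.
  move: (L0 `^ 2^-1) l0 => l l00 S_le sm.
  have h1 : q * (4 * l + 1) * S <= 2^-1 * S by rewrite ler_wpM2r.
  have h2 : q * v k0 <= 2^-1 * v k0.
    rewrite ler_wpM2r//; apply: le_trans sm; rewrite ler_peMr// lerDr.
    by rewrite mulr_ge0.
  have -> : S = 2 * (S - 2^-1 * S) by field.
  have : S - 2^-1 * S <= q * v k0 + eps.
    rewrite lerBlDr; apply: le_trans S_le _.
    rewrite (_ : q * _ + eps = q * v k0 + eps + q * (4 * l + 1) * S); last by ring.
    by rewrite lerD2l.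
  lra.
apply: le_trans (vj j hj) _.
have LT : L0 `^ 2^-1 <= T `^ 2^-1.
  apply: ge0_ler_powR; rewrite ?nnegrE ?(ltW T0)//.
    by rewrite -xa0 ltW.
  by rewrite /L0 ler_pdivrMr ?ltr0n ?expn_gt0// ler_peMr ?(ltW T0)// ler1n expn_gt0.
have h1 : S * (4 * L0 `^ 2^-1) <= (v k0 + 2 * eps) * (4 * T `^ 2^-1).
  by apply: ler_pM => //; [exact: mulr_ge0|rewrite ler_wpM2l].
have T20 : 0 <= T `^ 2^-1 by exact: powR_ge0.
have := mulr_ge0 (v_ge0 k0) T20; move: h1; move: (v k0) (T `^ 2^-1) (S * _) (v_ge0 k0) => V t Z V0.
by move: eps0; lra.
Qed.

(** [v + eps] is multiplied by at most [rho] on each window; carrying eps along turns 1 + 8 T^(1/2)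
    into 2 + 8 T^(1/2). There are 2^m0 windows, and the additional power covers the partial window
    that contains j. *)
Lemma window_bound j : (j <= 2 ^ N)%N ->
  v j <= (2 + 8 * T `^ 2^-1) ^+ (2 ^ m0).+1 * (v 0%N + eps).
Proof.
set rho := 2 + _.
have T20 : 0 <= T `^ 2^-1 by exact: powR_ge0.
have rho1 : 1 <= rho by rewrite /rho; lra.
have NE : (2 ^ N = 2 ^ m0 * 2 ^ a0)%N by rewrite -expnD addnC subnK.
have step k0 i : (k0 + 2 ^ a0 <= 2 ^ N)%N -> (i <= 2 ^ a0)%N ->
    v (k0 + i) + eps <= rho * (v k0 + eps).
  move=> h1 h2; have := window h1 h2; have := v_ge0 k0; rewrite /rho; lra.
have start q : (q <= 2 ^ m0)%N -> v (q * 2 ^ a0) + eps <= rho ^+ q * (v 0%N + eps).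
  elim: q => [_|q ih qm]; first by rewrite mul0n expr0 mul1r.
  rewrite exprS -mulrA mulSnr; apply: le_trans (step _ _ _ (leqnn _)) _.
    by rewrite -mulSnr NE leq_mul2r qm orbT.
  by rewrite ler_wpM2l ?(le_trans ler01)//; exact/ih/ltnW.
move=> hj; pose q := (j %/ 2 ^ a0)%N.
have p0 : (0 < 2 ^ a0)%N by rewrite expn_gt0.
have [qm|qm] := ltnP q (2 ^ m0).
  apply: (@le_trans _ _ (v j + eps)); first by rewrite lerDl.
  rewrite [j](divn_eq j (2 ^ a0)) -/q; apply: le_trans (step _ _ _ _) _.
  - by rewrite -mulSnr NE leq_mul2r qm orbT.
  - by rewrite ltnW// ltn_mod.
  - apply: le_trans (ler_wpM2l (le_trans ler01 rho1) (start q (ltnW qm))) _.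
    rewrite mulrA -exprS ler_wpM2r ?addr_ge0//.
    by apply: ler_weXn2l => //; exact: ltnW.
have -> : j = (2 ^ m0 * 2 ^ a0)%N.
  apply/eqP; rewrite eqn_leq -NE hj/= NE; apply: leq_trans (leq_trunc_div j (2 ^ a0)).
  by rewrite leq_mul2r qm orbT.
apply: (@le_trans _ _ (v (2 ^ m0 * 2 ^ a0) + eps)); first by rewrite lerDl.
apply: le_trans (start _ (leqnn _)) _; rewrite ler_wpM2r ?addr_ge0//.
by apply: ler_weXn2l.
Qed.

End Windows.

(** * The drift of a solution *)

Section NearCurve.
Context {R : realType}.

(** Only the time interval is compact, so the modulus is made uniform along the curve and not on a
    neighbourhood of it. It serves for the drift coefficient along a path and, with the identity as
    curve, for the path itself. *)
Lemma near_curve (T : R) (V : pseudoMetricType R) (gam : R -> V) (D : set V) (f : V -> R) :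
  {within `[0, T], continuous gam} -> {within D, continuous f} ->
  (forall u, 0 <= u <= T -> D (gam u)) -> forall e, 0 < e ->
  exists2 del, 0 < del & forall u p, 0 <= u <= T -> D p -> ball (gam u) del p ->
    `|f p - f (gam u)| <= e.
Proof.
move=> /subspace_continuousP cgam /subspace_continuousP cf gD e e0.
have e20 : 0 < e / 2 by rewrite divr_gt0.
pose Pr (del u : R) := forall p, D p -> ball (gam u) del p -> 0 <= u <= T ->
  `|f p - f (gam u)| <= e.
have := @segment_compact R 0 T; rewrite compact_near_coveringP.
move=> /(_ R (0^'+) Pr _) cov.
have {}cov : \forall del \near 0^'+, `[0, T] `<=` Pr del.
  apply: cov => u0 u0T; have u0T' : 0 <= u0 <= T by move: u0T; rewrite /= in_itv.
  have /cvgrPdist_le /(_ _ e20) := cf _ (gD _ u0T').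
  rewrite near_withinE => /nbhs_ballP[rho /= rho0 hrho].
  have rho20 : 0 < rho / 2 by rewrite divr_gt0.
  have /cvg_ballP/(_ _ rho20) := cgam _ u0T.
  rewrite near_withinE => hgam.
  exists ([set u | u \in `[0, T] -> ball (gam u0) (rho / 2) (gam u)],
    [set del | del < rho / 2]).
    split; first by apply: filterS hgam => u h uT; apply: h.
    exact: nbhs_right_lt.
  move=> [u del] [/= h1 h2] p Dp bp uT.
  have b1 : ball (gam u0) (rho / 2) (gam u) by apply: h1; rewrite in_itv.
  have b2 : ball (gam u0) rho p.
    rewrite [rho]splitr; apply: ball_triangle b1 _.
    by apply: le_ball bp; exact: ltW.
  have b3 : ball (gam u0) rho (gam u).
    by apply: le_ball b1; rewrite ler_pdivrMr// ler_peMr// ?(ltW rho0)// ler1n.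
  have h3 : `|f (gam u0) - f (gam u)| <= e / 2 := hrho _ b3 (gD _ uT).
  have h4 : `|f (gam u0) - f p| <= e / 2 := hrho _ b2 Dp.
  rewrite (_ : f p - f (gam u) = (f (gam u0) - f (gam u)) - (f (gam u0) - f p)); last by ring.
  by rewrite (le_trans (ler_normB _ _))// [leRHS]splitr lerD.
have pos : \forall del \near (0:R)^'+, 0 < del by exact: nbhs_right_gt.
have FF := at_right_proper_filter (0 : R).
have [del [h d0]] := @filter_ex _ _ FF _ (@filterI _ _ FF _ _ cov pos); exists del => // u p uT Dp bp; exact: h.
Qed.

End NearCurve.

Section IntervalIntegral.
Context {R : realType}.
Local Notation mu := (@lebesgue_measure R).

Lemma Rintegral_itv_dist_le (g : R -> R) (s t c e : R) : s <= t ->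
  mu.-integrable `]s, t] (EFin \o g) ->
  (forall u, s < u <= t -> `|g u - c| <= e) ->
  `|\int[mu]_(u in `]s, t]) g u - c * (t - s)| <= e * (t - s).
Proof.
move=> st ig hg.
have mI : measurable `]s, t]%classic by exact: measurable_itv.
have len : mu `]s, t]%classic = (t - s)%:E.
  rewrite lebesgue_measure_itv/= lte_fin; case: ltP => // ts.
  by rewrite (_ : t = s) ?subrr//; apply/eqP; rewrite eq_le ts st.
have icst k : mu.-integrable `]s, t] (EFin \o cst k).
  apply/integrableP; split; first by apply/measurable_EFinP; exact: measurable_cst.
  under eq_integral do rewrite abse_EFin.
  by rewrite (integral_cst mu mI (`|k|%:E))/= len -EFinM ltry.
have Icst k : \int[mu]_(u in `]s, t]) k = k * (t - s).
  by rewrite Rintegral_cst//; congr (_ * _); rewrite -[RHS]/(fine (t - s)%:E) -len.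
have ib : mu.-integrable `]s, t] (EFin \o (fun u => g u - c)).
  have : mu.-integrable `]s, t] ((EFin \o g) \- (EFin \o cst c))%E.
    by apply: integrableB => //; exact: icst.
  exact: eq_integrable.
rewrite -!Icst -RintegralB//; last exact: icst.
apply: le_trans (le_normr_Rintegral _ _) _ => //.
apply: le_Rintegral => //.
- exact: integrable_norm.
- exact: icst.
Qed.

End IntervalIntegral.

Section SolutionDrift.
Context {R : realType} {disp : measure_display} {Omega : measurableType disp}.
Variable P : probability Omega R.
Variables (d : nat) (T H K : R) (B : R -> Omega -> 'rV[R]_d).
Hypothesis hB : is_fbm P T H B.
Variables (b : R -> 'rV[R]_d -> 'rV[R]_d).
Hypothesis bK : forall t v i, 0 <= t <= T -> `|b t v 0 i| <= K.
Variables (x : 'rV[R]_d) (X : R -> Omega -> 'rV[R]_d).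
Hypothesis hX : strong_solution P T b B x X.

(* The exceptional set is removed by freezing the drift at x there; the result
   is still adapted because [past] contains the null sets. *)
Lemma solution_drift : exists phi : R -> Omega -> 'rV[R]_d, exists N : set Omega,
  [/\ measurable N /\ P N = 0%E,
      forall t, 0 <= t <= T -> brv_row (past P B t) (phi t),
      0 <= T -> forall w, phi 0 w = x,
      forall w, ~ N w -> forall t, 0 <= t <= T -> X t w = phi t w + B t w &
      (forall s t w i, 0 <= s -> s <= t -> t <= T ->
         `|phi t w 0 i - phi s w 0 i| <= K * (t - s)) /\
      forall w, ~ N w -> forall s t i c e, 0 <= s -> s <= t -> t <= T ->
        (forall u, s < u <= t -> `|b u (phi u w + B u w) 0 i - c| <= e) ->
        `|phi t w 0 i - phi s w 0 i - c * (t - s)| <= e * (t - s)].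
Proof.
have [mX aX [N [mN PN hN]]] := hX.
pose phi t w := if `[< N w >] then x else X t w - B t w.
have good w : ~ N w -> (forall i : 'I_d, lebesgue_measure.-integrable `[0, T]
       (fun s => (b s (X s w) 0 i)%:E)) /\
    (forall t, 0 <= t <= T ->
       X t w = x
         + \row_(i < d) (\int[lebesgue_measure]_(s in `[0, t]) b s (X s w) 0 i)
         + B t w).
  by move=> nN; apply: contrapT => h; apply: nN; apply: hN.
have phiN w t : ~ N w -> phi t w = X t w - B t w by move=> nN; rewrite /phi asboolF.
have phiE w t i : ~ N w -> 0 <= t <= T ->
    phi t w 0 i = x 0 i + \int[lebesgue_measure]_(s in `[0, t]) b s (X s w) 0 i.
  by move=> nN tT; rewrite phiN// (good w nN).2// addrK !mxE.
have XE w : ~ N w -> forall t, 0 <= t <= T -> X t w = phi t w + B t w.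
  by move=> nN t tT; rewrite phiN// subrK.
(* The integral equation is remembered through this mean-value estimate only; c = 0 and e = K give
   the Lipschitz bound. *)
have incr w : ~ N w -> forall s t i c e, 0 <= s -> s <= t -> t <= T ->
    (forall u, s < u <= t -> `|b u (phi u w + B u w) 0 i - c| <= e) ->
    `|phi t w 0 i - phi s w 0 i - c * (t - s)| <= e * (t - s).
  move=> nN s t i c e s0 st tT he.
  have t0 : 0 <= t by exact: le_trans st.
  have it : lebesgue_measure.-integrable `[0, t] (EFin \o (fun s => b s (X s w) 0 i)).
    apply: integrableS ((good w nN).1 i) => //.
    by apply: subset_itvl; rewrite bnd_simp.
  rewrite !phiE ?t0 ?s0 ?(le_trans st)// opprD addrACA subrr add0r.
  rewrite Rintegral_itvB ?bnd_simp//.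
  apply: Rintegral_itv_dist_le => //.
    by apply: integrableS it => //; apply: subset_itvr; rewrite bnd_simp.
  move=> u /andP[su ut]; rewrite XE//; first by apply: he; rewrite su.
  by rewrite (le_trans ut)// andbT (le_trans s0)// ltW.
have lip s t w i : 0 <= s -> s <= t -> t <= T -> `|phi t w 0 i - phi s w 0 i| <= K * (t - s).
  move=> s0 st tT; have [Nw|nN] := pselect (N w).
    rewrite /phi !asboolT// subrr normr0 mulr_ge0 ?subr_ge0//.
    have tT' : 0 <= t <= T by rewrite (le_trans s0).
    exact: le_trans (normr_ge0 _) (bK 0 i tT').
  have := incr w nN s t i 0 K s0 st tT; rewrite mul0r subr0; apply.
  move=> u /andP[su ut]; rewrite subr0; apply: bK.
  by rewrite (le_trans ut)// andbT (le_trans s0)// ltW.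
have phi0 : 0 <= T -> forall w, phi 0 w = x.
  move=> T0 w; have [Nw|nN] := pselect (N w); first by rewrite /phi asboolT.
  apply/rowP => i; rewrite phiE ?lexx//.
  by rewrite set_itv1 Rintegral_set1 addr0.
exists phi, N; split => //.
move=> t tT; have [t0 tT'] := andP tT.
have mBT := fbm_measurable hB.
have sG := past_sigma_algebra P mBT tT'.
have Gaug A : augmented_filtration P B t A -> measurable A -> past P B t A.
  by move=> hA mA; split => //; exact: (approx_past_augmented mBT tT').
split.
- move=> i; apply/(sub_measurableP sG).
  (* With the correction written through the indicator of [N], adaptedness reduces to that of [X],
     of [B] and of a null set. *)
  rewrite (_ : (fun w => phi t w 0 i) =
      fun w => x 0 i + (1 - \1_N w) * (X t w 0 i - B t w 0 i - x 0 i)); last first.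
    apply/funext => w; have [Nw|nN] := pselect (N w).
      by rewrite /phi asboolT// indicE mem_set// subrr mul0r addr0.
    by rewrite phiN// indicE memNset// subr0 mul1r !mxE; ring.
  apply: measurable_funD => //; apply: measurable_funM.
    apply: measurable_funB => //; apply: measurable_indic; apply: sub_sigma_algebra.
    apply: Gaug => //; apply: sub_sigma_algebra; right.
    by exists N; split.
  apply: measurable_funB => //; apply: measurable_funB.
    apply/(sub_measurableP sG) => U mU; apply: Gaug; first exact: aX.
    by rewrite -[X in measurable X]setTI; exact: mX.
  apply/(sub_measurableP sG) => U mU; apply: Gaug.
    apply: sub_sigma_algebra; left; apply: sub_sigma_algebra.
    by exists (t, i); [rewrite /= t0 lexx|exists U].
  by rewrite -[X in measurable X]setTI; exact: mBT.
- exists (\sum_i `|x 0 i| + K * T) => w i.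
  have := lip 0 t w i (lexx _) t0 tT'; rewrite phi0 ?(le_trans t0)// subr0 => h.
  rewrite -[phi t w 0 i](subrK (x 0 i)) addrC (le_trans (ler_normD _ _))// lerD//.
    by rewrite (bigD1 i)//= lerDl sumr_ge0.
  apply: le_trans h _; rewrite ler_wpM2l//.
  exact: le_trans (normr_ge0 _) (bK 0 i tT).
Qed.

End SolutionDrift.

(** * The gap between two solutions on a dyadic grid *)

Section GridDrift.
Context {R : realType} {disp : measure_display} {Omega : measurableType disp}.
Variable P : probability Omega R.
Local Notation Ex := (Ex P).
Local Notation nr := (nr P).
Variables (d : nat) (T H K : R) (B : R -> Omega -> 'rV[R]_d).
Hypothesis T0 : 0 < T.
Hypothesis hH : 0 < H < 2^-1.
Hypothesis hB : is_fbm P T H B.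
Variables (b : R -> 'rV[R]_d -> 'rV[R]_d).
Hypothesis K0 : 0 <= K.
Hypothesis bK : forall t v i, 0 <= t <= T -> `|b t v 0 i| <= K.
Hypothesis cb : forall t i, 0 <= t <= T -> continuous (fun v => b t v 0 i).

Let past_algebra t : t <= T -> sigma_algebra setT (past P B t).
Proof. exact: (past_sigma_algebra P (fbm_measurable hB)). Qed.

Lemma fbm_adapted t i : 0 <= t <= T -> sub_measurable (past P B t) (fun w => B t w 0 i).
Proof.
move=> tT U mU; have /andP[t0 tT'] := tT.
have mBT := fbm_measurable hB.
split; last by rewrite -[X in measurable X]setTI; exact: mBT.
apply: (approx_past_augmented mBT tT').
apply: sub_sigma_algebra; left; apply: sub_sigma_algebra.
by exists (t, i); [rewrite /= t0 lexx|exists U].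
Qed.

Lemma shifted_fbm_adapted s t (phi : Omega -> 'rV[R]_d) (g : 'rV[R]_d -> R) : continuous g ->
  0 <= s -> s <= t -> t <= T -> brv_row (past P B s) phi ->
  sub_measurable (past P B t) (fun w => g (B t w + phi w)).
Proof.
move=> cg s0 st tT [mphi _]; have sG := past_algebra tT.
apply/(sub_measurableP sG).
rewrite (_ : (fun w => _) = fun w => g (\row_i (B t w 0 i + phi w 0 i))); last first.
  by apply/funext => w; congr g; apply/rowP => i; rewrite !mxE.
apply: measurable_continuous_row => // i; apply: measurable_funD.
  by apply/(sub_measurableP sG); apply: fbm_adapted; rewrite tT (le_trans s0).
by apply/(sub_measurableP sG) => U mU; apply: (past_mono st); exact: mphi.
Qed.

Lemma brv_row_coord s (phi : Omega -> 'rV[R]_d) i : brv_row (past P B s) phi -> brv (fun w => phi w 0 i).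
Proof.
move=> [mphi [C hC]]; split; last by exists C.
by move=> _ U mU; rewrite setTI; exact: (mphi i U mU).2.
Qed.

Lemma shifted_fbm_brv s t (phi : Omega -> 'rV[R]_d) (g : 'rV[R]_d -> R) : continuous g ->
  (exists C : R, forall v, `|g v| <= C) -> 0 <= t <= T -> brv_row (past P B s) phi ->
  brv (fun w => g (B t w + phi w)).
Proof.
move=> cg [C hC] tT hphi; split; last by exists C.
rewrite (_ : (fun w => _) = fun w => g (\row_i (B t w 0 i + phi w 0 i))); last first.
  by apply/funext => w; congr g; apply/rowP => i; rewrite !mxE.
apply: measurable_continuous_row => // i; apply: measurable_funD.
  exact: (fbm_measurable hB).
exact: (brv_row_coord i hphi).1.
Qed.

Variables phi psi : R -> Omega -> 'rV[R]_d.
Hypothesis aphi : forall t, 0 <= t <= T -> brv_row (past P B t) (phi t).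
Hypothesis apsi : forall t, 0 <= t <= T -> brv_row (past P B t) (psi t).
Hypothesis lphi : forall s t w i, 0 <= s -> s <= t -> t <= T ->
  `|phi t w 0 i - phi s w 0 i| <= K * (t - s).
Hypothesis lpsi : forall s t w i, 0 <= s -> s <= t -> t <= T ->
  `|psi t w 0 i - psi s w 0 i| <= K * (t - s).

Definition drift_gap t w : 'rV[R]_d := phi t w - psi t w.
Local Notation D := drift_gap.

Lemma brv_l1_gap s t : 0 <= s <= T -> 0 <= t <= T -> brv (fun w => l1 (D t w - D s w)).
Proof.
move=> sT tT; apply: brv_sum => i _; apply: brv_norm.
rewrite (_ : (fun w => _) = fun w => phi t w 0 i - psi t w 0 i - (phi s w 0 i - psi s w 0 i)).
  by apply: brvB; apply: brvB; apply: brv_row_coord;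
    [exact: aphi|exact: apsi|exact: aphi|exact: apsi].
by apply/funext => w; rewrite !mxE.
Qed.

Lemma brv_l1_drift t : 0 <= t <= T -> brv (fun w => l1 (D t w)).
Proof.
move=> tT; apply: brv_sum => i _; apply: brv_norm.
rewrite (_ : (fun w => _) = fun w => phi t w 0 i - psi t w 0 i).
  by apply: brvB; apply: brv_row_coord; [exact: aphi|exact: apsi].
by apply/funext => w; rewrite !mxE.
Qed.

Variable N : nat.
Let h : R := T / (2 ^ N)%:R.
Let n := (2 ^ N)%N.
(** Capping the index at n makes every natural number a time of [0, T], so that the filtration is
    indexed by all of them. *)
Definition grid_time k : R := (minn k n)%:R * h.
Local Notation tt := grid_time.

Let n0 : 0 < n%:R :> R. Proof. by rewrite ltr0n expn_gt0. Qed.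
Let h0 : 0 < h. Proof. by rewrite divr_gt0. Qed.

Lemma grid_time_itv k : 0 <= tt k <= T.
Proof.
rewrite mulr_ge0 ?(ltW h0)//= /tt -ler_pdivlMr//.
by rewrite invf_div mulrC divfK ?gt_eqF// ler_nat geq_minr.
Qed.

Lemma grid_time_mono k l : (k <= l)%N -> tt k <= tt l.
Proof. by move=> kl; rewrite ler_wpM2r ?(ltW h0)// ler_nat leq_min geq_minr geq_min kl. Qed.

Lemma grid_timeB u j : (u <= j)%N -> (j <= n)%N -> tt j - tt u = (j - u)%:R * h.
Proof.
move=> uj jn; rewrite /tt (minn_idPl jn) (minn_idPl (leq_trans uj jn)).
by rewrite natrB// mulrBl.
Qed.

(** The numerator of [smoothing_const]. Below, K bounds the drift coefficient, and the factor d K of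
    the second-order constant is the Lipschitz constant in time, for [l1], of a drift part. *)
Let c0 : R := 2 * (12 * expR 1).
Let ca : R := K * c0.
Let cb' : R := K * c0 ^+ 2 * (d%:R * K).
Let al (i : nat) : R := ca * h * (i%:R * h) `^ (- H).
Let be (i : nat) : R := cb' * h * h * (i%:R * h) `^ (- (2 * H)).
Let v k := nr (fun w => l1 (D (tt k) w)).
Let dv k l := nr (fun w => l1 (D (tt l) w - D (tt k) w)).

Section Coordinate.
Variable i : 'I_d.
Let g j (z : 'rV[R]_d) := b (tt j) z 0 i.
(** The noise is read at j and the drifts at k. In the Riemann sums j = k + 1: reading the noise at
    the right end leaves it a fresh part to average over, even for a single step. *)
Definition drift_step k j w : R :=
  h * (g j (B (tt j) w + phi (tt k) w) - g j (B (tt j) w + psi (tt k) w)).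
Local Notation Z := drift_step.

Let cg j : continuous (g j). Proof. by apply: cb; exact: grid_time_itv. Qed.
Let hg j z : `|g j z| <= K. Proof. by apply: bK; exact: grid_time_itv. Qed.

Let kapE u j : (u < j)%N -> (j <= n)%N ->
  smoothing_const H (tt u) (tt j) = c0 * ((j - u)%:R * h) `^ (- H).
Proof. by move=> uj jn; rewrite /smoothing_const grid_timeB ?(ltnW uj)// powRN. Qed.

Let adapted_at k u : (k <= u)%N -> forall (xi : R -> Omega -> 'rV[R]_d),
  (forall t, 0 <= t <= T -> brv_row (past P B t) (xi t)) ->
  brv_row (past P B (tt u)) (xi (tt k)).
Proof.
move=> ku xi hxi; have [h1 h2] := hxi _ (grid_time_itv k); split => // l U mU.
by apply: (past_mono (grid_time_mono ku)); exact: h1.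
Qed.

Lemma drift_step_brv k j : brv (Z k j).
Proof.
apply: brvZ; apply: brvB; (apply: (shifted_fbm_brv (s := tt k)) => //;
  [by exists K; exact: hg|exact: grid_time_itv|]).
- exact/aphi/grid_time_itv.
- exact/apsi/grid_time_itv.
Qed.

Lemma drift_step_bound k j w : `|Z k j w| <= 2 * K * h.
Proof.
rewrite normrM gtr0_norm// mulrC ler_wpM2r ?(ltW h0)//.
by rewrite (le_trans (ler_normB _ _))// mulrDl !mul1r lerD.
Qed.

Lemma drift_step_adapted j : (j < n)%N ->
  adapted_brv (fun k => past P B (tt k)) j.+1 (Z j j.+1).
Proof.
move=> jn; have sG := past_algebra (andP (grid_time_itv j.+1)).2.
split; last by exists (2 * K * h); exact: drift_step_bound.
have /andP[t0 _] := grid_time_itv j; have /andP[_ t1] := grid_time_itv j.+1.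
have tj := grid_time_mono (leqnSn j).
apply/(sub_measurableP sG); apply: measurable_funM => //; apply: measurable_funB.
  by apply/(sub_measurableP sG); apply: (shifted_fbm_adapted (@cg j.+1) t0 tj t1);
    exact/aphi/grid_time_itv.
by apply/(sub_measurableP sG); apply: (shifted_fbm_adapted (@cg j.+1) t0 tj t1);
  exact/apsi/grid_time_itv.
Qed.

Lemma drift_step_first_order k u j z : (k <= u)%N -> (u < j)%N -> (j <= n)%N ->
  adapted_brv (fun k => past P B (tt k)) u z ->
  `|Ex (fun w => z w * Z k j w)| <= nr z * (al (j - u) * v k).
Proof.
move=> ku uj jn [mz bz].
have /andP[tu0 _] := grid_time_itv u; have /andP[_ tjT] := grid_time_itv j.
have tuj : tt u < tt j.
  by rewrite -subr_gt0 grid_timeB ?(ltnW uj)// mulr_gt0// ltr0n subn_gt0.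
have [b1 b2 b3] := frozen_first_diff hH hB tu0 tuj tjT (@cg j) (@hg j)
  mz bz (adapted_at ku aphi) (adapted_at ku apsi).
rewrite (_ : (fun w => _) = fun w => h * (z w *
    (g j (B (tt j) w + phi (tt k) w) - g j (B (tt j) w + psi (tt k) w)))); last first.
  by apply/funext => w; rewrite /Z mulrCA.
rewrite ExZ// normrM (gtr0_norm h0).
have bzz : brv z by have [C hC] := bz; split;
  [move=> _ U mU; rewrite setTI; exact: (mz U mU).2|exists C].
have bl := brv_l1_drift (grid_time_itv k).
apply: (@le_trans _ _ (h * (K * smoothing_const H (tt u) (tt j) * (nr z * v k)))).
  rewrite ler_wpM2l ?(ltW h0)//; apply: le_trans b3 _.
  rewrite (_ : (fun w => _) = fun w => K * smoothing_const H (tt u) (tt j) *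
    (`|z w| * l1 (D (tt k) w))); last by apply/funext => w; rewrite mulrCA.
  rewrite ExZ; last by apply: brvM => //; exact: brv_norm.
  apply: ler_wpM2l; last by rewrite -(nr_norm P z); apply: Ex_mul_le => //; exact: brv_norm.
  by apply: mulr_ge0 => //; rewrite kapE// mulr_ge0 ?powR_ge0// !mulr_ge0// expR_ge0.
by rewrite kapE// /al /ca; rewrite le_eqVlt; apply/orP; left; apply/eqP; ring.
Qed.

Let l1_lip (xi : R -> Omega -> 'rV[R]_d) k u w : (k <= u)%N -> (u <= n)%N ->
  (forall s t w l, 0 <= s -> s <= t -> t <= T ->
    `|xi t w 0 l - xi s w 0 l| <= K * (t - s)) ->
  l1 (xi (tt u) w - xi (tt k) w) <= d%:R * K * ((u - k)%:R * h).
Proof.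
move=> ku un hxi; rewrite -grid_timeB//.
apply: (@le_trans _ _ (\sum_(l < d) (K * (tt u - tt k)))).
  apply: ler_sum => l _; rewrite !mxE.
  have /andP[? _] := grid_time_itv k; have /andP[_ ?] := grid_time_itv u.
  by apply: hxi => //; exact: grid_time_mono.
by rewrite sumr_const card_ord -[leRHS]mulrA mulr_natl.
Qed.

(** The second difference has corners phi and psi at times u and k. Its first-order part sees the
    increment of the gap from k to u; in the bilinear part, the shift from phi at k to phi at u is
    bounded by the Lipschitz estimate and the gap at k is kept. *)
Lemma drift_step_second_order k u j z : (k <= u)%N -> (u < j)%N -> (j <= n)%N ->
  adapted_brv (fun k => past P B (tt k)) u z ->
  `|Ex (fun w => z w * (Z k j w - Z u j w))| <=
  nr z * (al (j - u) * dv k u + be (j - u) * ((u - k)%:R * v k)).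
Proof.
move=> ku uj jn [mz bz].
have /andP[tu0 _] := grid_time_itv u; have /andP[_ tjT] := grid_time_itv j.
have tuj : tt u < tt j.
  by rewrite -subr_gt0 grid_timeB ?(ltnW uj)// mulr_gt0// ltr0n subn_gt0.
have [b1 b2 b3] := frozen_second_diff hH hB tu0 tuj tjT (@cg j) (@hg j)
  mz bz (adapted_at (leqnn u) aphi) (adapted_at (leqnn u) apsi)
  (adapted_at ku aphi) (adapted_at ku apsi).
set kap := smoothing_const H (tt u) (tt j) in b2 b3.
have kap0 : 0 <= kap.
  by rewrite /kap kapE// mulr_ge0 ?powR_ge0// !mulr_ge0// expR_ge0.
have bzz : brv z by have [C hC] := bz; split;
  [move=> _ U mU; rewrite setTI; exact: (mz U mU).2|exists C].
have bnz := brv_norm bzz.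
have bl := brv_l1_drift (grid_time_itv k).
have bdl := brv_l1_gap (grid_time_itv k) (grid_time_itv u).
rewrite (_ : (fun w => _) = fun w => - h * (z w *
    (g j (B (tt j) w + phi (tt u) w) - g j (B (tt j) w + psi (tt u) w) -
    (g j (B (tt j) w + phi (tt k) w) - g j (B (tt j) w + psi (tt k) w))))); last first.
  by apply/funext => w; rewrite /Z; ring.
rewrite ExZ// normrM normrN (gtr0_norm h0).
pose lip := d%:R * K * ((u - k)%:R * h).
apply: (@le_trans _ _ (h * (K * kap * (nr z * dv k u) + K * kap ^+ 2 * lip * (nr z * v k)))).
  rewrite ler_wpM2l ?(ltW h0)//; apply: le_trans b3 _.
  apply: (@le_trans _ _ (Ex (fun w => K * kap * (`|z w| * l1 (D (tt u) w - D (tt k) w)) +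
      K * kap ^+ 2 * lip * (`|z w| * l1 (D (tt k) w))))).
    apply: Ex_le => //.
      by apply: brvD; apply: brvZ; apply: brvM.
    move=> w; rewrite mulrDr; apply: lerD; first by rewrite mulrCA.
    rewrite mulrCA -[leRHS]mulrA; apply: ler_wpM2l; first by rewrite mulr_ge0 ?exprn_ge0.
    rewrite [leRHS]mulrCA; apply: ler_wpM2l => //; apply: ler_wpM2r; first exact: l1_ge0.
    by apply: l1_lip => //; exact: leq_trans (ltnW uj) jn.
  rewrite ExD; [|by apply: brvZ; exact: brvM|by apply: brvZ; exact: brvM].
  rewrite !ExZ; [|exact: brvM|exact: brvM].
  apply: lerD; apply: ler_wpM2l; rewrite -?(nr_norm P z); do ?exact: Ex_mul_le.
    by rewrite mulr_ge0.
  apply: mulr_ge0; first by rewrite mulr_ge0 ?exprn_ge0.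
  by apply: mulr_ge0; apply: mulr_ge0 => //; exact: ltW.
have E2 : ((j - u)%:R * h) `^ (- (2 * H)) = (((j - u)%:R * h) `^ (- H)) ^+ 2.
  by rewrite -powR_mulrn ?powR_ge0// -powRrM; congr (_ `^ _); ring.
rewrite /kap kapE// /al /be E2 /ca /cb' /lip; rewrite le_eqVlt; apply/orP; left; apply/eqP.
by move: (powR _ _) => q; ring.
Qed.

Local Notation theta := (2^-1 - H).
Local Notation C1 := (block_const H T ca cb').

Lemma drift_step_sum_le k a G0 S : (k + 2 ^ a <= n)%N -> 0 <= G0 -> 0 <= S ->
  (forall p, (p < 2 ^ a)%N -> v (k + p) <= G0) ->
  (forall c p, (c < a)%N -> (p < 2 ^ (a - c))%N ->
    dv (k + p * 2 ^ c) (k + p * 2 ^ c + 2 ^ c) <= S * ((2 ^ c)%:R * h) `^ 2^-1) ->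
  nr (fun w => \sum_(p < 2 ^ a) Z (k + p) (k + p).+1 w) <=
  ((2 ^ a)%:R * h) `^ 2^-1 * (C1 * ((2 ^ a)%:R * h) `^ theta * (G0 + S) + 4 * K * h `^ 2^-1).
Proof.
move=> ka G00 S0 hG hS.
have ca0 : 0 <= ca by rewrite !mulr_ge0// expR_ge0.
have cb0 : 0 <= cb' by rewrite /cb' !mulr_ge0 ?exprn_ge0// !mulr_ge0// expR_ge0.
have al0 i' : 0 <= al i' by rewrite mulr_ge0 ?powR_ge0// mulr_ge0// ltW.
have be0 i' : 0 <= be i' by rewrite mulr_ge0 ?powR_ge0// !mulr_ge0// ltW.
have xT : (2 ^ a)%:R * h <= T.
  rewrite /h mulrC -mulrA ler_piMr ?(ltW T0)// mulrC ler_pdivrMr// mul1r ler_nat.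
  exact: leq_trans (leq_addl _ _) ka.
apply: le_trans (sewing (F := fun k => past P B (tt k)) (Z := Z) (K1 := 2 * K * h)
  _ _ _ _ _ _ _ al0 be0 _ _ _ ka hG hS) _.
- by move=> k'; apply: past_algebra; exact: (andP (grid_time_itv k')).2.
- by move=> k' A [].
- by move=> k' l kl; apply: past_mono; exact: grid_time_mono.
- exact: drift_step_brv.
- exact: drift_step_bound.
- by move=> k'; exact: nr_ge0.
- by move=> k' l; exact: nr_ge0.
- exact: drift_step_first_order.
- exact: drift_step_second_order.
- exact: drift_step_adapted.
apply: le_trans (dyadic_block_le hH h0 ca0 cb0 T0 (2 * K * h) G00 S0 xT) _.
apply: ler_wpM2l; first exact: powR_ge0.
rewrite lerD2l {1}(_ : h = h `^ 2^-1 * h `^ 2^-1).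
  have hh : h `^ 2^-1 != 0 by rewrite gt_eqF// powR_gt0.
  by move: (h `^ 2^-1) hh => q hh; rewrite le_eqVlt; apply/orP; left; apply/eqP; field.
rewrite -powRD ?gt_eqF ?implybT//.
by rewrite -[LHS](powRr1 (ltW h0)); congr (_ `^ _); field.
Qed.

Definition step_error j w : R := D (tt j.+1) w 0 i - D (tt j) w 0 i - Z j j.+1 w.

Let brv_gap_coord j l : brv (fun w => D (tt j) w 0 i - D (tt l) w 0 i).
Proof.
rewrite (_ : (fun w => _) = fun w => phi (tt j) w 0 i - psi (tt j) w 0 i -
    (phi (tt l) w 0 i - psi (tt l) w 0 i)).
  by apply: brvB; apply: brvB; apply: brv_row_coord;
    do ?[exact/aphi/grid_time_itv|exact/apsi/grid_time_itv].
by apply/funext => w; rewrite !mxE.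
Qed.

Lemma step_error_brv j : brv (step_error j).
Proof. by apply: brvB => //; exact: drift_step_brv. Qed.

Lemma step_error_bound j w : (j < n)%N -> `|step_error j w| / h <= 4 * K.
Proof.
move=> jn; rewrite ler_pdivrMr//.
have hz := drift_step_bound j j.+1 w.
have /andP[t0 _] := grid_time_itv j; have /andP[_ t1] := grid_time_itv j.+1.
have tj := grid_time_mono (leqnSn j).
have e1 := lphi w i t0 tj t1; have e2 := lpsi w i t0 tj t1.
have E : step_error j w = (phi (tt j.+1) w 0 i - phi (tt j) w 0 i) -
  (psi (tt j.+1) w 0 i - psi (tt j) w 0 i) - Z j j.+1 w.
  by rewrite /step_error !mxE; ring.
rewrite E; apply: le_trans (ler_normB _ _) _.
rewrite (_ : 4 * K * h = 2 * K * h + 2 * K * h); last by ring.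
apply: lerD => //; apply: le_trans (ler_normB _ _) _.
rewrite (_ : 2 * K * h = K * h + K * h); last by ring.
by move: e1 e2; rewrite (grid_timeB (leqnSn j) jn) subSnn mul1r; exact: lerD.
Qed.

Lemma drift_gap_sum k m w : D (tt (k + m)) w 0 i - D (tt k) w 0 i =
  \sum_(p < m) Z (k + p) (k + p).+1 w + \sum_(p < m) step_error (k + p) w.
Proof.
rewrite -big_split/=; elim: m => [|m ih]; first by rewrite big_ord0 addn0 subrr.
by rewrite big_ord_recr/= -ih addnS /step_error; ring.
Qed.

End Coordinate.

(** Divided by h because the error of one Riemann step is o(h), uniformly over the steps of the
    grid. *)
Definition max_error w : R :=
  \big[Num.max/0]_(p : 'I_n * 'I_d) (`|step_error p.2 p.1 w| / h).

Lemma max_error_brv : brv max_error.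
Proof.
rewrite /max_error; elim: (index_enum _) => [|p s ih].
  by rewrite (_ : (fun w => _) = fun=> 0); [exact: brv_cst|apply/funext => w; rewrite big_nil].
rewrite (_ : (fun w => _) = fun w => Num.max (`|step_error p.2 p.1 w| / h)
    (\big[Num.max/0]_(p <- s) (`|step_error p.2 p.1 w| / h))); last first.
  by apply/funext => w; rewrite big_cons.
have [m1 [c1 h1]] : brv (fun w => `|step_error p.2 p.1 w| / h).
  by apply: brvM; [exact/brv_norm/step_error_brv|exact: brv_cst].
have [m2 [c2 h2]] := ih.
split; first exact: measurable_maxr.
exists (Num.max c1 c2) => w; case: (leP (`|step_error p.2 p.1 w| / h)) => _.
  by rewrite le_max h2 orbT.
by rewrite le_max h1.
Qed.

Lemma max_error_itv w : 0 <= max_error w <= 4 * K.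
Proof.
rewrite /max_error; apply/andP; split; first exact: bigmax_ge_id.
by apply: bigmax_le => [|p _]; [rewrite mulr_ge0|exact: step_error_bound].
Qed.

Lemma step_error_le i j w : (j < n)%N -> `|step_error i j w| <= h * max_error w.
Proof.
move=> jn; rewrite mulrC -ler_pdivrMr//.
exact: (le_bigmax _ (fun p : 'I_n * 'I_d => `|step_error p.2 p.1 w| / h) (Ordinal jn, i)).
Qed.

(** The part of a block estimate that is not proportional to the gap: the unit-step term of the
    sewing bound, and the Riemann errors, whose sum over a block of length x is at most x times the
    maximal one, with x <= x^(1/2) T^(1/2). *)
Definition grid_error : R := d%:R * (4 * K * h `^ 2^-1 + T `^ 2^-1 * nr max_error).

Lemma drift_block k a G0 S : (k + 2 ^ a <= n)%N -> 0 <= G0 -> 0 <= S ->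
  (forall p, (p < 2 ^ a)%N -> v (k + p) <= G0) ->
  (forall c p, (c < a)%N -> (p < 2 ^ (a - c))%N ->
    dv (k + p * 2 ^ c) (k + p * 2 ^ c + 2 ^ c) <= S * ((2 ^ c)%:R * h) `^ 2^-1) ->
  dv k (k + 2 ^ a) <= ((2 ^ a)%:R * h) `^ 2^-1 *
    (d%:R * block_const H T ca cb' * ((2 ^ a)%:R * h) `^ (2^-1 - H) * (G0 + S) + grid_error).
Proof.
move=> ka G00 S0 hG hS.
have xT : (2 ^ a)%:R * h <= T.
  rewrite /h mulrC -mulrA ler_piMr ?(ltW T0)// mulrC ler_pdivrMr// mul1r ler_nat.
  exact: leq_trans (leq_addl _ _) ka.
set x := (2 ^ a)%:R * h in xT *.
have x0 : 0 < x by rewrite mulr_gt0// ltr0n expn_gt0.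
have bme := max_error_brv.
have err i : nr (fun w => \sum_(p < 2 ^ a) step_error i (k + p) w) <=
    x `^ 2^-1 * (T `^ 2^-1 * nr max_error).
  apply: le_trans (nr_sum P _ (X := fun p : 'I_(2 ^ a) => step_error i (k + p)) _) _.
    by move=> p _; exact: step_error_brv.
  apply: (@le_trans _ _ ((2 ^ a)%:R * (h * nr max_error))).
    apply: (sum_le_cst (f := fun p => nr (step_error i (k + p)))) => p pa.
    rewrite -{1}(gtr0_norm h0) -nrZ//; apply: nr_le; [exact: step_error_brv|exact: brvZ|].
    move=> w; have /andP[m0 _] := max_error_itv w.
    rewrite [leRHS]ger0_norm ?(mulr_ge0 (ltW h0) m0)//; apply: step_error_le.
    by apply: leq_trans ka; rewrite ltn_add2l.
  rewrite mulrA [leRHS]mulrA ler_wpM2r ?nr_ge0// -/x.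
  rewrite [leLHS](_ : x = x `^ 2^-1 * x `^ 2^-1); last first.
    rewrite -powRD ?gt_eqF ?implybT//.
    by rewrite -[LHS](powRr1 (ltW x0)); congr (_ `^ _); field.
  rewrite ler_wpM2l ?powR_ge0//.
  by apply: ge0_ler_powR => //; rewrite ?nnegrE ?ltW.
have coord i : nr (fun w => D (tt (k + 2 ^ a)) w 0 i - D (tt k) w 0 i) <=
    x `^ 2^-1 * (block_const H T ca cb' * x `^ (2^-1 - H) * (G0 + S) + 4 * K * h `^ 2^-1) +
    x `^ 2^-1 * (T `^ 2^-1 * nr max_error).
  rewrite (_ : (fun w => _) = fun w => \sum_(p < 2 ^ a) drift_step i (k + p) (k + p).+1 w +
      \sum_(p < 2 ^ a) step_error i (k + p) w); last first.
    by apply/funext => w; exact: drift_gap_sum.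
  apply: le_trans (nrD _ _ _) _; first by apply: brv_sum => p _; exact: drift_step_brv.
    by apply: brv_sum => p _; exact: step_error_brv.
  by apply: lerD => //; exact: drift_step_sum_le.
have bgap i : brv (fun w => D (tt (k + 2 ^ a)) w 0 i - D (tt k) w 0 i).
  rewrite (_ : (fun w => _) = fun w => \sum_(p < 2 ^ a) drift_step i (k + p) (k + p).+1 w +
      \sum_(p < 2 ^ a) step_error i (k + p) w); last first.
    by apply/funext => w; exact: drift_gap_sum.
  by apply: brvD; apply: brv_sum => p _; [exact: drift_step_brv|exact: step_error_brv].
rewrite /dv (_ : (fun w => _) = fun w => \sum_(i < d)
    `|D (tt (k + 2 ^ a)) w 0 i - D (tt k) w 0 i|); last first.
  by apply/funext => w; apply: eq_bigr => i _; rewrite !mxE.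
apply: le_trans (nr_sum P _ (X := fun i w => `|D (tt (k + 2 ^ a)) w 0 i - D (tt k) w 0 i|) _) _.
  by move=> i _; exact: brv_norm.
apply: le_trans (ler_sum (G := fun=> x `^ 2^-1 * (block_const H T ca cb' * x `^ (2^-1 - H) *
  (G0 + S) + 4 * K * h `^ 2^-1) + x `^ 2^-1 * (T `^ 2^-1 * nr max_error)) _ _) _.
  by move=> i _; rewrite nr_norm.
rewrite sumr_const card_ord -[leLHS]mulr_natl /grid_error.
by rewrite le_eqVlt; apply/orP; left; apply/eqP; ring.
Qed.

Let l1D (y z : 'rV[R]_d) : l1 (y + z) <= l1 y + l1 z.
Proof. by rewrite /l1 -big_split/=; apply: ler_sum => i _; rewrite mxE ler_normD. Qed.

Let C := d%:R * block_const H T ca cb'.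
Let L0 m0 : R := T / (2 ^ m0)%:R.

Lemma drift_window m0 j : (m0 <= N)%N -> (j <= n)%N ->
  C * L0 m0 `^ (2^-1 - H) * (4 * L0 m0 `^ 2^-1 + 1) <= 2^-1 ->
  v j <= (2 + 8 * T `^ 2^-1) ^+ (2 ^ m0).+1 * (v 0%N + grid_error).
Proof.
move=> mN jn small.
have ca0 : 0 <= ca by rewrite !mulr_ge0// expR_ge0.
have cb0 : 0 <= cb' by rewrite /cb' !mulr_ge0 ?exprn_ge0// !mulr_ge0// expR_ge0.
have nrl X Y : brv X -> brv Y -> (forall w, 0 <= X w) -> (forall w, 0 <= Y w) ->
    (forall w, X w <= Y w) -> nr X <= nr Y.
  by move=> bX bY X0 Y0 XY; apply: nr_le => // w; rewrite !ger0_norm.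
have bl k := brv_l1_drift (grid_time_itv k).
have bg k l := brv_l1_gap (grid_time_itv k) (grid_time_itv l).
apply: (window_bound (N := N) (m0 := m0) (dv := dv) (C := C) (theta := 2^-1 - H)) => //.
- by rewrite mulr_ge0//; exact: block_const_ge0.
- rewrite mulr_ge0// addr_ge0//; first by rewrite !mulr_ge0// powR_ge0.
  by rewrite mulr_ge0 ?powR_ge0// nr_ge0.
- by rewrite subr_gt0; case/andP: hH.
- by move=> k; exact: nr_ge0.
- move=> k; rewrite /dv (_ : (fun w => _) = fun=> 0) ?nr_cst ?normr0//.
  apply/funext => w; rewrite subrr /l1 big1// => i _.
  by rewrite mxE normr0.
- move=> k l m; rewrite /dv.
  apply: (@le_trans _ _ (nr (fun w => l1 (D (tt l) w - D (tt k) w) + l1 (D (tt m) w - D (tt l) w)))).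
    apply: nrl => // [|w|w|w]; [exact: brvD|exact: l1_ge0|by rewrite addr_ge0 ?l1_ge0|].
    apply: le_trans (l1D _ _); rewrite le_eqVlt; apply/orP; left; apply/eqP; congr l1.
    by rewrite [RHS]addrC addrA subrK.
  exact: nrD.
- move=> k l.
  apply: (@le_trans _ _ (nr (fun w => l1 (D (tt k) w) + l1 (D (tt l) w - D (tt k) w)))).
    apply: nrl => // [|w|w|w]; [exact: brvD|exact: l1_ge0|by rewrite addr_ge0 ?l1_ge0|].
    by apply: le_trans (l1D _ _); rewrite addrC subrK.
  exact: nrD.
- by move=> k a G0 S *; exact: drift_block.
Qed.

End GridDrift.

Lemma near_dyadic_lt (R : realType) (T rho : R) : 0 < rho ->
  \forall N \near \oo, T / (2 ^ N)%:R < rho.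
Proof.
move=> r0; apply: filterS (nbhs_infty_gtr (T / rho)) => N hN.
rewrite ltr_pdivrMr ?ltr0n ?expn_gt0// mulrC -ltr_pdivrMr//.
by apply: lt_trans hN _; rewrite ltr_nat ltn_expl.
Qed.

Lemma small_dyadic_window (R : realType) (T C theta : R) : 0 < T -> 0 <= C -> 0 < theta ->
  exists m : nat, C * (T / (2 ^ m)%:R) `^ theta * (4 * (T / (2 ^ m)%:R) `^ 2^-1 + 1) <= 2^-1.
Proof.
(* Once L^theta <= q and L^(1/2) <= 1, the left-hand side is at most 5 C q <= 1/2. *)
move=> T0 C0 th0; pose q : R := (10 * C + 10)^-1.
have q0 : 0 < q by rewrite invr_gt0; lra.
have rho0 : 0 < Num.min 1 (q `^ theta^-1) by rewrite lt_min ltr01 powR_gt0.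
have [m hm] := filter_ex (near_dyadic_lt T rho0); exists m.
move: hm; set L := T / _; rewrite lt_min => /andP[L1 Lq].
have L0 : 0 < L by rewrite divr_gt0// ltr0n expn_gt0.
have Lth : L `^ theta <= q.
  rewrite -[leRHS](powRr1 (ltW q0)) -(mulVf (lt0r_neq0 th0)) powRrM.
  by rewrite ge0_ler_powR ?(ltW th0)// ?nnegrE ?powR_ge0// ltW.
have Lh : L `^ 2^-1 <= 1.
  rewrite [leRHS](_ : 1 = 1 `^ 2^-1); last by rewrite powR1.
  by rewrite ge0_ler_powR// ?nnegrE// ltW.
apply: (@le_trans _ _ (C * q * 5)).
  apply: ler_pM; rewrite ?mulr_ge0 ?powR_ge0// ?addr_ge0 ?mulr_ge0 ?powR_ge0//.
    by rewrite ler_wpM2l.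
  by move: Lh; lra.
rewrite /q mulrAC ler_pdivrMr; last by lra.
by lra.
Qed.

(** * Error of a Riemann step along a fixed path *)

Section LocalError.
Context {R : realType} {d : nat}.
Variables (T K : R) (b : R -> 'rV[R]_d -> 'rV[R]_d) (xi beta : R -> 'rV[R]_d).
Hypothesis T0 : 0 < T.
Hypothesis K0 : 0 <= K.
Hypothesis hbc : {within [set p : R * 'rV[R]_d | 0 <= p.1 <= T],
  continuous (fun p : R * 'rV[R]_d => b p.1 p.2)}.
Hypothesis cbeta : {within `[0, T], continuous beta}.
Hypothesis lxi : forall s t i, 0 <= s -> s <= t -> t <= T ->
  `|xi t 0 i - xi s 0 i| <= K * (t - s).
Hypothesis ixi : forall s t i c e, 0 <= s -> s <= t -> t <= T ->
  (forall u, s < u <= t -> `|b u (xi u + beta u) 0 i - c| <= e) ->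
  `|xi t 0 i - xi s 0 i - c * (t - s)| <= e * (t - s).

Let lxi_abs s t i : 0 <= s <= T -> 0 <= t <= T -> `|xi t 0 i - xi s 0 i| <= K * `|t - s|.
Proof.
move=> /andP[s0 sT] /andP[t0 tT]; have [st|ts] := leP s t.
  by rewrite (ger0_norm (_ : 0 <= t - s)) ?subr_ge0//; exact: lxi.
rewrite distrC (distrC t) (ger0_norm (_ : 0 <= s - t)) ?subr_ge0 ?(ltW ts)//.
by apply: lxi => //; exact: ltW.
Qed.

Let cxi : {within `[0, T], continuous xi}.
Proof.
apply/subspace_continuousP => u uT; apply/cvg_ballP => e e0.
have uT' : 0 <= u <= T by move: uT; rewrite /= in_itv.
have K10 : 0 < K + 1 by rewrite (lt_le_trans ltr01)// lerDr.
have r0 : 0 < e / (K + 1) by rewrite divr_gt0.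
apply/nbhs_ballP; exists (e / (K + 1)) => //= p hp pT; split => // i l.
have pT' : 0 <= p <= T by move: pT; rewrite /= in_itv.
move: hp; rewrite -!ball_normE/= !ord1 => hp.
apply: le_lt_trans (lxi_abs l pT' uT') _.
apply: (@le_lt_trans _ _ ((K + 1) * `|u - p|)); first by rewrite ler_wpM2r// lerDl.
by rewrite mulrC -ltr_pdivlMr.
Qed.

Lemma uniform_row (del : R) : 0 < del -> \forall N \near \oo, forall u p l,
  0 <= u <= T -> 0 <= p <= T -> `|u - p| <= T / (2 ^ N)%:R -> `|beta p 0 l - beta u 0 l| <= del.
Proof.
move=> del0.
have key l : \forall N \near \oo, forall u p, 0 <= u <= T -> 0 <= p <= T ->
    `|u - p| <= T / (2 ^ N)%:R -> `|beta p 0 l - beta u 0 l| <= del.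
  have cid : {within `[0, T], continuous (@id R)}.
    by apply/subspace_continuousP => u _; exact: cvg_within.
  have cbl : {within `[0, T], continuous (fun u => beta u 0 l)}.
    apply/subspace_continuousP => u uT; move/subspace_continuousP: cbeta => /(_ u uT) h.
    exact: (cvg_comp _ _ h (@coord_continuous _ _ _ 0 l _)).
  have idT u : 0 <= u <= T -> (`[0, T]%classic : set R) u by rewrite /= in_itv.
  have [rho r0 hr] := near_curve cid cbl idT del0.
  apply: filterS (near_dyadic_lt T r0) => N hN u p uT pT up.
  apply: hr => //.
  by rewrite -ball_normE/=; exact: le_lt_trans hN.
by apply: filterS (filter_forall _ key) => N h u p l uT pT up; exact: h.
Qed.

Local Notation tt := (grid_time T).

(** The coefficient is evaluated with the noise at the right end and the drift part at the left end,
    hence off the path. This point is within [del] of the path over the whole step once the mesh is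
    small, which is what [near_curve] asks for. *)
Lemma drift_local_error i e : 0 < e -> \forall N \near \oo, forall j, (j < 2 ^ N)%N ->
  `|xi (tt N j.+1) 0 i - xi (tt N j) 0 i -
    T / (2 ^ N)%:R * b (tt N j.+1) (beta (tt N j.+1) + xi (tt N j)) 0 i| <=
  e * (T / (2 ^ N)%:R).
Proof.
move=> e0.
pose f (p : R * 'rV[R]_d) := b p.1 p.2 0 i.
pose gam u : R * 'rV[R]_d := (u, xi u + beta u).
have cf : {within [set p : R * 'rV[R]_d | 0 <= p.1 <= T], continuous f}.
  apply/subspace_continuousP => p pT; move/subspace_continuousP: hbc => /(_ p pT) h.
  exact: (cvg_comp _ _ h (@coord_continuous _ _ _ 0 i _)).
have cgam : {within `[0, T], continuous gam}.
  apply/subspace_continuousP => u uT.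
  apply: (@cvg_pair _ R 'rV[R]_d _ (nbhs u) (nbhs (xi u + beta u)) _ _ _
    (fun u => u) (fun u => xi u + beta u)); first exact: cvg_within.
  apply: cvgD; [move/subspace_continuousP: cxi|move/subspace_continuousP: cbeta];
    by move=> /(_ u uT).
have [del del0 hdel] := near_curve cgam cf (fun u uT => uT) e0.
have d40 : 0 < del / 4 by rewrite divr_gt0.
have dd : del / 4 + del / 4 < del by move: (del0 : 0 < del); move: (del : R) => q q0; lra.
have K10 : 0 < K + 1 by rewrite (lt_le_trans ltr01)// lerDr.
have d4K : 0 < del / 4 / (K + 1) by rewrite divr_gt0.
near=> N.
have h1 : T / (2 ^ N)%:R < del by near: N; exact: near_dyadic_lt.
have h2 : T / (2 ^ N)%:R < del / 4 / (K + 1) by near: N; exact: near_dyadic_lt.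
have h3 : forall u p l, 0 <= u <= T -> 0 <= p <= T -> `|u - p| <= T / (2 ^ N)%:R ->
  `|beta p 0 l - beta u 0 l| <= del / 4 by near: N; exact: uniform_row.
move=> j jn; have t0T := grid_time_itv T0 N j; have t1T := grid_time_itv T0 N j.+1.
have E : tt N j.+1 - tt N j = T / (2 ^ N)%:R.
  by rewrite (grid_timeB T (leqnSn j) jn) subSnn mul1r.
have h0 : 0 < T / (2 ^ N)%:R by rewrite divr_gt0// ltr0n expn_gt0.
rewrite -E [X in _ - _ - X]mulrC; apply: ixi; [by case/andP: t0T|by rewrite -subr_ge0 E ltW|by case/andP: t1T|].
move=> u /andP[ju uj].
have uT : 0 <= u <= T.
  have /andP[? _] := t0T; have /andP[_ ?] := t1T.
  by rewrite (le_trans _ (ltW ju))//= (le_trans uj).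
have up : `|u - tt N j.+1| <= T / (2 ^ N)%:R.
  by rewrite distrC ger0_norm ?subr_ge0// -E lerD2l lerN2 ltW.
rewrite distrC; apply: (hdel u (tt N j.+1, beta (tt N j.+1) + xi (tt N j))) => //.
split => /=; first by rewrite -ball_normE/=; exact: le_lt_trans h1.
split => // a l; rewrite !ord1 -ball_normE/= !mxE.
have b1 := h3 _ _ l uT t1T up.
have b2 : `|xi u 0 l - xi (tt N j) 0 l| <= del / 4.
  apply: le_trans (lxi_abs l t0T uT) _.
  apply: (@le_trans _ _ ((K + 1) * (T / (2 ^ N)%:R))); last first.
    by rewrite mulrC -ler_pdivlMr// ltW.
  apply: ler_pM => //; first by rewrite lerDl.
  by rewrite ger0_norm ?subr_ge0 ?(ltW ju)// -E lerD2r.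
rewrite (_ : _ - _ = (xi u 0 l - xi (tt N j) 0 l) - (beta (tt N j.+1) 0 l - beta u 0 l)); last by ring.
apply: le_lt_trans (ler_normB _ _) _.
by apply: (@le_lt_trans _ _ (del / 4 + del / 4)); [exact: lerD|].
Unshelve. all: by end_near. Qed.

End LocalError.

(** * Bound on the gap at dyadic times, uniform in the mesh *)

Section DyadicBound.
Context {R : realType} {disp : measure_display} {Omega : measurableType disp}.
Variable P : probability Omega R.
Local Notation nr := (nr P).
Variables (d : nat) (T H K : R) (B : R -> Omega -> 'rV[R]_d).
Hypothesis T0 : 0 < T.
Hypothesis hH : 0 < H < 2^-1.
Hypothesis hB : is_fbm P T H B.
Variables (b : R -> 'rV[R]_d -> 'rV[R]_d).
Hypothesis hbc : {within [set p : R * 'rV[R]_d | 0 <= p.1 <= T],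
  continuous (fun p : R * 'rV[R]_d => b p.1 p.2)}.
Hypothesis K0 : 0 <= K.
Hypothesis bK : forall t v i, 0 <= t <= T -> `|b t v 0 i| <= K.

Let cb t i : 0 <= t <= T -> continuous (fun v => b t v 0 i).
Proof.
move=> tT v.
have cp : (t, u) @[u --> v] --> (t, v).
  apply: (@cvg_pair _ R 'rV[R]_d (nbhs v) (nbhs t) (nbhs v) _ _ _ (fun=> t) id) => //.
  exact: cvg_cst.
have cw : (t, u) @[u --> v] --> within [set p : R * 'rV[R]_d | 0 <= p.1 <= T] (nbhs (t, v)).
  by move=> S /cp; apply: (@filterS _ (nbhs v) (nbhs_filter v)) => u; apply.
move/subspace_continuousP: hbc => /(_ (t, v) tT) h.
exact: (cvg_comp _ _ (cvg_comp _ _ cw h) (@coord_continuous _ _ _ 0 i _)).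
Qed.

Definition dyadic_bound_const m0 : R := (2 + 8 * T `^ 2^-1) ^+ (2 ^ m0).+1.

Lemma exists_window : exists m0 : nat,
  d%:R * block_const H T (K * (2 * (12 * expR 1)))
    (K * (2 * (12 * expR 1)) ^+ 2 * (d%:R * K)) *
  (T / (2 ^ m0)%:R) `^ (2^-1 - H) * (4 * (T / (2 ^ m0)%:R) `^ 2^-1 + 1) <= 2^-1.
Proof.
apply: small_dyadic_window => //; last by rewrite subr_gt0; case/andP: hH.
rewrite mulr_ge0//; apply: block_const_ge0 => //; first by rewrite !mulr_ge0// expR_ge0.
by rewrite !mulr_ge0 ?exprn_ge0// !mulr_ge0// expR_ge0.
Qed.

Variables (phi psi : R -> Omega -> 'rV[R]_d) (x y : 'rV[R]_d) (M : set Omega).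
Hypothesis mM : measurable M.
Hypothesis PM : P M = 0%E.
Hypothesis aphi : forall t, 0 <= t <= T -> brv_row (past P B t) (phi t).
Hypothesis apsi : forall t, 0 <= t <= T -> brv_row (past P B t) (psi t).
Hypothesis phi0 : forall w, phi 0 w = x.
Hypothesis psi0 : forall w, psi 0 w = y.
Hypothesis lphi : forall s t w i, 0 <= s -> s <= t -> t <= T ->
  `|phi t w 0 i - phi s w 0 i| <= K * (t - s).
Hypothesis lpsi : forall s t w i, 0 <= s -> s <= t -> t <= T ->
  `|psi t w 0 i - psi s w 0 i| <= K * (t - s).
Hypothesis iphi : forall w, ~ M w -> forall s t i c e, 0 <= s -> s <= t -> t <= T ->
  (forall u, s < u <= t -> `|b u (phi u w + B u w) 0 i - c| <= e) ->
  `|phi t w 0 i - phi s w 0 i - c * (t - s)| <= e * (t - s).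
Hypothesis ipsi : forall w, ~ M w -> forall s t i c e, 0 <= s -> s <= t -> t <= T ->
  (forall u, s < u <= t -> `|b u (psi u w + B u w) 0 i - c| <= e) ->
  `|psi t w 0 i - psi s w 0 i - c * (t - s)| <= e * (t - s).

Lemma max_error_cvg0 w : ~ M w -> max_error T B b phi psi N w @[N --> \oo] --> (0 : R).
Proof.
move=> nM; apply/cvgr0Pnorm_le => e e0.
have e20 : 0 < e / 2 by rewrite divr_gt0.
have [_ _ cB] := hB.
have e1 := fun i => @drift_local_error R d T K b (phi^~ w) (B^~ w) T0 K0 hbc (cB w)
  (fun s t i => lphi w i) (iphi nM) i _ e20.
have e2 := fun i => @drift_local_error R d T K b (psi^~ w) (B^~ w) T0 K0 hbc (cB w)
  (fun s t i => lpsi w i) (ipsi nM) i _ e20.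
apply: filterS (filterI (filter_forall _ e1) (filter_forall _ e2)) => N [h1 h2].
have /andP[m0 _] := max_error_itv B T0 K0 bK lphi lpsi N w.
rewrite ger0_norm//; apply: bigmax_le => [|[j i] _ /=]; first exact: ltW.
have h0 : 0 < T / (2 ^ N)%:R by rewrite divr_gt0// ltr0n expn_gt0.
rewrite ler_pdivrMr//.
have := h1 i j (ltn_ord j); have := h2 i j (ltn_ord j).
rewrite /step_error /drift_step /drift_gap !mxE.
set h := T / _; move=> a1 a2.
set b1 := b _ (B _ w + phi _ w) 0 i; set b2 := b _ (B _ w + psi _ w) 0 i.
rewrite (_ : _ - _ - _ = (phi (grid_time T N j.+1) w 0 i - phi (grid_time T N j) w 0 i - h * b1)
  - (psi (grid_time T N j.+1) w 0 i - psi (grid_time T N j) w 0 i - h * b2)); last by ring.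
apply: le_trans (ler_normB _ _) _; rewrite [e]splitr mulrDl.
exact: lerD.
Qed.

(** The Riemann errors tend to 0 along almost every path and are bounded by 4 K, so they tend to 0
    in L^2. Continuity of b gives no rate, and the argument asks for none. *)
Lemma grid_error_cvg0 : grid_error P T K B b phi psi N @[N --> \oo] --> (0 : R).
Proof.
have nr0 : nr (max_error T B b phi psi N) @[N --> \oo] --> (0 : R).
  apply: (@nr_cvg0 _ _ _ P _ (4 * K)).
  - by move=> N; have [] := max_error_brv T0 hB bK cb aphi apsi N.
  - by move=> N w; have /andP[? ?] := max_error_itv B T0 K0 bK lphi lpsi N w; rewrite ger0_norm.
  - exists M; split => // w /= h; apply: contrapT => nM; apply: h.
    exact: max_error_cvg0.
have h0 : (T / (2 ^ N)%:R) `^ 2^-1 @[N --> \oo] --> (0 : R).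
  apply/cvgr0Pnorm_le => e e0; have e20 : 0 < e ^+ 2 by rewrite exprn_gt0.
  apply: filterS (near_dyadic_lt T e20) => N hN.
  rewrite ger0_norm ?powR_ge0// -(ler_pXn2r (ltn0Sn 1)) ?nnegrE ?powR_ge0 ?(ltW e0)//.
  rewrite -powR_mulrn ?powR_ge0// -powRrM mulVf// powRr1 ?ltW//.
  by rewrite divr_gt0// ltr0n expn_gt0.
rewrite -[X in _ --> X](mulr0 d%:R); apply: cvgMr.
rewrite -[X in _ --> X](addr0 0); apply: cvgD.
  by rewrite -[X in _ --> X](mulr0 (4 * K)); exact: cvgMr.
by rewrite -[X in _ --> X](mulr0 (T `^ 2^-1)); exact: cvgMr.
Qed.

(** The dyadic time is kept fixed while the grid is refined. The window count [m0], and with it the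
    constant, does not change, whereas the grid error tends to 0. *)
Lemma dyadic_gap_le m0 :
  d%:R * block_const H T (K * (2 * (12 * expR 1)))
    (K * (2 * (12 * expR 1)) ^+ 2 * (d%:R * K)) *
  (T / (2 ^ m0)%:R) `^ (2^-1 - H) * (4 * (T / (2 ^ m0)%:R) `^ 2^-1 + 1) <= 2^-1 ->
  forall m j, (j <= 2 ^ m)%N ->
  nr (fun w => l1 (drift_gap phi psi (grid_time T m j) w)) <=
  dyadic_bound_const m0 * l1 (x - y).
Proof.
move=> small m j jm; set rho := dyadic_bound_const m0.
have rho0 : 0 <= rho.
  by rewrite exprn_ge0// addr_ge0// mulr_ge0// powR_ge0.
apply/ler_addgt0Pr => e e0.
have e1 : rho * grid_error P T K B b phi psi N @[N --> \oo] --> (0 : R).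
  by rewrite -[X in _ --> X](mulr0 rho); apply: cvgMr; exact: grid_error_cvg0.
move/cvgr0Pnorm_le : e1 => /(_ _ e0) e1.
have [N [hN mN]] := filter_ex (filterI e1 (nbhs_infty_ge (maxn m m0))).
move: mN; rewrite /= geq_max => /andP[mN m0N].
have jN : (j * 2 ^ (N - m) <= 2 ^ N)%N.
  by rewrite -{2}(subnKC mN) expnD leq_mul2r jm orbT.
have tE : grid_time T m j = grid_time T N (j * 2 ^ (N - m)).
  rewrite /grid_time (minn_idPl jm) (minn_idPl jN) -{2}(subnKC mN) expnD !natrM.
  by field; rewrite !pnatr_eq0 -!lt0n !expn_gt0.
rewrite tE; apply: le_trans (drift_window T0 hH hB K0 bK cb aphi apsi lphi lpsi m0N jN small) _.
rewrite -/(dyadic_bound_const m0) -/rho mulrDr lerD//.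
  rewrite (_ : (fun w => _) = fun=> l1 (x - y)); last first.
    by apply/funext => w; rewrite /drift_gap /grid_time min0n mul0r phi0 psi0.
  by rewrite nr_cst ger0_norm// l1_ge0.
exact: le_trans (ler_norm _) hN.
Qed.

End DyadicBound.

(** * Conclusion *)

Section SupBound.
Context {R : realType} {disp : measure_display} {Omega : measurableType disp}.
Variable P : probability Omega R.
Local Notation Ex := (Ex P).
Local Notation nr := (nr P).

(** Adding +oo on the null set makes the bound hold everywhere at no cost in the integral. It is
    meant for the supremum over all times, which is controlled only where both equations hold. *)
Lemma integral_le_off_null (f : Omega -> \bar R) (g : Omega -> R) (N : set Omega) :
  measurable N -> P N = 0%E -> (forall w, 0 <= f w)%E -> (forall w, 0 <= g w) -> brv g ->
  (forall w, ~ N w -> (f w <= (g w)%:E)%E) -> (\int[P]_w f w <= (Ex g)%:E)%E.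
Proof.
move=> mN PN f0 g0 bg fg.
pose G w : \bar R := ((g w)%:E + +oo * (\1_N w)%:E)%E.
have mG1 : measurable_fun setT (fun w => (g w)%:E : \bar R).
  by apply/measurable_EFinP; exact: bg.1.
have mN1 : measurable_fun setT (fun w => (\1_N w)%:E : \bar R).
  by apply/measurable_EFinP; exact: measurable_indic.
have G20 w : (0 <= +oo * (\1_N w)%:E :> \bar R)%E by rewrite mule_ge0// lee_fin.
apply: (@le_trans _ _ (\int[P]_w G w)%E).
  have G0 w : (0 <= G w)%E by apply: adde_ge0 => //; rewrite lee_fin.
  (* [f] need not be measurable; monotonicity is read off the definition of
     the integral as a supremum over simple functions. *)
  rewrite !ge0_integralTE//; apply: ereal_sup_le => _ [k kf <-]; exists k => // w.
  apply: le_trans (kf w) _; rewrite /G indicE; have [Nw|nN] := pselect (N w).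
    by rewrite mem_set// mule1 addey// leey.
  by rewrite memNset// mule0 adde0; exact: fg.
rewrite ge0_integralD//; last 2 first.
- by move=> w _; rewrite lee_fin.
- by apply: emeasurable_funM.
rewrite ge0_integralZl//.
have -> : (\int[P]_x (\1_N x)%:E = 0)%E by rewrite integral_indic// setIT.
rewrite mule0 adde0 /Ex /Rintegral fineK//.
exact: integrable_fin_num (brv_integrable P bg).
Qed.

Lemma enorm_sqr_le_l1 (d : nat) (v : 'rV[R]_d) : enorm v ^+ 2 <= l1 v ^+ 2.
Proof.
rewrite /enorm sqr_sqrtr; last by apply: sumr_ge0 => i _; exact: sqr_ge0.
rewrite expr2 /l1 mulr_suml; apply: ler_sum => i _.
rewrite -real_normK ?num_real// expr2 ler_wpM2l//.
by rewrite (bigD1 i)//= lerDl sumr_ge0.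
Qed.

Lemma coord_le_enorm (d : nat) (v : 'rV[R]_d) i : `|v 0 i| <= enorm v.
Proof.
rewrite -sqrtr_sqr; apply: ler_wsqrtr; rewrite (bigD1 i)//= lerDl.
by apply: sumr_ge0 => j _; exact: sqr_ge0.
Qed.

Variables (d : nat) (T H K : R) (B : R -> Omega -> 'rV[R]_d).
Hypothesis T0 : 0 < T.
Hypothesis hH : 0 < H < 2^-1.
Hypothesis hB : is_fbm P T H B.
Variables (b : R -> 'rV[R]_d -> 'rV[R]_d).
Hypothesis hbc : {within [set p : R * 'rV[R]_d | 0 <= p.1 <= T],
  continuous (fun p : R * 'rV[R]_d => b p.1 p.2)}.
Hypothesis K0 : 0 <= K.
Hypothesis bK : forall t v i, 0 <= t <= T -> `|b t v 0 i| <= K.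

(** At time t the gap is compared with its value at the grid point just below, at a cost c of the
    order of the mesh; then (l + c)^2 <= 2 l^2 + 2 c^2, and the grid value is bounded by the sum
    over the grid. The constant [rho] precedes the starting points and [m], which can therefore be
    chosen freely. *)
Lemma sup_gap_le : exists rho : R, forall x y X Y m,
  strong_solution P T b B x X -> strong_solution P T b B y Y ->
  (\int[P]_w ereal_sup [set (enorm (X t w - Y t w) ^+ 2)%:E | t in `[0%R, T]] <=
   ((2 ^ m).+1%:R * (2 * (rho * l1 (x - y)) ^+ 2) +
    2 * (d%:R * (2 * K) * (T / (2 ^ m)%:R)) ^+ 2)%:E)%E.
Proof.
have [m0 small] := exists_window d T0 hH K0.
exists (dyadic_bound_const T m0) => x y X Y m hX hY.
set rho := dyadic_bound_const T m0; set h := T / (2 ^ m)%:R.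
have h0 : 0 < h by rewrite divr_gt0// ltr0n expn_gt0.
have [phi [N1 [[mN1 PN1] aphi phi0 XE [lphi iphi]]]] := solution_drift hB bK hX.
have [psi [N2 [[mN2 PN2] apsi psi0 YE [lpsi ipsi]]]] := solution_drift hB bK hY.
pose M := N1 `|` N2.
have mM : measurable M by exact: measurableU.
have PM : P M = 0%E.
  apply/eqP; rewrite eq_le measure_ge0 andbT.
  apply: (@le_trans _ _ (P N1 + P N2)%E); first exact: measureU2.
  by rewrite PN1 PN2 adde0.
have gap := @dyadic_gap_le _ _ _ P d T H K B T0 hH hB b hbc K0 bK phi psi x y M mM PM
  aphi apsi (phi0 (ltW T0)) (psi0 (ltW T0)) lphi lpsi
  (fun w nM => iphi w (fun h => nM (or_introl h)))
  (fun w nM => ipsi w (fun h => nM (or_intror h))) m0 small m.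
pose D := drift_gap phi psi; pose tt := grid_time T m.
pose c := d%:R * (2 * K) * h.
have c0 : 0 <= c by rewrite mulr_ge0 ?(ltW h0)// mulr_ge0// mulr_ge0.
pose g w := \sum_(j < (2 ^ m).+1) 2 * l1 (D (tt j) w) ^+ 2 + 2 * c ^+ 2.
have bl j : brv (fun w => l1 (D (tt j) w)).
  exact: (brv_l1_drift aphi apsi (grid_time_itv T0 m j)).
have bg1 : brv (fun w => \sum_(j < (2 ^ m).+1) 2 * l1 (D (tt j) w) ^+ 2).
  by apply: brv_sum => j _; apply: brvZ; exact: brvX.
have bg : brv g by apply: brvD => //; exact: brv_cst.
have g0 w : 0 <= g w.
  rewrite /g addr_ge0//; last by rewrite mulr_ge0// sqr_ge0.
  by apply: sumr_ge0 => j _; rewrite mulr_ge0// sqr_ge0.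
apply: le_trans (integral_le_off_null mM PM _ g0 bg _) _.
- move=> w; apply: (@le_trans _ _ (enorm (X 0 w - Y 0 w) ^+ 2)%:E).
    by rewrite lee_fin sqr_ge0.
  by apply: ereal_sup_ubound; exists 0 => //=; rewrite in_itv/= lexx ltW.
- move=> w nM; apply: ge_ereal_sup => _ [t /= + <-]; rewrite in_itv/= => tT.
  rewrite lee_fin; apply: le_trans (enorm_sqr_le_l1 _) _.
  have nN1 : ~ N1 w by move=> h1; apply: nM; left.
  have nN2 : ~ N2 w by move=> h1; apply: nM; right.
  rewrite XE// YE// opprD addrACA subrr addr0.
  have /andP[t0 tT'] := tT.
  pose j := Num.truncn (t / h).
  have th0 : 0 <= t / h by rewrite divr_ge0 ?(ltW h0).
  have /andP[j1 j2] := truncn_itv th0.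
  have jm : (j <= 2 ^ m)%N.
    rewrite -(ler_nat R); apply: le_trans j1 _; rewrite ler_pdivrMr//.
    by rewrite /h mulrC divfK// gt_eqF// ltr0n expn_gt0.
  have ttE : tt j = j%:R * h by rewrite /tt /grid_time (minn_idPl jm).
  have ttle : tt j <= t by rewrite ttE -ler_pdivlMr.
  have tlt : t - tt j <= h.
    rewrite lerBlDr ttE -{1}[h]mul1r -mulrDl -ler_pdivrMr// addrC natr1; exact: ltW.
  have /andP[tt0 _] := grid_time_itv T0 m j.
  have lD : l1 (phi t w - psi t w) <= l1 (D (tt j) w) + c.
    apply: (@le_trans _ _ (\sum_(i < d) (`|D (tt j) w 0 i| + 2 * K * h))); last first.
      by rewrite big_split/= sumr_const card_ord -[_ *+ d]mulr_natl lerD2l /c mulrA.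
    apply: ler_sum => i _; rewrite !mxE.
    have e1 := lphi _ _ w i tt0 ttle tT'; have e2 := lpsi _ _ w i tt0 ttle tT'.
    rewrite (_ : phi t w 0 i - psi t w 0 i = (phi (tt j) w 0 i - psi (tt j) w 0 i) +
      ((phi t w 0 i - phi (tt j) w 0 i) - (psi t w 0 i - psi (tt j) w 0 i))); last by ring.
    apply: le_trans (ler_normD _ _) _; apply: lerD => //.
    apply: le_trans (ler_normB _ _) _.
    rewrite (_ : 2 * K * h = K * h + K * h); last by ring.
    by apply: lerD; [apply: le_trans e1 _|apply: le_trans e2 _]; rewrite ler_wpM2l.
  have l0 : 0 <= l1 (D (tt j) w) by exact: l1_ge0.
  have sq : l1 (phi t w - psi t w) ^+ 2 <= (l1 (D (tt j) w) + c) ^+ 2.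
    by rewrite ler_pXn2r ?nnegrE ?l1_ge0// addr_ge0.
  apply: le_trans sq _; rewrite /g.
  rewrite (bigD1 (Ordinal (jm : (j < (2 ^ m).+1)%N)))//=.
  set rest := \sum_(_ < _ | _) _; have rest0 : 0 <= rest.
    by apply: sumr_ge0 => i _; rewrite mulr_ge0 ?sqr_ge0.
  rewrite -subr_ge0; have := addr_ge0 rest0 (sqr_ge0 (l1 (D (tt j) w) - c)).
  set s := (X in 0 <= X -> _); rewrite (_ : _ - _ = s)//; rewrite /s; ring.
- rewrite lee_fin /g ExD//; last exact: brv_cst.
  rewrite Ex_cst lerD2r Ex_sum; last by move=> j _; apply: brvZ; exact: brvX.
  apply: (sum_le_cst (f := fun j => Ex (fun w => 2 * l1 (D (tt j) w) ^+ 2))) => j jm.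
  rewrite ExZ; last exact: brvX.
  rewrite -nr_sqr ler_wpM2l// ler_pXn2r ?nnegrE ?nr_ge0//; first exact: gap.
  exact: le_trans (nr_ge0 _ _) (gap j jm).
Qed.

End SupBound.

Theorem theorem3p1 (R : realType) (T : R) (hT : 0 < T)
    (d : nat) (hd : (1 <= d)%N) (H : R) (hH : 0 < H < 2^-1)
    (disp : measure_display) (Omega : measurableType disp)
    (P : probability Omega R)
    (B : R -> Omega -> 'rV[R]_d) (hB : is_fbm P T H B)
    (b : R -> 'rV[R]_d -> 'rV[R]_d)
    (hbc : {within [set p : R * 'rV[R]_d | 0 <= p.1 <= T],
              continuous (fun p : R * 'rV[R]_d => b p.1 p.2)})
    (hbb : exists M : R, forall (t : R) (x : 'rV[R]_d),
              0 <= t <= T -> enorm (b t x) <= M)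
    (X : 'rV[R]_d -> R -> Omega -> 'rV[R]_d)
    (hX : forall x : 'rV[R]_d,
       strong_solution P T b B x (X x) /\
       forall Y : R -> Omega -> 'rV[R]_d,
         strong_solution P T b B x Y -> indistinguishable P T Y (X x))
    (hPU : pathwise_uniqueness T H b)
    (x0 : 'rV[R]_d) :
  (\int[P]_w ereal_sup
     [set (enorm (X x t w - X x0 t w) ^+ 2)%:E | t in `[0%R, T]])%E
    @[x --> x0] --> 0%E.
Proof.
have [K hK] := hbb.
have K0 : 0 <= K.
  by apply: le_trans (hK 0 0 _); [exact: sqrtr_ge0|rewrite lexx ltW].
have bK t v i : 0 <= t <= T -> `|b t v 0 i| <= K.
  by move=> tT; apply: le_trans (coord_le_enorm _ _) (hK _ _ tT).
have [rho hrho] := sup_gap_le hT hH hB hbc K0 bK.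
set I := fun x => (\int[P]_w _)%E.
have I0 x : (0 <= I x)%E.
  apply: integral_ge0 => w _; apply: (@le_trans _ _ (enorm (X x 0 w - X x0 0 w) ^+ 2)%:E).
    by rewrite lee_fin sqr_ge0.
  by apply: ereal_sup_ubound; exists 0 => //=; rewrite in_itv/= lexx ltW.
have key e : 0 < e -> \forall x \near x0, (I x <= e%:E)%E.
  move=> e0; pose del := Num.sqrt e / 2.
  have del0 : 0 < del by rewrite divr_gt0// sqrtr_gt0.
  have del2 : 2 * del ^+ 2 = e / 2.
    by rewrite /del expr_div_n sqr_sqrtr ?(ltW e0)//; field.
  pose L := d%:R * (2 * K) + 1.
  have L0 : 0 < L by rewrite ltr_wpDl// mulr_ge0// mulr_ge0.
  have r0 : 0 < del / L by rewrite divr_gt0.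
  (* The grid is fixed here, before the neighbourhood of x0, so that the factor 2^m + 1 is a
     constant when l1 (x - x0) is made small. *)
  have [m hm] := filter_ex (near_dyadic_lt T r0).
  pose A := (2 ^ m).+1%:R * (2 * rho ^+ 2) + 1.
  have A0 : 0 < A by rewrite ltr_wpDl// mulr_ge0// mulr_ge0// sqr_ge0.
  (* The cap at 1 bounds the square of l1 (x - x0) by l1 (x - x0) itself. *)
  pose q := Num.min 1 (e / 2 / A).
  have q0 : 0 < q by rewrite lt_min ltr01 !divr_gt0.
  pose r := q / (d%:R + 1).
  have d1 : 0 < d%:R + 1 :> R by rewrite ltr_wpDl.
  apply/nbhs_ballP; exists r; first by rewrite /= divr_gt0.
  move=> x /= [_ hx]; apply: le_trans (hrho _ _ _ _ m (hX x).1 (hX x0).1) _.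
  have lx : l1 (x - x0) <= q.
    apply: (@le_trans _ _ (\sum_(i < d) r)).
      apply: ler_sum => i _; rewrite !mxE distrC; apply: ltW.
      by have := hx 0 i; rewrite -ball_normE.
    rewrite sumr_const card_ord -mulr_natl /r mulrCA ler_piMr ?(ltW q0)//.
    by rewrite ler_pdivrMr// mul1r lerDl.
  have lx0 : 0 <= l1 (x - x0) by exact: l1_ge0.
  move: lx; rewrite le_min => /andP[lx1 lx2].
  rewrite lee_fin [leRHS]splitr; apply: lerD.
    apply: (@le_trans _ _ (A * l1 (x - x0))).
      rewrite (_ : _ * _ = (A - 1) * (l1 (x - x0) * l1 (x - x0))).
        apply: ler_pM; rewrite ?mulr_ge0// ?ler_piMr// /A ?addrK ?lerDl//.
        by rewrite mulr_ge0// mulr_ge0// sqr_ge0.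
      by rewrite /A; ring.
    by rewrite mulrC -ler_pdivlMr.
  have b0 : 0 <= d%:R * (2 * K) by rewrite mulr_ge0// mulr_ge0.
  have h0 : 0 <= T / (2 ^ m)%:R by rewrite divr_ge0 ?(ltW hT).
  rewrite -del2 ler_wpM2l// ler_pXn2r ?nnegrE ?(ltW del0) ?(mulr_ge0 b0 h0)//.
  apply: (@le_trans _ _ (L * (T / (2 ^ m)%:R))).
    by rewrite ler_wpM2r ?divr_ge0 ?(ltW hT)// lerDl.
  by rewrite mulrC -ler_pdivlMr// ltW.
have fin : \forall x \near x0, I x \is a fin_num.
  have := key 1 ltr01; apply: filterS => x h; rewrite ge0_fin_numE//.
  exact: le_lt_trans h (ltry _).
apply/(@fine_cvgP R 'rV[R]_d (nbhs x0) _ I 0); split; first exact: fin.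
apply/cvgr0Pnorm_le => e e0; apply: filterS (key e e0) => x h.
rewrite /= ger0_norm ?fine_ge0// -lee_fin fineK// ge0_fin_numE//.
exact: le_lt_trans h (ltry _).
Qed.
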